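(* Let $$X=\Big\{u:\mathbb{R}^2\to\mathbb{C}:\ \int_{\mathbb{R}^2}\big(|\nabla u|^2+|u|^2+\ln(1+|x|)\,|u|^2\big)\,dx<\infty\Big\}.$$ For every $u\in X$ with $u\neq 0$, setting $\lambda=\int_{\mathbb{R}^2}|u|^2dx$, $T(u)=\int_{\mathbb{R}^2}|\nabla u|^2dx$ and $V(u)=\frac{1}{2\pi}\int_{\mathbb{R}^2}\int_{\mathbb{R}^2}\ln(|x-y|)\,|u(x)|^2|u(y)|^2\,dx\,dy$, one has $$-V(u)\le\frac{\lambda^2}{4\pi}\ln\frac{8\pi\,T(u)}{N\lambda}-\Big(\frac{I+1}{N}-\frac{1}{8\pi}\Big)\lambda^2,$$ where $N$ and $I$ are the constants defined in the context.
   Context: Let $(u_0,W)$ be the unique radial solution of $\Delta u_0=(W-1)u_0$, $\Delta W=|u_0|^2$ on $\mathbb{R}^2$ with $W(0)=W'(0)=0$, $u_0>0$ decreasing and vanishing at infinity. Then $N=\int_{\mathbb{R}^2}|u_0|^2dx$ and $I=\frac{1}{2\pi}\int_{\mathbb{R}^2}\ln(|x|)|u_0(x)|^2dx$. *)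

(* Defs.v *)
From HB Require Import structures.
From mathcomp Require Import all_boot all_order all_algebra.
From mathcomp Require Import all_classical all_reals all_analysis.
Set Implicit Arguments. Unset Strict Implicit. Unset Printing Implicit Defensive.
Import Order.TTheory GRing.Theory Num.Theory.
Import numFieldNormedType.Exports.
Local Open Scope classical_set_scope.
Local Open Scope ring_scope.

Notation leb2 R := ((@lebesgue_measure R) \x (@lebesgue_measure R))%E.

Section Defs.
Variable R : realType.

(* The plane R^2, represented as R * R (the differential structure, i.e.
   directional derivatives, does not depend on the choice of norm). *)
Definition plane := (R * R)%type.

Definition eucl (x : plane) : R := Num.sqrt (x.1 ^+ 2 + x.2 ^+ 2).

Definition evec (b : bool) : plane := if b then (0, 1) else (1, 0).

Definition partial (b : bool) (F : plane -> R) : plane -> R :=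
  fun x => 'D_(evec b) F x.

Definition ipartial (s : seq bool) (F : plane -> R) : plane -> R :=
  foldr partial F s.

Definition Ck (k : nat) (F : plane -> R) : Prop :=
  forall s : seq bool, (size s <= k)%N ->
    continuous (ipartial s F) /\
    ((size s < k)%N -> forall b x, derivable (ipartial s F) x (evec b)).

Definition smooth (F : plane -> R) : Prop := forall k, Ck k F.

Definition test_fun (phi : plane -> R) : Prop :=
  smooth phi /\ compact (closure [set x | phi x != 0]).

(* g is the weak partial derivative d/dx_b of v (v, g locally integrable) *)
Definition weak_partial (b : bool) (v g : plane -> R) : Prop :=
  forall phi, test_fun phi ->
    Rintegral (leb2 R) setT (fun x => v x * partial b phi x)
    = - Rintegral (leb2 R) setT (fun x => g x * phi x).

Definition laplacian (F : plane -> R) : plane -> R :=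
  fun x => partial false (partial false F) x + partial true (partial true F) x.

Definition ground_state (U0 W : plane -> R) : Prop :=
  Ck 2 U0 /\ Ck 2 W /\
  (forall x, laplacian U0 x = (W x - 1) * U0 x) /\
  (forall x, laplacian W x = U0 x ^+ 2) /\
  W (0, 0) = 0 /\ partial false W (0, 0) = 0 /\ partial true W (0, 0) = 0 /\
  exists f w : R -> R,
    (forall x, U0 x = f (eucl x)) /\ (forall x, W x = w (eucl x)) /\
    (forall r, 0 <= r -> 0 < f r) /\
    (forall r s, 0 <= r -> r < s -> f s < f r) /\
    (f @ +oo --> 0).

Definition Nconst (U0 : plane -> R) : R :=
  Rintegral (leb2 R) setT (fun x => U0 x ^+ 2).

Definition Iconst (U0 : plane -> R) : R :=
  (2 * pi)^-1 * Rintegral (leb2 R) setT (fun x => ln (eucl x) * U0 x ^+ 2).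

(* u = ur + i ui, with weak gradient (g1r + i g1i, g2r + i g2i) *)
Definition in_X (ur ui g1r g1i g2r g2i : plane -> R) : Prop :=
  measurable_fun setT ur /\ measurable_fun setT ui /\
  measurable_fun setT g1r /\ measurable_fun setT g1i /\
  measurable_fun setT g2r /\ measurable_fun setT g2i /\
  weak_partial false ur g1r /\ weak_partial false ui g1i /\
  weak_partial true ur g2r /\ weak_partial true ui g2i /\
  (\int[leb2 R]_x ((g1r x ^+ 2 + g1i x ^+ 2 + g2r x ^+ 2 + g2i x ^+ 2)
      + (ur x ^+ 2 + ui x ^+ 2)
      + ln (1 + eucl x) * (ur x ^+ 2 + ui x ^+ 2))%:E < +oo)%E.

End Defs.

(* Main.v *)
(** Replace [|u|] by its symmetric decreasing rearrangement [v], a function of [q = |x|^2]. The L^2 modulus of continuity,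
hence the kinetic energy, does not increase, and by Riesz's inequality neither does the logarithmic interaction, which
Newton's theorem evaluates as the integral of [ln q * M q * v q ^ 2], [M] being the mass function of [v]. The modulus of
continuity of [v] yields a Hardy inequality: the integral of [v^2 (beta + q beta' - q beta^2)] is at most [T / (4 pi)],
for every admissible weight [beta]. After normalising the mass of [v] to [N], let [tau] transport it to the ground state,
that is [M = m o tau], and take [beta q = k A(tau q) / sqrt (q * tau q)], where [- A / q] is the logarithmic derivative of the
ground state profile. Convexity of the exponential bounds the Hardy integrand below by an exact derivative plus a multiple of
[ln q * M * v^2]; integrating and choosing the scale [k] gives [N^2 / (8 pi) * exp (- 2 c) <= T], whose logarithm is the
inequality. *)
Require Import Defs.
From HB Require Import structures.
From mathcomp Require Import all_boot all_order all_algebra.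
From mathcomp Require Import all_classical all_reals all_analysis.
From mathcomp Require Import measurable_realfun ring lra.
Import Order.TTheory GRing.Theory Num.Theory.
Import numFieldNormedType.Exports.
Local Open Scope classical_set_scope.
Local Open Scope ring_scope.
Set Implicit Arguments.
Unset Strict Implicit.
Unset Printing Implicit Defensive.

(** The modulus of continuity is used because the rearrangement [v] is known only to be monotone:
    Riesz's inequality at each scale [e] keeps enough of the kinetic energy, and Fatou's lemma
    recovers a local inequality as [e] tends to 0. With [psi' = beta] and [p = exp (- psi)], the
    Hardy integrand is a quarter of [- Delta p / p]. The choice of [beta] is dictated by equality:
    if [v] is the ground state profile, then [tau] is the identity, [k = 1], [beta = A / q], and [p]
    is that profile up to a factor; [N^2 / (8 pi)] is its kinetic energy. Two obstacles shape the
    rest. First, [M] has a derivative only almost everywhere and [tau] is Lipschitz only on compact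
    intervals, so the transport runs on a window [[a, b]] that [tau] maps onto [[1/t, t]], with
    [beta] extended by hand outside; the end terms vanish as [t] grows thanks to quantitative decay
    of the ground state. Second, the logarithm changes sign and is unbounded both ways, so the
    interaction is truncated at distance [L], treated with nonnegative kernels, and [L] is sent to
    infinity. *)

Notation mble := (measurable_fun setT).
Notation sqrt := Num.sqrt.
Notation "x ^2" := (x ^+ 2) (at level 29, left associativity, format "x ^2") : ring_scope.
Notation derives x := (is_derive x (1 : Real.sort _)).
Notation ind b := ((nat_of_bool b%R)%:R)%R.

(** * Measurability and Tonelli *)

Section Measurability.
Context {d} {T : measurableType d} {R : realType}.
Implicit Types (f g : T -> R) (b c : T -> bool).

Lemma mfun_add f g : mble f -> mble g ->
 mble (fun x => f x + g x).
Proof. exact: measurable_funD. Qed.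

Lemma mfun_mul f g : mble f -> mble g ->
 mble (fun x => f x * g x).
Proof. exact: measurable_funM. Qed.

Lemma mfun_opp f : mble f -> mble (fun x => - f x).
Proof. exact: measurable_funN. Qed.

Lemma mfun_exp f n : mble f -> mble (fun x => f x ^+ n).
Proof. by exact: measurable_funX. Qed.

Lemma mfun_norm f : mble f -> mble (fun x => `|f x|).
Proof. by move=> mf; apply: measurableT_comp mf. Qed.

Lemma mfun_ln f : mble f -> mble (fun x => ln (f x)).
Proof. by move=> mf; apply: measurableT_comp mf. Qed.

Lemma mfun_expR f : mble f -> mble (fun x => expR (f x)).
Proof. by move=> mf; apply: measurableT_comp mf. Qed.

Lemma mfun_sqrt f : mble f ->
 mble (fun x => sqrt (f x)).
Proof.
move=> mf; apply: measurableT_comp mf; apply: continuous_measurable_fun.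
exact: sqrt_continuous.
Qed.

Lemma mfun_inv f : mble f -> mble (fun x => (f x)^-1).
Proof.
move=> mf; apply: (@measurableT_comp _ _ _ _ _ _ (@GRing.inv R)) mf.
have -> : @GRing.inv R = fun x => if x == 0 then 0 else x^-1 by apply/funext => x; case: eqP => // ->; rewrite invr0.
apply: measurable_fun_if => //; first exact: measurable_fun_eqr.
apply: (@measurable_funS _ _ _ _ [set x : R | x != 0]).
- apply: open_measurable; rewrite (_ : mkset _ = ~` [set 0]); last first.
  by apply/seteqP; split=> x /=; [move=> /eqP|move=> /eqP].
 by apply: closed_openC.
- by move=> x /= [_ /negbT].
apply: open_continuous_measurable_fun.
- rewrite (_ : mkset _ = ~` [set 0]); last first.
  by apply/seteqP; split=> x /=; [move=> /eqP|move=> /eqP].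
 by apply: closed_openC.
- by move=> x; rewrite inE => x0; exact: inv_continuous.
Qed.

Lemma mfun_max f g : mble f -> mble g ->
 mble (fun x => Num.max (f x) (g x)).
Proof. exact: measurable_maxr. Qed.

Lemma mfun_min f g : mble f -> mble g ->
 mble (fun x => Num.min (f x) (g x)).
Proof. exact: measurable_minr. Qed.

Lemma mfun_lt f g : mble f -> mble g ->
 mble (fun x => f x < g x).
Proof. exact: measurable_fun_ltr. Qed.

Lemma mfun_le f g : mble f -> mble g ->
 mble (fun x => f x <= g x).
Proof. exact: measurable_fun_ler. Qed.

Lemma mfun_eq f g : mble f -> mble g ->
 mble (fun x => f x == g x).
Proof. exact: measurable_fun_eqr. Qed.

Lemma mfun_nat b : mble b ->
 mble (fun x => (b x)%:R : R).
Proof.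
move=> mb; rewrite (_ : (fun x => _) = fun x => if b x then 1 else 0); last first.
 by apply/funext => x; case: (b x).
exact: measurable_fun_ifT.
Qed.

Lemma mfun_EFin f : mble f -> mble (fun x => (f x)%:E).
Proof. by move=> mf; exact/measurable_EFinP. Qed.

Lemma mfun_fst {d1 d2} {T1 : measurableType d1} {T2 : measurableType d2}
 (e : T -> T1 * T2) : mble e -> mble (fun x => (e x).1).
Proof. by exact: (measurableT_comp measurable_fst). Qed.

Lemma mfun_snd {d1 d2} {T1 : measurableType d1} {T2 : measurableType d2}
 (e : T -> T1 * T2) : mble e -> mble (fun x => (e x).2).
Proof. by exact: (measurableT_comp measurable_snd). Qed.

Lemma mfun_emul (f g : T -> \bar R) : mble f -> mble g ->
 mble (fun x => (f x * g x)%E).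
Proof. exact: emeasurable_funM. Qed.

Lemma mfun_eadd (f g : T -> \bar R) : mble f -> mble g ->
 mble (fun x => (f x + g x)%E).
Proof. exact: emeasurable_funD. Qed.

Lemma mfun_fine (f : T -> \bar R) : mble f ->
 mble (fun x => fine (f x)).
Proof. by move=> mf; apply: measurableT_comp mf. Qed.

End Measurability.

Section Tonelli.
Context {R : realType} {d1 d2} {T1 : measurableType d1} {T2 : measurableType d2}.
Variables (m1 : {sigma_finite_measure set T1 -> \bar R})
 (m2 : {sigma_finite_measure set T2 -> \bar R}).
Implicit Type f : T1 -> T2 -> \bar R.
Local Open Scope ereal_scope.

Lemma mfun_int f : mble (fun z => f z.1 z.2) ->
 (forall x y, 0 <= f x y) -> mble (fun x => \int[m2]_y f x y).
Proof.
move=> mf f0.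
by have := @measurable_fun_fubini_tonelli_F _ _ _ _ _ m2 (fun z => f z.1 z.2) mf (fun z => f0 z.1 z.2).
Qed.

Lemma tonelli f : mble (fun z => f z.1 z.2) ->
 (forall x y, 0 <= f x y) ->
 \int[m1]_x \int[m2]_y f x y = \int[m2]_y \int[m1]_x f x y.
Proof.
move=> mf f0.
exact: (@fubini_tonelli _ _ _ _ _ m1 m2 (fun z => f z.1 z.2) mf (fun z => f0 z.1 z.2)).
Qed.

Lemma prod_int (f : T1 * T2 -> \bar R) : mble f ->
 (forall z, 0 <= f z) ->
 \int[(m1 \x m2)%E]_z f z = \int[m1]_x \int[m2]_y f (x, y).
Proof. by move=> mf f0; rewrite fubini_tonelli1. Qed.

End Tonelli.

Section PlanarQuantities.
Variable R : realType.
Local Notation plane := (plane R).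

Definition nsq (x : plane) : R := x.1^2 + x.2^2.

Definition dsq (x y : plane) : R := (x.1 - y.1)^2 + (x.2 - y.2)^2.

(* Twice the signed distance of [x] to the mirror line [x.1 + k x.2 = c], in
 units of the normal vector [(1, k)]. *)
Definition gap (k c : R) (x : plane) : R := 2 * (c - (x.1 + k * x.2)) / (1 + k^2).

Definition refl (k c : R) (x : plane) : plane := (x.1 + gap k c x, x.2 + gap k c x * k).

Lemma nsq_ge0 x : 0 <= nsq x. Proof. by rewrite addr_ge0 ?sqr_ge0. Qed.

End PlanarQuantities.

Ltac pos1 :=
 match goal with
 | H : is_true (0 <= ?a) |- is_true (0 <= ?a) => exact H
 | |- is_true (@Order.le _ _ _ (@GRing.add _ _ _)) => first [apply: adde_ge0 | apply: addr_ge0]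
 | |- is_true (0 <= ?a * ?b) => apply: mulr_ge0
 | |- is_true (0 <= ?a ^-1) => rewrite invr_ge0
 | |- is_true (0 <= ?a^2) => exact (sqr_ge0 _)
 | |- is_true (0 <= ?a ^+ _) => apply: exprn_ge0
 | |- is_true (0 <= `| _ |) => exact (normr_ge0 _)
 | |- is_true (0 <= expR _) => exact (expR_ge0 _)
 | |- is_true (0 <= sqrt _) => exact (sqrtr_ge0 _)
 | |- is_true (0 <= _%:R) => exact (ler0n _ _)
 | |- is_true (0 <= nsq _) => exact (nsq_ge0 _)
 | |- is_true (0 <= pi) => exact (pi_ge0 _)
 | |- is_true (@Order.le _ _ _ (if ?b then _ else _)) => case: b
 | |- is_true (@Order.le _ _ _ (@EFin _ _)) => rewrite lee_fin
 | |- is_true (@Order.le _ _ _ (@mule _ _ _)) => apply: mule_ge0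
 | |- is_true (@Order.le _ _ _ (integral _ _ _)) => apply: integral_ge0
 | |- forall _, _ => intro
 | H : forall x, is_true (@Order.le _ _ _ (?f x)) |- is_true (@Order.le _ _ _ (?f _)) => apply: H
 | H : forall x y, is_true (@Order.le _ _ _ (?f x y)) |- is_true (@Order.le _ _ _ (?f _ _)) => apply: H
 end.
Ltac pos := repeat pos1; try done.

Section PlaneMeasure.
Variable R : realType.
Local Notation leb := (@lebesgue_measure R).

Lemma leb2_sigma_finite : sigma_finite setT (leb2 R).
Proof.
pose B (n : nat) : set (measurableTypeR R) := `[(- n%:R), n%:R]%classic.
have mB n : measurable (B n) by exact: measurable_itv.
exists (fun n => B n `*` B n).
 apply/seteqP; split=> // -[x y] _.
 exists (Num.bound (`|x| + `|y|)) => //=.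
 have h := archi_boundP (addr_ge0 (normr_ge0 x) (normr_ge0 y)).
 by split; rewrite /B /= in_itv/= -ler_norml; apply: le_trans (ltW h);
  rewrite ?lerDl ?lerDr.
move=> n; split; first exact: measurableX.
have Boo : (leb (B n) < +oo)%E by rewrite lebesgue_measure_itv/=; case: ifP => _; rewrite ltry.
by rewrite product_measure1E// lte_mul_pinfty// ge0_fin_numE.
Qed.

(** The same measure as [leb2 R], bundled with its sigma-finiteness so that Tonelli applies to
    products of which the plane is a factor. *)
Definition plane_measure : {sigma_finite_measure set _ -> \bar R} :=
 HB.pack (leb2 R) (Measure_isSigmaFinite.Build _ _ _ (leb2 R) leb2_sigma_finite).

Lemma tonelli_plane (f : plane R -> plane R -> \bar R) :
 mble (fun z : plane R * plane R => f z.1 z.2) ->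
 (forall x y, 0 <= f x y)%E ->
 (\int[leb2 R]_x \int[leb2 R]_y f x y = \int[leb2 R]_y \int[leb2 R]_x f x y)%E.
Proof. exact: (@tonelli R _ _ _ _ plane_measure plane_measure f). Qed.

Lemma tonelli_line_plane (f : R -> plane R -> \bar R) :
 mble (fun z : R * plane R => f z.1 z.2) ->
 (forall x y, 0 <= f x y)%E ->
 (\int[leb]_x \int[leb2 R]_y f x y = \int[leb2 R]_y \int[leb]_x f x y)%E.
Proof. exact: (@tonelli R _ _ _ _ leb plane_measure f). Qed.

End PlaneMeasure.

Section IntegralMeasurability.
Context {R : realType} {d} {T : measurableType d}.

Lemma mfun_int_line (f : T -> R -> \bar R) :
 mble (fun z : T * R => f z.1 z.2) -> (forall x y, 0 <= f x y)%E ->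
 mble (fun x => \int[@lebesgue_measure R]_y f x y)%E.
Proof. exact: (@mfun_int R _ _ T _ (@lebesgue_measure R) f). Qed.

Lemma mfun_int_plane (f : T -> plane R -> \bar R) :
 mble (fun z : T * plane R => f z.1 z.2) -> (forall x y, 0 <= f x y)%E ->
 mble (fun x => \int[leb2 R]_y f x y)%E.
Proof. exact: (@mfun_int R _ _ T _ (plane_measure R) f). Qed.

End IntegralMeasurability.

Ltac meas0 :=
 match goal with
 | H : measurable_fun _ ?f |- measurable_fun _ ?f => exact H
 | |- measurable_fun _ (fun x => x) => exact (@measurable_id _ _ _)
 | |- measurable_fun _ (fun x => ?c) => refine (@measurable_cst _ _ _ _ _ _)
 | |- measurable_fun _ (fun x => (@?e x).1) => refine (@mfun_fst _ _ _ _ _ _ e _)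
 | |- measurable_fun _ (fun x => (@?e x).2) => refine (@mfun_snd _ _ _ _ _ _ e _)
 | |- measurable_fun _ (fun x => (@?a x, @?b x)) => refine (@measurable_fun_pair _ _ _ _ _ _ a b _ _)
 | |- measurable_fun _ (fun x => @GRing.add _ (@?a x) (@?b x)) =>
   first [refine (@mfun_eadd _ _ _ a b _ _) | refine (@mfun_add _ _ _ a b _ _)]
 | |- measurable_fun _ (fun x => @?a x * @?b x) => refine (@mfun_mul _ _ _ a b _ _)
 | |- measurable_fun _ (fun x => - @?a x) => refine (@mfun_opp _ _ _ a _)
 | |- measurable_fun _ (fun x => @?a x ^+ _) => refine (@mfun_exp _ _ _ a _ _)
 | |- measurable_fun _ (fun x => (@?a x)^-1) => refine (@mfun_inv _ _ _ a _)
 | |- measurable_fun _ (fun x => `|@?a x|) => refine (@mfun_norm _ _ _ a _)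
 | |- measurable_fun _ (fun x => ln (@?a x)) => refine (@mfun_ln _ _ _ a _)
 | |- measurable_fun _ (fun x => expR (@?a x)) => refine (@mfun_expR _ _ _ a _)
 | |- measurable_fun _ (fun x => sqrt (@?a x)) => refine (@mfun_sqrt _ _ _ a _)
 | |- measurable_fun _ (fun x => Num.max (@?a x) (@?b x)) => refine (@mfun_max _ _ _ a b _ _)
 | |- measurable_fun _ (fun x => Num.min (@?a x) (@?b x)) => refine (@mfun_min _ _ _ a b _ _)
 | |- measurable_fun _ (fun x => (@?a x) < (@?b x)) => refine (@mfun_lt _ _ _ a b _ _)
 | |- measurable_fun _ (fun x => (@?a x) <= (@?b x)) => refine (@mfun_le _ _ _ a b _ _)
 | |- measurable_fun _ (fun x => (@?a x) == (@?b x)) => refine (@mfun_eq _ _ _ a b _ _)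
 | |- measurable_fun _ (fun x => (@?a x) && (@?b x)) => refine (@measurable_and _ _ _ a b _ _)
 | |- measurable_fun _ (fun x => (@?a x) || (@?b x)) => refine (@measurable_or _ _ _ a b _ _)
 | |- measurable_fun _ (fun x => ~~ (@?a x)) => refine (@measurable_neg _ _ _ a _)
 | |- measurable_fun _ (fun x => (@?a x)%:E) => refine (@mfun_EFin _ _ _ a _)
 | |- measurable_fun _ (fun x => ((@?a x) * (@?b x))%E) => refine (@mfun_emul _ _ _ a b _ _)
 | |- measurable_fun _ (fun x => fine (@?a x)) => refine (@mfun_fine _ _ _ a _)
 | |- measurable_fun _ (fun x => (nat_of_bool (@?b x))%:R) => refine (@mfun_nat _ _ _ b _)
 | |- measurable_fun _ (fun x => integral _ _ (@?f x)) =>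
   first [refine (@mfun_int_line _ _ _ f _ _) | refine (@mfun_int_plane _ _ _ f _ _)]
 | H : measurable_fun _ ?f |- measurable_fun _ (fun x => ?f (@?e x)) =>
   refine (@measurableT_comp _ _ _ _ _ _ f _ e H _)
 | |- measurable_fun _ (fun x => _) => refine (@measurable_fun_ifT _ _ _ _ _ _ _ _ _ _)
 end.
Section PlanarMeasurability.
Context {R : realType} {d} {T : measurableType d}.
Implicit Types f g : T -> plane R.

Lemma mfun_nsq_comp f : mble f -> mble (fun z => nsq (f z)).
Proof. by move=> mf; rewrite /nsq; repeat meas0. Qed.

Lemma mfun_dsq_comp f g : mble f -> mble g ->
 mble (fun z => dsq (f z) (g z)).
Proof. by move=> mf mg; rewrite /dsq; repeat meas0. Qed.

Lemma mfun_refl_comp (k c : T -> R) f : mble k -> mble c ->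
 mble f -> mble (fun z => refl (k z) (c z) (f z)).
Proof. by move=> mk mc mf; rewrite /refl /gap; repeat meas0. Qed.

End PlanarMeasurability.

Ltac meas1 :=
 match goal with
 | |- measurable_fun _ (fun x => nsq (@?e x)) => refine (@mfun_nsq_comp _ _ _ e _)
 | |- measurable_fun _ (fun x => dsq (@?e x) (@?f x)) => refine (@mfun_dsq_comp _ _ _ e f _ _)
 | |- measurable_fun _ (fun x => refl (@?k x) (@?c x) (@?e x)) => refine (@mfun_refl_comp _ _ _ k c e _ _ _)
 | |- _ => meas0
 end.
Ltac meas := repeat meas1.
Ltac isd := solve [done | meas; pos | by rewrite lee_fin | by move=> ? _; rewrite lee_fin | move=> *; pos | move=> *; rewrite -?EFinM ?lee_fin; pos
 | exact: mfun_EFin | move=> *; exact: sqr_ge0].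
Ltac side :=
 match goal with
 | |- measurable_fun _ _ => solve [meas; pos]
 | |- is_true _ => solve [pos]
 | |- forall _, _ => solve [pos]
 | |- measurable _ => solve [trivial]
 end.

(** * Affine changes of variables and polar coordinates *)

Section Plane.
Variable R : realType.
Local Notation leb := (@lebesgue_measure R).
Local Notation mu2 := (leb2 R).
Local Notation plane := (plane R).
Local Open Scope ereal_scope.

(** Lebesgue measure is determined by its values on half-open intervals, so it suffices that the
    rescaled pushforward gives them the same length. The signs of [a] are separate because a
    negative slope exchanges the open and the closed end. *)
Lemma int_affine (a b : R) (f : R -> \bar R) : a != 0%R ->
 mble f -> (forall x, 0 <= f x) ->
 \int[leb]_x f x = `|a|%:E * \int[leb]_x f (a * x + b)%R.
Proof.
move=> a0 mf f0.
have maff : mble (fun x : R => a * x + b)%R by meas.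
have na : (0 <= `|a|)%R by [].
pose m := mscale (NngNum na) (pushforward leb (fun x : R => (a * x + b)%R : measurableTypeR R)).
have pre (A : set R) : measurable A -> leb A = m maff A.
 apply: lebesgue_measure_unique => _ [[u v] _ <-] /=.
 rewrite /mscale /= /pushforward.
 have [agt|age|] := ltgtP a 0%R; last by move/eqP; rewrite (negbTE a0).
 - have -> : (fun x => a * x + b)%R @^-1` `]u, v] = `[((v - b) / a)%R, ((u - b) / a)%R[%classic by apply/seteqP; split=> x /=; rewrite !in_itv/= ler_ndivrMr// ltr_ndivlMr//; lra.
  rewrite !lebesgue_measure_itv/= !lte_fin ltr_ndivrMr// divrK ?unitfE// ltrD2r.
  case: ifP => uv; last by rewrite mule0.
  rewrite ltr0_norm//; congr (_%:E); field.
  by [].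
 - have -> : (fun x => a * x + b)%R @^-1` `]u, v] = `](((u - b) / a)%R), ((v - b) / a)%R]%classic by apply/seteqP; split=> x /=; rewrite !in_itv/= ler_pdivlMr// ltr_pdivrMr//; lra.
  rewrite !lebesgue_measure_itv/= !lte_fin ltr_pdivrMr// divrK ?unitfE// ltrD2r.
  case: ifP => uv; last by rewrite mule0.
  rewrite gtr0_norm//; congr (_%:E); field.
  by [].
rewrite (eq_measure_integral (m maff)); last by move=> A mA _; exact: pre.
rewrite ge0_integral_mscale//=.
by rewrite ge0_integral_pushforward//=.
Qed.

Lemma int_opp (f : R -> \bar R) :
 mble f -> (forall x, 0 <= f x) ->
 \int[leb]_x f (- x)%R = \int[leb]_x f x.
Proof.
move=> mf f0; rewrite [RHS](@int_affine (-1) 0)// normrN normr1 mul1e.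
by apply: eq_integral => x _; rewrite mulN1r addr0.
Qed.

Lemma int_plane (f : plane -> \bar R) : mble f ->
 (forall z, 0 <= f z) ->
 \int[mu2]_z f z = \int[leb]_x \int[leb]_y f (x, y).
Proof.
move=> mf f0; exact: (@prod_int R _ _ _ _ leb leb f mf f0).
Qed.

Lemma int_plane_swap (f : plane -> \bar R) : mble f ->
 (forall z, 0 <= f z) ->
 \int[mu2]_z f z = \int[mu2]_z f (z.2, z.1).
Proof.
move=> mf f0; rewrite !int_plane; try side.
by rewrite tonelli//=; meas.
Qed.

(** For [d] nonzero the map splits into one-dimensional affine substitutions: in [y] at fixed [x],
    of slope [d], then in [x], of slope [a - b * c / d], which is the determinant divided by [d]. *)
Lemma int_plane_affine_aux (a b c d e g : R) (f : plane -> \bar R) :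
 d != 0%R -> (`|a * d - b * c| = 1)%R ->
 mble f -> (forall z, 0 <= f z) ->
 \int[mu2]_z f (a * z.1 + b * z.2 + e, c * z.1 + d * z.2 + g)%R = \int[mu2]_z f z.
Proof.
move=> d0 det1 mf f0.
rewrite int_plane//=; last by meas.
have det0 : (a - b * c / d != 0)%R.
 have -> : (a - b * c / d = (a * d - b * c) / d)%R by field.
 rewrite mulf_neq0 ?invr_eq0// -normr_eq0 det1; exact: oner_neq0.
transitivity (\int[leb]_x \int[leb]_y (`|d|^-1%:E *
 f ((a - b * c / d) * x + (b / d * (y - g) + e), y)%R)).
 apply: eq_integral => x _.
 rewrite ge0_integralZl//; last by meas.
 rewrite [in RHS](@int_affine d (c * x + g))//; last by meas.
 rewrite muleA -EFinM mulVf ?normr_eq0// mul1e.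
 apply: eq_integral => y _; congr f; congr pair; last by ring.
 by field.
rewrite tonelli//=; last 2 first.
 by meas.
 by move=> x y; pos.
rewrite int_plane_swap; try side.
rewrite int_plane; try side.
apply: eq_integral => y _.
rewrite ge0_integralZl//; last by meas.
rewrite [RHS](@int_affine (a - b * c / d) (b / d * (y - g) + e))//; last by meas.
congr (_%:E * _).
have -> : (a - b * c / d = (a * d - b * c) / d)%R by field.
by rewrite normrM det1 mul1r normfV.
Qed.

Lemma int_plane_affine (a b c d e g : R) (f : plane -> \bar R) :
 (`|a * d - b * c| = 1)%R ->
 mble f -> (forall z, 0 <= f z) ->
 \int[mu2]_z f (a * z.1 + b * z.2 + e, c * z.1 + d * z.2 + g)%R = \int[mu2]_z f z.
Proof.
move=> det1 mf f0; have [d0|d0] := eqVneq d 0%R; last exact: int_plane_affine_aux.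
(* A vanishing [d] forces [c] to be nonzero, and exchanging the two variables reduces to the
   previous case. *)
have c0 : c != 0%R.
 apply/eqP => c0; move: det1; rewrite d0 c0 !mulr0 subr0 normr0 => /eqP.
 by lra.
rewrite int_plane_swap//=; last by meas.
rewrite -[RHS](@int_plane_affine_aux b a d c e g f c0)//.
 by apply: eq_integral => z _; congr f; congr pair; ring.
by rewrite distrC.
Qed.

Lemma int_plane_shift (h : plane) (f : plane -> \bar R) :
 mble f -> (forall z, 0 <= f z) ->
 \int[mu2]_z f (z.1 + h.1, z.2 + h.2)%R = \int[mu2]_z f z.
Proof.
move=> mf f0; rewrite -[RHS](@int_plane_affine 1 0 0 1 h.1 h.2 f)//.
 by apply: eq_integral => z _; congr f; congr pair; ring.
by rewrite mulr1 mulr0 subr0 normr1.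
Qed.

Lemma int_plane_opp (f : plane -> \bar R) :
 mble f -> (forall z, 0 <= f z) ->
 \int[mu2]_z f (- z.1, - z.2)%R = \int[mu2]_z f z.
Proof.
move=> mf f0; rewrite -[RHS](@int_plane_affine (-1) 0 0 (-1) 0 0 f)//.
 by apply: eq_integral => z _; congr f; congr pair; ring.
by rewrite mulrNN mulr1 mulr0 subr0 normr1.
Qed.

Lemma int_plane_scale (s : R) (f : plane -> \bar R) : (0 < s)%R ->
 mble f -> (forall z, 0 <= f z) ->
 \int[mu2]_z f z = (s^2)%:E * \int[mu2]_z f (s * z.1, s * z.2)%R.
Proof.
move=> s0 mf f0; rewrite !int_plane//=; last by meas.
have s1 := lt0r_neq0 s0.
rewrite (@int_affine s 0 _ s1); try side.
rewrite -ge0_integralZl; try side.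
rewrite -[RHS]ge0_integralZl; try side.
apply: eq_integral => x _.
rewrite (@int_affine s 0 _ s1); try side.
rewrite muleA -EFinM -expr2 ger0_norm ?(ltW s0)// addr0.
by congr (_ * _); apply: eq_integral => y _; rewrite addr0.
Qed.

Lemma mfun_nsq : mble (@nsq R). Proof. by rewrite /nsq; meas. Qed.

End Plane.

Section Polar.
Variable R : realType.
Local Notation leb := (@lebesgue_measure R).
Local Notation mu2 := (leb2 R).
Local Notation plane := (plane R).
Local Open Scope ereal_scope.

Lemma eq_int_off (p : R) (f g : R -> \bar R) :
 mble f -> mble g ->
 (forall x, x != p -> f x = g x) -> \int[leb]_x f x = \int[leb]_x g x.
Proof.
move=> mf mg fg.
have mp : measurable ([set: R] `\ p) by exact: measurableD.
rewrite -(@integral_setD1 _ f p setT)//; last exact: measurable_funTS.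
rewrite -(@integral_setD1 _ g p setT)//; last exact: measurable_funTS.
by apply: eq_integral => x; rewrite inE => -[_ /eqP xp]; exact: fg.
Qed.

(** Polar coordinates without trigonometry: a line through the origin is given by its slope [k], a
    point on it by a signed radius [r], and the angular measure becomes [dk / (1 + k^2)], of total
    mass pi. The vertical line is null. *)
Lemma int_polar (f : plane -> \bar R) : mble f ->
 (forall z, 0 <= f z) ->
 \int[mu2]_z f z = \int[leb]_k \int[leb]_r
  (((1 + k^2)^-1 * `|r|)%:E *
   f (r / sqrt (1 + k^2), k * r / sqrt (1 + k^2))%R).
Proof.
move=> mf f0; rewrite int_plane; try side.
transitivity (\int[leb]_x \int[leb]_k (`|x|%:E * f (x, x * k)%R)).
 apply: (@eq_int_off 0%R); try side.
 move=> x x0; rewrite (@int_affine R x 0 (fun y => f (x, y)) x0); try side.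
 rewrite -ge0_integralZl; try side.
 by apply: eq_integral => k _; rewrite addr0.
rewrite tonelli; try side.
apply: eq_integral => k _.
pose s := (sqrt (1 + k^2))^-1%R.
have k1 : (0 < 1 + k^2)%R by rewrite ltr_pwDl ?sqr_ge0.
have s0 : (0 < s)%R by rewrite invr_gt0 sqrtr_gt0.
rewrite [LHS](@int_affine R s 0); try side; last exact: lt0r_neq0.
rewrite -ge0_integralZl; try side.
apply: eq_integral => r _; rewrite muleA -EFinM addr0 normrM mulrA.
rewrite (ger0_norm (ltW s0)) -expr2 exprVn sqr_sqrtr ?(ltW k1)//.
by congr (_ * f (_, _)); rewrite -/s; ring.
Qed.

Lemma int_cauchy : \int[leb]_k ((1 + k^2)^-1)%:E = pi%:E :> \bar R.
Proof.
have -> : \int[leb]_k ((1 + k^2)^-1)%:E = \int[leb]_k ((oneDsqr k)^-1)%:E by [].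
rewrite (@ge0_symfun_integralT _ (fun k => (oneDsqr k)^-1))%R; first last.
- by move=> x /=; rewrite /oneDsqr sqrrN.
- exact: continuous_oneDsqrV.
- by [].
rewrite -set_itvcy (@ge0_continuous_FTC2y _ _ atan _ (pi / 2))//.
- by rewrite atan0 sube0 -EFinM mulrC divfK.
- by apply: continuous_subspaceT; exact: continuous_oneDsqrV.
- exact: cvgy_atan.
- by apply: cvg_at_right_filter; exact: continuous_atan.
- by move=> x _; rewrite derive1_atan.
Qed.

Lemma int_abs_ball (q : R) : (0 <= q)%R ->
 \int[leb]_r (`|r| * ind (r^2 <= q))%:E = q%:E.
Proof.
move=> q0.
transitivity (2%:E * \int[leb]_r (Num.max r 0 * ind (r^2 <= q))%:E).
 rewrite EFinD ge0_muleDl// mul1e.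
 rewrite -[in X in _ = _ + X]int_opp; try side; first last.
  by move=> x; rewrite lee_fin mulr_ge0// le_max lexx orbT.
 rewrite -ge0_integralD//; try side; first last.
 - by move=> x _; rewrite lee_fin mulr_ge0// le_max lexx orbT.
 - by move=> x _; rewrite lee_fin mulr_ge0// le_max lexx orbT.
 apply: eq_integral => r _; rewrite -EFinD sqrrN -mulrDl; congr (_ * _)%:E.
 case: (lerP 0 r) => r0.
  by rewrite ger0_norm// max_r ?addr0// oppr_le0.
 by rewrite ltr0_norm// max_l ?add0r// oppr_ge0 ltW.
have [->|qn] := eqVneq q 0%R.
 rewrite (eq_integral (fun=> 0)); first by rewrite integral0 mule0.
 move=> r _; have [r0|r0] := leP (r^2)%R 0%R; last by rewrite mulr0.
 have /eqP -> : r == 0%R by rewrite -sqrf_eq0 eq_le r0 sqr_ge0.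
 by rewrite maxxx mul0r.
have qp : (0 < q)%R by lra.
have sp : (0 < sqrt q)%R by rewrite sqrtr_gt0.
have -> : \int[leb]_r (Num.max r 0 * ind (r^2 <= q))%:E =
 \int[leb]_(r in `[0%R, sqrt q]) r%:E.
 rewrite [RHS]integral_mkcond; apply: eq_integral => r _; rewrite patchE mem_setE in_itv/=.
 case: (lerP 0 r) => r0 /=; last by rewrite mul0r.
 rewrite -[in (r^2 <= q)%R](sqr_sqrtr q0) ler_sqr ?nnegrE//.
 by case: (_ <= _)%R; rewrite ?mulr1 ?mulr0.
rewrite (@continuous_FTC2 _ _ (fun r => r^2 / 2)%R)//.
- by rewrite sqr_sqrtr//; congr (_%:E); field.
- by apply: continuous_subspaceT => x.
- split.
 + by [].
 + by apply: cvg_at_right_filter; apply: cvgM; [exact: exprn_continuous|exact: cvg_cst].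
 + by apply: cvg_at_left_filter; apply: cvgM; [exact: exprn_continuous|exact: cvg_cst].
- by move=> x _; rewrite derive1E derive_val /GRing.scale /=; field.
Qed.

Lemma disc_area (q : R) : (0 <= q)%R -> mu2 [set z | nsq z <= q]%R = (pi * q)%:E.
Proof.
move=> q0.
have m1 : measurable [set z : plane | nsq z <= q]%R.
 have mb : mble (fun z : plane => (nsq z <= q)%R) by meas.
 by have := mb measurableT [set true] Logic.I; rewrite setTI.
rewrite -[X in mu2 X]setIT -integral_indic//.
transitivity (\int[mu2]_z (ind (nsq z <= q))%:E).
 by apply: eq_integral => z _; congr ((nat_of_bool _)%:R%:E); apply/idP/idP; rewrite inE.
rewrite int_polar; try side.
transitivity (\int[leb]_k (q%:E * ((1 + k^2)^-1)%:E)).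
 apply: eq_integral => k _.
 have k1 : (0 < 1 + k^2)%R by rewrite ltr_pwDl ?sqr_ge0.
 rewrite -(int_abs_ball q0) -ge0_integralZr; try side.
 apply: eq_integral => r _; rewrite -!EFinM; congr (_%:E).
 have -> : nsq (r / sqrt (1 + k^2), k * r / sqrt (1 + k^2))%R = (r^2)%R.
  rewrite /nsq !exprMn exprVn sqr_sqrtr ?(ltW k1)//; field; exact: lt0r_neq0.
 by ring.
rewrite ge0_integralZl; try side.
by rewrite int_cauchy mulrC.
Qed.

(** The image of plane measure under the squared norm is pi times Lebesgue measure on the half-line,
    because the area of a disc is linear in its squared radius. Hence the squared radius [q] as the
    variable in all that follows. *)
Lemma int_radial (f : R -> \bar R) : mble f ->
 (forall q, 0 <= f q) ->
 \int[mu2]_z f (nsq z) = pi%:E * \int[leb]_(q in `]0%R, +oo[) f q.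
Proof.
move=> mf f0; have mn := @mfun_nsq R.
rewrite integral_itv_obnd_cbnd; last exact: measurable_funTS.
have pV : (0 <= pi^-1 :> R)%R by pos.
pose m1 := mscale (NngNum pV) (pushforward mu2 (@nsq R : _ -> measurableTypeR R)).
(* Uniqueness of Lebesgue measure concerns the whole line, so the missing negative half-line is
   added to the pushforward; it drops out again once the integral is restricted to nonnegative
   [q]. *)
pose D : set (measurableTypeR R) := `]-oo, 0%R[%classic.
have mD : measurable D by exact: measurable_itv.
pose m := measure_add (m1 mn) (mrestr leb mD).
have ball0 (v : R) : mu2 [set z | nsq z <= v]%R = (pi * Num.max v 0)%:E.
 case: (lerP 0 v) => v0; first exact: disc_area.
 rewrite mulr0 (_ : mkset _ = set0) ?measure0//; apply/seteqP; split=> // z /= h.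
 by have := le_lt_trans h v0; rewrite ltNge nsq_ge0.
have eqm (A : set R) : measurable A -> leb A = m A.
 apply: lebesgue_measure_unique => _ [[u v] _ <-] /=.
 rewrite -[RHS]/(m _) /m measure_addE.
 suff : leb `]u, v] = pi^-1%:E * mu2 ((@nsq R) @^-1` `]u, v]) + leb (`]u, v] `&` D) by [].
 have [uv|uv] := leP v u.
  rewrite set_itv_ge -?leNgt//.
  by rewrite set0I !measure0 mule0 adde0.
 have -> : (@nsq R) @^-1` `]u, v] = [set z | nsq z <= v]%R `\` [set z | nsq z <= u]%R.
  apply/seteqP; split => z /=; rewrite in_itv/=; first by move=> /andP[a b]; split => //; apply/negP; rewrite -ltNge.
  by lra.
 have mb (w : R) : measurable [set z : plane | nsq z <= w]%R.
  have mw : mble (fun z : plane => (nsq z <= w)%R) by meas.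
  by have := mw measurableT [set true] Logic.I; rewrite setTI.
 have -> : mu2 ([set z | nsq z <= v]%R `\` [set z | nsq z <= u]%R) =
   mu2 [set z | nsq z <= v]%R - mu2 [set z | nsq z <= u]%R.
  rewrite [LHS]measureD; [|exact: mb|exact: mb|by rewrite [X in X < _]ball0 ltry].
  by rewrite setIidr// => z /= h; apply: le_trans h (ltW uv).
 rewrite !ball0 -EFinM.
 have -> : (pi^-1 * (pi * Num.max v 0 - pi * Num.max u 0) = Num.max v 0 - Num.max u 0)%R by rewrite -mulrBr mulrA mulVf ?mul1r// gt_eqF// pi_gt0.
 have -> : `]u, v] `&` D = if (v < 0)%R then `]u, v]%classic else `]u, 0%R[%classic.
  apply/seteqP; split=> x; rewrite /D /= !in_itv/=.
   move=> [/andP[a b] c]; case: ifPn => vv /=; rewrite in_itv/= ?a//.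
  case: ifPn => vv /=; rewrite in_itv/= => /andP[a b]; rewrite a b/=.
   by lra.
  by lra.
 rewrite lebesgue_measure_itv/= lte_fin uv; case: ifPn => vv.
  rewrite lebesgue_measure_itv/= lte_fin uv.
  by rewrite !max_r ?(ltW vv) ?(ltW (lt_trans uv vv))// subrr add0e.
 rewrite lebesgue_measure_itv/= lte_fin; rewrite -leNgt in vv.
 rewrite (max_l vv); case: ltP => u0.
  by congr (_%:E); ring.
 by rewrite adde0.
rewrite (eq_measure_integral (m1 mn)); last first.
 move=> A mA AD; rewrite [LHS]eqm// /m measure_addE /mrestr.
 transitivity (m1 mn A + leb (A `&` D)); first by [].
 suff -> : A `&` D = set0 by rewrite measure0 adde0.
 apply/seteqP; split=> // x [/AD]; rewrite /D /= !in_itv/= andbT => a b.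
 by lra.
rewrite ge0_integral_mscale//=; last exact: measurable_funTS.
rewrite ge0_integral_pushforward//=; last exact: measurable_funTS.
rewrite (_ : _ @^-1` _ = setT); last first.
 by apply/seteqP; split=> // z _ /=; rewrite in_itv/= nsq_ge0.
by rewrite muleA -EFinM mulfV ?mul1e// gt_eqF// pi_gt0.
Qed.

End Polar.

(** * Polarization and the Riesz inequality for sets *)

Section Polarization.
Variable R : realType.
Local Notation mu2 := (leb2 R).
Local Notation plane := (plane R).
Implicit Types (x y : plane) (k c : R) (a b : plane -> bool).

Lemma dsq_ge0 x y : 0 <= dsq x y. Proof. by rewrite addr_ge0 ?sqr_ge0. Qed.

Lemma dsqC x y : dsq x y = dsq y x.
Proof. by rewrite /dsq; ring. Qed.

Lemma onek_gt0 k : 0 < 1 + k^2.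
Proof. by rewrite ltr_pwDl ?sqr_ge0. Qed.

Lemma onek_neq0 k : 1 + k^2 != 0.
Proof. exact: lt0r_neq0 (onek_gt0 k). Qed.

Lemma gap_refl k c x : gap k c (refl k c x) = - gap k c x.
Proof. by rewrite /refl /gap /=; field; exact: onek_neq0. Qed.

Lemma reflK k c : involutive (refl k c).
Proof.
by move=> [x1 x2]; rewrite /refl gap_refl /=; congr pair; ring.
Qed.

Lemma nsq_refl k c x : nsq (refl k c x) = nsq x + 2 * c * gap k c x.
Proof. by rewrite /nsq /refl /gap /=; field; exact: onek_neq0. Qed.

(** The sign of the product of the gaps decides whether reflecting one of the points brings it
    closer: two points on the same side of the mirror are closer to each other than to each other's
    images. *)
Lemma dsq_reflr k c x y :
 dsq x (refl k c y) = dsq x y + gap k c x * gap k c y * (1 + k^2).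
Proof. by rewrite /dsq /refl /gap /=; field; exact: onek_neq0. Qed.

Lemma dsq_refll k c x y : dsq (refl k c x) y = dsq x (refl k c y).
Proof. by rewrite dsqC !dsq_reflr dsqC; ring. Qed.

Lemma dsq_refl2 k c x y : dsq (refl k c x) (refl k c y) = dsq x y.
Proof. by rewrite dsq_refll reflK. Qed.

Lemma int_refl k c (f : plane -> \bar R) : mble f ->
 (forall z, 0 <= f z)%E -> (\int[mu2]_z f (refl k c z) = \int[mu2]_z f z)%E.
Proof.
move=> mf f0; pose D := 1 + k^2; have D0 : D != 0 := onek_neq0 k.
rewrite -[RHS](@int_plane_affine R (1 - 2 / D) (- 2 * k / D) (- 2 * k / D)
 (1 - 2 * k^2 / D) (2 * c / D) (2 * c * k / D))//.
 by apply: eq_integral => z _; congr f; rewrite /refl /gap -/D; congr pair; field.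
have -> : (1 - 2 / D) * (1 - 2 * k^2 / D) - - 2 * k / D * (- 2 * k / D) = -1 by rewrite /D; field.
by rewrite normrN1.
Qed.

(** Two-point symmetrization: of a point and its mirror image, the one closer to the origin becomes
    a member if either was, the other only if both were. Ties are left alone, so nothing changes
    when the mirror passes through the origin. *)
Definition pol k c a x : bool :=
 if nsq x < nsq (refl k c x) then a x || a (refl k c x)
 else if nsq (refl k c x) < nsq x then a x && a (refl k c x) else a x.

Lemma mfun_pol k c a : mble a -> mble (pol k c a).
Proof. by move=> ma; rewrite /pol; meas. Qed.

Definition overlap t a b : \bar R :=
 (\int[mu2]_x \int[mu2]_y (ind (a x && b y && (dsq x y < t)))%:E)%E.

(** Reflections preserve the integral, so it is enough to compare the integrands summed over the
    four pairs made of [x], [y] and their images. Only two kernel values occur among them, and the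
    one for points on the same side is the larger. *)
Lemma pol_overlap t k c a b : mble a -> mble b ->
 (overlap t a b <= overlap t (pol k c a) (pol k c b))%E.
Proof.
move=> ma mb; pose s := refl k c.
pose G a b x y : \bar R := (ind (a x && b y && (dsq x y < t)))%:E.
have sum4 a' b' : mble a' -> mble b' ->
 (4%:R%:E * overlap t a' b' = \int[mu2]_x \int[mu2]_y
  (G a' b' x y + G a' b' (s x) y + (G a' b' x (s y) + G a' b' (s x) (s y))))%E.
 move=> ma' mb'.
 have G0 x y : (0 <= G a' b' x y)%E by rewrite lee_fin.
 have inner x : (\int[mu2]_y (G a' b' x y + G a' b' (s x) y +
    (G a' b' x (s y) + G a' b' (s x) (s y))) =
   2%:R%:E * (\int[mu2]_y G a' b' x y + \int[mu2]_y G a' b' (s x) y))%E.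
  rewrite /G /s ge0_integralD; try side.
  rewrite !ge0_integralD; try side.
  rewrite (@int_refl k c (fun y => (ind (a' x && b' y && (dsq x y < t)))%:E)); try side.
  rewrite (@int_refl k c (fun y => (ind (a' (refl k c x) && b' y && (dsq (refl k c x) y < t)))%:E)); try side.
  by rewrite EFinD ge0_muleDl ?mul1e//.
 under [RHS]eq_integral => x _ do rewrite inner.
 rewrite /G /s ge0_integralZl; try side.
 rewrite ge0_integralD; try side.
 rewrite (@int_refl k c (fun x => \int[mu2]_y (ind (a' x && b' y && (dsq x y < t)))%:E)%E); try side.
 rewrite -/(overlap t a' b') -[X in _ = (_ * (X + _))%E]mul1e -[X in _ = (_ * (_ + X))%E]mul1e.
 by rewrite -ge0_muleDl// muleA; congr (_%:E * _)%E; ring.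
have four : (0 < 4%:R%:E :> \bar R)%E by [].
rewrite -(lee_pmul2l _ four)//.
rewrite (sum4 _ _ ma mb) (sum4 _ _ (mfun_pol k c ma) (mfun_pol k c mb)).
have mpa := mfun_pol k c ma; have mpb := mfun_pol k c mb.
rewrite /G /s; apply: ge0_le_integral; try side.
move=> x _; apply: ge0_le_integral; try side.
move=> y _; rewrite -/(s x) -/(s y) lee_fin -!natrD ler_nat.
have d1 : dsq (s x) (s y) = dsq x y by exact: dsq_refl2.
have d2 : dsq (s x) y = dsq x (s y) by exact: dsq_refll.
have d3 := dsq_reflr k c x y.
have nx := nsq_refl k c x; have ny := nsq_refl k c y.
rewrite d1 d2 /pol -/(s x) -/(s y) ![refl k c (s _)]reflK.
have K := onek_gt0 k.
rewrite -/(s y) -/(s x) in d3 nx ny.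
set gx := gap k c x in d3 nx *; set gy := gap k c y in d3 ny *.
have same : 0 <= gx * gy -> (dsq x (s y) < t) -> (dsq x y < t).
 move=> g0; apply: le_lt_trans; rewrite d3 lerDl mulr_ge0// ltW//.
have opp : gx * gy <= 0 -> (dsq x y < t) -> (dsq x (s y) < t) by move=> g0; apply: le_lt_trans; rewrite d3 gerDl mulr_le0_ge0// ltW.
(* [u] and [v] say whether [x] and [y] are nearer the origin than their images; [k1] is the kernel
   at [(x, y)] and [(s x, s y)], [k2] at the two mixed pairs. In [key0] and [key1] one of the points
   lies on the mirror, so both kernel values agree. *)
have key (p p' q q' k1 k2 u v : bool) : (u == v -> k2 -> k1) -> (u != v -> k1 -> k2) ->
 ((p && q && k1) + (p' && q && k2) + ((p && q' && k2) + (p' && q' && k1)) <=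
 ((if u then p || p' else p && p') && (if v then q || q' else q && q') && k1) +
 ((if u then p && p' else p || p') && (if v then q || q' else q && q') && k2) +
 (((if u then p || p' else p && p') && (if v then q && q' else q || q') && k2) +
 ((if u then p && p' else p || p') && (if v then q && q' else q || q') && k1)))%N by case: u v p p' q q' k1 k2 => [] [] [] [] [] [] [] [] //= h1 h2;
  by [have := h1 isT isT|have := h2 isT isT].
have key0 (p p' q q' k1 v : bool) :
 ((p && q && k1) + (p' && q && k1) + ((p && q' && k1) + (p' && q' && k1)) <=
 (p && (if v then q || q' else q && q') && k1) +
 (p' && (if v then q || q' else q && q') && k1) +
 ((p && (if v then q && q' else q || q') && k1) +
 (p' && (if v then q && q' else q || q') && k1)))%N by case: v p p' q q' k1 => [] [] [] [] [] [].
have key1 (p p' q q' k1 u : bool) :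
 ((p && q && k1) + (p' && q && k1) + ((p && q' && k1) + (p' && q' && k1)) <=
 ((if u then p || p' else p && p') && q && k1) +
 ((if u then p && p' else p || p') && q && k1) +
 (((if u then p || p' else p && p') && q' && k1) +
 ((if u then p && p' else p || p') && q' && k1)))%N by case: u p p' q q' k1 => [] [] [] [] [] [].
have ss : 0 <= gx * gy -> gx * gy <= 0 -> (dsq x y < t) = (dsq x (s y) < t) by move=> g1 g2; apply/idP/idP; [exact: opp|exact: same].
have c2 : 0 <= c * c by rewrite sqr_ge0.
have [lx|lx|ex] := ltgtP (nsq x) (nsq (s x)); have [ly|ly|ey] := ltgtP (nsq y) (nsq (s y));
 rewrite ?(andbC (b (s y)) (b y)) ?(andbC (a (s x)) (a x)) ?(orbC (b (s y)) (b y)) ?(orbC (a (s x)) (a x)).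
- apply: (key _ _ _ _ _ _ true true) => // _; apply: same; nra.
- apply: (key _ _ _ _ _ _ true false) => // _; apply: opp; nra.
- have [c0|c0] := eqVneq c 0; first by move: lx; rewrite nx c0 mulr0 mul0r addr0 ltxx.
 have gy0 : gy = 0 by apply/eqP; move/eqP: ey; rewrite ny eq_sym -subr_eq0 addrC addKr !mulf_eq0 (negbTE c0) pnatr_eq0.
 by rewrite -ss ?gy0 ?mulr0//; exact: (key1 _ _ _ _ _ true).
- apply: (key _ _ _ _ _ _ false true) => // _; apply: opp; nra.
- apply: (key _ _ _ _ _ _ false false) => // _; apply: same; nra.
- have [c0|c0] := eqVneq c 0; first by move: lx; rewrite nx c0 mulr0 mul0r addr0 ltxx.
 have gy0 : gy = 0 by apply/eqP; move/eqP: ey; rewrite ny eq_sym -subr_eq0 addrC addKr !mulf_eq0 (negbTE c0) pnatr_eq0.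
 by rewrite -ss ?gy0 ?mulr0//; exact: (key1 _ _ _ _ _ false).
- have [c0|c0] := eqVneq c 0; first by move: ly; rewrite ny c0 mulr0 mul0r addr0 ltxx.
 have gx0 : gx = 0 by apply/eqP; move/eqP: ex; rewrite nx eq_sym -subr_eq0 addrC addKr !mulf_eq0 (negbTE c0) pnatr_eq0.
 by rewrite -ss ?gx0 ?mul0r//; exact: (key0 _ _ _ _ _ true).
- have [c0|c0] := eqVneq c 0; first by move: ly; rewrite ny c0 mulr0 mul0r addr0 ltxx.
 have gx0 : gx = 0 by apply/eqP; move/eqP: ex; rewrite nx eq_sym -subr_eq0 addrC addKr !mulf_eq0 (negbTE c0) pnatr_eq0.
 by rewrite -ss ?gx0 ?mul0r//; exact: (key0 _ _ _ _ _ false).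
- by [].
Qed.

(** Polarization moves membership from a point to its image nearer the origin, so a radially
    decreasing weight gains exactly the difference of its values wherever a move happens. Adding the
    integrand at the image makes this a pointwise identity. *)
Lemma pol_weight k c a (w : plane -> R) : mble a -> mble w ->
 (forall x, 0 <= w x) -> (forall x y, nsq x < nsq y -> w y <= w x) ->
 (\int[mu2]_x (ind (pol k c a x) * w x)%:E = \int[mu2]_x (ind (a x) * w x)%:E +
 \int[mu2]_x (ind (~~ a x && a (refl k c x) && (nsq x < nsq (refl k c x))) *
  (w x - w (refl k c x)))%:E)%E.
Proof.
move=> ma mw w0 wd; pose s := refl k c.
pose g x : R := ind (~~ a x && a (s x) && (nsq x < nsq (s x))) * (w x - w (s x)).
have mg : mble g by rewrite /g /s; meas.
have g0 x : 0 <= g x by rewrite /g; case: ltP => h; rewrite ?andbF ?mul0r// mulr_ge0// subr_ge0 wd.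
have double (f : plane -> R) : mble f -> (forall x, 0 <= f x) ->
  (2%:R%:E * \int[mu2]_x (f x)%:E = \int[mu2]_x (f x + f (s x))%:E)%E.
 move=> mf f0.
 under [RHS]eq_integral => x _ do rewrite EFinD.
 rewrite /s ge0_integralD; try side.
 rewrite (@int_refl k c (fun x => (f x)%:E)); try side.
 by rewrite EFinD ge0_muleDl// mul1e.
rewrite -[X in (_ = _ + X)%E]/(\int[mu2]_x (g x)%:E)%E.
rewrite -ge0_integralD; try side.
have eqd (p q : \bar R) : (2%:R%:E * p = 2%:R%:E * q)%E -> p = q.
 move=> /(congr1 (fun z => 2%:R^-1%:E * z)%E).
 by rewrite !muleA -EFinM mulVf ?mul1e.
apply: eqd; under [in RHS]eq_integral => x _ do rewrite -EFinD.
rewrite (double (fun x => ind (pol k c a x) * w x)); try side.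
rewrite (double (fun x => ind (a x) * w x + g x)); try side.
apply: eq_integral => x _; congr (_%:E).
rewrite /g /pol -/(s x) ![refl k c (s _)]reflK ![s (s _)]reflK.
by have [l|l|e] := ltgtP (nsq x) (nsq (s x)); case: (a x); case: (a (s x)) => /=; ring.
Qed.

End Polarization.

Section Dominated.
Context {d} {T : measurableType d} {R : realType} (mu : {measure set T -> \bar R}).
Implicit Types f g : T -> R.

Lemma le_int_real f g : mble f -> mble g ->
 (forall x, 0 <= f x) -> (forall x, f x <= g x) ->
 (\int[mu]_x (f x)%:E <= \int[mu]_x (g x)%:E)%E.
Proof.
move=> mf mg f0 fg; apply: ge0_le_integral => //.
- by pos.
- exact/measurable_EFinP.
- exact/measurable_EFinP.
- by pos.
Qed.

Lemma intble_real g : mble g -> (forall x, 0 <= g x) ->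
 (\int[mu]_x (g x)%:E < +oo)%E -> mu.-integrable setT (EFin \o g).
Proof.
move=> mg g0 goo; apply/integrableP; split; first exact/measurable_EFinP.
by under eq_integral => x _ do rewrite /= ger0_norm//.
Qed.

Lemma dominated_ae (f_ : nat -> T -> R) f g :
 (forall n, mble (f_ n)) -> mble f ->
 {ae mu, forall x, f_ n x @[n --> \oo] --> f x} -> (forall n x, `|f_ n x| <= g x) ->
 mble g -> (\int[mu]_x (g x)%:E < +oo)%E ->
 mu.-integrable setT (fun x => (f x)%:E) /\
 (\int[mu]_x (f_ n x)%:E)%E @[n --> \oo] --> (\int[mu]_x (f x)%:E)%E.
Proof.
move=> mf_ mf ff fg mg goo.
have g0 x : 0 <= g x by apply: le_trans (fg 0%N x).
have h1 n : mble (fun x => (f_ n x)%:E) by exact/measurable_EFinP.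
have h2 : mble (fun x => (f x)%:E) by exact/measurable_EFinP.
have h3 : {ae mu, forall x, setT x -> (f_ n x)%:E @[n --> \oo] --> (f x)%:E}.
 case: ff => B [mB B0 sB]; exists B; split => // x hx; apply: sB => /= h; apply: hx => _.
 by apply: cvg_EFin; [exact: nearW|exact: h].
have h4 := intble_real mg g0 goo.
have h5 : {ae mu, forall x n, setT x -> (`|(f_ n x)%:E| <= (EFin \o g) x)%E} by apply: aeW => x n _; rewrite lee_fin.
by have [? _ ?] := dominated_convergence measurableT h1 h2 h3 h4 h5.
Qed.

Lemma dominated_real (f_ : nat -> T -> R) f g :
 (forall n, mble (f_ n)) -> mble f ->
 (forall x, f_ n x @[n --> \oo] --> f x) -> (forall n x, `|f_ n x| <= g x) ->
 mble g -> (\int[mu]_x (g x)%:E < +oo)%E ->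
 (\int[mu]_x (f_ n x)%:E)%E @[n --> \oo] --> (\int[mu]_x (f x)%:E)%E.
Proof.
by move=> mf_ mf ff fg mg goo; apply: (dominated_ae mf_ mf _ fg mg goo).2; exact: aeW.
Qed.

End Dominated.

Section RieszSets.
Variable R : realType.
Local Notation leb := (@lebesgue_measure R).
Local Notation mu2 := (leb2 R).
Local Notation plane := (plane R).
Implicit Types (x y : plane) (k c : R) (a b : plane -> bool).

Definition mass a : \bar R := (\int[mu2]_x (ind (a x))%:E)%E.

Definition disc (q : R) x : bool := nsq x < q.

Lemma mfun_disc q : mble (disc q).
Proof. by rewrite /disc; meas. Qed.

Lemma mass_disc q : 0 <= q -> mass (disc q) = (pi * q)%:E.
Proof.
move=> q0; rewrite /mass /disc.
rewrite (@int_radial R (fun p => (ind (p < q))%:E)); try side.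
rewrite EFinM; congr (_ * _)%E.
transitivity (\int[leb]_(p in `]0%R, q[) cst 1 p)%E; last first.
 rewrite integral_cst//= mul1e lebesgue_measure_itv/= lte_fin.
 by case: ltP => h; [rewrite oppr0 adde0|congr EFin; apply/le_anti; rewrite q0 h].
rewrite integral_mkcond [RHS]integral_mkcond; apply: eq_integral => p _.
rewrite !patchE !mem_setE !in_itv/= andbT.
by case: (0 < p); case: (p < q).
Qed.

Lemma mass_ge0 a : (0 <= mass a)%E.
Proof. by apply: integral_ge0 => x _. Qed.

Lemma pol_mass k c a : mble a -> mass (pol k c a) = mass a.
Proof.
move=> ma; have := @pol_weight R k c a (fun=> 1) ma (measurable_cst _).
rewrite /mass => /(_ (fun=> ler01) (fun _ _ _ => lexx _)) h.
under eq_integral do rewrite -[X in X%:E]mulr1.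
rewrite h; under eq_integral do rewrite mulr1.
rewrite [X in (_ + X)%E](eq_integral (fun=> 0%E)) ?integral0 ?adde0//.
by move=> x _; rewrite subrr mulr0.
Qed.

Lemma pol_inner k c a r : mble a ->
 (mass (fun x => a x && (nsq x < r)%R) <= mass (fun x => pol k c a x && (nsq x < r)%R))%E.
Proof.
move=> ma; have mw : mble (fun x : plane => ind (nsq x < r) : R) by meas.
have h := @pol_weight R k c a _ ma mw (fun=> ler0n _ _).
rewrite /mass.
under eq_integral do rewrite -mulnb natrM.
under [leRHS]eq_integral do rewrite -mulnb natrM.
rewrite h.
 rewrite leeDl//; apply: integral_ge0 => x _; rewrite lee_fin.
 case: (ltP (nsq x) (nsq (refl k c x))) => l; last by rewrite andbF mul0r.
 rewrite mulr_ge0// subr_ge0 ler_nat; case: (ltP (nsq (refl k c x)) r) => //= lr.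
 by rewrite (lt_trans l lr).
by move=> x y xy; case: ltP => //= yr; rewrite (lt_trans xy yr).
Qed.

Definition pols (l : seq (R * R)) a := foldr (fun p a => pol p.1 p.2 a) a l.

Lemma mfun_pols l a : mble a -> mble (pols l a).
Proof. by move=> ma; elim: l => //= p l IH; exact: mfun_pol. Qed.

Lemma pols_mass l a : mble a -> mass (pols l a) = mass a.
Proof.
by move=> ma; elim: l => //= p l IH; rewrite pol_mass//; exact: mfun_pols.
Qed.

Lemma pols_inner l a r : mble a ->
 (mass (fun x => a x && (nsq x < r)%R) <= mass (fun x => pols l a x && (nsq x < r)%R))%E.
Proof.
move=> ma; elim: l => //= p l IH; apply: (le_trans IH); apply: pol_inner.
exact: mfun_pols.
Qed.

Lemma pols_overlap t l a b : mble a -> mble b ->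
 (overlap t a b <= overlap t (pols l a) (pols l b))%E.
Proof.
move=> ma mb; elim: l => [|p l IH] /=; first exact: lexx.
by apply: (le_trans IH); apply: pol_overlap; exact: mfun_pols.
Qed.

(** A bounded weight that decreases strictly with the distance to the origin; the integral of [wt]
    over a set records the progress of successive polarizations. *)
Definition wt x : R := (1 + nsq x)^-1.

Lemma wt_gt0 x : 0 < wt x.
Proof. by rewrite invr_gt0 ltr_pwDl ?nsq_ge0. Qed.

Lemma wt_le1 x : wt x <= 1.
Proof. by rewrite invf_le1 ?lerDl ?nsq_ge0// ltr_pwDl ?nsq_ge0. Qed.

Lemma wt_lt x y : nsq x < nsq y -> wt y < wt x.
Proof.
have p z : 0 < 1 + nsq z by rewrite ltr_pwDl ?nsq_ge0.
by move=> xy; rewrite ltf_pV2 ?posrE ?p// ltrD2l.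
Qed.

Lemma mfun_wt : mble wt.
Proof. by rewrite /wt; meas. Qed.

Definition gain k c a : \bar R :=
 (\int[mu2]_x (ind (~~ a x && a (refl k c x) && (nsq x < nsq (refl k c x))) *
  (wt x - wt (refl k c x)))%:E)%E.

Lemma gain_ge0 k c a : (0 <= gain k c a)%E.
Proof.
apply: integral_ge0 => x _; rewrite lee_fin.
case: (ltP (nsq x) (nsq (refl k c x))) => l; last by rewrite andbF mul0r.
by rewrite mulr_ge0// subr_ge0 ltW// wt_lt.
Qed.

(** In place of a limit of infinitely many polarizations: a finite list whose total [wt]-integral is
    within [e] of the supremum leaves every further reflection a gain of at most [e]. One list
    serves both sets, so that their overlap can be followed. *)
Lemma pols_near_optimal a b (e : R) : mble a -> mble b ->
 (mass a < +oo)%E -> (mass b < +oo)%E -> 0 < e ->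
 exists l, forall k c, (gain k c (pols l a) <= e%:E)%E /\ (gain k c (pols l b) <= e%:E)%E.
Proof.
move=> ma mb aoo boo e0.
pose Phi a := (\int[mu2]_x (ind (a x) * wt x)%:E)%E.
have mw := mfun_wt.
have w0 x : 0 <= wt x by exact: ltW (wt_gt0 x).
have Phi0 a' : (0 <= Phi a')%E by apply: integral_ge0 => x _; rewrite lee_fin mulr_ge0.
have PhiM a' : mble a' -> (Phi a' <= mass a')%E.
 move=> ma'; apply: le_int_real; try side.
 by move=> x; rewrite ler_piMr// wt_le1.
have PhiS k c a' : mble a' -> Phi (pol k c a') = (Phi a' + gain k c a')%E by move=> ma'; apply: pol_weight => // x y xy; exact: ltW (wt_lt xy).
have fin a' l : mble a' -> (mass a' < +oo)%E -> Phi (pols l a') \is a fin_num.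
 move=> ma' oo; rewrite ge0_fin_numE//; apply: le_lt_trans oo.
 by rewrite -(pols_mass l ma'); apply: PhiM; exact: mfun_pols.
pose val l := fine (Phi (pols l a)) + fine (Phi (pols l b)).
pose S := [set val l | l in [set: seq (R * R)]].
have ubS : ubound S (fine (mass a) + fine (mass b)).
 move=> _ [l _ <-]; apply: lerD; apply: fine_le; rewrite ?fin// ?ge0_fin_numE ?mass_ge0//.
  by rewrite -(pols_mass l ma); apply: PhiM; exact: mfun_pols.
 by rewrite -(pols_mass l mb); apply: PhiM; exact: mfun_pols.
have hS : has_sup S by split; [exists (val [::]), [::]|exists (fine (mass a) + fine (mass b))].
have [_ [l _ <-] hl] := sup_adherent e0 hS.
exists l => k c.
have up : val ((k, c) :: l) <= sup S by apply: sup_upper_bound => //; exists ((k, c) :: l).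
have fg a' : mble a' -> (mass a' < +oo)%E -> gain k c (pols l a') \is a fin_num.
 move=> ma' oo; have := fin a' ((k, c) :: l) ma' oo.
 rewrite /= PhiS; last exact: mfun_pols.
 by rewrite fin_numD => /andP[].
have va : val ((k, c) :: l) = val l + (fine (gain k c (pols l a)) + fine (gain k c (pols l b))).
 rewrite /val /= !PhiS; try exact: mfun_pols.
 rewrite (fineD (fin a l ma aoo) (fg a ma aoo)) (fineD (fin b l mb boo) (fg b mb boo)); ring.
have ga := fg a ma aoo; have gb := fg b mb boo.
have g1 := fine_ge0 (gain_ge0 k c (pols l a)).
have g2 := fine_ge0 (gain_ge0 k c (pols l b)).
by rewrite -(fineK ga) -(fineK gb) !lee_fin; split; lra.
Qed.

Definition cauchy (k : R) : R := (1 + k^2)^-1.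

Lemma cauchy_gt0 k : 0 < cauchy k.
Proof. by rewrite invr_gt0 onek_gt0. Qed.

(* The density with respect to Lebesgue measure of the image of a fixed point
 [x] under the reflection whose parameters [k], [c] are drawn with densities
 [cauchy]. *)
Definition theta x y : R :=
 let s := y.1 - x.1 in let k := (y.2 - x.2) / s in
 `|s|^-1 / 2 * cauchy ((1 + k^2) / 2 * s + (x.1 + k * x.2)).

Lemma theta_ge0 x y : 0 <= theta x y.
Proof. by rewrite /theta mulr_ge0 ?(ltW (cauchy_gt0 _))//; pos. Qed.

Lemma theta_gt0 x y : y.1 != x.1 -> 0 < theta x y.
Proof.
move=> xy; rewrite /theta mulr_gt0 ?cauchy_gt0// divr_gt0// invr_gt0 normr_gt0.
by rewrite subr_eq0.
Qed.

Lemma mfun_theta {d} {T : measurableType d} (f g : T -> plane) :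
 mble f -> mble g ->
 mble (fun z => theta (f z) (g z)).
Proof. by move=> mf mg; rewrite /theta /cauchy; meas. Qed.

(** At fixed [k], passing from [c] to the first displacement [s] has Jacobian [(1 + k^2) / 2], which
    cancels [cauchy k] up to the factor 1/2; then [v = k * s] turns [k] into the second
    displacement, with the factor [1 / |s|]. *)
Lemma refl_average x (f : plane -> \bar R) : mble f ->
 (forall z, 0 <= f z)%E ->
 (\int[leb]_k \int[leb]_c ((cauchy k * cauchy c)%:E * f (refl k c x)) =
 \int[mu2]_y ((theta x y)%:E * f y))%E.
Proof.
move=> mf f0.
transitivity (\int[leb]_k \int[leb]_s ((2^-1 *
  cauchy ((1 + k^2) / 2 * s + (x.1 + k * x.2)))%:E * f (x.1 + s, x.2 + s * k)%R))%E.
 apply: eq_integral => k _.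
 have K0 := onek_neq0 k; have K1 := onek_gt0 k.
 have A0 : (1 + k^2) / 2 != 0 by rewrite mulf_neq0// invr_eq0.
 have A1 : 0 <= (1 + k^2) / 2 by rewrite divr_ge0// ltW.
 rewrite (@int_affine R ((1 + k^2) / 2) (x.1 + k * x.2)); rewrite // /cauchy; try side.
 rewrite -ge0_integralZl; try side.
 apply: eq_integral => s _; rewrite muleA -EFinM (ger0_norm A1).
 congr (_%:E * f _)%E.
  by set z := (1 + (_ + _)^2)^-1; field.
 rewrite /refl /gap; have -> : 2 * ((1 + k^2) / 2 * s + (x.1 + k * x.2) - (x.1 + k * x.2)) /
  (1 + k^2) = s by field.
 by [].
rewrite tonelli; rewrite /cauchy; try side.
transitivity (\int[leb]_s \int[leb]_v ((`|s|^-1 / 2 *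
  cauchy ((1 + (v / s)^2) / 2 * s + (x.1 + v / s * x.2)))%:E * f (x.1 + s, x.2 + v)%R))%E.
 apply: (@eq_int_off R 0); rewrite /cauchy; try side.
 move=> s s0.
 rewrite [LHS](@int_affine R s^-1 0); try side; last by rewrite invr_eq0.
 rewrite -ge0_integralZl; try side.
 apply: eq_integral => v _; rewrite muleA -EFinM addr0 normfV.
 rewrite [s^-1 * v]mulrC.
 by congr (_%:E * f (_, _))%E; [rewrite mulrA|rewrite mulrCA mulfV// mulr1].
have mth := @mfun_theta.
rewrite -[RHS](@int_plane_shift R x (fun y => ((theta x y)%:E * f y)%E)); first last.
- by move=> z; rewrite mule_ge0// lee_fin theta_ge0.
- by rewrite /theta /cauchy; meas.
rewrite int_plane; first last.
- by move=> z; rewrite mule_ge0// lee_fin theta_ge0.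
- by rewrite /theta /cauchy; meas.
apply: eq_integral => s _; apply: eq_integral => v _ /=.
rewrite /theta /= !addrK.
by congr (_ * f (_, _))%E; rewrite addrC.
Qed.

(** Averages the uniform bound on the gain; [pi^2] is the total mass of the two densities. The
    reflected point then ranges over all [y], which turns a statement about reflections into one
    about all misplaced pairs. *)
Lemma gain_average a (e : R) : mble a ->
 (forall k c, gain k c a <= e%:E)%E ->
 (\int[mu2]_x \int[mu2]_y (theta x y * (ind (~~ a x && a y && (nsq x < nsq y)%R) *
  (wt x - wt y)))%:E <= (pi^2 * e)%:E)%E.
Proof.
move=> ma ge.
pose F x y : R := ind (~~ a x && a y && (nsq x < nsq y)) * (wt x - wt y).
have F0 x y : 0 <= F x y.
 rewrite /F; case: (ltP (nsq x) (nsq y)) => l; last by rewrite andbF mul0r.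
 by rewrite mulr_ge0// subr_ge0 ltW// wt_lt.
have mF d (T : measurableType d) (f g : T -> plane) : mble f ->
  mble g -> mble (fun z => F (f z) (g z)) by move=> mf mg; rewrite /F /wt; meas.
have c0 k : 0 <= cauchy k by exact: ltW (cauchy_gt0 k).
have e0 : 0 <= e by have := le_trans (gain_ge0 0 0 a) (ge 0 0); rewrite lee_fin.
have mid1 : mble (fun z : (plane * R) * R => refl z.1.2 z.2 z.1.1) by meas.
have mid2 : mble (fun z : (R * plane) * R => refl z.1.1 z.2 z.1.2) by meas.
have mid3 (k : R) : mble (fun z : plane * R => refl k z.2 z.1) by meas.
have mid4 (k c : R) : mble (fun z : plane => refl k c z) by meas.
apply: (@le_trans _ _ (\int[mu2]_x \int[leb]_k \int[leb]_c ((cauchy k * cauchy c)%:E *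
 (F x (refl k c x))%:E))%E).
 rewrite le_eqVlt; apply/orP; left; apply/eqP; apply: eq_integral => x _.
 rewrite (@refl_average x (fun y => (F x y)%:E)); last 2 first.
 - by apply/mfun_EFin/mF; meas.
 - by move=> z; rewrite lee_fin.
 by apply: eq_integral => y _; rewrite -EFinM.
rewrite -tonelli_line_plane; first last.
- by move=> k x; apply: integral_ge0 => c _; pos.
- apply: mfun_int_line; last by move=> z c; pos.
 apply: mfun_emul; apply: mfun_EFin; first by rewrite /cauchy; meas.
 by apply: mF; meas.
have step k : (\int[mu2]_x \int[leb]_c ((cauchy k * cauchy c)%:E * (F x (refl k c x))%:E) <=
  (pi * e)%:E * (cauchy k)%:E)%E.
 rewrite -tonelli_line_plane; first last.
 - by move=> c x; pos.
 - by apply: mfun_emul; apply: mfun_EFin; [rewrite /cauchy; meas|apply: mF; meas].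
 apply: (@le_trans _ _ (\int[leb]_c ((cauchy k * e)%:E * (cauchy c)%:E))%E).
  apply: ge0_le_integral => //.
  - by move=> c _; apply: integral_ge0 => x _; pos.
  - apply: mfun_int_plane; last by move=> *; pos.
   by apply: mfun_emul; apply: mfun_EFin; [rewrite /cauchy; meas|apply: mF; meas].
  - by rewrite /cauchy; meas.
  move=> c _; rewrite ge0_integralZl//; last 3 first.
  - by rewrite /F /wt; meas.
  - by move=> x _; rewrite lee_fin.
  - by pos.
  rewrite (_ : (cauchy k * e)%:E * (cauchy c)%:E = (cauchy k * cauchy c)%:E * e%:E)%E; last first.
   by rewrite -!EFinM; congr EFin; ring.
  by apply: lee_pmul => //; [pos|exact: gain_ge0|exact: ge].
 rewrite ge0_integralZl//; last 3 first.
 - by rewrite /cauchy; meas.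
 - by move=> x _; rewrite lee_fin.
 - by pos.
 rewrite int_cauchy -!EFinM lee_fin le_eqVlt; apply/orP; left; apply/eqP; ring.
apply: (@le_trans _ _ (\int[leb]_k ((pi * e)%:E * (cauchy k)%:E))%E).
 apply: ge0_le_integral => //.
 - by move=> k _; apply: integral_ge0 => x _; apply: integral_ge0 => c _; pos.
 - apply: mfun_int_plane; last by move=> k x; apply: integral_ge0 => c _; pos.
  apply: mfun_int_line; last by move=> z c; pos.
  by apply: mfun_emul; apply: mfun_EFin; [rewrite /cauchy; meas|apply: mF; meas].
 - by rewrite /cauchy; meas.
rewrite ge0_integralZl//; last 3 first.
- by rewrite /cauchy; meas.
- by move=> x _; rewrite lee_fin.
- by pos.
rewrite int_cauchy -!EFinM lee_fin le_eqVlt; apply/orP; left; apply/eqP; ring.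
Qed.

End RieszSets.

Section RieszSetsConclusion.
Variable R : realType.
Local Notation mu2 := (leb2 R).
Local Notation plane := (plane R).
Implicit Types (x y : plane) (a b : plane -> bool).

Lemma int2D (K L : plane -> plane -> R) :
 mble (fun z : plane * plane => K z.1 z.2) ->
 mble (fun z : plane * plane => L z.1 z.2) ->
 (forall x y, 0 <= K x y) -> (forall x y, 0 <= L x y) ->
 (\int[mu2]_x \int[mu2]_y (K x y + L x y)%:E =
 \int[mu2]_x \int[mu2]_y (K x y)%:E + \int[mu2]_x \int[mu2]_y (L x y)%:E)%E.
Proof.
move=> mK mL K0 L0.
have mK1 x : mble (K x) by apply: (measurable_fun_pair2 x mK).
have mL1 x : mble (L x) by apply: (measurable_fun_pair2 x mL).
rewrite -ge0_integralD; try side.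
apply: eq_integral => x _.
have mKx := mK1 x; have mLx := mL1 x.
rewrite -ge0_integralD; try side.
by [].
Qed.

Lemma int2Z (c : R) (K : plane -> plane -> R) : 0 <= c ->
 mble (fun z : plane * plane => K z.1 z.2) -> (forall x y, 0 <= K x y) ->
 (\int[mu2]_x \int[mu2]_y (c * K x y)%:E = c%:E * \int[mu2]_x \int[mu2]_y (K x y)%:E)%E.
Proof.
move=> c0 mK K0.
have mK1 x : mble (K x) by apply: (measurable_fun_pair2 x mK).
rewrite -ge0_integralZl; try side.
apply: eq_integral => x _.
have mKx := mK1 x.
by rewrite -ge0_integralZl; try side.
Qed.

Lemma le_int2 (K L : plane -> plane -> R) :
 mble (fun z : plane * plane => K z.1 z.2) ->
 mble (fun z : plane * plane => L z.1 z.2) ->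
 (forall x y, 0 <= K x y) -> (forall x y, K x y <= L x y) ->
 (\int[mu2]_x \int[mu2]_y (K x y)%:E <= \int[mu2]_x \int[mu2]_y (L x y)%:E)%E.
Proof.
move=> mK mL K0 KL.
have L0 x y : 0 <= L x y by exact: le_trans (K0 x y) (KL x y).
have mK1 x : mble (K x) by apply: (measurable_fun_pair2 x mK).
have mL1 x : mble (L x) by apply: (measurable_fun_pair2 x mL).
apply: ge0_le_integral; try side.
move=> x _; have mKx := mK1 x; have mLx := mL1 x.
by apply: le_int_real.
Qed.

Lemma mass_split a b : mble a -> mble b ->
 mass a = (mass (fun x => a x && b x) + mass (fun x => a x && ~~ b x))%E.
Proof.
move=> ma mb; rewrite /mass -ge0_integralD; try side.
by apply: eq_integral => x _; rewrite -EFinD -natrD; case: (a x); case: (b x).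
Qed.

Lemma mass_le a b : mble a -> mble b ->
 (forall x, a x -> b x) -> (mass a <= mass b)%E.
Proof.
move=> ma mb ab; apply: le_int_real; try side.
by move=> x; have := ab x; case: (a x); case: (b x) => // /(_ isT).
Qed.

Lemma mass_excess a b : mble a -> mble b ->
 mass a = mass b -> (mass b < +oo)%E ->
 mass (fun x => a x && ~~ b x) = mass (fun x => ~~ a x && b x).
Proof.
move=> ma mb eqab boo.
have mab : mble (fun x => a x && b x) by meas.
have h1 := mass_split ma mb; have h2 := mass_split mb ma.
have e1 : mass (fun x => b x && a x) = mass (fun x => a x && b x) by apply: eq_integral => x _; rewrite andbC.
have e2 : mass (fun x => b x && ~~ a x) = mass (fun x => ~~ a x && b x) by apply: eq_integral => x _; rewrite andbC.
have fin : mass (fun x => a x && b x) \is a fin_num.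
 rewrite ge0_fin_numE ?mass_ge0//; apply: le_lt_trans boo.
 by apply: mass_le => // x /andP[].
move: h1; rewrite eqab h2 e1 e2 => h.
have k p : p = (mass (fun x => a x && b x)%R + p - mass (fun x => a x && b x)%R)%E by rewrite [X in (X - _)%E]addeC addeK.
by rewrite [LHS]k -h.
Qed.

Lemma mass_prod a b : mble a -> mble b ->
 (\int[mu2]_x \int[mu2]_y (ind (a x) * ind (b y))%:E = mass a * mass b)%E.
Proof.
move=> ma mb.
transitivity (\int[mu2]_x ((ind (a x))%:E * mass b))%E; last first.
 by rewrite ge0_integralZr//; [by meas|exact: mass_ge0].
apply: eq_integral => x _; rewrite -ge0_integralZl; try side.
by [].
Qed.

Lemma diagonal_null : (\int[mu2]_x \int[mu2]_y (ind (y.1 == x.1))%:E = 0)%E.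
Proof.
rewrite (eq_integral (fun=> 0%E)) ?integral0// => x _.
rewrite int_plane; try side.
rewrite (@eq_int_off R x.1 _ (fun=> 0%E)); try side; first by rewrite integral0.
by move=> y yx; rewrite /= (negbTE yx) integral0.
Qed.

(** For [x] inside and [y] outside [disc q], [theta] times the weight difference is positive unless
    the first coordinates agree, which is a null event. Dominated convergence, available because [y]
    stays in [disc r], makes the pairs with small values negligible. *)
Lemma near_radial_null (q r e : R) : 0 <= q -> 0 <= r -> 0 < e -> exists n,
 (\int[mu2]_x \int[mu2]_y (ind [&& disc q x, ~~ disc q y, disc r y &
  (theta x y * (wt x - wt y) < n.+1%:R^-1)%R])%:E <= e%:E)%E.
Proof.
move=> q0 r0 e0.
pose m4 := ((plane_measure R) \x (plane_measure R))%E.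
pose F n (z : plane * plane) : R := ind [&& disc q z.1, ~~ disc q z.2, disc r z.2 &
  (theta z.1 z.2 * (wt z.1 - wt z.2) < n.+1%:R^-1)%R].
pose F0 (z : plane * plane) : R :=
 ind [&& disc q z.1, ~~ disc q z.2, disc r z.2 & (z.2.1 == z.1.1)].
pose G (z : plane * plane) : R := ind (disc q z.1) * ind (disc r z.2).
have mth := @mfun_theta R _ _ _ _ (@measurable_fst _ _ plane plane) (@measurable_snd _ _ plane plane).
have mF n : mble (F n).
 rewrite /F /disc /wt; apply: mfun_nat.
 do 3! (apply: measurable_and; first by meas).
 by meas.
have mF0 : mble F0 by rewrite /F0 /disc; meas.
have mG : mble G by rewrite /G /disc; meas.
have Goo : (\int[m4]_z (G z)%:E < +oo)%E.
 rewrite (@prod_int R _ _ _ _ (plane_measure R) (plane_measure R) (fun z => (G z)%:E)).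
 - rewrite [X in (X < _)%E](@mass_prod (disc q) (disc r)); try exact: mfun_disc.
  by rewrite !mass_disc// ltry.
 - exact: mfun_EFin.
 - by rewrite /G.
have cF z : F n z @[n --> \oo] --> F0 z.
 rewrite /F /F0; case qx : (disc q z.1) => /=; last exact: cvg_cst.
 case qy : (disc q z.2) => /=; first exact: cvg_cst.
 case ry : (disc r z.2) => /=; last exact: cvg_cst.
 have [e1|ne] := eqVneq z.2.1 z.1.1.
  rewrite (_ : (fun n => _) = fun=> 1); first exact: cvg_cst.
  apply/funext => n; rewrite /theta e1 subrr normr0 invr0 !mul0r.
  by rewrite invr_gt0 ltr0Sn.
 have gam : 0 < theta z.1 z.2 * (wt z.1 - wt z.2).
  rewrite mulr_gt0 ?theta_gt0// subr_gt0 wt_lt//.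
  by apply: lt_le_trans qx _; rewrite leNgt; apply/negbT.
 apply: cvg_near_cst; have := near_infty_natSinv_lt (PosNum gam).
 apply: filterS => n /= h; apply/eqP; rewrite pnatr_eq0 eqb0 -leNgt ltW//.
have cv := @dominated_real _ _ R m4 F F0 G mF mF0 cF.
have FG n z : `|F n z| <= G z.
 rewrite ger0_norm// /G -natrM mulnb ler_nat.
 by case: (disc q z.1); case: (disc r z.2); case: (disc q z.2) => //=; case: (_ < _).
move/(_ FG mG Goo): cv => cv.
have z0 : (\int[m4]_z (F0 z)%:E = 0)%E.
 apply/eqP; rewrite eq_le integral_ge0 ?andbT; last by move=> z _; rewrite lee_fin.
 rewrite (@prod_int R _ _ _ _ (plane_measure R) (plane_measure R) (fun z => (F0 z)%:E)).
 - rewrite -[leRHS]diagonal_null; apply: ge0_le_integral; rewrite /F0 /disc; try side.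
  move=> x _; apply: ge0_le_integral; try side.
  move=> y _; rewrite lee_fin ler_nat /=.
  by case: (nsq x < q); case: (nsq y < q); case: (nsq y < r).
 - exact: mfun_EFin.
 - by pos.
rewrite z0 in cv.
have e0' : (0 < e%:E :> \bar R)%E by [].
have [N _ hN] := cv _ (open_ereal_lt' e0').
exists N; have := hN N (leqnn N); rewrite /= => /ltW.
rewrite (@prod_int R _ _ _ _ (plane_measure R) (plane_measure R) (fun z => (F N z)%:E)) //.
 exact: mfun_EFin (mF N).
by pos.
Qed.

Lemma disc_close (q r e : R) : 0 <= q -> 0 <= r -> 0 < e -> exists2 dl : R, 0 < dl &
 forall a, mble a -> mass a = (pi * q)%:E ->
 (mass (fun x => a x && ~~ disc r x) <= e%:E)%E ->
 (forall k c, gain k c a <= dl%:E)%E ->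
 (mass (fun x => a x && ~~ disc q x) * mass (fun x => a x && ~~ disc q x) <=
  ((pi * q + 2) * e)%:E)%E.
Proof.
move=> q0 r0 e0; have [n hn] := near_radial_null q0 r0 e0.
have pi0 : 0 < pi :> R := pi_gt0 R.
have n0 : 0 < n.+1%:R :> R by [].
(* Chosen so that [n.+1 * (pi^2 * dl) = e]; the three contributions are then [pi * q * e], [e] and
   [e]. *)
exists (e / (n.+1%:R * pi^2)); first by rewrite divr_gt0// mulr_gt0// exprn_gt0.
move=> a ma qa tail ga.
have mq := @mfun_disc R q; have mr := @mfun_disc R r.
have mth d (T : measurableType d) (f g : T -> plane) := @mfun_theta R d T f g.
rewrite [X in (X * _)%E]mass_excess//; last 2 first.
- by rewrite mass_disc.
- by rewrite mass_disc// ltry.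
rewrite -mass_prod; try by meas.
pose F x y : R := theta x y * (ind (~~ a x && a y && (nsq x < nsq y)) * (wt x - wt y)).
have F0 x y : 0 <= F x y.
 rewrite mulr_ge0 ?theta_ge0//.
 case: (ltP (nsq x) (nsq y)) => l; last by rewrite andbF mul0r.
 by rewrite mulr_ge0// subr_ge0 ltW// wt_lt.
pose H x y : R := ind [&& disc q x, ~~ disc q y, disc r y &
  (theta x y * (wt x - wt y) < n.+1%:R^-1)%R].
have mF d (T : measurableType d) (f g : T -> plane) : mble f ->
  mble g -> mble (fun z => F (f z) (g z)).
 move=> mf mg; apply: mfun_mul; first exact: mth.
 by rewrite /wt; meas.
have mH d (T : measurableType d) (f g : T -> plane) : mble f ->
  mble g -> mble (fun z => H (f z) (g z)).
 move=> mf mg; rewrite /H; apply: mfun_nat.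
 do 3! (apply: measurable_and; first by meas).
 by apply: mfun_lt; [apply: mfun_mul; [exact: mth|rewrite /wt; meas]|meas].
pose L x y : R := ind (disc q x) * ind (a y && ~~ disc r y).
have mL d (T : measurableType d) (f g : T -> plane) : mble f ->
  mble g -> mble (fun z => L (f z) (g z)) by move=> mf mg; rewrite /L; meas.
have L0 x y : 0 <= L x y by rewrite /L.
have pw x y : ind (~~ a x && disc q x) * ind (a y && ~~ disc q y) <=
 L x y + (H x y + n.+1%:R * F x y).
 rewrite -natrM mulnb.
 have [/andP[/andP[ax qx] /andP[ay qy]]|] := boolP (_ && _); last first.
  by pos.
 rewrite /L /H /F ax qx ay qy /=.
 have xy : nsq x < nsq y by apply: lt_le_trans qx _; rewrite leNgt.
 case: (disc r y) => /=; rewrite ?mulr1 ?mulr0 ?add0r; last first.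
  by rewrite lerDl mulr_ge0// mulr_ge0 ?theta_ge0// xy mul1r subr_ge0 ltW// wt_lt.
 rewrite xy mul1r; case: ltP => h.
  by rewrite lerDl mulr_ge0// mulr_ge0 ?theta_ge0// subr_ge0 ltW// wt_lt.
 by rewrite add0r -ler_pdivrMl// mulr1.
have mfs := @measurable_fst _ _ plane plane.
have msn := @measurable_snd _ _ plane plane.
have mF2 := mF _ _ _ _ mfs msn; have mH2 := mH _ _ _ _ mfs msn; have mL2 := mL _ _ _ _ mfs msn.
apply: (le_trans (le_int2 _ _ _ pw)); try side.
rewrite int2D; try side.
rewrite int2D; try side.
rewrite int2Z; try side.
have b1 : (\int[mu2]_x \int[mu2]_y (L x y)%:E <= (pi * q * e)%:E)%E.
 rewrite mass_prod//; try by meas.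
 rewrite mass_disc// [leRHS]EFinM; apply: lee_pmul => //; rewrite ?mass_ge0//.
 by pos.
have b3 := @gain_average R a _ ma ga.
apply: (@le_trans _ _ ((pi * q * e)%:E + (e%:E + n.+1%:R%:E * (pi^2 * (e / (n.+1%:R * pi^2)))%:E))%E).
 apply: leeD => //; apply: leeD => //; apply: lee_pmul => //.
 - by pos.
rewrite lee_fin le_eqVlt; apply/orP; left; apply/eqP.
have Nn := lt0r_neq0 n0; have Pn := lt0r_neq0 pi0.
by move: Nn Pn; move: (n.+1%:R : R) (pi : R) => N P Nn Pn; field; rewrite Pn.
Qed.

Lemma tail_small a (e : R) : mble a -> (mass a < +oo)%E -> 0 < e ->
 exists2 r, 0 <= r & (mass (fun x => a x && ~~ disc r x) <= e%:E)%E.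
Proof.
move=> ma aoo e0.
pose F n x : R := ind (a x && ~~ disc n%:R x).
have cF x : F n x @[n --> \oo] --> (0 : R).
 apply: cvg_near_cst; have [n hn] : exists n : nat, nsq x < n%:R.
  by exists (Num.bound (nsq x)); apply: archi_boundP; exact: nsq_ge0.
 exists n => // m /= nm; rewrite /F /disc (lt_le_trans hn) ?andbF//.
 by rewrite ler_nat.
have cv : (\int[mu2]_x (F n x)%:E)%E @[n --> \oo] --> (\int[mu2]_x 0%:E)%E.
 apply: (@dominated_real _ _ R mu2 F (fun=> 0) (fun x => ind (a x))) => //.
 - by move=> n; rewrite /F /disc; meas.
 - by move=> n x; rewrite /F ger0_norm//; case: (a x); case: disc.
 - by meas.
rewrite integral0 in cv.
have e0' : (0 < e%:E :> \bar R)%E by [].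
have [N _ hN] := cv _ (open_ereal_lt' e0').
by exists N%:R => //; exact: ltW (hN N (leqnn N)).
Qed.

Lemma riesz_sets t a b qa qb : mble a -> mble b ->
 0 <= qa -> 0 <= qb -> mass a = (pi * qa)%:E -> mass b = (pi * qb)%:E ->
 (overlap t a b <= overlap t (disc qa) (disc qb))%E.
Proof.
move=> ma mb qa0 qb0 ha hb.
have pi0 : 0 < pi :> R := pi_gt0 R.
pose C := pi * qa + pi * qb + 2.
have C0 : 0 < C by rewrite ltr_wpDl// addr_ge0// mulr_ge0// ltW.
have aoo : (mass a < +oo)%E by rewrite ha ltry.
have boo : (mass b < +oo)%E by rewrite hb ltry.
apply/lee_addgt0Pr => h h0.
(* With these sizes [disc_close] gives either set a misplaced mass of at most [eta], and the
   overlaps then differ by at most [eta * (pi * qa + pi * qb) <= h]. *)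
pose eta := h / C; have eta0 : 0 < eta by rewrite divr_gt0.
pose e := eta^2 / C; have e0 : 0 < e by rewrite divr_gt0// exprn_gt0.
have [ra ra0 ta] := tail_small ma aoo e0; have [rb rb0 tb] := tail_small mb boo e0.
have [da da0 ca] := disc_close qa0 ra0 e0; have [db db0 cb] := disc_close qb0 rb0 e0.
have dm : 0 < Num.min da db by rewrite lt_min da0.
have [l hl] := pols_near_optimal ma mb aoo boo dm.
(* Polarization keeps the total mass and does not decrease the mass in a centred disc, hence it does
   not increase the tail. *)
have tailS a' r : mble a' -> (mass a' < +oo)%E ->
  (mass (fun x => pols l a' x && ~~ disc r x) <= mass (fun x => a' x && ~~ disc r x))%E.
 move=> ma' oo; have mp := mfun_pols l ma'; have md := @mfun_disc R r.
 have s1 := mass_split mp md; have s2 := mass_split ma' md.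
 rewrite (pols_mass l ma') s2 in s1.
 have fin c : mble c -> (mass c <= mass a')%E -> mass c \is a fin_num by move=> mc ca'; rewrite ge0_fin_numE ?mass_ge0//; exact: le_lt_trans ca' oo.
 have f1 : mass (fun x => a' x && disc r x) \is a fin_num by apply: fin; [meas|apply: mass_le => //; [meas|move=> x /andP[]]].
 have f2 : mass (fun x => a' x && ~~ disc r x) \is a fin_num by apply: fin; [meas|apply: mass_le => //; [meas|move=> x /andP[]]].
 have f3 : mass (fun x => pols l a' x && disc r x) \is a fin_num by apply: fin; [meas|rewrite -(pols_mass l ma'); apply: mass_le => //; [meas|move=> x /andP[]]].
 have f4 : mass (fun x => pols l a' x && ~~ disc r x) \is a fin_num by apply: fin; [meas|rewrite -(pols_mass l ma'); apply: mass_le => //; [meas|move=> x /andP[]]].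
 have := pols_inner l r ma'; rewrite -/(disc r).
 move: s1; rewrite -(fineK f1) -(fineK f2) -(fineK f3) -(fineK f4) => -[s1].
 rewrite [X in (X <= _)%E](_ : _ = (fine (mass (fun x => a' x && disc r x)))%:E); last by rewrite fineK.
 rewrite [X in (_ <= X)%E -> _](_ : _ = (fine (mass (fun x => pols l a' x && disc r x)))%:E); last by rewrite fineK.
 by rewrite !lee_fin => s3; lra.
have mpa := mfun_pols l ma; have mpb := mfun_pols l mb.
have cla := ca _ mpa (etrans (pols_mass l ma) ha) (le_trans (tailS _ _ ma aoo) ta).
have clb := cb _ mpb (etrans (pols_mass l mb) hb) (le_trans (tailS _ _ mb boo) tb).
have ga k c : (gain k c (pols l a) <= da%:E)%E by apply: le_trans (hl k c).1 _; rewrite lee_fin ge_min lexx.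
have gb k c : (gain k c (pols l b) <= db%:E)%E by apply: le_trans (hl k c).2 _; rewrite lee_fin ge_min lexx orbT.
have {}cla := cla ga; have {}clb := clb gb.
have small q (z : \bar R) : (0 <= z)%E -> 0 <= q -> pi * q + 2 <= C ->
  (z * z <= ((pi * q + 2) * e)%:E)%E -> (z <= eta%:E)%E.
 case: z => [z|_ _ _|]; last by rewrite leeNy_eq.
  2: by rewrite gt0_mulye// leye_eq.
 rewrite !lee_fin => z0 q0 qC zz.
 rewrite -(@ler_pXn2r _ 2)// ?nnegrE ?(ltW eta0)// expr2.
 apply: le_trans zz _; rewrite mulrC -mulrA ler_piMr ?sqr_ge0//.
 by rewrite mulrC ler_pdivrMr// mul1r.
have Da := small qa _ (mass_ge0 _) qa0 _ cla; have Db := small qb _ (mass_ge0 _) qb0 _ clb.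
have pqa : 0 <= pi * qa by pos.
have pqb : 0 <= pi * qb by pos.
have {}Da : (mass (fun x => pols l a x && ~~ disc qa x) <= eta%:E)%E by apply: Da; rewrite /C; lra.
have {}Db : (mass (fun x => pols l b x && ~~ disc qb x) <= eta%:E)%E by apply: Db; rewrite /C; lra.
apply: (le_trans (pols_overlap t l ma mb)).
have mqa := @mfun_disc R qa; have mqb := @mfun_disc R qb.
set a' := pols l a in mpa Da *; set b' := pols l b in mpb Db *.
have up : (overlap t a' b' <= overlap t (disc qa) (disc qb) +
 (mass (fun x => a' x && ~~ disc qa x) * mass b' + mass (disc qa) * mass (fun x => b' x && ~~ disc qb x)))%E.
 rewrite -!mass_prod; try by meas.
 rewrite /overlap -int2D; try side.
 rewrite -int2D; try side.
 apply: le_int2; try side.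
 move=> x y; rewrite -!natrM -!natrD ler_nat.
 by case: (a' x); case: (b' y); case: (disc qa x); case: (disc qb y); case: (_ < t).
apply: (le_trans up); rewrite leeD2l//.
have mb' : mass b' = (pi * qb)%:E by rewrite pols_mass.
rewrite mb' mass_disc//.
apply: (@le_trans _ _ (eta%:E * (pi * qb)%:E + (pi * qa)%:E * eta%:E)%E).
 by apply: leeD; apply: lee_pmul => //; rewrite ?mass_ge0//.
rewrite lee_fin (_ : _ + _ = eta * (pi * qa + pi * qb)); last by ring.
rewrite -mulrA ler_piMr ?(ltW h0)// mulrC ler_pdivrMr// mul1r lerDl.
by [].
Qed.

End RieszSetsConclusion.

(** * Symmetric decreasing rearrangement *)

Section Rearrangement.
Variable R : realType.
Local Notation leb := (@lebesgue_measure R).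
Local Notation mu2 := (leb2 R).
Local Notation plane := (plane R).
Implicit Types (x y : plane).

Lemma eq_int_off0 (f g : plane -> \bar R) : mble f ->
 mble g -> (forall x, 0 <= f x)%E -> (forall x, 0 <= g x)%E ->
 (forall x, 0 < nsq x -> f x = g x) -> (\int[mu2]_x f x = \int[mu2]_x g x)%E.
Proof.
move=> mf mg f0 g0 fg; rewrite (int_plane mf f0) (int_plane mg g0).
apply: (@eq_int_off R 0); try side.
move=> x x0; apply: eq_integral => y _; apply: fg.
by rewrite ltr_pwDl ?sqr_ge0// exprn_even_gt0.
Qed.

(** The two sets have equal measure outside their intersection; there [g] is at most [g q] on the
    disc and at least [g q] off it. *)
Lemma bathtub (a : plane -> bool) (q : R) (g : R -> R) : mble a ->
 0 <= q -> mass a = (pi * q)%:E -> mble g -> (forall p, 0 <= g p) ->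
 (forall p p', 0 <= p -> p <= p' -> g p <= g p') ->
 (\int[mu2]_x (ind (disc q x) * g (nsq x))%:E <= \int[mu2]_x (ind (a x) * g (nsq x))%:E)%E.
Proof.
move=> ma q0 aq mg g0 ginc; have mq := @mfun_disc R q.
have split b c : mble b -> mble c ->
 (\int[mu2]_x (ind (b x) * g (nsq x))%:E = \int[mu2]_x (ind (b x && c x) * g (nsq x))%:E +
 \int[mu2]_x (ind (b x && ~~ c x) * g (nsq x))%:E)%E.
 move=> mb mc; rewrite -ge0_integralD; try side.
 by apply: eq_integral => x _; rewrite -EFinD -mulrDl -natrD; case: (b x); case: (c x).
rewrite (split _ _ mq ma) (split _ _ ma mq); apply: leeD.
 by under eq_integral do rewrite andbC.
have ex := @mass_excess R a (disc q) ma mq (etrans aq (esym (mass_disc q0))).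
have {}ex : mass (fun x => a x && ~~ disc q x) = mass (fun x => ~~ a x && disc q x) by apply: ex; rewrite mass_disc// ltry.
apply: (@le_trans _ _ ((g q)%:E * mass (fun x => ~~ a x && disc q x))%E).
 rewrite -ge0_integralZl; try side.
 apply: ge0_le_integral; try side.
 move=> x _; rewrite lee_fin andbC mulrC.
 case: (boolP (disc q x)) => xq; last by rewrite andbF !mulr0.
 by rewrite ler_wpM2r// ginc ?nsq_ge0// ltW.
rewrite -ex -ge0_integralZl; try side.
apply: ge0_le_integral; try side.
move=> x _; rewrite lee_fin mulrC.
case: (boolP (disc q x)) => xq; first by rewrite andbF !mul0r.
by rewrite ler_wpM2l// ginc// leNgt.
Qed.

Variable w : plane -> R.
Hypotheses (mw : mble w)
 (wfin : forall s, 0 < s -> (mass (fun x => (s < w x)%R) < +oo)%E).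

(** Squared radius of the centred disc that has the area of the superlevel set. *)
Definition lev (s : R) : R := fine (mass (fun x => s < w x)) / pi.

Lemma mfun_lev : mble lev.
Proof. by rewrite /lev /mass; meas. Qed.

Lemma lev_ge0 s : 0 <= lev s.
Proof. by rewrite divr_ge0 ?pi_ge0// fine_ge0// mass_ge0. Qed.

Lemma mass_lev s : 0 < s -> mass (fun x => s < w x) = (pi * lev s)%:E.
Proof.
move=> s0; rewrite mulrC divfK ?gt_eqF ?pi_gt0// fineK//.
by rewrite ge0_fin_numE ?mass_ge0// wfin.
Qed.

Lemma lev_noninc s s' : 0 < s -> s <= s' -> lev s' <= lev s.
Proof.
move=> s0 ss'; rewrite ler_pM2r ?invr_gt0 ?pi_gt0//; apply: fine_le.
- by rewrite ge0_fin_numE ?mass_ge0// wfin// (lt_le_trans s0 ss').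
- by rewrite ge0_fin_numE ?mass_ge0// wfin.
by apply: mass_le; [meas|meas|move=> x; exact: le_lt_trans ss'].
Qed.

(* For [q <= 0] the integral may be infinite, and [vst q] is then the junk value 0. *)
Definition vst (q : R) : R := fine (\int[leb]_s (ind ((0 < s) && (q < lev s)))%:E)%E.

Lemma vst_ge0 q : 0 <= vst q.
Proof. by rewrite fine_ge0// integral_ge0// => s _. Qed.

Lemma mfun_vst : mble vst.
Proof. by have ml := mfun_lev; rewrite /vst; meas. Qed.

Hypothesis wint : exists2 C, 0 <= C & forall s, 0 < s -> s^2 * lev s <= C.

Lemma lev_small q : 0 < q -> exists2 S, 0 < S & forall s, S <= s -> lev s <= q.
Proof.
move=> q0; have [C C0 hC] := wint.
have S0 : 0 < C / q + 1 by rewrite ltr_wpDl// divr_ge0// ltW.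
exists (C / q + 1) => // s Ss.
have s0 := lt_le_trans S0 Ss; have s1 : 1 <= s by apply: le_trans Ss; rewrite lerDr divr_ge0// ltW.
have := hC s s0; rewrite -ler_pdivlMl ?exprn_gt0// => h; apply: (le_trans h).
rewrite mulrC ler_pdivrMr ?exprn_gt0// mulrC -ler_pdivrMr//.
apply: (@le_trans _ _ s); first by apply: le_trans Ss; rewrite lerDl.
by rewrite ler_peMl// ltW.
Qed.

Lemma int_itv_ind (S : R) : 0 <= S ->
 (\int[leb]_s (ind ((0 < s) && (s < S))%R)%:E = S%:E)%E.
Proof.
move=> S0; transitivity (\int[leb]_(s in `]0%R, S[) cst 1 s)%E.
 rewrite [RHS]integral_mkcond; apply: eq_integral => s _.
 by rewrite patchE mem_setE in_itv/=; case: (_ && _).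
rewrite integral_cst//= mul1e lebesgue_measure_itv/= lte_fin.
by case: ltP => h; [rewrite oppr0 adde0|congr EFin; apply/le_anti; rewrite S0 h].
Qed.

Lemma vst_fin q : 0 < q ->
 (\int[leb]_s (ind ((0 < s) && (q < lev s))%R)%:E = (vst q)%:E)%E.
Proof.
move=> q0; have ml := mfun_lev; rewrite fineK// ge0_fin_numE; last first.
 by pos.
have [S S0 hS] := lev_small q0.
apply: le_lt_trans (ltry S); rewrite -(int_itv_ind (ltW S0)).
apply: le_int_real; try side.
move=> s; rewrite ler_nat; case: (0 < s) => //=; case: ltP => // h.
by case: ltP => // /hS; rewrite leNgt h.
Qed.

(** With [vst_ge] this says that [vst] and [lev] are generalized inverses: [s < vst q] and
    [q < lev s] are equivalent except perhaps at [s = vst q]. Both functions may jump, so this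
    single level is given up; it is null in integrals over levels. *)
Lemma lt_vst q s : 0 < q -> 0 < s -> s < vst q -> q < lev s.
Proof.
move=> q0 s0 sv; rewrite ltNge; apply/negP => h.
move: sv; rewrite ltNge => /negP; apply; have ml := mfun_lev.
rewrite -lee_fin -(vst_fin q0) -(int_itv_ind (ltW s0)).
apply: (@le_trans _ _ (\int[leb]_p (ind ((0 < p) && (p <= s)))%:E)%E).
 apply: le_int_real; try side.
 move=> p; rewrite ler_nat; case: ltP => //= p0; case: ltP => // hp.
 case: leP => // sp; have := lev_noninc s0 (ltW sp).
 by lra.
rewrite le_eqVlt; apply/orP; left; apply/eqP.
by apply: (@eq_int_off R s); try side; move=> p ps; rewrite le_eqVlt (negbTE ps).
Qed.

Lemma vst_ge q s : 0 < q -> 0 < s -> q < lev s -> s <= vst q.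
Proof.
move=> q0 s0 qs; have ml := mfun_lev.
rewrite -lee_fin -(vst_fin q0) -(int_itv_ind (ltW s0)).
apply: le_int_real; try side.
move=> p; rewrite ler_nat; case: ltP => //= p0; case: ltP => // ps.
by rewrite (lt_le_trans qs)// lev_noninc// ltW.
Qed.

Lemma vst_noninc q q' : 0 < q -> q <= q' -> vst q' <= vst q.
Proof.
move=> q0 qq'; have ml := mfun_lev; have q'0 := lt_le_trans q0 qq'.
rewrite -lee_fin -!vst_fin//; apply: le_int_real; try side.
move=> s; rewrite ler_nat; case: (0 < s) => //=; case: ltP => // h.
by rewrite (le_lt_trans qq' h).
Qed.

Section Cake.
Variable phi : R -> R.
Hypotheses (mphi : mble phi) (phi0 : forall s, 0 < s -> 0 <= phi s).

(** Layer cake form of a primitive of [phi]: [phi = 1] gives [v] and [phi s = 2 s] gives [v^2].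
    Functions become superpositions of superlevel sets, so each rearrangement inequality reduces to
    its version for sets. *)
Definition cake (v : R) : \bar R := (\int[leb]_s (ind ((0 < s) && (s < v)) * phi s)%:E)%E.

Let Iphi0 (b : bool) s : 0 <= ind ((0 < s) && b) * phi s.
by case: ltP => s0; rewrite ?mul0r// mulr_ge0// phi0. Qed.

Lemma cake_ge0 v : (0 <= cake v)%E.
Proof. by apply: integral_ge0 => s _; rewrite lee_fin. Qed.

Lemma mfun_cake {d} {T : measurableType d} (f : T -> R) : mble f ->
 mble (fun z => cake (f z)).
Proof.
by move=> mf; apply: mfun_int_line => [|z s]; [meas|rewrite lee_fin Iphi0].
Qed.

Lemma cake_vst q : 0 < q ->
 cake (vst q) = (\int[leb]_s (ind ((0 < s) && (q < lev s)) * phi s)%:E)%E.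
Proof.
move=> q0; have ml := mfun_lev.
apply: (@eq_int_off R (vst q)); try by meas.
move=> s sv; case: (ltP 0 s) => //= s0; congr (_ * _)%:E; congr ((nat_of_bool _)%:R).
apply/idP/idP => h; first exact: lt_vst.
by rewrite lt_neqAle sv/= vst_ge.
Qed.

Lemma cake_equimeas :
 (\int[mu2]_x cake (w x) = \int[mu2]_x cake (vst (nsq x)))%E.
Proof.
have ml := mfun_lev; have mv := mfun_vst.
rewrite [RHS](@eq_int_off0 _
 (fun x => \int[leb]_s (ind ((0 < s) && (nsq x < lev s)) * phi s)%:E)%E); first last.
- by move=> x x0; exact: cake_vst.
- by move=> x; apply: integral_ge0 => s _; rewrite lee_fin.
- by move=> x; exact: cake_ge0.
- by apply: mfun_int_line => [|x s]; [meas|rewrite lee_fin Iphi0].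
- by apply: mfun_cake; meas.
rewrite -[RHS]tonelli_line_plane; [|by meas|by move=> s x; rewrite lee_fin Iphi0].
rewrite -[LHS]tonelli_line_plane; [|by meas|by move=> s x; rewrite lee_fin Iphi0].
apply: eq_integral => s _; case: (ltP 0 s) => s0 /=; last first.
 by [].
under eq_integral do rewrite mulrC EFinM.
under [RHS]eq_integral do rewrite mulrC EFinM.
rewrite !ge0_integralZl; try side; rewrite ?lee_fin ?phi0//.
by rewrite -/(mass _) mass_lev// -mass_disc ?lev_ge0.
Qed.

Lemma cake_bathtub (g : R -> R) : mble g -> (forall p, 0 <= g p) ->
 (forall p p', 0 <= p -> p <= p' -> g p <= g p') ->
 (\int[mu2]_x (cake (vst (nsq x)) * (g (nsq x))%:E) <= \int[mu2]_x (cake (w x) * (g (nsq x))%:E))%E.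
Proof.
move=> mg g0 ginc; have ml := mfun_lev; have mv := mfun_vst.
rewrite (@eq_int_off0 _
 (fun x => \int[leb]_s (ind ((0 < s) && (nsq x < lev s)) * phi s * g (nsq x))%:E)%E); first last.
- move=> x x0; rewrite cake_vst// -ge0_integralZr//.
 + by meas.
 + by move=> s _; rewrite lee_fin.
 + by rewrite lee_fin.
- by move=> x; apply: integral_ge0 => s _; rewrite lee_fin mulr_ge0.
- by move=> x; rewrite mule_ge0 ?cake_ge0// lee_fin.
- by apply: mfun_int_line => [|x s]; [meas|rewrite lee_fin mulr_ge0].
- by apply: mfun_emul; [apply: mfun_cake; meas|meas].
have -> : (\int[mu2]_x (cake (w x) * (g (nsq x))%:E) =
 \int[mu2]_x \int[leb]_s (ind ((0 < s) && (s < w x)) * phi s * g (nsq x))%:E)%E.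
 apply: eq_integral => x _; rewrite -ge0_integralZr//.
 + by meas.
 + by move=> s _; rewrite lee_fin.
 + by rewrite lee_fin.
rewrite -[leRHS]tonelli_line_plane; [|by meas|by move=> s x; rewrite lee_fin mulr_ge0].
rewrite -[leLHS]tonelli_line_plane; [|by meas|by move=> s x; rewrite lee_fin mulr_ge0].
apply: ge0_le_integral => //.
- by move=> s _; apply: integral_ge0 => x _; rewrite lee_fin mulr_ge0.
- by apply: mfun_int_plane => [|s x]; [meas|rewrite lee_fin mulr_ge0].
- by apply: mfun_int_plane => [|s x]; [meas|rewrite lee_fin mulr_ge0].
move=> s _; case: (ltP 0 s) => s0 /=; last first.
 exact: lexx.
under eq_integral do rewrite mulrAC mulrC EFinM.
under [leRHS]eq_integral do rewrite mulrAC mulrC EFinM.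
rewrite !ge0_integralZl; try side; rewrite ?lee_fin ?phi0//.
apply: lee_pmul => //; rewrite ?lee_fin ?phi0//.
 by pos.
by apply: bathtub => //; [meas|exact: lev_ge0|exact: mass_lev].
Qed.

(** The product of two layer cakes is an integral over pairs of levels [(s, s')]; after exchanging
    the integrals the claim is [riesz_sets] for each pair. *)
Lemma cake_riesz t :
 (\int[mu2]_x \int[mu2]_y (cake (w x) * cake (w y) * (ind (dsq x y < t))%:E) <=
 \int[mu2]_x \int[mu2]_y (cake (vst (nsq x)) * cake (vst (nsq y)) * (ind (dsq x y < t))%:E))%E.
Proof.
have ml := mfun_lev; have mv := mfun_vst.
pose K (a : R -> plane -> bool) x y (p : plane) : R :=
 ind ((0 < p.1) && a p.1 x) * phi p.1 * (ind ((0 < p.2) && a p.2 y) * phi p.2) * ind (dsq x y < t).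
have K0 a x y p : 0 <= K a x y p by rewrite mulr_ge0// mulr_ge0.
have expand (a : R -> plane -> bool) x y :
  mble (fun z : R * plane => a z.1 z.2) ->
 ((\int[leb]_s (ind ((0 < s) && a s x) * phi s)%:E) *
 (\int[leb]_s (ind ((0 < s) && a s y) * phi s)%:E) * (ind (dsq x y < t))%:E =
 \int[mu2]_p (K a x y p)%:E)%E.
 move=> ma; have ma1 z : mble (a^~ z) by apply: (measurable_fun_pair1 z ma).
 have max := ma1 x; have may := ma1 y.
 have max1 : mble (fun p : plane => a p.1 x) by exact: (measurableT_comp max measurable_fst).
 have may2 : mble (fun p : plane => a p.2 y) by exact: (measurableT_comp may measurable_snd).
 rewrite int_plane; last 2 first.
 - by rewrite /K; meas.
 - by pos.
 rewrite -muleA -ge0_integralZr//; last 3 first.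
 - by meas.
 - by move=> s _; rewrite lee_fin.
 - by rewrite mule_ge0// integral_ge0// => s _; rewrite lee_fin.
 apply: eq_integral => s _; rewrite /K /= -ge0_integralZr//; last 2 first.
 - by meas.
 - by move=> s' _; rewrite lee_fin.
 rewrite -ge0_integralZl; [|isd|isd|by move=> s' _; rewrite mule_ge0// lee_fin|isd].
 by apply: eq_integral => s' _; rewrite -!EFinM mulrA.
pose a1 s x := s < w x; pose a2 s x := nsq x < lev s.
have ma1 : mble (fun z : R * plane => a1 z.1 z.2) by rewrite /a1; meas.
have ma2 : mble (fun z : R * plane => a2 z.1 z.2) by rewrite /a2; meas.
have mK a : mble (fun z : R * plane => a z.1 z.2) ->
  mble (fun z : (plane * plane) * plane => K a z.1.1 z.1.2 z.2).
 move=> ma; have mc1 : mble (fun z : (plane * plane) * plane => a z.2.1 z.1.1).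
  by apply: (measurableT_comp ma (g := fun z : (plane * plane) * plane => (z.2.1, z.1.1))); meas.
 have mc2 : mble (fun z : (plane * plane) * plane => a z.2.2 z.1.2) by apply: (measurableT_comp ma (g := fun z : (plane * plane) * plane => (z.2.2, z.1.2))); meas.
 by rewrite /K; meas.
have swap a : mble (fun z : R * plane => a z.1 z.2) ->
 (\int[mu2]_x \int[mu2]_y \int[mu2]_p (K a x y p)%:E =
 \int[mu2]_p \int[mu2]_x \int[mu2]_y (K a x y p)%:E)%E.
 move=> ma; have mka := mK a ma.
 have sh (T : Type) d (T' : measurableType d) (h : T' -> (plane * plane) * plane) :
  mble h -> mble (fun z => (K a (h z).1.1 (h z).1.2 (h z).2)%:E) by move=> mh; apply: mfun_EFin; exact: (measurableT_comp mka mh).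
 transitivity (\int[mu2]_x \int[mu2]_p \int[mu2]_y (K a x y p)%:E)%E.
  apply: eq_integral => x _; apply: tonelli_plane => [|y p]; last by rewrite lee_fin.
  by apply: (sh plane _ _ (fun z => ((x, z.1), z.2))); meas.
 apply: tonelli_plane => [|x p]; last by apply: integral_ge0 => y _; rewrite lee_fin.
 apply: mfun_int_plane => [|z y]; last by rewrite lee_fin.
 by apply: (sh plane _ _ (fun z => ((z.1.1, z.2), z.1.2))); meas.
have lhs : (\int[mu2]_x \int[mu2]_y (cake (w x) * cake (w y) * (ind (dsq x y < t))%:E) =
  \int[mu2]_x \int[mu2]_y \int[mu2]_p (K a1 x y p)%:E)%E by apply: eq_integral => x _; apply: eq_integral => y _; rewrite -expand.
have mcv : mble (fun x : plane => cake (vst (nsq x))) by apply: mfun_cake; meas.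
have mIp : mble (fun z : plane * plane => \int[mu2]_p (K a2 z.1 z.2 p)%:E)%E.
 apply: mfun_int_plane => [|z p]; last by rewrite lee_fin.
 by apply: mfun_EFin; exact: mK.
have rhs : (\int[mu2]_x \int[mu2]_y (cake (vst (nsq x)) * cake (vst (nsq y)) * (ind (dsq x y < t))%:E) =
  \int[mu2]_x \int[mu2]_y \int[mu2]_p (K a2 x y p)%:E)%E.
 have I0 x : (0 <= \int[mu2]_y (cake (vst (nsq x)) * cake (vst (nsq y)) * (ind (dsq x y < t))%:E))%E by apply: integral_ge0 => y _; rewrite !mule_ge0 ?cake_ge0//.
 have J0 x : (0 <= \int[mu2]_y \int[mu2]_p (K a2 x y p)%:E)%E by pos.
 apply: eq_int_off0; [| |exact: I0|exact: J0|].
 - apply: mfun_int_plane => [|x y]; last by rewrite !mule_ge0 ?cake_ge0//.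
  by apply: mfun_emul; [apply: mfun_emul; apply: mfun_cake; meas|meas].
 - apply: mfun_int_plane => //.
  by pos.
 move=> x x0; apply: eq_int_off0.
 - by apply: mfun_emul; [apply: mfun_emul; [exact: measurable_cst|exact: mcv]|meas].
 - by apply: (measurable_fun_pair2 x mIp).
 - by move=> y; rewrite !mule_ge0 ?cake_ge0//.
 - by pos.
 by move=> y y0; rewrite -expand// !cake_vst.
rewrite [leLHS](etrans lhs (swap a1 ma1)) [leRHS](etrans rhs (swap a2 ma2)).
apply: ge0_le_integral; first exact: measurableT.
- by pos.
- apply: mfun_int_plane => [|p x]; last by apply: integral_ge0 => y _; rewrite lee_fin.
 apply: mfun_int_plane => [|z y]; last by rewrite lee_fin.
 by apply: mfun_EFin; rewrite /K /a1; meas.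
- apply: mfun_int_plane => [|p x]; last by apply: integral_ge0 => y _; rewrite lee_fin.
 apply: mfun_int_plane => [|z y]; last by rewrite lee_fin.
 by apply: mfun_EFin; rewrite /K /a2; meas.
move=> [s s'] _.
have form a : (forall s, mble (a s)) -> (\int[mu2]_x \int[mu2]_y (K a x y (s, s'))%:E =
 (ind (0 < s) * phi s * (ind (0 < s') * phi s'))%:E * overlap t (a s) (a s'))%E.
 move=> ma; have mas := ma s; have mas' := ma s'.
 have ph u : 0 <= ind (0 < u) * phi u by case: ltP => u0; [rewrite mul1r; exact: phi0 u0|rewrite mul0r; exact: lexx].
 have cc : 0 <= ind (0 < s) * phi s * (ind (0 < s') * phi s') by rewrite mulr_ge0.
 rewrite -(int2Z cc); [|by meas|by move=> *; exact: ler0n].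
 apply: eq_integral => x _; apply: eq_integral => y _; congr EFin.
 by rewrite /K /=; case: (0 < s); case: (0 < s'); case: (a s x); case: (a s' y); rewrite /=; ring.
have mas1 u : mble (a1 u) by rewrite /a1; meas.
have mas2 u : mble (a2 u) by rewrite /a2; meas.
rewrite (form _ mas1) (form _ mas2).
case: (ltP 0 s) => s0; last by rewrite !mul0r !mul0e lexx.
case: (ltP 0 s') => s0'; last by rewrite mul0r mulr0 !mul0e lexx.
apply: lee_pmul.
- rewrite lee_fin !mul1r; exact: mulr_ge0 (phi0 s0) (phi0 s0').
- by apply: integral_ge0 => x _; apply: integral_ge0 => y _.
- exact: lexx.
apply: riesz_sets; [exact: mas1|exact: mas1|exact: lev_ge0|exact: lev_ge0| |].
 exact: mass_lev.
exact: mass_lev.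
Qed.

End Cake.

End Rearrangement.

(** * A Hardy type inequality from the modulus of continuity *)

Section Calculus.
Variable R : realType.
Implicit Types (f df : R -> R) (a b : R).

Lemma is_der1_cont f (x d : R) : derives x f d -> {for x, continuous f}.
Proof.
by move=> h; apply: differentiable_continuous; apply/derivable1_diffP.
Qed.

Lemma mean_value f df a b : a < b ->
 (forall x, a <= x -> x <= b -> derives x f (df x)) ->
 exists c, [/\ a < c, c < b & f b - f a = df c * (b - a)].
Proof.
move=> ab h.
have d x : x \in `]a, b[ -> derives x f (df x) by rewrite in_itv/= => /andP[ax xb]; apply: h; exact: ltW.
have cf : {within `[a, b], continuous f}.
 apply: derivable_within_continuous => x; rewrite in_itv/= => /andP[ax xb].
 by have hx := h x ax xb.
have [c] := MVT ab d cf; rewrite in_itv/= => /andP[ac cb] e.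
by exists c.
Qed.

Lemma der_ge0_le f df a b : a <= b ->
 (forall x, a <= x -> x <= b -> derives x f (df x)) ->
 (forall x, a < x -> x < b -> 0 <= df x) -> f a <= f b.
Proof.
rewrite le_eqVlt => /predU1P[->//|ab] h d0.
have [c [ac cb e]] := mean_value ab h.
by rewrite -subr_ge0 e mulr_ge0 ?d0// subr_ge0 ltW.
Qed.

Lemma der_le0_ge f df a b : a <= b ->
 (forall x, a <= x -> x <= b -> derives x f (df x)) ->
 (forall x, a < x -> x < b -> df x <= 0) -> f b <= f a.
Proof.
rewrite le_eqVlt => /predU1P[->//|ab] h d0.
have [c [ac cb e]] := mean_value ab h.
by rewrite -subr_le0 e mulr_le0_ge0 ?d0// subr_ge0 ltW.
Qed.

End Calculus.

Section ExpBounds.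
Variable R : realType.
Implicit Types x M : R.

(** From [exp (- x) >= 1 - x] the remainder [exp x - 1 - x] is at most [x (exp x - 1)], and tangent
    line bounds control this product by [x^2 exp M] for either sign of [x]. *)
Lemma expR_le_quadratic x M : `|x| <= M -> expR x <= 1 + x + x^2 * expR M.
Proof.
move=> xM.
have h1 : expR x - 1 - x <= x * (expR x - 1).
 have := expR_ge1Dx (- x); rewrite expRN => h.
 have e0 := expR_gt0 x.
 have : (1 - x) * expR x <= 1 by rewrite -ler_pdivlMr// mul1r.
 by nra.
have h2 : x * (expR x - 1) <= x^2 * expR M.
 have [x0|x0] := leP 0 x.
  have : expR x <= expR M by rewrite ler_expR; apply: le_trans xM; rewrite ger0_norm.
  have h3 : expR x - 1 <= x * expR x.
   have := expR_ge1Dx (- x); rewrite expRN => h.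
   have e0 := expR_gt0 x.
   have : (1 - x) * expR x <= 1 by lra.
   by nra.
  by nra.
 have h3 := expR_ge1Dx x.
 have h4 : 1 <= expR M by rewrite -expR0 ler_expR; apply: le_trans xM.
 by nra.
lra.
Qed.

End ExpBounds.

Section Moments.
Variable R : realType.
Local Notation leb := (@lebesgue_measure R).
Local Notation mu2 := (leb2 R).
Local Notation plane := (plane R).
Implicit Types x y h k : plane.

Lemma int_itv_id (t : R) : 0 <= t ->
 (\int[leb]_(q in `]0%R, +oo[) (ind (q < t) * q)%:E = (t^2 / 2)%:E)%E.
Proof.
rewrite le_eqVlt => /predU1P[<-|t0].
 rewrite expr0n mul0r integral0_eq// => q; rewrite /= in_itv/= andbT => q0.
 by rewrite ltNge (ltW q0) mul0r.
transitivity (\int[leb]_(q in `[0%R, t]) q%:E)%E.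
 rewrite [RHS]integral_itv_bndoo; last by apply: measurable_funTS; meas.
 rewrite integral_mkcond [RHS]integral_mkcond; apply: eq_integral => q _.
 rewrite !patchE !mem_setE !in_itv/= andbT.
 by case: (0 < q); case: (q < t); rewrite ?mul1r ?mul0r.
rewrite (@continuous_FTC2 _ _ (fun r => r^2 / 2))//.
- by rewrite expr0n mul0r sube0.
- by apply: continuous_subspaceT => x.
- split.
 + by [].
 + by apply: cvg_at_right_filter; apply: cvgM; [exact: exprn_continuous|exact: cvg_cst].
 + by apply: cvg_at_left_filter; apply: cvgM; [exact: exprn_continuous|exact: cvg_cst].
- by move=> x _; rewrite derive1E derive_val /GRing.scale /=; field.
Qed.

Lemma disc_nsq (t : R) : 0 <= t ->
 (\int[mu2]_k (ind (nsq k < t) * nsq k)%:E = (pi * t^2 / 2)%:E)%E.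
Proof.
move=> t0; rewrite (@eq_int_off0 R _ (fun k => (ind (nsq k < t) * `|nsq k|)%:E)); try side; last first.
 by move=> k _; rewrite (ger0_norm (nsq_ge0 k)).
rewrite (@int_radial R (fun q => (ind (q < t) * `|q|)%:E)); try side.
have -> : (\int[leb]_(q in `]0%R, +oo[) (ind (q < t) * `|q|)%:E =
  \int[leb]_(q in `]0%R, +oo[) (ind (q < t) * q)%:E)%E by apply: eq_integral => q; rewrite inE /= in_itv/= andbT => q0; rewrite gtr0_norm.
by rewrite int_itv_id// -EFinM mulrA.
Qed.

(** The cross term cancels against the image under [k.2 -> - k.2], and by symmetry each squared
    coordinate carries half of [nsq]. With [t = e^2] this is the origin of the constant [pi e^4 / 4]
    in the modulus of continuity. *)
Lemma disc_quadratic (t a b : R) : 0 <= t ->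
 (\int[mu2]_k (ind (nsq k < t) * (a * k.1 + b * k.2)^2)%:E =
 (pi * t^2 / 4 * (a^2 + b^2))%:E)%E.
Proof.
move=> t0.
pose m := (\int[mu2]_k (ind (nsq k < t) * k.1^2)%:E)%E.
have m2 : (\int[mu2]_k (ind (nsq k < t) * k.2^2)%:E = m)%E.
 rewrite int_plane_swap; try side.
 by apply: eq_integral => k _; rewrite /nsq addrC.
have mm : (m + m = (pi * t^2 / 2)%:E)%E.
 rewrite -{2}m2 -ge0_integralD; try side.
 rewrite -disc_nsq//; apply: eq_integral => k _.
 by rewrite -EFinD -mulrDr.
have mE : m = (pi * t^2 / 4)%:E.
 have m0 : (0 <= m)%E by apply: integral_ge0 => k _; pos.
 move: m0 mm; case: (m) => [r||]; [|by []|by rewrite leeNy_eq].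
 by move=> _; rewrite -EFinD => -[h]; congr EFin; lra.
have two (X Y : \bar R) : (2%:R%:E * X = 2%:R%:E * Y)%E -> X = Y.
 move=> /(congr1 (fun z => 2%:R^-1%:E * z)%E).
 by rewrite !muleA -EFinM mulVf ?mul1e.
apply: two.
have dbl (X : \bar R) : (0 <= X)%E -> (2%:R%:E * X = X + X)%E by rewrite EFinD ge0_muleDl// mul1e.
rewrite dbl; last by apply: integral_ge0 => k _; pos.
rewrite -[X in (_ + X)%E](@int_plane_affine R 1 0 0 (-1) 0 0); try side; last first.
 by rewrite mul1r mulr0 subr0 normrN1.
rewrite -ge0_integralD; try side.
transitivity (\int[mu2]_k ((2 * a^2)%:E * (ind (nsq k < t) * k.1^2)%:E +
  (2 * b^2)%:E * (ind (nsq k < t) * k.2^2)%:E))%E.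
 apply: eq_integral => k _; rewrite -!EFinM; congr EFin.
 have -> : nsq (1 * k.1 + 0 * k.2 + 0, 0 * k.1 + -1 * k.2 + 0) = nsq k by rewrite /nsq /=; ring.
 by rewrite /=; ring.
rewrite ge0_integralD; try side.
rewrite !ge0_integralZl; try side.
by rewrite m2 -/m mE; congr EFin; field.
Qed.

Lemma int_dsq_ball x (t : R) : 0 <= t ->
 (\int[mu2]_y (ind (dsq x y < t))%:E = (pi * t)%:E)%E.
Proof.
move=> t0; rewrite -(mass_disc t0) /mass /disc.
rewrite -[RHS](@int_plane_shift R (- x.1, - x.2)); try side.
apply: eq_integral => y _; congr (ind (_ < t))%:E.
by rewrite /dsq /nsq /=; ring.
Qed.

Lemma cake_one (v : R) : 0 <= v -> cake (fun=> 1) v = v%:E.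
Proof.
move=> v0; rewrite /cake -(int_itv_ind v0).
by apply: eq_integral => s _; rewrite mulr1.
Qed.

Lemma cake_sqr (v : R) : 0 <= v -> cake (fun s => 2 * s) v = (v^2)%:E.
Proof.
move=> v0.
have -> : (v^2)%:E = (2%:E * (v^2 / 2)%:E)%E :> \bar R by congr EFin; field.
rewrite -(int_itv_id v0) [in RHS]integral_mkcond.
rewrite -ge0_integralZl//; last 2 first.
- apply/(measurable_restrictT _ _).1 => //; apply: measurable_funTS; meas.
- move=> q _; rewrite patchE mem_setE in_itv/= andbT; case: ltP => // q0.
 by rewrite lee_fin mulr_ge0// ltW.
apply: eq_integral => s _; rewrite patchE mem_setE in_itv/= andbT.
case: (0 < s) => /=; rewrite ?mul0r; congr EFin; ring.
Qed.

End Moments.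

Section Fatou.
Context {d} {T : measurableType d} {R : realType} (mu : {measure set T -> \bar R}).

Lemma fatou_real (f_ : nat -> T -> R) (f : T -> R) (M : \bar R) :
 (forall n, mble (f_ n)) -> (forall n x, 0 <= f_ n x) ->
 (forall x, f_ n x @[n --> \oo] --> f x) ->
 (forall n, (\int[mu]_x (f_ n x)%:E <= M)%E) -> (\int[mu]_x (f x)%:E <= M)%E.
Proof.
move=> mf f0 ff fM.
have -> : (\int[mu]_x (f x)%:E = \int[mu]_x limn_einf (fun n => (f_ n x)%:E))%E.
 apply: eq_integral => x _.
 have h : (f_ n x)%:E @[n --> \oo] --> (f x)%:E by apply: cvg_EFin; [exact: nearW|exact: ff].
 by rewrite (cvg_limn_einf_sup h).1.
apply: (le_trans (@fatou _ _ _ mu setT measurableT (fun n x => (f_ n x)%:E) _ _)).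
- by move=> n; exact/measurable_EFinP.
- by pos.
rewrite limn_einf_lim; apply: lime_le; first exact: is_cvg_einfs.
apply: nearW => n; apply: le_trans (fM n).
by apply: ereal_inf_lbound; exists n => //=.
Qed.

End Fatou.

(** What the sequel retains of the kinetic energy. Expanding [p (nsq y) / p (nsq x)] to second order
    as [e] tends to 0 produces the integral of [- v^2 Delta p / p]: this is a Hardy inequality in
    nonlocal form, free of derivatives of [v]. *)
Definition weighted_bound (R : realType) (v : R -> R) (lam T : R) : Prop := forall (p : R -> R) (e : R), mble p ->
 (forall q, 0 < p q) -> 0 < e ->
 ((pi * e^2 * lam)%:E <= (pi * e ^+ 4 / 8 * T)%:E +
 \int[leb2 R]_x \int[leb2 R]_y (v (nsq x)^2 * (p (nsq y) / p (nsq x)) * ind (dsq x y < e^2)%R)%:E)%E.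

Section RearrangedModulus.
Variable R : realType.
Local Notation mu2 := (leb2 R).
Local Notation plane := (plane R).
Variables (w : plane -> R) (lam T : R).
Hypotheses (mw : mble w) (w0 : forall x, 0 <= w x).
Hypothesis w2 : (\int[mu2]_x (w x^2)%:E = lam%:E)%E.

Lemma lam_ge0 : 0 <= lam.
Proof. by rewrite -lee_fin -w2; pos. Qed.

Lemma level_mass s : 0 < s -> (mass (fun x => (s < w x)%R) <= (lam / s^2)%:E)%E.
Proof.
move=> s0; have s2 : 0 < s^2 by rewrite exprn_gt0.
rewrite mulrC EFinM -w2 -ge0_integralZl; try side.
apply: le_int_real; try side.
move=> x; case: ltP => sx; last by rewrite mulr_ge0 ?sqr_ge0// invr_ge0 ltW.
by rewrite mulrC ler_pdivlMr// mul1r ler_pXn2r// ?nnegrE ltW// (lt_trans s0 sx).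
Qed.

Lemma level_fin s : 0 < s -> (mass (fun x => (s < w x)%R) < +oo)%E.
Proof. by move=> s0; apply: le_lt_trans (level_mass s0) (ltry _). Qed.

Lemma level_bound : exists2 C, 0 <= C & forall s, 0 < s -> s^2 * lev w s <= C.
Proof.
exists (lam / pi); first by rewrite divr_ge0 ?lam_ge0// pi_ge0.
move=> s s0; have s2 : 0 < s^2 by rewrite exprn_gt0.
rewrite mulrA ler_pM2r ?invr_gt0 ?pi_gt0// mulrC -ler_pdivlMr//.
by rewrite -lee_fin fineK ?level_mass// ge0_fin_numE ?mass_ge0// level_fin.
Qed.

Local Notation v := (vst w).

Lemma vst_L2 : (\int[mu2]_x (v (nsq x)^2)%:E = lam%:E)%E.
Proof.
have h := @cake_equimeas R w mw level_fin level_bound (fun s => 2 * s).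
rewrite -w2; transitivity (\int[mu2]_x cake (fun s : R => (2 * s)%R) (v (nsq x)))%E.
 by apply: eq_integral => x _; rewrite cake_sqr ?vst_ge0.
rewrite -h; first by apply: eq_integral => x _; rewrite cake_sqr.
 by meas.
by move=> s s0; exact: (mulr_ge0 (ler0n _ _) (ltW s0)).
Qed.

Lemma vst_riesz (t : R) :
 (\int[mu2]_x \int[mu2]_y (w x * w y * ind (dsq x y < t))%:E <=
 \int[mu2]_x \int[mu2]_y (v (nsq x) * v (nsq y) * ind (dsq x y < t))%:E)%E.
Proof.
have h := @cake_riesz R w mw level_fin level_bound (fun=> 1) _ _ t.
have {h} := h (measurable_cst _) (fun _ _ => ler01).
move=> h; apply: le_trans (le_trans _ h) _; rewrite le_eqVlt; apply/orP; left; apply/eqP;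
 apply: eq_integral => x _; apply: eq_integral => y _; first by rewrite !cake_one//.
by rewrite !cake_one ?vst_ge0//.
Qed.

Lemma vst_riesz_sqr (t : R) :
 (\int[mu2]_x \int[mu2]_y (w x^2 * w y^2 * ind (dsq x y < t))%:E <=
 \int[mu2]_x \int[mu2]_y (v (nsq x)^2 * v (nsq y)^2 * ind (dsq x y < t))%:E)%E.
Proof.
have h := @cake_riesz R w mw level_fin level_bound (fun s => 2 * s) _ _ t.
have m2 : mble (fun s : R => 2 * s) by meas.
have {h} := h m2 (fun s s0 => mulr_ge0 (ler0n _ _) (ltW s0)).
move=> h; apply: le_trans (le_trans _ h) _; rewrite le_eqVlt; apply/orP; left; apply/eqP;
 apply: eq_integral => x _; apply: eq_integral => y _; first by rewrite !cake_sqr//.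
by rewrite !cake_sqr ?vst_ge0//.
Qed.

Hypothesis modulus : forall e, 0 < e ->
 (\int[mu2]_x \int[mu2]_y ((w x - w y)^2 * ind (dsq x y < e^2)%R)%:E <=
 (pi * e ^+ 4 / 4 * T)%:E)%E.

Lemma double_int_weight (f : plane -> R) (l e : R) : mble f ->
 (forall x, 0 <= f x) -> (\int[mu2]_x (f x)%:E = l%:E)%E -> 0 <= e ->
 (\int[mu2]_x \int[mu2]_y (f x * ind (dsq x y < e^2))%:E = (pi * e^2 * l)%:E)%E.
Proof.
move=> mf f0 fl e0; have e2 : 0 <= e^2 by exact: sqr_ge0.
transitivity (\int[mu2]_x ((pi * e^2)%:E * (f x)%:E))%E.
 apply: eq_integral => x _; rewrite -(int_dsq_ball x e2) -ge0_integralZr; try side.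
 by apply: eq_integral => y _; rewrite mulrC.
by rewrite ge0_integralZl; try side; rewrite fl.
Qed.

Lemma double_int_symm (J K : plane -> plane -> R) :
 mble (fun z : plane * plane => J z.1 z.2) ->
 mble (fun z : plane * plane => K z.1 z.2) ->
 (forall x y, 0 <= J x y) -> (forall x y, 0 <= K x y) ->
 (forall x y, 2 * J x y <= K x y + K y x) ->
 (\int[mu2]_x \int[mu2]_y (J x y)%:E <= \int[mu2]_x \int[mu2]_y (K x y)%:E)%E.
Proof.
move=> mJ mK J0 K0 JK.
have mK' : mble (fun z : plane * plane => K z.2 z.1).
 apply: (@measurableT_comp _ _ _ _ _ _ _ _ (fun z : plane * plane => (z.2, z.1)) mK); meas.
rewrite -(@lee_pmul2l _ 2%:E)//.
have -> : (2%:E * \int[mu2]_x \int[mu2]_y (K x y)%:E = \int[mu2]_x \int[mu2]_y (K x y + K y x)%:E)%E.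
 rewrite (int2D mK mK' K0 (fun x y => K0 y x)).
 rewrite [X in (_ + X)%E]tonelli_plane; [|exact: mfun_EFin|by move=> x y; rewrite lee_fin].
 rewrite EFinD ge0_muleDl// mul1e//.
rewrite -(int2Z _ mJ J0)//.
apply: le_int2 => //; [exact: mfun_mul|exact: mfun_add|by move=> x y; rewrite mulr_ge0].
Qed.

(* Expanding the square in the modulus, [2 w(x) w(y)] is rearranged by Riesz
 and then split by AM-GM with the weight [p]. *)
Lemma weighted_modulus (p : R -> R) (e : R) : mble p ->
 (forall q, 0 < p q) -> 0 < e ->
 ((pi * e^2 * lam)%:E <= (pi * e ^+ 4 / 8 * T)%:E +
 \int[mu2]_x \int[mu2]_y (v (nsq x)^2 * (p (nsq y) / p (nsq x)) * ind (dsq x y < e^2)%R)%:E)%E.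
Proof.
move=> mp p0 e0; have mv := mfun_vst mw.
pose kap x y : R := ind (dsq x y < e^2).
have kapC x y : kap x y = kap y x by rewrite /kap dsqC.
set B := (X in (_ <= _ + X)%E).
have half (X Y Z : \bar R) : (0 <= Y)%E -> (0 <= Z)%E ->
  (2%:E * X <= 2%:E * Y + 2%:E * Z)%E -> (X <= Y + Z)%E.
 move=> Y0 Z0; rewrite -ge0_muleDr//.
 by rewrite lee_pmul2l//.
have B0 : (0 <= B)%E.
 apply: integral_ge0 => x _; apply: integral_ge0 => y _; rewrite lee_fin.
 by rewrite mulr_ge0// mulr_ge0 ?sqr_ge0// divr_ge0// ltW.
have T0 : 0 <= T.
 have P0 : 0 < pi * e ^+ 4 / 4 by rewrite divr_gt0// mulr_gt0 ?pi_gt0 ?exprn_gt0.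
 rewrite -(pmulr_rge0 _ P0) -lee_fin; apply: le_trans (modulus e0).
 by pos.
apply: half => //; first by rewrite lee_fin mulr_ge0// divr_ge0// mulr_ge0 ?pi_ge0// exprn_ge0// ltW.
pose Q := (\int[mu2]_x \int[mu2]_y ((w x - w y)^2 * kap x y)%:E)%E.
pose J := (\int[mu2]_x \int[mu2]_y (w x * w y * kap x y)%:E)%E.
pose J' := (\int[mu2]_x \int[mu2]_y (v (nsq x) * v (nsq y) * kap x y)%:E)%E.
have v0 q : 0 <= v q by exact: vst_ge0.
have mw2 : mble (fun x => w x^2) by meas.
have dw2 := @double_int_weight _ lam e mw2 (fun x => sqr_ge0 (w x)) w2 (ltW e0).
have half2 : (\int[mu2]_x \int[mu2]_y (w y^2 * kap x y)%:E = (pi * e^2 * lam)%:E)%E.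
 rewrite tonelli_plane; rewrite /kap; try side.
 apply: etrans dw2.
 by apply: eq_integral => x _; apply: eq_integral => y _; rewrite dsqC.
(* Each of the two squares contributes [pi e^2 lam], so the modulus and the cross term add up to a
   constant: the larger cross term of the rearrangement amounts to a smaller modulus. *)
have h1 : (2%:E * (pi * e^2 * lam)%:E = Q + 2%:E * J)%E.
 rewrite /Q -int2Z; rewrite /kap; try side.
 rewrite -int2D; try side.
 transitivity (\int[mu2]_x \int[mu2]_y (w x^2 * kap x y + w y^2 * kap x y)%:E)%E; last first.
  by apply: eq_integral => x _; apply: eq_integral => y _; congr EFin; ring.
 rewrite int2D; rewrite /kap; try side.
 rewrite half2 [X in (X + _)%E]dw2.
 by rewrite EFinD ge0_muleDl// mul1e.
have h2 : (J' <= B)%E.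
 apply: double_int_symm.
 - by rewrite /kap; meas.
 - by meas.
 - by pos.
 - by move=> x y; rewrite mulr_ge0// mulr_ge0 ?sqr_ge0// divr_ge0// ltW.
 move=> x y; rewrite -/(kap x y) -/(kap y x) -(kapC x y).
 rewrite -mulrDl mulrA ler_wpM2r//.
 have p1 := p0 (nsq x); have p2 := p0 (nsq y).
 set a := v (nsq x); set b := v (nsq y); set P := p (nsq x) in p1 *; set P' := p (nsq y) in p2 *.
 have -> : a^2 * (P' / P) + b^2 * (P / P') = 2 * (a * b) + (a * P' - b * P)^2 / (P * P') by field; rewrite !gt_eqF.
 by rewrite lerDl divr_ge0 ?sqr_ge0// mulr_ge0// ltW.
rewrite h1; apply: leeD.
 apply: (le_trans (modulus e0)); rewrite lee_fin le_eqVlt; apply/orP; left; apply/eqP.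
 by field.
apply: lee_wpmul2l; [by rewrite lee_fin|exact: (le_trans (vst_riesz (e^2)) h2)].
Qed.

End RearrangedModulus.

Section SecondDifference.
Variable R : realType.

Lemma is_der_near (f : R -> R) (x d eta : R) : 0 < eta -> derives x f d ->
 exists2 dl, 0 < dl & forall h, `|h| < dl -> `|f (x + h) - f x - d * h| <= eta * `|h|.
Proof.
move=> e0 [hd dE].
have : (h^-1 *: ((f \o shift x) (h *: (1 : R)) - f x)) @[h --> (0 : R)^'] --> d by rewrite -dE.
move=> /cvgrPdist_le /(_ eta e0) /nbhs_ballP[dl dl0 hdl].
exists dl => // h hd1; have [->|h0] := eqVneq h 0.
 by rewrite addr0 subrr mulr0 subr0 normr0 mulr0.
have := hdl h; rewrite /ball/= sub0r normrN => /(_ hd1 h0).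
rewrite /GRing.scale /= mulr1 [h + x]addrC => h1.
have -> : f (x + h) - f x - d * h = - (d - h^-1 * (f (x + h) - f x)) * h by field.
by rewrite normrM normrN ler_wpM2r.
Qed.

(** [F'] is known to be differentiable only at 0, so the mean value theorem is applied once, to
    [F t + F (- t) - t^2 F2], whose derivative is estimated by the first-order expansion of [F'] at
    0. *)
Lemma second_difference (F F' : R -> R) (F2 eta : R) : 0 < eta ->
 (forall t, derives t F (F' t)) -> derives 0 F' F2 ->
 exists2 dl, 0 < dl & forall e, 0 < e -> e < dl ->
  `|F e + F (- e) - 2 * F 0 - e^2 * F2| <= eta * e^2.
Proof.
move=> eta0 dF dF'.
have eta2 : 0 < eta / 2 by lra.
have [dl dl0 h] := is_der_near eta2 dF'; exists dl => // e e0 edl.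
pose G t : R := F t + F (- t) - t^2 * F2.
have dG (t : R) : derives t G (F' t - F' (- t) - 2 * t * F2).
 have hN : derives t (F \o (fun s => - s)) (F' (- t) * -1) by apply: is_derive1_comp.
 have -> : G = (F + (F \o (fun s => - s)) - (fun t => t^2 * F2)) by [].
 apply: is_derive_eq; rewrite /GRing.scale /=; ring.
have [c [c0 ce E]] := @mean_value R G _ 0 e e0 (fun t _ _ => dG t).
have -> : F e + F (- e) - 2 * F 0 - e^2 * F2 = G e - G 0 by rewrite /G oppr0 expr0n mul0r; ring.
rewrite E subr0 normrM (gtr0_norm e0) mulrA ler_wpM2r ?(ltW e0)//.
have h1 := h c; have h2 := h (- c); rewrite !add0r in h1 h2.
rewrite normrN (gtr0_norm c0) in h1 h2.
have cd := lt_trans ce edl.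
have {h1} := h1 cd; have {h2} := h2 cd; rewrite 2!ler_norml => /andP[a1 a2] /andP[a3 a4].
have ec : eta * c <= eta * e by rewrite ler_pM2l// ltW.
by rewrite ler_norml; lra.
Qed.

End SecondDifference.

Section Hardy.
Variable R : realType.
Local Notation leb := (@lebesgue_measure R).
Local Notation mu2 := (leb2 R).
Local Notation plane := (plane R).
Implicit Types x k : plane.
Variables (psi beta dbeta : R -> R) (good : R -> bool) (B L : R).
Hypothesis dpsi : forall q : R, 0 <= q -> derives q psi (beta q).
Hypotheses (mbeta : mble beta) (mdbeta : mble dbeta)
 (mgood : mble good).
Hypothesis beta0 : forall q, 0 <= q -> 0 <= beta q.
Hypothesis betaB : forall q, 0 <= q -> beta q <= B.
Hypothesis betaL : forall q, 0 <= q -> beta q * sqrt q <= L.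
Hypothesis beta_mono : forall p q, 0 <= p -> p <= q -> p * beta p <= q * beta q.
Hypothesis dbetaE : forall q, good q -> 0 < q -> derives q beta (dbeta q).

Definition dotp x k : R := x.1 * k.1 + x.2 * k.2.
Definition ray x k t : R := nsq x + 2 * t * dotp x k + t^2 * nsq k.

Lemma nsq_ray x k t : nsq (x.1 + t * k.1, x.2 + t * k.2) = ray x k t.
Proof. by rewrite /ray /nsq /dotp /=; ring. Qed.

Lemma ray_ge0 x k t : 0 <= ray x k t.
Proof. by rewrite -nsq_ray nsq_ge0. Qed.

Lemma dotp_sqr x k : dotp x k^2 <= nsq x * nsq k.
Proof.
rewrite -subr_ge0 (_ : _ - _ = (x.1 * k.2 - x.2 * k.1)^2) ?sqr_ge0//.
by rewrite /dotp /nsq; ring.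
Qed.

Lemma dpsi_ray x k (t : R) :
 derives t (fun t => psi (ray x k t)) (beta (ray x k t) * (2 * (dotp x k + t * nsq k))).
Proof.
apply: (@is_derive1_comp R psi (ray x k)); first exact/dpsi/ray_ge0.
by apply: is_derive_eq; rewrite /GRing.scale /=; ring.
Qed.

Lemma L_ge0 : 0 <= L.
Proof. by have := betaL (lexx 0); rewrite sqrtr0 mulr0. Qed.

Lemma B_ge0 : 0 <= B.
Proof. exact: le_trans (beta0 (lexx 0)) (betaB (lexx 0)). Qed.

Lemma ray_slope x k t : `|beta (ray x k t) * (2 * (dotp x k + t * nsq k))| <= 2 * L * sqrt (nsq k).
Proof.
have q0 := ray_ge0 x k t; have b0 := beta0 q0.
have -> : dotp x k + t * nsq k = dotp (x.1 + t * k.1, x.2 + t * k.2) k by rewrite /dotp /nsq /=; ring.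
have := dotp_sqr (x.1 + t * k.1, x.2 + t * k.2) k; rewrite nsq_ray => h.
rewrite !normrM (ger0_norm b0) ger0_norm// mulrCA -mulrA ler_wpM2l//.
apply: (@le_trans _ _ (beta (ray x k t) * (sqrt (ray x k t) * sqrt (nsq k)))).
 by rewrite ler_wpM2l// -sqrtrM// -sqrtr_sqr ler_wsqrtr.
by rewrite mulrA ler_wpM2r// betaL.
Qed.

(** The bound on [beta q * sqrt q] makes [psi (nsq x)] Lipschitz as a function on the plane,
    uniformly in [x]. *)
Lemma ray_increment x k (t : R) : 0 < t ->
 `|psi (ray x k t) - psi (nsq x)| <= 2 * L * t * sqrt (nsq k).
Proof.
move=> t0.
have [c [_ _]] := @mean_value R _ _ 0 t t0 (fun s _ _ => dpsi_ray x k s).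
rewrite {2}/ray expr0n !mulr0 !mul0r !addr0 subr0 => ->.
rewrite normrM (gtr0_norm t0) [leRHS]mulrAC ler_wpM2r ?(ltW t0)//.
exact: ray_slope.
Qed.

Lemma ray_opp x k t : ray x (- k.1, - k.2) t = ray x k (- t).
Proof. by rewrite /ray /dotp /nsq /=; ring. Qed.

(* [q beta] nondecreasing controls the one unfavourable term of the difference
 of the slopes at [t] and [-t]. *)
Lemma ray_slope_difference x k t : 0 < t ->
 - (4 * B * t * nsq k) <=
 beta (ray x k t) * (2 * (dotp x k + t * nsq k)) -
 beta (ray x k (- t)) * (2 * (dotp x k + - t * nsq k)).
Proof.
move=> t0.
(* Here [a >= 0] stands for the scalar product up to sign. Only the term with [bm] can be negative,
   when [a > t * b]; multiplying by [Qp] and replacing [Qp * bp] by the smaller [Qm * bm] expresses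
   everything through [bm <= B]. *)
have core (q a b Qp Qm bp bm : R) : 0 <= q -> 0 <= b -> 0 <= a -> a^2 <= q * b ->
  Qp = q + 2 * t * a + t^2 * b -> Qm = q - 2 * t * a + t^2 * b ->
  0 <= bp -> 0 <= bm -> bm <= B -> Qm * bm <= Qp * bp ->
  - (4 * B * t * b) <= bp * (2 * (a + t * b)) + bm * (2 * (- a + t * b)).
 move=> q0 b0 a0 ab eQp eQm bp0 bm0 bmB mono.
 have tb : 0 <= t * b by rewrite mulr_ge0// ltW.
 have Btb : 0 <= B * (t * b) by rewrite mulr_ge0// B_ge0.
 have [atb|atb] := leP a (t * b).
  have h1 : 0 <= bp * (2 * (a + t * b)) by pos.
  have h2 : 0 <= bm * (2 * (- a + t * b)) by rewrite !mulr_ge0// addrC subr_ge0.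
  by lra.
 have Qp0 : 0 < Qp.
  have ta : 0 < t * a by rewrite mulr_gt0//; exact: le_lt_trans atb.
  have ttb : 0 <= t^2 * b by pos.
  by lra.
 rewrite -(ler_pM2l Qp0).
 have qQp : q <= Qp.
  have ta : 0 <= t * a by rewrite mulr_ge0// ltW.
  have ttb : 0 <= t^2 * b by pos.
  by lra.
 apply: (@le_trans _ _ (2 * (a + t * b) * (Qm * bm) + Qp * (bm * (2 * (- a + t * b))))); last first.
  have : 2 * (a + t * b) * (Qm * bm) <= 2 * (a + t * b) * (Qp * bp) by rewrite ler_wpM2l// mulr_ge0// addr_ge0.
  by lra.
 have -> : 2 * (a + t * b) * (Qm * bm) + Qp * (bm * (2 * (- a + t * b))) =
   4 * bm * t * (b * q + t^2 * b^2 - 2 * a^2) by rewrite eQp eQm; ring.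
 have h3 : bm * t * (2 * a^2 - b * q) <= bm * t * (b * q) by rewrite ler_wpM2l ?mulr_ge0//; lra.
 have h4 : bm * (t * b * q) <= B * (t * b * Qp) by rewrite ler_pM// ?mulr_ge0// ?(ltW t0)// ler_wpM2l.
 have h5 : 0 <= bm * t * (t^2 * b^2) by rewrite !mulr_ge0 ?(ltW t0).
 by lra.
have Qp := ray_ge0 x k t; have Qm := ray_ge0 x k (- t).
have ab := dotp_sqr x k.
have E1 : ray x k t = nsq x + 2 * t * dotp x k + t^2 * nsq k by [].
have E2 : ray x k (- t) = nsq x - 2 * t * dotp x k + t^2 * nsq k by rewrite /ray; ring.
have [a0|a0] := leP 0 (dotp x k).
 have := core _ _ _ _ _ _ _ (nsq_ge0 x) (nsq_ge0 k) a0 ab E1 E2 (beta0 Qp) (beta0 Qm) (betaB Qm).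
 move=> h; have /h : ray x k (- t) * beta (ray x k (- t)) <= ray x k t * beta (ray x k t).
  apply: beta_mono => //; rewrite E2 lerD2r lerD2l.
  by have := mulr_ge0 (ltW t0) a0; lra.
 by lra.
have ab' : (- dotp x k)^2 <= nsq x * nsq k by lra.
have E1' : ray x k (- t) = nsq x + 2 * t * (- dotp x k) + t^2 * nsq k by lra.
have E2' : ray x k t = nsq x - 2 * t * (- dotp x k) + t^2 * nsq k by lra.
have a0' : 0 <= - dotp x k by lra.
have := core _ _ _ _ _ _ _ (nsq_ge0 x) (nsq_ge0 k) a0' ab' E1' E2' (beta0 Qm) (beta0 Qp) (betaB Qp).
move=> h; have /h : ray x k t * beta (ray x k t) <= ray x k (- t) * beta (ray x k (- t)).
 apply: beta_mono => //; rewrite E2 lerD2r lerD2l.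
 by have := mulr_ge0 (ltW t0) a0'; lra.
by lra.
Qed.

Lemma ray_second_difference x k (e : R) : 0 < e ->
 - (2 * B * e^2 * nsq k) <= (psi (ray x k e) - psi (nsq x)) + (psi (ray x k (- e)) - psi (nsq x)).
Proof.
move=> e0.
pose F (t : R) := psi (ray x k t).
pose F' (t : R) := beta (ray x k t) * (2 * (dotp x k + t * nsq k)).
have dF (t : R) : derives t F (F' t) by exact: dpsi_ray.
pose G (t : R) : R := F t + F (- t) + t^2 * (2 * B * nsq k).
have dG (t : R) : derives t G (F' t - F' (- t) + 4 * B * t * nsq k).
 have hN : derives t (F \o (fun s => - s)) (F' (- t) * -1) by apply: is_derive1_comp.
 have -> : G = (F + (F \o (fun s => - s)) + (fun t => t^2 * (2 * B * nsq k))) by [].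
 apply: is_derive_eq; rewrite /GRing.scale /=; ring.
have := @der_ge0_le R G _ 0 e (ltW e0) (fun t _ _ => dG t).
have G0 : G 0 = 2 * psi (nsq x) by rewrite /G oppr0 /F /ray expr0n mulr0 !mul0r !addr0; ring.
rewrite G0 /G /F => h.
suff : 2 * psi (nsq x) <= psi (ray x k e) + psi (ray x k (- e)) + e^2 * (2 * B * nsq k) by lra.
apply: h => t t0 _; have := ray_slope_difference x k t0; rewrite /F'; lra.
Qed.

Definition bump_mean x k e : R :=
 (expR (psi (nsq x) - psi (ray x k e)) + expR (psi (nsq x) - psi (ray x k (- e)))) / 2.

(** [B] comes from the second difference of [psi], the other term from the quadratic remainder of
    the exponential. The constant disappears again in [hardy_bound]. *)
Definition hardy_const : R := B + 4 * L^2 * expR (2 * L).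

Lemma hardy_const_ge0 : 0 <= hardy_const.
Proof. by rewrite addr_ge0 ?B_ge0// mulr_ge0// mulr_ge0 ?sqr_ge0. Qed.

(** The uniform one-sided bound that makes [(1 - bump_mean x k e) / e^2 + hardy_const] nonnegative,
    as Fatou's lemma requires. Averaging over [k] and [- k] has removed the first-order term. *)
Lemma bump_mean_le x k (e : R) : 0 < e -> e <= 1 -> nsq k < 1 ->
 bump_mean x k e <= 1 + hardy_const * e^2.
Proof.
move=> e0 e1 k1.
have sk : sqrt (nsq k) <= 1 by rewrite -sqrtr1 ler_wsqrtr// ltW.
have L0 := L_ge0.
have bnd t : 0 < t -> t <= 1 -> forall k, sqrt (nsq k) <= 1 ->
  expR (psi (nsq x) - psi (ray x k t)) <=
  1 + (psi (nsq x) - psi (ray x k t)) + 4 * L^2 * t^2 * expR (2 * L).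
 move=> t0 t1 k' sk'; have h := ray_increment x k' t0; rewrite distrC in h.
 have h2 : 2 * L * t * sqrt (nsq k') <= 2 * L * t by rewrite ler_piMr// !mulr_ge0// ltW.
 have h1 := le_trans h h2.
 have hL : 2 * L * t <= 2 * L by rewrite ler_piMr// mulr_ge0.
 apply: (le_trans (expR_le_quadratic (le_trans h1 hL))); rewrite lerD2l.
 rewrite ler_wpM2r// -real_normK ?num_real//.
 have -> : 4 * L^2 * t^2 = (2 * L * t)^2 by lra.
 by rewrite ler_pXn2r// nnegrE// !mulr_ge0// ltW.
have b1 := bnd e e0 e1 k sk.
have sk' : sqrt (nsq (- k.1, - k.2)) <= 1 by rewrite /nsq !sqrrN.
have b2 := bnd e e0 e1 _ sk'; rewrite ray_opp in b2.
have b3 := ray_second_difference x k e0.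
have b4 : 2 * B * e^2 * nsq k <= 2 * B * e^2 by rewrite ler_piMr ?(ltW k1)// mulr_ge0 ?sqr_ge0// mulr_ge0// B_ge0.
rewrite /bump_mean /hardy_const; lra.
Qed.

(** The coefficient of [e^2] is minus half the second derivative at 0 of
    [exp (psi (nsq x) - psi (ray x k t))] in [t]. *)
Lemma bump_mean_lim x k (eta : R) : 0 < eta -> good (nsq x) -> 0 < nsq x ->
 exists2 dl, 0 < dl & forall e, 0 < e -> e < dl ->
  `|(1 - bump_mean x k e) - e^2 * (beta (nsq x) * nsq k +
   2 * (dbeta (nsq x) - beta (nsq x)^2) * dotp x k^2)| <= eta * e^2.
Proof.
move=> eta0 gx x0.
pose F (t : R) := expR (psi (nsq x) - psi (ray x k t)).
pose F' (t : R) := - F t * (beta (ray x k t) * (2 * (dotp x k + t * nsq k))).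
have dF (t : R) : derives t F (F' t).
 have h1 := dpsi_ray x k t.
 have h2 : derives t (fun t => psi (nsq x) - psi (ray x k t))
   (- (beta (ray x k t) * (2 * (dotp x k + t * nsq k)))).
  have -> : (fun t => psi (nsq x) - psi (ray x k t)) = cst (psi (nsq x)) - (fun t => psi (ray x k t)) by apply/funext.
  by apply: is_derive_eq; rewrite sub0r.
 have := @is_derive1_comp R expR _ t _ _ (is_derive_expR _) h2.
 by move=> h; apply: (@is_derive_eq _ _ _ _ _ _ _ _ h); rewrite /F' mulrN mulNr.
have r0 : ray x k 0 = nsq x by rewrite /ray expr0n mulr0 !mul0r !addr0.
have F0 : F 0 = 1 by rewrite /F r0 subrr expR0.
have dF' : is_derive (0 : R) (1 : R) F' (- (2 * (beta (nsq x) * nsq k +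
   2 * (dbeta (nsq x) - beta (nsq x)^2) * dotp x k^2))).
 have h2 : is_derive (0 : R) (1 : R) (beta \o ray x k) (dbeta (nsq x) * (2 * dotp x k)).
  apply: is_derive1_comp; first by rewrite r0; exact: dbetaE.
  by apply: is_derive_eq; rewrite /GRing.scale /=; ring.
 have h3 : is_derive (0 : R) (1 : R) (fun t : R => 2 * (dotp x k + t * nsq k)) (2 * nsq k) by apply: is_derive_eq; rewrite /GRing.scale /=; ring.
 have -> : F' = (- F) * ((beta \o ray x k) * (fun t : R => 2 * (dotp x k + t * nsq k))) by apply/funext.
 apply: is_derive_eq; rewrite /GRing.scale /= /F' !fctE r0 F0; ring.
have eta2 : 0 < 2 * eta by lra.
have [dl dl0 h] := second_difference eta2 dF dF'; exists dl => // e e0 ed.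
have := h e e0 ed; rewrite F0 !ler_norml /bump_mean -/(F e) -/(F (- e)) => /andP[a1 a2].
by lra.
Qed.
(** [(q + |q|) / 2] is the positive part of [q]: nothing is known of [psi] at negative arguments,
    yet [p] has to be measurable on the whole line. *)
Let p (q : R) : R := expR (- psi ((q + `|q|) / 2)).

Let pE q : 0 <= q -> p q = expR (- psi q).
by move=> q0; rewrite /p (ger0_norm q0) (_ : (q + q) / 2 = q)//; field. Qed.
Let mp : mble p.
apply: mfun_expR; apply: mfun_opp; apply: continuous_measurable_fun => q.
have c : {for q, continuous (fun q : R => (q + `|q|) / 2)} by apply: cvgM; [apply: cvgD; [exact: cvg_id|exact: norm_continuous]|exact: cvg_cst].
apply: (continuous_comp c); apply: is_der1_cont (dpsi _).
by have := ler_norm (- q); rewrite normrN; lra.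
Qed.
Let bump_meanE x k e : bump_mean x k e = (p (ray x k e) / p (nsq x) + p (ray x k (- e)) / p (nsq x)) / 2.
by rewrite !pE ?ray_ge0 ?nsq_ge0// -!expRB !opprK ![_ + psi (nsq x)]addrC. Qed.
Let mray e : mble (fun z : plane * plane => ray z.1 z.2 e).
by rewrite /ray /dotp; meas. Qed.
Let mbm e : mble (fun z : plane * plane => bump_mean z.1 z.2 e).
have m1 := mray e; have m2 := mray (- e); have mp' := mp.
have -> : (fun z : plane * plane => bump_mean z.1 z.2 e) = fun z =>
  (p (ray z.1 z.2 e) / p (nsq z.1) + p (ray z.1 z.2 (- e)) / p (nsq z.1)) / 2 by apply/funext => z.
apply: mfun_mul; last exact: measurable_cst.
have mn : mble (fun z : plane * plane => (p (nsq z.1))^-1) by meas.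
apply: mfun_add; apply: mfun_mul => //.
 exact: (measurableT_comp mp').
exact: (measurableT_comp mp').
Qed.

Variables (v : R -> R) (lam T : R).
Hypotheses (mv : mble v) (v2 : (\int[mu2]_x (v (nsq x)^2)%:E = lam%:E)%E).
Hypothesis weighted : weighted_bound v lam T.

Lemma bump_mean_ge0 x k e : 0 <= bump_mean x k e.
Proof. by rewrite divr_ge0//. Qed.

Lemma inner_bump x (e : R) : 0 < e ->
 (\int[mu2]_y (v (nsq x)^2 * (p (nsq y) / p (nsq x)) * ind (dsq x y < e^2)%R)%:E =
 (e^2)%:E * \int[mu2]_k (v (nsq x)^2 * (ind (nsq k < 1) * bump_mean x k e))%:E)%E.
Proof.
move=> e0; have mp' := mp; have p0 q : 0 < p q by exact: expR_gt0.
pose H k : R := v (nsq x)^2 * (ind (nsq k < 1) * (p (ray x k e) / p (nsq x))).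
have mH : mble H by rewrite /H /ray /dotp; meas.
have H0 k : 0 <= H k by rewrite mulr_ge0 ?sqr_ge0// mulr_ge0// divr_ge0// ltW.
have -> : (\int[mu2]_y (v (nsq x)^2 * (p (nsq y) / p (nsq x)) * ind (dsq x y < e^2)%R)%:E =
  (e^2)%:E * \int[mu2]_k (H k)%:E)%E.
 have i0 (y : plane) : 0 <= v (nsq x)^2 * (p (nsq y) / p (nsq x)) * ind (dsq x y < e^2) by rewrite mulr_ge0// mulr_ge0 ?sqr_ge0// divr_ge0// ltW.
 rewrite -(int_plane_shift x); [|by meas|by move=> y; rewrite lee_fin].
 rewrite (int_plane_scale e0); [|by meas|by move=> y; rewrite lee_fin].
 congr (_ * _)%E; apply: eq_integral => k _; congr EFin.
 rewrite /H -nsq_ray [e * k.1 + _]addrC [e * k.2 + _]addrC.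
 have -> : (dsq x (x.1 + e * k.1, x.2 + e * k.2) < e^2) = (nsq k < 1).
  rewrite (_ : dsq _ _ = e^2 * nsq k); last by rewrite /dsq /nsq /=; ring.
  by rewrite -[X in _ < X]mulr1 ltr_pM2l// exprn_gt0.
 by lra.
congr (_ * _)%E.
have mH' : mble (fun k : plane => H (- k.1, - k.2)) by meas.
have hH : (\int[mu2]_k (H (- k.1, - k.2)%R)%:E = \int[mu2]_k (H k)%:E)%E by apply: (@int_plane_opp R (fun k => (H k)%:E)); [exact: mfun_EFin|move=> k; rewrite lee_fin].
have dbl (X Y : \bar R) : (0 <= X)%E -> (X + X = 2%:E * Y)%E -> X = Y.
 move=> X0 XY; have : (2%:E * X = 2%:E * Y)%E.
  by rewrite -XY -[2]/(1 + 1) EFinD ge0_muleDl ?lee_fin ?ler01// mul1e.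
 by move=> /(congr1 (fun z => 2^-1%:E * z)%E); rewrite !muleA -!EFinM mulVf ?mul1e.
apply: dbl; first by apply: integral_ge0 => k _; rewrite lee_fin.
have mbx : mble (fun k => bump_mean x k e) by exact: (measurable_fun_pair2 x (mbm e)).
rewrite -{2}hH -ge0_integralD; [|by []|by move=> k _; rewrite lee_fin|exact: mfun_EFin
 |by move=> k _; rewrite lee_fin|exact: mfun_EFin].
rewrite -ge0_integralZl; [|isd|isd| |isd]; last first.
 by move=> k _; rewrite lee_fin mulr_ge0 ?sqr_ge0// mulr_ge0// bump_mean_ge0.
apply: eq_integral => k _; rewrite -EFinD; congr EFin.
rewrite /H ray_opp bump_meanE (_ : nsq (- k.1, - k.2) = nsq k); last by rewrite /nsq !sqrrN.
by lra.
Qed.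
Let C := hardy_const.

(** The nonlocal inequality for the weight [p], after [y = x + e k] and division by [e^4]. The
    multiple [hardy_const] of the mass is added to make the integrand nonnegative. *)
Lemma hardy_step (e : R) : 0 < e -> e <= 1 ->
 (\int[mu2]_x \int[mu2]_k (v (nsq x)^2 *
  (ind (nsq k < 1) * (e ^- 2 * (1 - bump_mean x k e) + C)))%:E <= (pi * (C * lam + T / 8))%:E)%E.
Proof.
move=> e0 e1; have e2 : 0 < e^2 by rewrite exprn_gt0.
have eV : 0 < e ^- 2 by rewrite invr_gt0.
have C0 := hardy_const_ge0 : 0 <= C.
pose A x k : R := v (nsq x)^2 * (ind (nsq k < 1) * bump_mean x k e).
pose X x k : R := v (nsq x)^2 * (ind (nsq k < 1) * (e ^- 2 * (1 - bump_mean x k e) + C)).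
have mA : mble (fun z : plane * plane => A z.1 z.2) by rewrite /A; meas.
have mX : mble (fun z : plane * plane => X z.1 z.2) by rewrite /X; meas.
have A0 x k : 0 <= A x k by rewrite mulr_ge0 ?sqr_ge0// mulr_ge0// bump_mean_ge0.
have X0 x k : 0 <= X x k.
 rewrite mulr_ge0 ?sqr_ge0//; case: (ltP (nsq k) 1) => [k1|_]; last by rewrite mul0r.
 rewrite mul1r; have := bump_mean_le x e0 e1 k1; rewrite -/C => h.
 have -> : e ^- 2 * (1 - bump_mean x k e) + C = e ^- 2 * (1 + C * e^2 - bump_mean x k e) by field; rewrite gt_eqF.
 by rewrite mulr_ge0 ?(ltW eV)// subr_ge0.
have AE0 : (0 <= \int[mu2]_x \int[mu2]_k (A x k)%:E)%E by pos.
have XE0 : (0 <= \int[mu2]_x \int[mu2]_k (X x k)%:E)%E by pos.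
have sumE : ((e ^- 2)%:E * \int[mu2]_x \int[mu2]_k (A x k)%:E + \int[mu2]_x \int[mu2]_k (X x k)%:E =
  ((e ^- 2 + C) * pi * lam)%:E)%E.
 rewrite -(int2Z (ltW eV) mA A0).
 rewrite -int2D; [|exact: mfun_mul|by []|by move=> x k; rewrite mulr_ge0 ?(ltW eV)|by []].
 transitivity (\int[mu2]_x (((e ^- 2 + C) * pi)%:E * (v (nsq x)^2)%:E))%E.
  apply: eq_integral => x _.
  transitivity (\int[mu2]_k ((v (nsq x)^2 * (e ^- 2 + C))%:E * (ind (disc 1 k))%:E))%E.
   by apply: eq_integral => k _; congr EFin; rewrite /A /X; ring.
  rewrite ge0_integralZl; [|isd|by rewrite /disc; meas|isd|by rewrite lee_fin mulr_ge0 ?sqr_ge0// addr_ge0// ltW].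
  by rewrite -/(mass _) mass_disc//; congr EFin; ring.
 rewrite ge0_integralZl; [|isd|isd|isd|]; last first.
  by pos.
 by rewrite v2.
have p0 q : 0 < p q by exact: expR_gt0.
have := weighted mp p0 e0.
have -> : (\int[mu2]_x \int[mu2]_y (v (nsq x)^2 * (p (nsq y) / p (nsq x)) * ind (dsq x y < e^2)%R)%:E =
  (e^2)%:E * \int[mu2]_x \int[mu2]_k (A x k)%:E)%E.
 rewrite -(int2Z (ltW e2) mA A0); apply: eq_integral => x _.
 have mAx := measurable_fun_pair2 x mA.
 rewrite inner_bump// -ge0_integralZl; [by []|isd|isd| |by rewrite lee_fin ltW].
 by move=> k _; exact: A0.
move: AE0 XE0 sumE; rewrite -[X in _ -> (X <= _)%E]/(\int[mu2]_x \int[mu2]_k (X x k)%:E)%E.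
move: (\int[mu2]_x \int[mu2]_k (A x k)%:E)%E (\int[mu2]_x \int[mu2]_k (X x k)%:E)%E => a y.
case: a => [a||//] _; last first.
 by move=> y0; rewrite gt0_muley// addye// -ltNye (lt_le_trans _ y0).
case: y => [y||//] _; last by rewrite -EFinM.
rewrite -!EFinM => -[] hs; rewrite !lee_fin => hw.
have hw2 : pi * lam <= pi * e^2 / 8 * T + a.
 rewrite -(ler_pM2l e2); lra.
have hw3 : e ^- 2 * (pi * lam) <= pi / 8 * T + e ^- 2 * a.
 have -> : pi / 8 * T + e ^- 2 * a = e ^- 2 * (pi * e^2 / 8 * T + a) by field; rewrite gt_eqF.
 by rewrite ler_pM2l.
lra.
Qed.

(** [c2] may be negative, so [|c2|] times the quadratic term is added on both sides to keep every
    integral nonnegative. *)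
Lemma disc_combination x (c1 c2 c3 : R) : 0 <= c1 -> 0 <= c3 ->
 (forall k, nsq k < 1 -> 0 <= c1 * nsq k + c2 * dotp x k^2 + c3) ->
 (\int[mu2]_k (ind (nsq k < 1) * (c1 * nsq k + c2 * dotp x k^2 + c3))%:E =
 (pi * (c1 / 2 + c2 * nsq x / 4 + c3))%:E)%E.
Proof.
move=> c10 c30 h.
have n0 : 0 <= c2 + `|c2| by have := ler_norm (- c2); rewrite normrN; lra.
have D : (\int[mu2]_k (ind (nsq k < 1) * dotp x k^2)%:E = (pi / 4 * nsq x)%:E)%E by rewrite (disc_quadratic x.1 x.2 ler01) expr1n mulr1.
have N : (\int[mu2]_k (ind (nsq k < 1) * nsq k)%:E = (pi / 2)%:E)%E by rewrite (disc_nsq ler01) expr1n mulr1.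
have O : (\int[mu2]_k (ind (nsq k < 1))%:E = pi%:E)%E by have := @mass_disc R 1 ler01; rewrite mulr1.
have md : mble (fun k => ind (nsq k < 1) * dotp x k^2) by rewrite /dotp; meas.
have mn : mble (fun k : plane => ind (nsq k < 1) * nsq k : R) by meas.
have mo : mble (fun k : plane => ind (nsq k < 1) : R) by meas.
have d0 k : 0 <= ind (nsq k < 1) * dotp x k^2 by pos.
have nn0 k : 0 <= ind (nsq k < 1) * nsq k :> R by pos.
set I := (\int[mu2]_k _)%E.
have E : (I + `|c2|%:E * (pi / 4 * nsq x)%:E =
  c1%:E * (pi / 2)%:E + (c2 + `|c2|)%:E * (pi / 4 * nsq x)%:E + c3%:E * pi%:E)%E.
 have Z (c : R) (f : plane -> R) : 0 <= c -> mble f -> (forall k, 0 <= f k) ->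
   (\int[mu2]_k (c * f k)%:E = c%:E * \int[mu2]_k (f k)%:E)%E.
  move=> c0 mf f0; rewrite -ge0_integralZl; [by []|isd|isd| |isd].
  by pos.
 have S (f f' : plane -> R) : mble f -> (forall k, 0 <= f k) ->
   mble f' -> (forall k, 0 <= f' k) ->
   (\int[mu2]_k (f k + f' k)%:E = \int[mu2]_k (f k)%:E + \int[mu2]_k (f' k)%:E)%E.
  move=> mf f0 mf' f0'; rewrite -ge0_integralD; [by []|isd| |isd| |isd];
   by move=> k _; rewrite lee_fin.
 have z k c (f : plane -> R) : 0 <= c -> (forall k, 0 <= f k) -> 0 <= c * f k by pos.
 have mz c (f : plane -> R) : mble f -> mble (fun k => c * f k) by apply: mfun_mul.
 rewrite -D -N -O -!Z// -!S//; try by [move=> k; apply: z|apply: mz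
  |move=> k; apply: addr_ge0; apply: z|apply: mfun_add; apply: mz].
 - by apply: eq_integral => k _; congr EFin; ring.
 - by pos.
 - by pos.
 - by pos.
 - by pos.
 - by rewrite /dotp; meas.
 - move=> k; case: (ltP (nsq k) 1) => k1; last by rewrite mul0r.
  by rewrite mul1r h.
 - by pos.
move: E; rewrite -!EFinM; case: (I) => [r||] //; rewrite -!EFinD => -[] E; congr EFin; lra.
Qed.

(** Fatou's lemma along [e = 1 / (n + 1)]. The mean of [beta |k|^2 + 2 (beta' - beta^2) (x . k)^2]
    over [k] in the unit disc is half of [beta + q beta' - q beta^2]. The maximum with 0 matters
    only where [v] vanishes; elsewhere the limit is nonnegative. *)
Theorem hardy : (\int[leb]_(q in `]0%R, +oo[)
  (ind (good q) * (v q^2 * Num.max 0 (beta q + q * dbeta q - q * beta q^2 + 2 * C)))%:E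
 <= ((T / 4 + 2 * C * lam) / pi)%:E)%E.
Proof.
have C0 := hardy_const_ge0 : 0 <= C.
pose G x : R := ind (good (nsq x) && (0 < nsq x)).
pose e n : R := n.+1%:R^-1.
have e0 n : 0 < e n by rewrite invr_gt0.
have e1 n : e n <= 1 by rewrite invf_le1// ler1n.
pose X n x k : R := v (nsq x)^2 *
  (ind (nsq k < 1) * (e n ^- 2 * (1 - bump_mean x k (e n)) + C)).
pose g x k : R := beta (nsq x) * nsq k + 2 * (dbeta (nsq x) - beta (nsq x)^2) * dotp x k^2 + C.
pose Y x k : R := G x * (v (nsq x)^2 * (ind (nsq k < 1) * g x k)).
have mX n : mble (fun z : plane * plane => X n z.1 z.2) by rewrite /X; meas.
have X0 n x k : 0 <= X n x k.
 rewrite mulr_ge0 ?sqr_ge0//; case: (ltP (nsq k) 1) => [k1|_]; last by rewrite mul0r.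
 rewrite mul1r; have := bump_mean_le x (e0 n) (e1 n) k1; rewrite -/C => h.
 have en := e0 n.
 have -> : e n ^- 2 * (1 - bump_mean x k (e n)) + C = e n ^- 2 * (1 + C * e n^2 - bump_mean x k (e n)) by field; rewrite gt_eqF.
 by rewrite mulr_ge0 ?subr_ge0// invr_ge0 sqr_ge0.
have mG : mble (fun z : plane * plane => G z.1) by rewrite /G; meas.
have limY x k : G x * X n x k @[n --> \oo] --> Y x k.
 rewrite /Y /G; case: (boolP (good (nsq x))) => gx; last first.
  by under eq_fun do rewrite mul0r; rewrite mul0r; exact: cvg_cst.
 case: (ltP 0 (nsq x)) => x0 /=; last first.
  by under eq_fun do rewrite mul0r; rewrite mul0r; exact: cvg_cst.
 under eq_fun do rewrite mul1r; rewrite mul1r.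
 apply: cvgM; first exact: cvg_cst.
 apply: cvgM; first exact: cvg_cst.
 apply: cvgD; last exact: cvg_cst.
 apply/cvgrPdist_le => eta eta0.
 have [dl dl0 h] := bump_mean_lim k eta0 gx x0.
 have := @near_infty_natSinv_lt R (PosNum dl0); apply: filterS => n /= nd.
 have := h _ (e0 n) nd; rewrite distrC; set b := bump_mean _ _ _.
 set a := beta (nsq x) * nsq k + _ => hh.
 have en : 0 < e n^2 by rewrite exprn_gt0.
 have -> : a - e n ^- 2 * (1 - b) = e n ^- 2 * (e n^2 * a - (1 - b)) by field; rewrite gt_eqF.
 by rewrite normrM ger0_norm ?invr_ge0 ?(ltW en)// mulrC ler_pdivrMr.
have mY : mble (fun z : plane * plane => Y z.1 z.2) by rewrite /Y /g /dotp; meas.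
have Y0 x k : 0 <= Y x k.
 rewrite -(cvg_lim (@Rhausdorff R) (limY x k)); apply: limr_ge; first exact: (cvgP _ (limY x k)).
 by apply: nearW => n; rewrite mulr_ge0.
have YM : (\int[mu2]_x \int[mu2]_k (Y x k)%:E <= (pi * (C * lam + T / 8))%:E)%E.
 have prodE (f : plane * plane -> R) : mble f -> (forall z, 0 <= f z) ->
   (\int[(plane_measure R \x plane_measure R)%E]_z (f z)%:E = \int[mu2]_x \int[mu2]_k (f (x, k))%:E)%E.
  move=> mf f0; apply: (@prod_int R _ _ _ _ (plane_measure R) (plane_measure R) (fun z => (f z)%:E)).
   exact: mfun_EFin.
  by [].
 rewrite -(prodE (fun z => Y z.1 z.2))//.
 apply: (@fatou_real _ _ R (plane_measure R \x plane_measure R)%E (fun n z => G z.1 * X n z.1 z.2)).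
 - by move=> n; exact: (mfun_mul mG (mX n)).
 - by pos.
 - by [].
 move=> n; rewrite prodE; [|exact: (mfun_mul mG (mX n))|by move=> z; rewrite mulr_ge0].
 apply: le_trans (hardy_step (e0 n) (e1 n)).
 apply: le_int2; [exact: (mfun_mul mG (mX n))|exact: mX|by move=> x k; rewrite mulr_ge0|].
 by move=> x k; rewrite ler_piMl// lern1 leq_b1.
pose m q : R := Num.max 0 (beta q + q * dbeta q - q * beta q^2 + 2 * C).
pose F q : R := ind (good q && (0 < q)) * (v q^2 * (pi / 2 * m q)).
have pi2 : 0 < pi / 2 :> R by rewrite divr_gt0 ?pi_gt0.
have m0 q : 0 <= m q by rewrite le_max lexx.
have mF : mble F by rewrite /F; meas.
have F0 q : 0 <= F q by rewrite mulr_ge0// mulr_ge0 ?sqr_ge0// mulr_ge0 ?(ltW pi2).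
have inner x : (\int[mu2]_k (Y x k)%:E = (F (nsq x))%:E)%E.
 rewrite /Y /F /G; case: (boolP (good (nsq x) && (0 < nsq x))) => gx; last first.
  by rewrite mul0r integral0_eq// => k _; rewrite mul0r.
 have [v0|v0] := eqVneq (v (nsq x)) 0.
  by rewrite v0 expr0n mul0r mulr0 integral0_eq// => k _; rewrite mul0r mulr0.
 have v20 : 0 < v (nsq x)^2 by rewrite lt_def sqr_ge0 sqrf_eq0 v0.
 have g0 k : nsq k < 1 -> 0 <= g x k by move=> k1; have := Y0 x k; rewrite /Y /G gx k1 !mul1r pmulr_rge0.
 transitivity (\int[mu2]_k ((v (nsq x)^2)%:E * (ind (nsq k < 1) * g x k)%:E))%E.
  by apply: eq_integral => k _; rewrite mul1r.
 rewrite ge0_integralZl; [|isd|by rewrite /g /dotp; meas| |by rewrite lee_fin ltW]; last first.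
  move=> k _; rewrite lee_fin; case: (ltP (nsq k) 1) => k1; last by rewrite mul0r.
  by rewrite mul1r g0.
 have hI := @disc_combination x (beta (nsq x)) (2 * (dbeta (nsq x) - beta (nsq x)^2)) C
  (beta0 (nsq_ge0 x)) C0 g0.
 have I0 : (0 <= \int[mu2]_k (ind (nsq k < 1) * g x k)%:E)%E.
  apply: integral_ge0 => k _; rewrite lee_fin; case: (ltP (nsq k) 1) => k1; last by rewrite mul0r.
  by rewrite mul1r g0.
 move: I0; rewrite hI lee_fin pmulr_rge0 ?pi_gt0// => I0.
 rewrite -EFinM; congr EFin; rewrite mul1r; congr (_ * _); rewrite /m max_r; first by field.
 by lra.
have FM : (\int[mu2]_x (F (nsq x))%:E <= (pi * (C * lam + T / 8))%:E)%E by apply: le_trans YM; rewrite le_eqVlt; apply/orP; left; apply/eqP; apply: eq_integral => x _.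
rewrite (@int_radial R (fun q => (F q)%:E)) in FM; [|exact: mfun_EFin|by move=> q; rewrite lee_fin].
set I := (\int[leb]_(q in _) _)%E.
have FI : (\int[leb]_(q in `]0%R, +oo[) (F q)%:E = (pi / 2)%:E * I)%E.
 rewrite -ge0_integralZl; [|isd| | |by rewrite lee_fin ltW].
 - apply: eq_integral => q; rewrite inE /= in_itv/= andbT => q0.
  by rewrite -/(m q) /F q0 andbT; congr EFin; ring.
 - by apply: measurable_funTS; meas.
 - by move=> q _; rewrite lee_fin -/(m q) mulr_ge0// mulr_ge0 ?sqr_ge0.
have I0 : (0 <= I)%E by apply: integral_ge0 => q _; rewrite lee_fin mulr_ge0// mulr_ge0 ?sqr_ge0// le_max lexx.
move: FM I0; rewrite FI muleA -EFinM; case: (I) => [r||//] FM _; last first.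
 by move: FM; rewrite gt0_muley ?lte_fin// mulr_gt0 ?pi_gt0.
move: FM; rewrite !lee_fin ler_pdivlMr ?pi_gt0// -mulrA ler_pM2l; lra.
Qed.

Lemma int_vsq : (\int[leb]_(q in `]0%R, +oo[) (v q^2)%:E = (lam / pi)%:E)%E.
Proof.
have := v2; rewrite (@int_radial R (fun q => (v q^2)%:E)); [|by meas|by move=> q; rewrite lee_fin sqr_ge0].
move=> /(congr1 (fun z => (pi^-1)%:E * z)%E); rewrite muleA -EFinM mulVf ?gt_eqF ?pi_gt0// mul1e => ->.
by rewrite mulrC.
Qed.

(** Replaces [2 C], which depends on the bounds of [beta], by any lower bound [- K] of the
    integrand: the two inequalities differ by a multiple of the finite integral of [v^2]. *)
Theorem hardy_bound (K : R) : 0 <= K -> {ae leb, forall q, 0 < q -> good q} ->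
 (forall q, good q -> 0 < q -> - K <= beta q + q * dbeta q - q * beta q^2) ->
 (\int[leb]_(q in `]0%R, +oo[)
  (v q^2 * (Num.max (beta q + q * dbeta q - q * beta q^2) (- K) + K))%:E
 <= ((T / 4 + K * lam) / pi)%:E)%E.
Proof.
move=> K0 ae_good low; have C0 := hardy_const_ge0 : 0 <= C.
pose z q := beta q + q * dbeta q - q * beta q^2.
pose D : set R := `]0%R, +oo[%classic; have mD : measurable D by exact: measurable_itv.
pose h q : R := ind (good q) * (v q^2 * Num.max 0 (z q + 2 * C)).
pose l q : R := v q^2 * (Num.max (z q) (- K) + K).
have mz : mble z by rewrite /z; meas.
have mh : mble h by rewrite /h; meas.
have ml : mble l by rewrite /l; meas.
have mv2 : mble (fun q => v q^2) by meas.
have h0 q : 0 <= h q by rewrite mulr_ge0// mulr_ge0 ?sqr_ge0// le_max lexx.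
have l0 q : 0 <= l q by rewrite mulr_ge0 ?sqr_ge0// -lerBlDr sub0r le_max lexx orbT.
have mE (f : R -> R) : mble f -> measurable_fun D (fun q => (f q)%:E) by move=> mf; apply: measurable_funTS; exact: mfun_EFin.
have Zv c : 0 <= c -> (\int[leb]_(q in D) (c * v q^2)%:E = (c * (lam / pi))%:E)%E.
 move=> c0; rewrite EFinM -int_vsq -ge0_integralZl; [by []|isd|exact: mE| |isd].
 by pos.
have S (f : R -> R) c : 0 <= c -> mble f -> (forall q, 0 <= f q) ->
  (\int[leb]_(q in D) (f q + c * v q^2)%:E = \int[leb]_(q in D) (f q)%:E + (c * (lam / pi))%:E)%E.
 move=> c0 mf f0; rewrite -Zv// -ge0_integralD; [by []|isd| |exact: mE| |].
 - by pos.
 - by pos.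
 - by apply: mE; apply: mfun_mul.
have hH : (\int[leb]_(q in D) (h q)%:E <= ((T / 4 + 2 * C * lam) / pi)%:E)%E by exact: hardy.
have le : (\int[leb]_(q in D) (l q + 2 * C * v q^2)%:E <= \int[leb]_(q in D) (h q + K * v q^2)%:E)%E.
 apply: ae_ge0_le_integral; [exact: mD| | | | |].
 - by pos.
 - by apply: mE; apply: mfun_add => //; apply: mfun_mul.
 - by pos.
 - by apply: mE; apply: mfun_add => //; apply: mfun_mul.
 case: ae_good => A [mA A0 sA]; exists A; split => // q hq; apply: sA => /= gq; apply: hq.
 rewrite /D /= in_itv/= andbT => q0; have {}gq := gq q0; have := low q gq q0; rewrite -/(z q) => zK.
 rewrite lee_fin /l /h gq mul1r max_l// -[X in _ <= _ + X]mulrC -[X in _ + X <= _]mulrC -!mulrDr.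
 rewrite ler_wpM2l ?sqr_ge0//; have : z q + 2 * C <= Num.max 0 (z q + 2 * C) by rewrite le_max lexx orbT.
 lra.
rewrite S// ?mulr_ge0// S// in le.
have L0 : (0 <= \int[leb]_(q in D) (l q)%:E)%E by pos.
have H0 : (0 <= \int[leb]_(q in D) (h q)%:E)%E by pos.
change (\int[leb]_(q in D) (l q)%:E <= ((T / 4 + K * lam) / pi)%:E)%E.
move: le hH L0 H0; case: (\int[leb]_(q in D) (h q)%:E)%E => [a||//]; last by [].
case: (\int[leb]_(q in D) (l q)%:E)%E => [b||//]; last by [].
have E c : (T / 4 + c * lam) / pi = T / 4 / pi + c * (lam / pi) by lra.
by rewrite !lee_fin => h1 h2 _ _; lra.
Qed.

End Hardy.

Section HardyContinuous.
Variable R : realType.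
Local Notation leb := (@lebesgue_measure R).
Local Notation mu2 := (leb2 R).
Variables (v : R -> R) (lam T : R).
Hypotheses (mv : mble v) (v2 : (\int[mu2]_x (v (nsq x)^2)%:E = lam%:E)%E).
Hypothesis weighted : weighted_bound v lam T.

Lemma antideriv (beta : R -> R) : continuous beta ->
 exists psi : R -> R, forall q : R, 0 <= q -> derives q psi (beta q).
Proof.
(* The base point -1 puts every [q >= 0] in the interior of the domain of integration, so the
   derivative at 0 is two-sided. *)
move=> cb; exists (fun q => (\int[leb]_(t in `[-1, q]) beta t)%R) => q q0.
have i : leb.-integrable `[-1, (q + 1)] (EFin \o beta).
 apply: continuous_compact_integrable; first exact: segment_compact.
 exact: continuous_subspaceT.
have [||d e] := @continuous_FTC1_closed R beta (-1) q (q + 1) _ i _ (cb q).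
- by rewrite ltrDl.
- by lra.
exact: (DeriveDef d (etrans (esym (derive1E _ _)) e)).
Qed.

Lemma hardy_cont (beta dbeta : R -> R) (good : R -> bool) (B L K : R) :
 continuous beta -> mble dbeta -> mble good ->
 (forall q, 0 <= q -> 0 <= beta q) -> (forall q, 0 <= q -> beta q <= B) ->
 (forall q, 0 <= q -> beta q * sqrt q <= L) ->
 (forall p q, 0 <= p -> p <= q -> p * beta p <= q * beta q) ->
 (forall q : R, good q -> 0 < q -> derives q beta (dbeta q)) ->
 0 <= K -> {ae leb, forall q, 0 < q -> good q} ->
 (forall q, good q -> 0 < q -> - K <= beta q + q * dbeta q - q * beta q^2) ->
 (\int[leb]_(q in `]0%R, +oo[)
  (v q^2 * (Num.max (beta q + q * dbeta q - q * beta q^2) (- K) + K))%:E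
 <= ((T / 4 + K * lam) / pi)%:E)%E.
Proof.
move=> cb mdb mg b0 bB bL bm db K0 ae low.
have [psi dpsi] := antideriv cb.
have mb : mble beta by exact: continuous_measurable_fun.
exact: (hardy_bound dpsi mb mdb mg b0 bB bL bm db mv v2 weighted K0 ae low).
Qed.

Lemma is_der_local (f g : R -> R) (x d : R) (a b : R) : a < x -> x < b ->
 (forall y, a < y -> y < b -> f y = g y) -> derives x g d -> derives x f d.
Proof.
move=> ax xb fg; apply: near_eq_is_derive.
have : x \in `]a, b[ by rewrite in_itv/= ax.
move=> /near_in_itvoo; apply: filterS => y /=; rewrite in_itv/= => /andP[ay yb].
by rewrite fg.
Qed.

Lemma cont_maxr (a : R) : continuous (Num.max a).
Proof.
have -> : Num.max a = fun q : R => (a + q + `|a - q|) / 2 by apply/funext => q; rewrite maxr_absE.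
move=> q; apply: cvgM; last exact: cvg_cst.
apply: cvgD; first by apply: cvgD; [exact: cvg_cst|exact: cvg_id].
by apply: cvg_norm; apply: cvgB; [exact: cvg_cst|exact: cvg_id].
Qed.

(* The Hardy weight is [beta q = s / (q + s^2)] with [s^2 = a], for which
 [beta + q beta' - q beta^2 = s^2 (s - q) / (q + s^2)^2]. *)
Lemma mass_small (a : R) : 0 < a -> a <= 1 ->
 (\int[leb]_(q in `]0%R, +oo[) (v q^2 * ind (q < a)%R)%:E <= (sqrt a * (T + lam) / pi)%:E)%E.
Proof.
move=> a0 a1; pose s := sqrt a.
have s0 : 0 < s by rewrite sqrtr_gt0.
have sa : a = s^2 by rewrite sqr_sqrtr// ltW.
have s1 : s <= 1 by rewrite -sqrtr1 ler_wsqrtr.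
pose beta (q : R) : R := s / (`|q| + a); pose dbeta q : R := - (s / (q + a)^2).
have d0 (q : R) : 0 < `|q| + a by rewrite ltr_wpDl.
have bE q : 0 <= q -> beta q = s / (q + a) by move=> q0; rewrite /beta ger0_norm.
have XE q : 0 < q -> beta q + q * dbeta q - q * beta q^2 = a * (s - q) / (q + a)^2.
 move=> q0; have n0 : q + a != 0 by rewrite gt_eqF// addr_gt0.
 by rewrite bE ?(ltW q0)// /dbeta; move: n0; rewrite sa => n0; field.
have X_ge q : 0 < q -> - 4^-1 <= beta q + q * dbeta q - q * beta q^2.
 move=> q0; rewrite XE// ler_pdivlMr ?exprn_gt0 ?addr_gt0//.
 have := sqr_ge0 (q - a); have := mulr_gt0 a0 s0; have := mulr_gt0 a0 q0.
 by lra.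
(* On [q < a] the Hardy integrand, shifted by 1/4, is at least [1 / (4 s)]; the inequality therefore
   bounds the mass there by [s = sqrt a] times [T + lam]. *)
have X_small q : 0 < q -> q < a -> (4 * s)^-1 - 4^-1 <= beta q + q * dbeta q - q * beta q^2.
 move=> q0 qa; rewrite XE// ler_pdivlMr ?exprn_gt0 ?addr_gt0//.
 have -> : (4 * s)^-1 - 4^-1 = (1 - s) / (4 * s) by field; rewrite gt_eqF.
 rewrite mulrAC ler_pdivrMr ?mulr_gt0//.
 have h : (q + a)^2 <= 4 * a^2.
  have -> : 4 * a^2 = (a + a)^2 by lra.
  by rewrite lerXn2r ?nnegrE ?addr_ge0 ?(ltW a0) ?(ltW q0)// lerD2r ltW.
 apply: le_trans (ler_wpM2l _ h) _; first by rewrite subr_ge0.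
 have : 0 <= 4 * (a * s) * (a - q) by rewrite mulr_ge0 ?subr_ge0 ?(ltW qa)// mulr_ge0// mulr_ge0// ltW.
 by move=> k; rewrite -subr_ge0; move: k; congr (0 <= _); rewrite sa; ring.
have mono p q : 0 <= p -> p <= q -> p * beta p <= q * beta q.
 move=> p0 pq; have q0 := le_trans p0 pq; rewrite !bE// !mulrA.
 rewrite ler_pdivrMr ?ltr_wpDl// mulrAC ler_pdivlMr ?ltr_wpDl//.
 have : 0 <= s * a * (q - p) by rewrite mulr_ge0 ?subr_ge0// mulr_ge0// ltW.
 by lra.
have cb : continuous beta.
 move=> q; apply: cvgM; first exact: cvg_cst.
 apply: cvgV; first by rewrite gt_eqF.
 by apply: cvgD; [exact: norm_continuous|exact: cvg_cst].
have main := @hardy_cont beta dbeta xpredT s^-1 1 4^-1 cb.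
pose c := (4 * s)^-1.
have c0 : 0 < c by rewrite invr_gt0 mulr_gt0.
have le : (c%:E * \int[leb]_(q in `]0%R, +oo[) (v q^2 * ind (q < a)%R)%:E <=
  ((T / 4 + 4^-1 * lam) / pi)%:E)%E.
 apply: (@le_trans _ _ (\int[leb]_(q in `]0%R, +oo[)
  (v q^2 * (Num.max (beta q + q * dbeta q - q * beta q^2) (- 4^-1) + 4^-1))%:E)%E); last first.
  apply: main.
  - by rewrite /dbeta; meas.
  - by meas.
  - by move=> q _; rewrite divr_ge0 ?(ltW s0) ?(ltW (d0 q)).
  - move=> q q0; rewrite ler_pdivrMr// mulrC ler_pdivlMr// -expr2 -sa lerDr//.
  - move=> q q0; rewrite bE// mulrAC ler_pdivrMr ?ltr_wpDl// mul1r sa -{2}(sqr_sqrtr q0).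
   by have := sqr_ge0 (s - sqrt q); have := mulr_ge0 (ltW s0) (sqrtr_ge0 q); lra.
  - exact: mono.
  - move=> q _ q0; apply: (@is_der_local _ (fun y => s / (y + a)) _ _ 0 (q + 1)) => //.
   + by rewrite ltrDl.
   + by move=> y y0 _; rewrite bE// ltW.
   have nz : q + a != 0 by lra.
   have d1 : derives q (fun y : R => y + a) 1 by apply: is_derive_eq; rewrite addr0.
   apply: is_derive_eq; rewrite /dbeta /GRing.scale /=; by field.
  - by [].
  - by apply: aeW.
  - by move=> q _; exact: X_ge.
 rewrite -ge0_integralZl; [|isd|by apply: measurable_funTS; meas
  |isd|by rewrite lee_fin ltW].
 apply: ge0_le_integral; [by []| | | |].
 - by move=> q _; rewrite lee_fin mulr_ge0 ?(ltW c0)// mulr_ge0// sqr_ge0.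
 - by apply: measurable_funTS; meas.
 - have mb : mble beta by exact: continuous_measurable_fun.
  by apply: measurable_funTS; rewrite /dbeta; meas.
 move=> q; rewrite /= in_itv/= andbT => q0; rewrite lee_fin mulrCA ler_wpM2l ?sqr_ge0//.
 have := X_ge q q0; have := X_small q q0; move: (_ - q * _) => z.
 rewrite /c => h1 h2; rewrite max_l//; case: (ltP q a) h1 => [_ /(_ isT) h1|_ _].
  by rewrite mulr1 -lerBlDr.
 by rewrite mulr0 -lerBlDr sub0r.
have I0 : (0 <= \int[leb]_(q in `]0%R, +oo[) (v q^2 * ind (q < a)%R)%:E)%E by pos.
move: le I0; case: (\int[leb]_(q in _) _)%E => [r||//]; last by rewrite gt0_muley.
rewrite !lee_fin ler_pdivrMl ?mulr_gt0// => h _; apply: (le_trans h).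
rewrite -/s le_eqVlt; apply/orP; left; apply/eqP; rewrite mulrA; congr (_ / _); by field.
Qed.

End HardyContinuous.

(** * Weak derivatives and the modulus of continuity *)

Section SmoothLine.
Variable R : realType.
Implicit Types f g : R -> R.

(** An explicit chain of derivatives, so that sums, products and affine substitutions go by
    induction. Continuity of [f] itself takes [diffn 1]. *)
Fixpoint diffn (k : nat) f : Prop :=
 if k is k'.+1 then exists g, (forall x : R, derives x f (g x)) /\ diffn k' g else True.

Lemma diffnW k f : diffn k.+1 f -> diffn k f.
Proof.
elim: k f => [//|k IH] f [g [fg h]]; exists g; split => //.
by apply: IH.
Qed.

Lemma diffn0 k : diffn k (fun=> 0).
Proof.
elim: k => // k IH; exists (fun=> 0); split => // x; exact: is_derive_cst.
Qed.

Lemma diffnD k f g : diffn k f -> diffn k g -> diffn k (fun x => f x + g x).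
Proof.
elim: k f g => [//|k IH] f g [f' [df hf]] [g' [dg hg]].
exists (fun x => f' x + g' x); split; last exact: IH.
by move=> x; apply: is_deriveD.
Qed.

Lemma diffnM k f g : diffn k f -> diffn k g -> diffn k (fun x => f x * g x).
Proof.
elim: k f g => [//|k IH] f g hf0 hg0.
have hf1 := diffnW hf0; have hg1 := diffnW hg0.
case: hf0 hg0 => f' [df hf] [g' [dg hg]].
exists (fun x => f x * g' x + g x * f' x); split; last by apply: diffnD; exact: IH.
by move=> x; have := is_deriveM (df x) (dg x).
Qed.

Lemma diffn_cst k (c : R) : diffn k (fun=> c).
Proof.
case: k => // k; exists (fun=> 0); split; last exact: diffn0.
by move=> x; exact: is_derive_cst.
Qed.

Lemma diffn_affine k f (c d : R) : diffn k f -> diffn k (fun x => f (c * x + d)).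
Proof.
elim: k f => [//|k IH] f [f' [df hf]].
exists (fun x => c * f' (c * x + d)); split.
 move=> x; rewrite mulrC; apply: (@is_derive1_comp R f (fun x => c * x + d)) => //.
 by apply: is_derive_eq; rewrite /GRing.scale /=; ring.
by apply: diffnM; [exact: diffn_cst|exact: IH].
Qed.

Lemma diffn_cont k f : diffn k.+1 f -> continuous f.
Proof. by move=> [g [fg _]] x; exact: is_der1_cont (fg x). Qed.

(** The derivative of each member of this family is a combination of two others, so smoothness of
    the whole family follows by induction. *)
Definition flat (k : nat) (x : R) : R := if 0 < x then x^-1 ^+ k * expR (- x^-1) else 0.

Lemma flat_pow (n : nat) (y : R) : 0 < y -> y ^+ n * expR (- y) <= n.+1%:R ^+ n.
Proof.
move=> y0; rewrite expRN ler_pdivrMr ?expR_gt0//.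
have -> : expR y = expR (y / n.+1%:R) ^+ n.+1 by rewrite -expRM_natl mulrC divfK//.
have h : y / n.+1%:R <= expR (y / n.+1%:R) by apply: le_trans (expR_ge1Dx _); rewrite lerDr.
have h1 : 1 <= expR (y / n.+1%:R) by rewrite -[X in X <= _]expR0 ler_expR divr_ge0// ltW.
rewrite -[y in y ^+ n](@divfK _ n.+1%:R)// exprMn mulrC.
rewrite ler_wpM2l// exprSr.
apply: (@le_trans _ _ (expR (y / n.+1%:R) ^+ n)); last by rewrite ler_peMr//.
by rewrite lerXn2r ?nnegrE// divr_ge0// ltW.
Qed.

(** Quadratic vanishing at 0, which gives the derivative 0 there; it is [flat_pow] with two extra
    powers of [1 / x]. *)
Lemma flat_bound k (x : R) : `|flat k x| <= (k.+3%:R ^+ k.+2) * x^2.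
Proof.
rewrite /flat; case: ifPn => x0; last by rewrite normr0 mulr_ge0 ?sqr_ge0.
have y0 : 0 < x^-1 by rewrite invr_gt0.
rewrite ger0_norm; last by rewrite mulr_ge0 ?expR_ge0 ?exprn_ge0 ?ltW.
have := flat_pow k.+2 y0; rewrite -(ler_pM2r (exprn_gt0 2 x0)).
have -> : x^-1 ^+ k.+2 * expR (- x^-1) * x^2 = x^-1 ^+ k * expR (- x^-1) by rewrite 2!exprS; field; rewrite gt_eqF.
by [].
Qed.

Lemma is_der_flat k (x : R) : derives x (flat k) (- k%:R * flat k.+1 x + flat k.+2 x).
Proof.
have [x0|x0|->] := ltgtP x 0.
- rewrite /flat !ltNge !(ltW x0)/= mulr0 addr0.
 apply: (@is_der_local R _ (cst 0) _ _ (x - 1) 0) => //; first by rewrite ltrBlDr ltrDl.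
 by move=> y _ y0; rewrite ltNge (ltW y0).
- rewrite /flat x0.
 apply: (@is_der_local R _ (fun y => y^-1 ^+ k * expR (- y^-1)) _ _ 0 (x + 1)) => //.
 + by rewrite ltrDl.
 + by move=> y y0 _; rewrite y0.
 have xn : x != 0 by lra.
 have d1 : derives x (fun y : R => y^-1) (- x ^- 2).
  have := @is_deriveV R id x _ _ xn (is_derive_id x (1 : R)).
  by move=> h; apply: (@is_derive_eq _ _ _ _ _ _ _ _ h); rewrite /GRing.scale /= mulr1.
 have d2 : derives x (fun y : R => y^-1 ^+ k) (k%:R * x^-1 ^+ k.-1 * - x ^- 2).
  have -> : (fun y : R => y^-1 ^+ k) = (fun y : R => y^-1) ^+ k by rewrite exprfctE.
  by apply: is_derive_eq.
 have d3 : derives x (fun y : R => expR (- y^-1)) (expR (- x^-1) * x ^- 2).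
  have dN : derives x (fun y : R => - y^-1) (x ^- 2) by apply: is_derive_eq; rewrite opprK.
  exact: (@is_derive1_comp R expR _ x _ _ (is_derive_expR _) dN).
 have := is_deriveM d2 d3.
 move=> h; apply: (@is_derive_eq _ _ _ _ _ _ _ _ h); rewrite /GRing.scale /=.
 rewrite -!exprVn; case: (k) => [|j] /=; first by rewrite !expr0; ring.
 by rewrite !exprS; ring.
have F0 j : flat j 0 = 0 by rewrite /flat ltxx.
rewrite !F0 mulr0 addr0.
have lim : (h^-1 *: ((flat k \o shift 0) (h *: (1 : R)) - flat k 0)) @[h --> (0 : R)^'] --> (0 : R).
 apply/cvgrPdist_le => e e0.
 pose M : R := k.+3%:R ^+ k.+2; have M0 : 0 < M by rewrite exprn_gt0.
 have eM : 0 < e / M by rewrite divr_gt0.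
 apply/nbhs_ballP; exists (e / M) => //= h; rewrite /ball /= !sub0r !normrN => hd h0.
 rewrite F0 subr0 /GRing.scale /= mulr1 addr0 normrM normfV.
 have hp : 0 < `|h| by rewrite normr_gt0.
 rewrite ler_pdivrMl//; apply: (le_trans (flat_bound k h)).
 rewrite -[h^2]real_normK ?num_real// -/M mulrA [leRHS]mulrC ler_wpM2r// mulrC.
 by rewrite -ler_pdivlMr// ltW.
by apply: DeriveDef; [exact: (cvgP _ lim)|exact: (cvg_lim (@Rhausdorff R) lim)].
Qed.

Lemma diffn_flat n k : diffn n (flat k).
Proof.
elim: n k => [//|n IH] k.
exists (fun x => - k%:R * flat k.+1 x + flat k.+2 x); split; first exact: is_der_flat.
by apply: diffnD => //; apply: diffnM => //; exact: diffn_cst.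
Qed.

(** Smooth functions with values in [[0, 1]] that converge, as [n] grows, to the indicator of the
    open interval; products of two of them approximate rectangles. *)
Definition bump (a b : R) (n : nat) (x : R) : R :=
 flat 0 (n.+1%:R * (x - a)) * flat 0 (n.+1%:R * (b - x)).

Lemma diffn_bump a b n k : diffn k (bump a b n).
Proof.
rewrite (_ : bump a b n = fun x => flat 0 (n.+1%:R * x + - (n.+1%:R * a)) * flat 0 (- n.+1%:R * x + n.+1%:R * b)).
 by apply: diffnM; apply: (diffn_affine _ _ (diffn_flat _ _)).
by apply/funext => x; congr (flat 0 _ * flat 0 _); ring.
Qed.

Lemma flat_ge0 k (x : R) : 0 <= flat k x.
Proof.
rewrite /flat; case: ifPn => // x0.
by rewrite mulr_ge0// exprn_ge0// invr_ge0 ltW.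
Qed.

Lemma flat0_le1 (x : R) : flat 0 x <= 1.
Proof.
rewrite /flat; case: ifPn => // x0.
by rewrite mul1r -[X in _ <= X]expR0 ler_expR oppr_le0 invr_ge0 ltW.
Qed.

Lemma bump_ge0 a b n x : 0 <= bump a b n x.
Proof. by rewrite mulr_ge0// flat_ge0. Qed.

Lemma bump_le1 a b n x : bump a b n x <= 1.
Proof. by rewrite mulr_ile1 ?flat_ge0 ?flat0_le1. Qed.

Lemma bump_supp a b n x : bump a b n x != 0 -> a <= x <= b.
Proof.
rewrite /bump /flat -subr_ge0 -[x <= b]subr_ge0; rewrite !pmulr_rgt0//.
case: ltP => [h|_]; last by rewrite mul0r eqxx.
by case: ltP => [h'|_]; [rewrite !ltW|rewrite mulr0 eqxx].
Qed.

Lemma flat_cvg (y : R) : flat 0 (n.+1%:R * y) @[n --> \oo] --> (ind (0 < y) : R).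
Proof.
rewrite /flat; case: (ltP 0 y) => y0; last first.
 by under eq_fun do rewrite pmulr_rgt0 ?ltr0n// ltNge y0/=; exact: cvg_cst.
under eq_fun do rewrite mulr_gt0 ?ltr0n// expr0 mul1r invfM.
suff : expR (- (n.+1%:R^-1 * y^-1)) @[n --> \oo] --> expR (- (0 * y^-1)) by rewrite mul0r oppr0 expR0.
apply: continuous_cvg; first exact: continuous_expR.
by apply: cvgN; apply: cvgMl; exact: cvg_harmonic.
Qed.

Lemma bump_cvg a b x : bump a b n x @[n --> \oo] --> (ind ((a < x) && (x < b)) : R).
Proof.
rewrite -mulnb natrM -(subr_gt0 a) -(subr_gt0 x b).
by apply: cvgM; exact: flat_cvg.
Qed.

End SmoothLine.

Section TestFunctions.
Variable R : realType.
Local Notation plane := (plane R).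
Implicit Types (a b : R -> R) (x : plane).

Definition tens a b x : R := a x.1 * b x.2.

Lemma is_der_tens1 a b x (d : R) : is_derive x.1 (1 : R) a d ->
 is_derive x (evec R false) (tens a b) (d * b x.2).
Proof.
move=> [da dE].
have lim : h^-1 *: ((tens a b \o shift x) (h *: evec R false) - tens a b x) @[h --> (0 : R)^'] --> d * b x.2.
 have -> : (fun h : R => h^-1 *: ((tens a b \o shift x) (h *: evec R false) - tens a b x)) =
   fun h => (h^-1 *: ((a \o shift x.1) (h *: (1 : R)) - a x.1)) * b x.2.
  apply/funext => h; rewrite /tens /= /GRing.scale /= mulr0 add0r; ring.
 apply: cvgM; last exact: cvg_cst.
 by rewrite -dE.
by apply: DeriveDef; [exact: (cvgP _ lim)|exact: (cvg_lim (@Rhausdorff R) lim)].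
Qed.

Lemma is_der_tens2 a b x (d : R) : is_derive x.2 (1 : R) b d ->
 is_derive x (evec R true) (tens a b) (a x.1 * d).
Proof.
move=> [db dE].
have lim : h^-1 *: ((tens a b \o shift x) (h *: evec R true) - tens a b x) @[h --> (0 : R)^'] --> a x.1 * d.
 have -> : (fun h : R => h^-1 *: ((tens a b \o shift x) (h *: evec R true) - tens a b x)) =
   fun h => a x.1 * (h^-1 *: ((b \o shift x.2) (h *: (1 : R)) - b x.2)).
  apply/funext => h; rewrite /tens /= /GRing.scale /= mulr0 add0r; ring.
 apply: cvgM; first exact: cvg_cst.
 by rewrite -dE.
by apply: DeriveDef; [exact: (cvgP _ lim)|exact: (cvg_lim (@Rhausdorff R) lim)].
Qed.

Lemma partial_tens1 a a' b : (forall x : R, derives x a (a' x)) ->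
 partial false (tens a b) = tens a' b.
Proof.
move=> h; apply/funext => x; have hx := is_der_tens1 b (h x.1).
by rewrite /partial derive_val.
Qed.

Lemma partial_tens2 a b b' : (forall x : R, derives x b (b' x)) ->
 partial true (tens a b) = tens a b'.
Proof.
move=> h; apply/funext => x; have hx := is_der_tens2 a (h x.2).
by rewrite /partial derive_val.
Qed.

(** Every iterated partial derivative of a tensor product is again one, so smoothness in the plane
    reduces to smoothness of the factors. *)
Lemma ipartial_tens a b (s : seq bool) : (forall k, diffn k a) -> (forall k, diffn k b) ->
 forall k, exists a' b', [/\ diffn k a', diffn k b' & ipartial s (tens a b) = tens a' b'].
Proof.
move=> ha hb; elim: s => [|c s IH] k; first by exists a, b.
have [a' [b' [ha' hb' E]]] := IH k.+1.
rewrite /= E; case: c.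
 have [b'' [db hb'']] := hb'; exists a', b''; split => //; first exact: diffnW.
 exact: partial_tens2.
have [a'' [da ha'']] := ha'; exists a'', b'; split => //; first exact: diffnW.
exact: partial_tens1.
Qed.

Lemma cont_tens a b : continuous a -> continuous b -> continuous (tens a b).
Proof.
move=> ca cb x; apply: cvgM.
 by apply: (@continuous_comp _ _ _ fst a); [exact: cvg_fst|exact: ca].
by apply: (@continuous_comp _ _ _ snd b); [exact: cvg_snd|exact: cb].
Qed.

Lemma test_fun_tens a b (l r : R) : (forall k, diffn k a) -> (forall k, diffn k b) ->
 (forall x : R, a x != 0 -> l <= x <= r) -> (forall x : R, b x != 0 -> l <= x <= r) ->
 test_fun (tens a b).
Proof.
move=> ha hb sa sb; split.
 move=> k s _; have [a' [b' [da db ->]]] := ipartial_tens s ha hb 1; split.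
  by apply: cont_tens; [exact: diffn_cont da|exact: diffn_cont db].
 move=> _ c x; case: c.
  by have [b'' [hb'' _]] := db; have h := is_der_tens2 a' (hb'' x.2).
 by have [a'' [ha'' _]] := da; have h := is_der_tens1 b' (ha'' x.1).
have cB : compact (`[l, r]%classic `*` `[l, r]%classic : set plane) by apply: compact_setX; exact: segment_compact.
apply: (subclosed_compact _ cB); first exact: closed_closure.
have clB : closed (`[l, r]%classic `*` `[l, r]%classic : set plane) by apply: compact_closed => //.
have sub : [set x | tens a b x != 0] `<=` (`[l, r]%classic `*` `[l, r]%classic : set plane) by move=> x /=; rewrite mulf_eq0 negb_or => /andP[/sa h1 /sb h2].
by rewrite ((closure_id _).1 clB); exact: closure_subset.
Qed.

End TestFunctions.

Section DuBoisReymond.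
Variable R : realType.
Local Notation mu2 := (leb2 R).
Local Notation plane := (plane R).
Implicit Types x : plane.

Definition rect (l r l' r' : R) x : bool := [&& l < x.1, x.1 < r, l' < x.2 & x.2 < r'].

Definition rects : set (set plane) :=
 [set A | exists l r l' r', A = [set x | rect l r l' r' x]].

Lemma mfun_rect l r l' r' : mble (rect l r l' r').
Proof. by rewrite /rect; meas. Qed.

Lemma meas_bool {d} {T : measurableType d} (b : T -> bool) :
 mble b -> measurable [set x | b x].
Proof.
move=> mb; rewrite (_ : [set x | b x] = setT `&` b @^-1` [set true]); first exact: mb.
by apply/seteqP; split=> x /=; [move=> ->|case].
Qed.

Lemma rects_generate : @measurable _ (measurableTypeR R * measurableTypeR R)%type = <<s rects >>.
Proof.
rewrite eqEsubset; split; last first.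
 apply: smallest_sub; first exact: sigma_algebra_measurable.
 by move=> _ [l [r [l' [r' ->]]]]; apply: meas_bool; exact: mfun_rect.
apply: smallest_sub; first exact: smallest_sigma_algebra.
have big (P : plane -> Prop) (r : nat -> plane -> bool) :
  (forall n, rects [set x | r n x]) -> (forall x, P x <-> exists n, r n x) -> <<s rects >> [set x | P x].
 move=> hr hP; rewrite (_ : [set x | P x] = \bigcup_n [set x | r n x]).
  have := @bigcup_measurable _ (g_sigma_algebraType rects) (fun n => [set x | r n x]) setT.
  by apply => n _; apply: sub_sigma_algebra.
 by apply/seteqP; split=> x /=; [move=> /hP[n]; exists n|move=> [n _ h]; apply/hP; exists n].
have arch (y z w : R) : exists n : nat, [/\ y < n%:R, - n%:R < z & z < n%:R] /\ w < n%:R.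
 have h := archi_boundP (addr_ge0 (addr_ge0 (normr_ge0 y) (normr_ge0 z)) (normr_ge0 w)).
 exists (Num.bound (`|y| + `|z| + `|w|)); move: h; set b := _%:R => h.
 have := ler_norm y; have := ler_norm z; have := ler_norm (- z); have := ler_norm w.
 rewrite normrN; have := normr_ge0 y; have := normr_ge0 z; have := normr_ge0 w.
 by split; [split|]; lra.
have m1 : mble (fst : g_sigma_algebraType rects -> measurableTypeR R).
 apply: (measurability _ (RGenOInfty.measurableE R)) => _ [_ [a ->] <-]; rewrite setTI.
 rewrite (_ : fst @^-1` `]a, +oo[ = [set x : plane | a < x.1]); last first.
  by apply/seteqP; split=> x /=; rewrite in_itv/= andbT.
 apply: (big _ (fun n => rect a n%:R (- n%:R) n%:R)); first by move=> n; do 4 eexists.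
 move=> x; split=> [ax|[n /and4P[]]//].
 by have [n [[h1 h2 h3] _]] := arch x.1 x.2 0; exists n; apply/and4P.
have m2 : mble (snd : g_sigma_algebraType rects -> measurableTypeR R).
 apply: (measurability _ (RGenOInfty.measurableE R)) => _ [_ [a ->] <-]; rewrite setTI.
 rewrite (_ : snd @^-1` `]a, +oo[ = [set x : plane | a < x.2]); last first.
  by apply/seteqP; split=> x /=; rewrite in_itv/= andbT.
 apply: (big _ (fun n => rect (- n%:R) n%:R a n%:R)); first by move=> n; do 4 eexists.
 move=> x; split=> [ax|[n /and4P[]]//].
 by have [n [[h1 h2 h3] _]] := arch x.2 x.1 0; exists n; apply/and4P.
rewrite subUset; split => _ [A mA <-]; rewrite setTI.
 by have := m1 measurableT A mA; rewrite setTI.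
by have := m2 measurableT A mA; rewrite setTI.
Qed.

Lemma rectI l r l' r' k s k' s' x :
 rect l r l' r' x && rect k s k' s' x =
 rect (Num.max l k) (Num.min r s) (Num.max l' k') (Num.min r' s') x.
Proof.
rewrite /rect !gt_max !lt_min.
lra.
Qed.

(** Open rectangles are stable under intersection and generate the measurable sets, so a Dynkin
    argument extends the vanishing of the integral to all measurable sets. It is run inside a box,
    where [D] is integrable. *)
Lemma du_bois_reymond (D : plane -> R) : mble D ->
 (forall l r l' r', mu2.-integrable setT (fun x => (D x * ind (rect l r l' r' x))%:E)) ->
 (forall l r l' r', (\int[mu2]_x (D x * ind (rect l r l' r' x))%:E = 0)%E) ->
 {ae mu2, forall x, D x = 0}.
Proof.
move=> mD iD zD.
pose box (N : nat) x := rect (- N%:R) N%:R (- N%:R) N%:R x.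
suff h N : {ae mu2, forall x, D x * ind (box N x) = 0}.
 have : {ae mu2, forall x N, D x * ind (box N x) = 0} by apply/ae_foralln.
 case=> A [mA A0 sA]; exists A; split => // x Dx; apply: sA => h0; apply: Dx.
 have b := archi_boundP (addr_ge0 (normr_ge0 x.1) (normr_ge0 x.2)).
 have := h0 (Num.bound (`|x.1| + `|x.2|)); rewrite /box /rect; move: b; set N := _%:R => b E.
 have := ler_norm x.1; have := ler_norm (- x.1); have := ler_norm x.2; have := ler_norm (- x.2).
 rewrite !normrN; have := normr_ge0 x.1; have := normr_ge0 x.2 => *.
 have hr : [&& - N < x.1, x.1 < N, - N < x.2 & x.2 < N] by apply/and4P; split; lra.
 by move: E; rewrite hr mulr1.
pose DN x := D x * ind (box N x).
have mDN : mble DN by rewrite /DN; meas.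
have iN : mu2.-integrable setT (fun x => (DN x)%:E) by exact: iD.
have key A : measurable A -> (\int[mu2]_(x in A) (DN x)%:E = 0)%E.
 rewrite rects_generate; apply: (@dynkin_induction _ (measurableTypeR R * measurableTypeR R)%type rects
  (fun A => (\int[mu2]_(x in A) (DN x)%:E = 0)%E)) => //.
 - exact: rects_generate.
 - move=> _ _ [l [r [l' [r' ->]]]] [k [s [k' [s' ->]]]].
  exists (Num.max l k), (Num.min r s), (Num.max l' k'), (Num.min r' s').
  by apply/seteqP; split=> x /=; rewrite -rectI => /andP.
 - exact: zD.
 - move=> _ [l [r [l' [r' ->]]]].
  rewrite integral_mkcond -[RHS](zD (Num.max l (- N%:R)) (Num.min r N%:R) (Num.max l' (- N%:R)) (Num.min r' N%:R)).
  apply: eq_integral => x _; rewrite patchE -rectI /DN /box.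
  case: (boolP (rect l r l' r' x)) => hx; first by rewrite mem_set.
  by rewrite memNset ?mulr0//=; exact/negP.
 - move=> S mS S0; have := zD (- N%:R) N%:R (- N%:R) N%:R.
  rewrite -(setUv S) integral_setU; rewrite ?S0 ?add0e//.
  + exact: measurableC.
  + by rewrite setUv; exact: mfun_EFin.
  + by rewrite disj_set2E setICr.
 - move=> F mF tF F0; rewrite integral_bigcup//.
   by rewrite eseries0// => n _ _.
  by apply: integrableS iN => //; exact: bigcup_measurable.
have := @integral_ae_eq _ _ _ mu2 setT measurableT (fun=> 0%E) (fun x => (DN x)%:E) iN (measurable_cst _).
move=> /(_ _)[|A [mA A0 sA]]; first by move=> E _ mE; rewrite integral0; exact: key.
exists A; split => // x Dx; apply: sA => h0; apply: Dx.
by have [] := h0 I.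
Qed.

End DuBoisReymond.

Section Integrability.
Context {d} {T : measurableType d} {R : realType} (mu : {measure set T -> \bar R}).

Lemma intble_le (f g : T -> R) : mble f -> mble g ->
 (forall x, `|f x| <= g x) -> (\int[mu]_x (g x)%:E < +oo)%E ->
 mu.-integrable setT (fun x => (f x)%:E).
Proof.
move=> mf mg fg goo; apply/integrableP; split; first exact: mfun_EFin.
apply: le_lt_trans goo; apply: ge0_le_integral => //.
- by apply: mfun_EFin; exact: mfun_norm.
- exact: mfun_EFin.
- by pos.
Qed.

Lemma int_sub_eq0 (f g : T -> R) : mu.-integrable setT (fun x => (f x)%:E) ->
 mu.-integrable setT (fun x => (g x)%:E) ->
 (\int[mu]_x (f x)%:E = \int[mu]_x (g x)%:E)%E -> (\int[mu]_x (f x - g x)%:E = 0)%E.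
Proof.
move=> hf hg E.
have := @integralB_EFin _ _ _ mu setT f g measurableT hf hg.
under eq_integral do rewrite -EFinB.
by rewrite E subee// integrable_fin_num.
Qed.

Lemma int_lin (f g : T -> R) (c e : R) : mu.-integrable setT (fun x => (f x)%:E) ->
 mu.-integrable setT (fun x => (g x)%:E) ->
 (\int[mu]_x (c * f x + e * g x)%:E = (c * Rintegral mu setT f + e * Rintegral mu setT g)%:E)%E.
Proof.
move=> hf hg.
have i1 : mu.-integrable setT (EFin \o (fun y => c * f y)) by exact: (integrableZl measurableT c hf).
have i2 : mu.-integrable setT (EFin \o (fun y => e * g y)) by exact: (integrableZl measurableT e hg).
apply: (etrans (integralD_EFin measurableT i1 i2)).
rewrite EFinD; congr (_ + _)%E.
 rewrite -(RintegralZl c measurableT hf) fineK//; exact: integrable_fin_num.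
rewrite -(RintegralZl e measurableT hg) fineK//; exact: integrable_fin_num.
Qed.

Lemma int_RintE (f : T -> R) : mu.-integrable setT (fun x => (f x)%:E) ->
 (\int[mu]_x (f x)%:E = (Rintegral mu setT f)%:E)%E.
Proof. by move=> hf; rewrite fineK// integrable_fin_num. Qed.

End Integrability.

Section LineFTC.
Variable R : realType.
Local Notation leb := (@lebesgue_measure R).

Lemma ftc_line (F f : R -> R) (a b : R) : a < b ->
 (forall x : R, derives x F (f x)) -> continuous f ->
 (\int[leb]_(x in `[a, b]) (f x)%:E = (F b - F a)%:E)%E.
Proof.
move=> ab dF cf; rewrite EFinB; apply: continuous_FTC2 => //.
- exact: continuous_subspaceT.
- split.
 + by [].
 + by apply: cvg_at_right_filter; exact: is_der1_cont (dF a).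
 + by apply: cvg_at_left_filter; exact: is_der1_cont (dF b).
- by move=> x _; rewrite derive1E derive_val.
Qed.

Lemma int_unit (f : R -> R) :
 (\int[leb]_t (ind ((0 <= t) && (t <= 1)) * f t)%:E = \int[leb]_(t in `[0%R, 1%R]) (f t)%:E)%E.
Proof.
rewrite [RHS]integral_mkcond; apply: eq_integral => t _.
rewrite patchE mem_setE in_itv/=; case: (_ && _); by rewrite ?mul1r ?mul0r.
Qed.

Lemma unit_mass : (\int[leb]_t (ind ((0 <= t) && (t <= 1)))%:E = 1)%E.
Proof.
under eq_integral do rewrite -[X in X%:E]mulr1.
rewrite (int_unit (fun=> 1)) integral_cst//= mul1e lebesgue_measure_itv/= lte_fin ltr01.
by rewrite oppr0 adde0.
Qed.

Lemma diffn_bounded (f : R -> R) (l r : R) : continuous f -> (forall x, f x != 0 -> l <= x <= r) ->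
 exists2 M, 0 <= M & forall x, `|f x| <= M.
Proof.
move=> cf sf.
have := @continuous_compact _ _ f `[l, r]%classic (continuous_subspaceT cf) (@segment_compact R l r).
move=> /compact_bounded[M [_ hM]].
exists (`|M| + 1); first by rewrite addr_ge0.
move=> x; have [->|fx] := eqVneq (f x) 0; first by rewrite normr0.
have M1 : M < `|M| + 1 by rewrite (le_lt_trans (ler_norm M))// ltrDl.
by apply: (hM _ M1) => /=; exists x => //; rewrite in_itv/= sf.
Qed.

End LineFTC.

Section Pairing.
Variable R : realType.
Local Notation mu2 := (leb2 R).
Local Notation plane := (plane R).
Implicit Types (x y : plane) (f phi : plane -> R).

Lemma rect_mass_fin l r l' r' : (mass (rect l r l' r') < +oo :> \bar R)%E.
Proof.
have q0 : 0 <= (`|l| + `|r|)^2 + (`|l'| + `|r'|)^2 + 1 :> R by [].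
apply: le_lt_trans (ltry (pi * ((`|l| + `|r|)^2 + (`|l'| + `|r'|)^2 + 1))).
rewrite -mass_disc//; apply: le_int_real; try by rewrite /disc /rect; meas.
move=> x; have [/and4P[h1 h2 h3 h4]|_] := boolP (rect l r l' r' x); last exact: ler0n.
have key (a b c : R) : a < c -> c < b -> c^2 <= (`|a| + `|b|)^2.
 move=> ac cb; have := ler_norm (- a); have := ler_norm b; rewrite normrN.
 have := normr_ge0 a; have := normr_ge0 b => *.
 by rewrite -(real_normK (num_real c)) ler_pXn2r ?nnegrE// ler_norml; lra.
have -> // : disc ((`|l| + `|r|)^2 + (`|l'| + `|r'|)^2 + 1) x by rewrite /disc /nsq; have := key _ _ _ h1 h2; have := key _ _ _ h3 h4; lra.
Qed.

Lemma int_fin_comb (f g : plane -> R) (c : R) : mble f -> mble g ->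
 (forall x, 0 <= f x) -> (forall x, 0 <= g x) -> 0 <= c ->
 (\int[mu2]_x (f x)%:E < +oo)%E -> (\int[mu2]_x (g x)%:E < +oo)%E ->
 (\int[mu2]_x (f x + c * g x)%:E < +oo)%E.
Proof.
move=> mf mg f0 g0 c0 hf hg.
have -> : (\int[mu2]_x (f x + c * g x)%:E = \int[mu2]_x (f x)%:E + c%:E * \int[mu2]_x (g x)%:E)%E.
 rewrite -ge0_integralZl; [|isd..].
 rewrite -ge0_integralD; [by []|isd|isd|isd|by move=> x _; rewrite -EFinM lee_fin mulr_ge0|by apply: mfun_emul => //; exact: mfun_EFin].
by rewrite lte_add_pinfty// lte_mul_pinfty//.
Qed.

Lemma pairing_intble f phi (M l r : R) : mble f -> mble phi ->
 (\int[mu2]_x (f x^2)%:E < +oo)%E -> (forall x, `|phi x| <= M * ind (rect l r l r x)) ->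
 mu2.-integrable setT (fun x => (f x * phi x)%:E).
Proof.
move=> mf mphi f2 hphi; have mr := @mfun_rect R l r l r.
apply: (@intble_le _ _ R mu2 _ (fun x => f x^2 + M^2 * ind (rect l r l r x))).
- by meas.
- by meas.
- move=> x; rewrite normrM; have := hphi x; have := normr_ge0 (phi x); have := normr_ge0 (f x).
 have := sqr_ge0 (`|f x| - `|phi x|); rewrite -[f x^2]real_normK ?num_real//.
 move: (`|f x|) (`|phi x|) => p q; case: (rect _ _ _ _ _) => /=; rewrite ?mulr1 => *; nra.
- apply: int_fin_comb => //; try by meas.
 + by pos.
 + exact: sqr_ge0.
 + exact: rect_mass_fin.
Qed.

Lemma int_shift_signed (h : plane) (f : plane -> R) : mble f ->
 (\int[mu2]_z (f (z.1 + h.1, z.2 + h.2)%R)%:E = \int[mu2]_z (f z)%:E)%E.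
Proof.
move=> mf; rewrite integralE [RHS]integralE.
have := @int_plane_shift R h (fun z => (fun x => (f x)%:E)^\+ z)%E.
have := @int_plane_shift R h (fun z => (fun x => (f x)%:E)^\- z)%E.
move=> <-; first move=> <-.
- by congr (_ - _)%E; apply: eq_integral => x _; rewrite ?funeposE ?funenegE.
- by apply: measurable_funepos; exact: mfun_EFin.
- by [].
- by apply: measurable_funeneg; exact: mfun_EFin.
- by [].
Qed.

Lemma sqr_shift_fin (h : plane) f : mble f -> (\int[mu2]_x (f x^2)%:E < +oo)%E ->
 (\int[mu2]_x (f (x.1 + h.1, x.2 + h.2)%R^2)%:E < +oo)%E.
Proof.
by move=> mf hf; rewrite (@int_shift_signed h (fun x => f x^2))//; meas.
Qed.

End Pairing.

(** * Translates of a function with square integrable weak gradient *)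

Section WeakTranslation.
Variable R : realType.
Local Notation leb := (@lebesgue_measure R).
Local Notation mu2 := (leb2 R).
Local Notation plane := (plane R).
Implicit Types (x y : plane) (t : R).
Variables (v g1 g2 : plane -> R).
Hypotheses (mv : mble v) (mg1 : mble g1) (mg2 : mble g2).
Hypotheses (v2 : (\int[mu2]_x (v x^2)%:E < +oo)%E) (g12 : (\int[mu2]_x (g1 x^2)%:E < +oo)%E)
 (g22 : (\int[mu2]_x (g2 x^2)%:E < +oo)%E).
Hypotheses (w1 : weak_partial false v g1) (w2 : weak_partial true v g2).
Variable h : plane.

Let G x := h.1 * g1 x + h.2 * g2 x.
Let tt t : R := ind ((0 <= t) && (t <= 1)).
Let sh x t : plane := (x.1 + t * h.1, x.2 + t * h.2).

Let mG : mble G. by rewrite /G; meas. Qed.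
Let mtt : mble tt. by rewrite /tt; meas. Qed.
Let G2 : (\int[mu2]_x (G x^2)%:E < +oo)%E.
apply: (@le_lt_trans _ _ (\int[mu2]_x (0 + (2 * h.1^2) * g1 x^2 + (2 * h.2^2) * g2 x^2)%R%:E)%E).
 apply: le_int_real; try by rewrite /G; meas.
  by pos.
 move=> x; rewrite /G; have := sqr_ge0 (h.1 * g1 x - h.2 * g2 x); lra.
apply: int_fin_comb => //; try by meas.
- by pos.
- by pos.
- by pos.
apply: int_fin_comb => //; try by meas.
- by pos.
- by pos.
- by rewrite integral0.
Qed.

Section Test.
Variables (a b : R -> R) (l r : R).
Hypotheses (ha : forall k, diffn k a) (hb : forall k, diffn k b).
Hypotheses (sa : forall s, a s != 0 -> l <= s <= r) (sb : forall s, b s != 0 -> l <= s <= r).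

Let phi := tens a b.

Let Lo := l - `|h.1| - `|h.2| - 1.
Let Hi := r + `|h.1| + `|h.2| + 1.
Let box y := rect Lo Hi Lo Hi y.

Lemma deriv_support (c c' : R -> R) : (forall s : R, derives s c (c' s)) ->
 (forall s, c s != 0 -> l <= s <= r) -> forall s, c' s != 0 -> l <= s <= r.
Proof.
move=> dc sc s; apply: contraNT => hs.
have c0 (p q : R) : p < s -> s < q -> (forall y : R, p < y -> y < q -> ~~ (l <= y <= r)) -> c' s == 0.
 move=> ps sq hy.
 have h1 : derives s c 0.
  apply: (@is_der_local R c (cst 0) s 0 p q ps sq).
  by move=> y py yq; apply/eqP; apply: contraNT (hy y py yq); exact: sc.
 have h2 := dc s; have := @derive_val _ _ _ _ _ _ _ h1.
 by rewrite (@derive_val _ _ _ _ _ _ _ h2) => ->.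
move: hs; rewrite negb_and -!ltNge => /orP[sl|rs].
 by apply: (c0 (s - 1) l) => //; [rewrite ltrBlDr ltrDl|move=> y _ yl; rewrite negb_and -ltNge yl].
by apply: (c0 r (s + 1)) => //; [rewrite ltrDl|move=> y ry _; rewrite negb_and -!ltNge ry orbT].
Qed.

Lemma shifted_in_box (t s1 s2 : R) y : 0 <= t <= 1 ->
 l <= y.1 - t * h.1 <= r -> l <= y.2 - t * h.2 <= r -> box y.
Proof.
move=> /andP[t0 t1] /andP[a1 a2] /andP[b1 b2].
have key (c : R) : `|t * c| <= `|c| by rewrite normrM ger0_norm// ler_piMl.
have := key h.1; have := key h.2; rewrite !ler_norml => /andP[k1 k2] /andP[k3 k4].
have := normr_ge0 h.1; have := normr_ge0 h.2 => n1 n2.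
by apply/and4P; rewrite /Lo /Hi; split; lra.
Qed.

(** The fundamental theorem in [t] for [v y * phi (y - t h)], followed by Fubini. At each [t] the
    shifted tensor product is itself a test function, so the weak derivatives of [v] may be moved
    onto it. *)
Lemma translate_test :
 (\int[mu2]_y (v y * (phi (sh y (- 1)) - phi y))%:E =
 \int[leb]_t (\int[mu2]_y (tt t * (G y * phi (sh y (- t))))%:E))%E.
Proof.
have [a' [da ha']] := ha 2; have [b' [db hb']] := hb 2.
have ca := diffn_cont (ha 1); have cb := diffn_cont (hb 1).
have ca' := @diffn_cont R 0 a' ha'; have cb' := @diffn_cont R 0 b' hb'.
have sa' := deriv_support da sa; have sb' := deriv_support db sb.
have [Ma Ma0 bMa] := diffn_bounded ca sa; have [Mb Mb0 bMb] := diffn_bounded cb sb.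
have [Ma' Ma0' bMa'] := diffn_bounded ca' sa'; have [Mb' Mb0' bMb'] := diffn_bounded cb' sb'.
pose M := (Ma + Ma') * (Mb + Mb').
have bnd (c d : R -> R) t y : 0 <= t <= 1 ->
  (forall s, `|c s| <= Ma + Ma') -> (forall s, `|d s| <= Mb + Mb') ->
  (forall s, c s != 0 -> l <= s <= r) -> (forall s, d s != 0 -> l <= s <= r) ->
  `|tens c d (sh y (- t))| <= M * ind (box y).
 move=> t01 bc bd sc sd; rewrite /tens /= !mulNr.
 have [->|c0] := eqVneq (c (y.1 - t * h.1)) 0; first by rewrite mul0r normr0 mulr_ge0// mulr_ge0// addr_ge0.
 have [->|d0] := eqVneq (d (y.2 - t * h.2)) 0; first by rewrite mulr0 normr0 mulr_ge0// mulr_ge0// addr_ge0.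
 by rewrite (shifted_in_box 0 0 t01 (sc _ c0) (sd _ d0)) mulr1 normrM ler_pM.
have ba s : `|a s| <= Ma + Ma' by rewrite (le_trans (bMa s))// lerDl.
have ba' s : `|a' s| <= Ma + Ma' by rewrite (le_trans (bMa' s))// lerDr.
have bb s : `|b s| <= Mb + Mb' by rewrite (le_trans (bMb s))// lerDl.
have bb' s : `|b' s| <= Mb + Mb' by rewrite (le_trans (bMb' s))// lerDr.
have ma : mble a by exact: continuous_measurable_fun.
have mb : mble b by exact: continuous_measurable_fun.
have ma' : mble a' by exact: continuous_measurable_fun.
have mb' : mble b' by exact: continuous_measurable_fun.
pose psi t y := - (h.1 * tens a' b (sh y (- t)) + h.2 * tens a b' (sh y (- t))).
have step t : 0 <= t <= 1 ->
  (\int[mu2]_y (v y * psi t y)%:E = \int[mu2]_y (G y * phi (sh y (- t)))%:E)%E.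
 move=> t01.
 pose at_ s := a (1 * s + - (t * h.1)); pose bt s := b (1 * s + - (t * h.2)).
 have hat k : diffn k at_ by exact: diffn_affine.
 have hbt k : diffn k bt by exact: diffn_affine.
 have dat (s : R) : derives s at_ (a' (1 * s + - (t * h.1))).
  rewrite -[X in is_derive _ _ _ X]mulr1; apply: (@is_derive1_comp R a (fun s => 1 * s + - (t * h.1))) => //.
  by apply: is_derive_eq; rewrite /GRing.scale /=; ring.
 have dbt (s : R) : derives s bt (b' (1 * s + - (t * h.2))).
  rewrite -[X in is_derive _ _ _ X]mulr1; apply: (@is_derive1_comp R b (fun s => 1 * s + - (t * h.2))) => //.
  by apply: is_derive_eq; rewrite /GRing.scale /=; ring.
 have nb1 := normr_ge0 h.1; have nb2 := normr_ge0 h.2.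
 have key (c : R) : `|t * c| <= `|c| by move: t01 => /andP[t0 t1]; rewrite normrM ger0_norm// ler_piMl.
 have k1 := key h.1; have k2 := key h.2; rewrite ler_norml in k1; rewrite ler_norml in k2.
 move/andP: k1 => [k1 k1']; move/andP: k2 => [k2 k2'].
 have tst : test_fun (tens at_ bt).
  apply: (@test_fun_tens _ at_ bt Lo Hi) => // s.
   by rewrite /at_ mul1r => /sa /andP[p q]; rewrite /Lo /Hi; apply/andP; split; lra.
  by rewrite /bt mul1r => /sb /andP[p q]; rewrite /Lo /Hi; apply/andP; split; lra.
 have E (c d : R -> R) y : tens (fun s => c (1 * s + - (t * h.1))) (fun s => d (1 * s + - (t * h.2))) y = tens c d (sh y (- t)) by rewrite /tens /sh !mul1r !mulNr.
 have := w1 tst; have := w2 tst.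
 rewrite (partial_tens1 _ dat) (partial_tens2 _ dbt).
 rewrite (_ : tens at_ bt = fun y => phi (sh y (- t))); last by apply/funext => y; exact: E.
 rewrite (_ : tens at_ (fun s => b' (1 * s + - (t * h.2))) = fun y => tens a b' (sh y (- t))); last first.
  by apply/funext => y; exact: E.
 rewrite (_ : tens (fun s => a' (1 * s + - (t * h.1))) bt = fun y => tens a' b (sh y (- t))); last first.
  by apply/funext => y; exact: E.
 have mab : mble (fun y => phi (sh y (- t))) by rewrite /phi /tens /sh; meas.
 have mab' : mble (fun y => tens a b' (sh y (- t))) by rewrite /tens /sh; meas.
 have ma'b : mble (fun y => tens a' b (sh y (- t))) by rewrite /tens /sh; meas.
 have iv1 : mu2.-integrable setT (fun y => (v y * tens a b' (sh y (- t)))%:E) by apply: (pairing_intble mv mab' v2) => y; apply: bnd.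
 have iv2 : mu2.-integrable setT (fun y => (v y * tens a' b (sh y (- t)))%:E) by apply: (pairing_intble mv ma'b v2) => y; apply: bnd.
 have ig1 : mu2.-integrable setT (fun y => (g1 y * phi (sh y (- t)))%:E) by apply: (pairing_intble mg1 mab g12) => y; apply: bnd.
 have ig2 : mu2.-integrable setT (fun y => (g2 y * phi (sh y (- t)))%:E) by apply: (pairing_intble mg2 mab g22) => y; apply: bnd.
 move=> e2 e1.
 transitivity (\int[mu2]_y (- h.1 * (v y * tens a' b (sh y (- t))) + - h.2 * (v y * tens a b' (sh y (- t))))%:E)%E.
  by apply: eq_integral => y _; congr EFin; rewrite /psi; ring.
 rewrite int_lin// e1 e2.
 transitivity (\int[mu2]_y (h.1 * (g1 y * phi (sh y (- t))) + h.2 * (g2 y * phi (sh y (- t))))%:E)%E.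
  by rewrite int_lin//; congr EFin; ring.
 by apply: eq_integral => y _; congr EFin; rewrite /G; ring.
pose H (z : R * plane) : \bar R := (tt z.1 * (v z.2 * psi z.1 z.2))%:E.
have mH : mble (fun z : R * plane => tt z.1 * (v z.2 * psi z.1 z.2)) by rewrite /psi /tens /sh; meas.
have mbox : mble box by exact: mfun_rect.
have iH : (leb \x plane_measure R)%E.-integrable setT H.
 pose K := (`|h.1| + `|h.2|) * M.
 have hK t y : 0 <= t <= 1 -> `|psi t y| <= K * ind (box y).
  move=> t01; rewrite normrN (le_trans (ler_normD _ _))// [`|h.1 * _|]normrM [`|h.2 * _|]normrM /K mulrDl mulrDl lerD//.
   by rewrite -mulrA ler_wpM2l// bnd.
  by rewrite -mulrA ler_wpM2l// bnd.
 pose Bd (z : R * plane) : R := tt z.1 * (v z.2^2 + K^2 * ind (box z.2)).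
 have mBd : mble Bd by rewrite /Bd; meas.
 apply: (@intble_le _ _ R (leb \x plane_measure R)%E _ Bd) => //.
  move=> [t y]; rewrite /Bd /tt /=; case: (boolP (0 <= t <= 1)) => t01; last by rewrite !mul0r normr0.
  rewrite !mul1r normrM; have := hK t y t01; have := normr_ge0 (psi t y); have := normr_ge0 (v y).
  have := sqr_ge0 (`|v y| - `|psi t y|); rewrite -[v y^2]real_normK ?num_real//.
  move: (`|v y|) (`|psi t y|) => p q; case: (box y) => /=; rewrite ?mulr1 ?mulr0 => *; nra.
 have Bd0 z : 0 <= Bd z by rewrite mulr_ge0// addr_ge0 ?sqr_ge0// mulr_ge0// sqr_ge0.
 rewrite (@prod_int R _ _ _ _ leb (plane_measure R) (fun z => (Bd z)%:E)); last 2 first.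
 - exact: mfun_EFin.
 - by [].
 have fin : (\int[mu2]_y (v y^2 + K^2 * ind (box y))%:E < +oo)%E.
  apply: int_fin_comb => //; try by meas.
  + by pos.
  + exact: sqr_ge0.
  + exact: rect_mass_fin.
 have -> : (\int[leb]_t \int[plane_measure R]_y (Bd (t, y))%:E =
   \int[leb]_t ((tt t)%:E * \int[mu2]_y (v y^2 + K^2 * ind (box y))%:E))%E.
  apply: eq_integral => t _; rewrite -ge0_integralZl; [by []|isd|isd| |isd].
  by pos.
 rewrite ge0_integralZr; [|isd|isd|isd|]; last first.
  by pos.
 by rewrite unit_mass mul1e.
have := @Fubini _ _ _ _ _ leb (plane_measure R) H iH.
have -> : (\int[plane_measure R]_y \int[leb]_t H (t, y) =
  \int[mu2]_y (v y * (phi (sh y (- 1)) - phi y))%:E)%E.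
 apply: eq_integral => y _; rewrite (int_unit (fun t => v y * psi t y)).
 have dp (t : R) : derives t (fun t => v y * phi (sh y (- t))) (v y * psi t y).
  have d1 : derives t (fun t => a (y.1 + - t * h.1)) (a' (y.1 + - t * h.1) * - h.1).
   apply: (@is_derive1_comp R a (fun t => y.1 + - t * h.1)) => //.
   by apply: is_derive_eq; rewrite /GRing.scale /=; ring.
  have d2 : derives t (fun t => b (y.2 + - t * h.2)) (b' (y.2 + - t * h.2) * - h.2).
   apply: (@is_derive1_comp R b (fun t => y.2 + - t * h.2)) => //.
   by apply: is_derive_eq; rewrite /GRing.scale /=; ring.
  have d3 := is_deriveZ (v y) (is_deriveM d1 d2).
  apply: (@is_derive_eq _ _ _ _ _ _ _ _ d3).
  by rewrite /psi /tens /GRing.scale /=; ring.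
 have cp : continuous (fun t => v y * psi t y).
  move=> t.
  have cl (p q : R) : {for t, continuous (fun t : R => p + - t * q)} by apply: cvgD; [exact: cvg_cst|apply: cvgM; [apply: cvgN; exact: cvg_id|exact: cvg_cst]].
  have cc (c : R -> R) p q : continuous c -> {for t, continuous (fun t : R => c (p + - t * q))} by move=> cc0; apply: (continuous_comp (cl p q)); exact: cc0.
  rewrite /psi /tens /=; apply: cvgM; first exact: cvg_cst.
  apply: cvgN; apply: cvgD; apply: cvgM; try exact: cvg_cst; apply: cvgM; exact: cc.
 have := @ftc_line R _ _ 0 1 ltr01 dp cp; rewrite oppr0 => ->.
 by rewrite /sh !mul0r !addr0 mulrBr.
move=> <-; apply: eq_integral => t _.
rewrite /H /tt /=; case: (boolP (0 <= t <= 1)) => t01; last first.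
 by rewrite !integral0_eq// => y _; rewrite !mul0r.
transitivity (\int[mu2]_y (v y * psi t y)%:E)%E.
 by apply: eq_integral => y _; rewrite !mul1r.
by rewrite step//; apply: eq_integral => y _; rewrite !mul1r.
Qed.

End Test.

Lemma unit_average (K : plane -> R) : mble K -> (forall x, 0 <= K x) ->
 (\int[mu2]_x \int[leb]_t (tt t * K (sh x t))%:E = \int[mu2]_x (K x)%:E)%E.
Proof.
move=> mK K0.
rewrite -(@tonelli_line_plane R (fun t x => (tt t * K (sh x t))%:E)); last 2 first.
- by rewrite /sh; meas.
- by pos.
transitivity (\int[leb]_t ((tt t)%:E * \int[mu2]_x (K x)%:E))%E.
 apply: eq_integral => t _; rewrite -[in RHS](int_plane_shift (t * h.1, t * h.2)); last 2 first.
 - exact: mfun_EFin.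
 - by [].
 rewrite -ge0_integralZl; [by []|isd..].
rewrite ge0_integralZr; [|isd|isd|isd|]; last first.
 by pos.
by rewrite unit_mass mul1e.
Qed.
Let Gp x := Num.max (G x) 0.
Let Gm x := Num.max (- G x) 0.
(** [E] below is the mean of [G] on the segment from [x] to [x + h], split into positive and
    negative parts. [fine] sends an infinite value to 0; this can occur only where [Q x] is
    infinite, a null set. *)
Let Ep x := fine (\int[leb]_t (tt t * Gp (sh x t))%:E)%E.
Let Em x := fine (\int[leb]_t (tt t * Gm (sh x t))%:E)%E.
Let E x := Ep x - Em x.
Let Q x := (\int[leb]_t (tt t * G (sh x t)^2)%:E)%E.
Let F x := v (x.1 + h.1, x.2 + h.2) - v x.

Let Gp0 x : 0 <= Gp x. by rewrite le_max lexx orbT. Qed.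
Let Gm0 x : 0 <= Gm x. by rewrite le_max lexx orbT. Qed.
Let mGp : mble Gp. by rewrite /Gp; meas. Qed.
Let mGm : mble Gm. by rewrite /Gm; meas. Qed.
Let mE : mble E.
by rewrite /E /Ep /Em /sh; meas; move=> *; rewrite lee_fin mulr_ge0. Qed.
Let mF : mble F. by rewrite /F; meas. Qed.
Let mQ : mble Q.
by rewrite /Q /sh; meas; move=> *; rewrite lee_fin mulr_ge0// sqr_ge0. Qed.
Let Q0 x : (0 <= Q x)%E.
by apply: integral_ge0 => t _; rewrite lee_fin mulr_ge0// sqr_ge0. Qed.
Let intQ : (\int[mu2]_x Q x = \int[mu2]_x (G x^2)%:E)%E.
by rewrite -(@unit_average (fun x => G x^2))//; [meas|move=> x; exact: sqr_ge0]. Qed.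
Let section_intble (K : plane -> R) x : mble K -> (forall x, `|K x| <= `|G x|) ->
 (Q x < +oo)%E -> leb.-integrable setT (fun t => (tt t * K (sh x t))%:E).
move=> mK hK Qx.
apply: (@intble_le _ _ R leb _ (fun t => tt t + tt t * G (sh x t)^2)).
- by rewrite /sh; meas.
- by rewrite /sh; meas.
- move=> t; rewrite normrM /tt; case: (_ && _); rewrite ?normr0 ?mul0r// normr1 !mul1r.
 apply: (le_trans (hK _)); rewrite -[G _^2]real_normK ?num_real//.
 have -> : ind true = 1 :> R by [].
 by nra.
have -> : (\int[leb]_t (tt t + tt t * G (sh x t)^2)%:E = \int[leb]_t (tt t)%:E + Q x)%E.
 rewrite -ge0_integralD; [by []|isd|isd|isd| |].
 - by pos.
 - by rewrite /sh; meas.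
by rewrite unit_mass lte_add_pinfty// ltry.
Qed.
Let Gp_le x : `|Gp x| <= `|G x|.
by rewrite ger0_norm// ge_max ler_norm normr_ge0. Qed.
Let Gm_le x : `|Gm x| <= `|G x|.
by rewrite ger0_norm// ge_max normr_ge0 -normrN ler_norm. Qed.
(** Jensen's inequality on the segment: with [c] the mean of [|G|], integrating
    [2 c |G| <= G^2 + c^2] gives [c^2 <= Q x]. *)
Let E_sqr x : ((E x^2)%:E <= Q x)%E.
have [Qx|] := ltP (Q x) +oo%E; last by rewrite leye_eq => /eqP ->; exact: leey.
have ip := section_intble mGp Gp_le Qx; have im := section_intble mGm Gm_le Qx.
have Qf : Q x \is a fin_num by rewrite ge0_fin_numE.
pose c := Ep x + Em x.
have Ep0 : 0 <= Ep x by apply: fine_ge0; apply: integral_ge0 => t _; rewrite lee_fin mulr_ge0.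
have Em0 : 0 <= Em x by apply: fine_ge0; apply: integral_ge0 => t _; rewrite lee_fin mulr_ge0.
have c0 : 0 <= c by rewrite addr_ge0.
have key : ((2 * c * c)%:E <= Q x + (c^2)%:E)%E.
 have -> : ((2 * c * c)%:E = \int[leb]_t (2 * c * (tt t * Gp (sh x t)) + 2 * c * (tt t * Gm (sh x t)))%:E)%E by rewrite (int_lin _ _ ip im) -mulrDr.
 have -> : (Q x + (c^2)%:E = \int[leb]_t (tt t * G (sh x t)^2 + c^2 * tt t)%:E)%E.
  have mt : mble (fun t => (tt t)%:E) by exact: mfun_EFin.
  have -> : ((c^2)%:E = \int[leb]_t ((c^2)%:E * (tt t)%:E))%E.
   rewrite ge0_integralZl; [|isd..].
   by rewrite unit_mass mule1.
  rewrite -ge0_integralD; [by []|isd| | | |].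
  - by move=> t _; rewrite lee_fin mulr_ge0// sqr_ge0.
  - by rewrite /sh; meas.
  - by move=> t _; rewrite -EFinM lee_fin mulr_ge0// sqr_ge0.
  - by meas.
 apply: le_int_real.
 - by rewrite /sh; meas.
 - by rewrite /sh; meas.
 - by move=> t; rewrite addr_ge0// !mulr_ge0.
 move=> t; rewrite /tt; case: (_ && _) => /=; rewrite ?mul0r ?mulr0 ?addr0// !mul1r mulr1 -mulrDr.
 have -> : Gp (sh x t) + Gm (sh x t) = `|G (sh x t)|.
  rewrite /Gp /Gm; have [g|g] := leP 0 (G (sh x t)).
   by rewrite max_r ?addr0 ?ger0_norm// oppr_le0.
  by rewrite add0r max_l ?ltr0_norm// oppr_ge0 ltW.
 rewrite -[G _^2]real_normK ?num_real//.
 by have := sqr_ge0 (`|G (sh x t)| - c); nra.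
move: key; rewrite -(fineK Qf) -EFinD !lee_fin => key.
have : E x^2 <= c^2 by rewrite /E /c; have := mulr_ge0 Ep0 Em0; nra.
by lra.
Qed.
Let aeQ : {ae mu2, forall x, (Q x < +oo)%E}.
have iQ : mu2.-integrable setT Q.
 apply/integrableP; split => //.
 by under eq_integral do rewrite gee0_abs//; rewrite intQ.
case: (integrable_ae measurableT iQ) => A [mA A0 sA]; exists A; split => // x hx; apply: sA => /= h0.
by have := h0 I; rewrite ge0_fin_numE.
Qed.
Let E2 : (\int[mu2]_x (E x^2)%:E < +oo)%E.
apply: le_lt_trans G2; rewrite -intQ; apply: ge0_le_integral => //.
- by move=> x _; rewrite lee_fin sqr_ge0.
- by apply: mfun_EFin; exact: mfun_exp.
Qed.
Let F2 : (\int[mu2]_x (F x^2)%:E < +oo)%E.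
have vs := sqr_shift_fin h mv v2.
apply: (@le_lt_trans _ _ (\int[mu2]_x (0 + 2 * v (x.1 + h.1, x.2 + h.2)%R^2 + 2 * v x^2)%R%:E)%E).
 apply: le_int_real; try by rewrite /F; meas.
  by move=> x; exact: sqr_ge0.
 move=> x; rewrite /F; have := sqr_ge0 (v (x.1 + h.1, x.2 + h.2) + v x); lra.
apply: int_fin_comb => //; try by meas.
- by move=> x; rewrite add0r mulr_ge0// sqr_ge0.
- by move=> x; exact: sqr_ge0.
apply: int_fin_comb => //; try by meas.
- by move=> x; exact: sqr_ge0.
- by rewrite integral0.
Qed.
Let translate_average (a b : R -> R) (l r : R) :
 (forall k, diffn k a) -> (forall k, diffn k b) ->
 (forall s, a s != 0 -> l <= s <= r) -> (forall s, b s != 0 -> l <= s <= r) ->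
 (\int[mu2]_x (F x * tens a b x)%:E = \int[mu2]_x (E x * tens a b x)%:E)%E.
move=> ha hb sa sb; set phi := tens a b.
have ca := diffn_cont (ha 1); have cb := diffn_cont (hb 1).
have [Ma Ma0 bMa] := diffn_bounded ca sa; have [Mb Mb0 bMb] := diffn_bounded cb sb.
have ma : mble a by exact: continuous_measurable_fun.
have mb : mble b by exact: continuous_measurable_fun.
have mphi : mble phi by rewrite /phi /tens; meas.
have bphi x : `|phi x| <= Ma * Mb * ind (rect (l - 1) (r + 1) (l - 1) (r + 1) x).
 rewrite /phi /tens.
 have [->|/sa/andP[a1 a2]] := eqVneq (a x.1) 0; first by rewrite mul0r normr0 !mulr_ge0.
 have [->|/sb/andP[b1 b2]] := eqVneq (b x.2) 0; first by rewrite mulr0 normr0 !mulr_ge0.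
 have -> : rect (l - 1) (r + 1) (l - 1) (r + 1) x by apply/and4P; split; lra.
 by rewrite mulr1 normrM ler_pM.
have mvh : mble (fun x => v (x.1 + h.1, x.2 + h.2)) by meas.
have ivh := pairing_intble mvh mphi (sqr_shift_fin h mv v2) bphi.
have iv := pairing_intble mv mphi v2 bphi.
have shE y t : phi (sh (y.1 + t * h.1, y.2 + t * h.2) (- t)) = phi y by rewrite /sh /= !mulNr !addrK -surjective_pairing.
have mphis t : mble (fun y => phi (sh y t)) by rewrite /sh; meas.
have iv1 : mu2.-integrable setT (fun y => (v y * phi (sh y (- 1)))%:E).
 have mvp := mfun_mul mv (mphis (- 1)).
 apply/integrableP; split; first exact: mfun_EFin.
 have -> : (\int[mu2]_y `|(v y * phi (sh y (- 1)))%:E| = \int[mu2]_y `|(v (y.1 + h.1, y.2 + h.2)%R * phi y)%:E|)%E.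
  rewrite -[LHS](int_plane_shift h); last 2 first.
  - by apply: mfun_EFin; apply: mfun_norm.
  - by move=> y; rewrite lee_fin.
  apply: eq_integral => y _; congr (`|(_ * _)%R%:E|%E).
  by rewrite -(shE y 1) !mul1r.
 by have /integrableP[] := ivh.
have L : (\int[mu2]_x (F x * phi x)%:E = \int[mu2]_y (v y * (phi (sh y (- 1)) - phi y))%:E)%E.
 have -> : (\int[mu2]_x (F x * phi x)%:E =
   \int[mu2]_x (1 * (v (x.1 + h.1, x.2 + h.2) * phi x) + -1 * (v x * phi x))%R%:E)%E by apply: eq_integral => x _; congr EFin; rewrite /F; ring.
 have -> : (\int[mu2]_y (v y * (phi (sh y (- 1)) - phi y))%:E =
   \int[mu2]_y (1 * (v y * phi (sh y (- 1))) + -1 * (v y * phi y))%R%:E)%E by apply: eq_integral => x _; congr EFin; ring.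
 rewrite !int_lin//; congr ((1 * _ + _)%R%:E); congr fine.
 rewrite -[RHS](@int_shift_signed R h (fun y => v y * phi (sh y (- 1)))); last exact: (mfun_mul mv (mphis (- 1))).
 apply: eq_integral => y _; congr (_ * _)%R%:E.
 by rewrite -[LHS](shE y 1) !mul1r.
rewrite L (translate_test ha hb sa sb) -/phi.
pose H (z : R * plane) : \bar R := (tt z.1 * (G (sh z.2 z.1) * phi z.2))%:E.
have mH : mble (fun z : R * plane => tt z.1 * (G (sh z.2 z.1) * phi z.2)) by rewrite /sh; meas.
pose M := Ma * Mb; pose box x := rect (l - 1) (r + 1) (l - 1) (r + 1) x.
have mbox : mble box by exact: mfun_rect.
have iH : (leb \x plane_measure R)%E.-integrable setT H.
 pose Bd (z : R * plane) : R := tt z.1 * (G (sh z.2 z.1)^2 + M^2 * ind (box z.2)).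
 have mBd : mble Bd by rewrite /Bd /sh; meas.
 apply: (@intble_le _ _ R (leb \x plane_measure R)%E _ Bd) => //.
  move=> [t y]; rewrite /Bd /tt /=; case: (_ && _); last by rewrite !mul0r normr0.
  rewrite !mul1r normrM; have := bphi y; have := normr_ge0 (phi y); have := normr_ge0 (G (sh y t)).
  have := sqr_ge0 (`|G (sh y t)| - `|phi y|); rewrite -[G _^2]real_normK ?num_real// -/(box y) -/M.
  move: (`|G _|) (`|phi y|) => p q; case: (box y) => /=; rewrite ?mulr1 ?mulr0 => *; nra.
 have Bd0 z : 0 <= Bd z by rewrite /Bd mulr_ge0// addr_ge0 ?sqr_ge0// mulr_ge0// sqr_ge0.
 rewrite (@prod_int R _ _ _ _ leb (plane_measure R) (fun z => (Bd z)%:E)); last 2 first.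
 - exact: mfun_EFin.
 - by move=> z; rewrite lee_fin.
 pose c := (\int[mu2]_y (G y^2)%:E + (M^2)%:E * \int[mu2]_y (ind (box y))%:E)%E.
 have -> : (\int[leb]_t \int[plane_measure R]_y (Bd (t, y))%:E = \int[leb]_t ((tt t)%:E * c))%E.
  apply: eq_integral => t _.
  have -> : c = (\int[mu2]_y (G (sh y t)^2 + M^2 * ind (box y))%:E)%E.
   rewrite /c -(int_plane_shift (t * h.1, t * h.2)); [|by meas|by move=> z; rewrite lee_fin sqr_ge0].
   rewrite -ge0_integralZl; [|isd..].
   rewrite -ge0_integralD; [by []|isd|isd|isd| |isd].
   by move=> z _; rewrite -EFinM lee_fin mulr_ge0// sqr_ge0.
  rewrite -ge0_integralZl; [by []|isd|by rewrite /sh; meas| |isd].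
  by move=> y _; rewrite lee_fin addr_ge0 ?sqr_ge0// mulr_ge0// sqr_ge0.
 have c0 : (0 <= c)%E.
  rewrite adde_ge0//; first by apply: integral_ge0 => y _; rewrite lee_fin sqr_ge0.
  by rewrite mule_ge0 ?lee_fin ?sqr_ge0//; apply: integral_ge0 => y _; rewrite lee_fin.
 rewrite ge0_integralZr; [|isd..].
 rewrite unit_mass mul1e /c lte_add_pinfty// lte_mul_pinfty ?lee_fin ?sqr_ge0//.
 exact: rect_mass_fin.
have fub := @Fubini _ _ _ _ _ leb (plane_measure R) H iH.
transitivity (\int[leb]_t \int[plane_measure R]_x H (t, x))%E.
 apply: eq_integral => t _.
 rewrite -[LHS](@int_shift_signed R (t * h.1, t * h.2) (fun y => tt t * (G y * phi (sh y (- t))))); last first.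
  by apply: mfun_mul; [exact: measurable_cst|exact: (mfun_mul mG (mphis (- t)))].
 by apply: eq_integral => x _; rewrite /H /= shE.
rewrite fub; apply: ae_eq_integral => //.
- exact: (measurable_fubini_G iH).
- by apply: mfun_EFin; apply: mfun_mul.
case: aeQ => A [mA A0 sA]; exists A; split => // x hx; apply: sA => /= Qx; apply: hx => _.
have ip := section_intble mGp Gp_le Qx; have im := section_intble mGm Gm_le Qx.
transitivity (\int[leb]_t (phi x * (tt t * Gp (sh x t)) + - phi x * (tt t * Gm (sh x t)))%:E)%E.
 apply: eq_integral => t _; rewrite /H /=; congr EFin.
 have -> : G (sh x t) = Gp (sh x t) - Gm (sh x t).
  rewrite /Gp /Gm; have [g|g] := leP 0 (G (sh x t)).
   by rewrite max_r ?subr0// oppr_le0.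
  by rewrite sub0r max_l ?opprK// oppr_ge0 ltW.
 by ring.
by rewrite int_lin// /E /Ep /Em /Rintegral; congr EFin; ring.
Qed.

(** The increment [F] and the mean directional derivative [E] have equal integrals against smooth
    tensor products. These approximate indicators of rectangles, so [F = E] almost everywhere, and
    Jensen's inequality with translation invariance concludes. *)
Theorem weak_translation : (\int[mu2]_x (F x^2)%:E <= \int[mu2]_x (G x^2)%:E)%E.
Proof.
pose D x := F x - E x.
have mD : mble D by rewrite /D; apply: mfun_add => //; exact: mfun_opp.
have D2 : (\int[mu2]_x (D x^2)%:E < +oo)%E.
 apply: (@le_lt_trans _ _ (\int[mu2]_x (0 + 2 * F x^2 + 2 * E x^2)%R%:E)%E).
  apply: le_int_real; try by meas.
   by move=> x; exact: sqr_ge0.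
  move=> x; rewrite /D; have := sqr_ge0 (F x + E x); lra.
 apply: int_fin_comb => //; try by meas.
 - by move=> x; rewrite add0r mulr_ge0// sqr_ge0.
 - by move=> x; exact: sqr_ge0.
 apply: int_fin_comb => //; try by meas.
 - by move=> x; exact: sqr_ge0.
 - by rewrite integral0.
have iD (phi : plane -> R) l r : mble phi -> (forall x, `|phi x| <= 1 * ind (rect l r l r x)) ->
  mu2.-integrable setT (fun x => (D x * phi x)%:E) by move=> mphi; exact: pairing_intble.
have sub l r l' r' x : rect l r l' r' x ->
  rect (Num.min l l' - 1) (Num.max r r' + 1) (Num.min l l' - 1) (Num.max r r' + 1) x.
 move=> /and4P[h1 h2 h3 h4].
 have m1 : Num.min l l' <= l by rewrite ge_min lexx.
 have m2 : Num.min l l' <= l' by rewrite ge_min lexx orbT.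
 have m3 : r <= Num.max r r' by rewrite le_max lexx.
 have m4 : r' <= Num.max r r' by rewrite le_max lexx orbT.
 by apply/and4P; split; lra.
have ae0 : {ae mu2, forall x, D x = 0}.
 apply: du_bois_reymond => // l r l' r'.
  apply: (@iD _ (Num.min l l' - 1) (Num.max r r' + 1)).
   by apply: mfun_nat; exact: mfun_rect.
  move=> x; rewrite mul1r ger0_norm// ler_nat; case: (boolP (rect l r l' r' x)) => // /sub ->//.
 pose b n := tens (bump l r n) (bump l' r' n).
 have sb1 n s : bump l r n s != 0 -> Num.min l l' <= s <= Num.max r r' by move=> /bump_supp/andP[p q]; rewrite ge_min p le_max q.
 have sb2 n s : bump l' r' n s != 0 -> Num.min l l' <= s <= Num.max r r' by move=> /bump_supp/andP[p q]; rewrite ge_min p le_max q !orbT.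
 have mb n : mble (b n).
  have m1 : mble (bump l r n) by apply: continuous_measurable_fun; exact: diffn_cont (diffn_bump _ _ _ 1).
  have m2 : mble (bump l' r' n) by apply: continuous_measurable_fun; exact: diffn_cont (diffn_bump _ _ _ 1).
  by rewrite /b /tens; meas.
 pose B x : R := ind (rect (Num.min l l' - 1) (Num.max r r' + 1) (Num.min l l' - 1) (Num.max r r' + 1) x).
 have mB : mble B by apply: mfun_nat; exact: mfun_rect.
 have bB n x : `|b n x| <= B x.
  rewrite /b /tens.
  have [->|/sb1/andP[a1 a2]] := eqVneq (bump l r n x.1) 0; first by rewrite mul0r normr0.
  have [->|/sb2/andP[b1 b2]] := eqVneq (bump l' r' n x.2) 0; first by rewrite mulr0 normr0.
  have -> : B x = 1 by rewrite /B (_ : rect _ _ _ _ _)//; apply/and4P; split; lra.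
  rewrite normrM; apply: mulr_ile1 => //; rewrite ger0_norm; first [exact: bump_le1|exact: bump_ge0].
 have bB1 n x : `|b n x| <= 1 * B x by rewrite mul1r.
 have z n : (\int[mu2]_x (D x * b n x)%:E = 0)%E.
  have hb1 k := diffn_bump l r n k; have hb2 k := diffn_bump l' r' n k.
  have h1 := translate_average hb1 hb2 (@sb1 n) (@sb2 n).
  have iF : mu2.-integrable setT (fun x => (F x * b n x)%:E).
   exact: (pairing_intble mF (mb n) F2 (bB1 n)).
  have iE : mu2.-integrable setT (fun x => (E x * b n x)%:E).
   exact: (pairing_intble mE (mb n) E2 (bB1 n)).
  rewrite -[RHS](int_sub_eq0 iF iE h1).
  by apply: eq_integral => x _; congr EFin; rewrite /D mulrBl.
 have DB : (\int[mu2]_x (`|D x| * B x)%:E < +oo)%E.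
  have BB x : `|B x| <= 1 * B x by rewrite mul1r ger0_norm.
  have /integrableP[_] := iD B _ _ mB BB.
  by under eq_integral do rewrite abse_EFin normrM [`|B _|]ger0_norm//.
 have mDb n : mble (fun x => D x * b n x) by exact: (mfun_mul mD (mb n)).
 have mDr : mble (fun x => D x * ind (rect l r l' r' x)) by apply: mfun_mul => //; apply: mfun_nat; exact: mfun_rect.
 have mDB : mble (fun x => `|D x| * B x) by apply: mfun_mul => //; exact: mfun_norm.
 have cv x : D x * b n x @[n --> \oo] --> D x * ind (rect l r l' r' x).
  apply: cvgM; first exact: cvg_cst.
  have -> : ind (rect l r l' r' x) = ind ((l < x.1) && (x.1 < r)) * ind ((l' < x.2) && (x.2 < r')) :> R by rewrite -natrM mulnb /rect -andbA.
  by apply: cvgM; exact: bump_cvg.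
 have dom n x : `|D x * b n x| <= `|D x| * B x by rewrite normrM ler_wpM2l.
 have := @dominated_real _ _ _ mu2 _ _ _ mDb mDr cv dom mDB DB.
 under eq_fun do rewrite z.
 by move=> /(cvg_lim (@ereal_hausdorff R)) <-; rewrite lim_cst//; exact: ereal_hausdorff.
have -> : (\int[mu2]_x (F x^2)%:E = \int[mu2]_x (E x^2)%:E)%E.
 apply: ae_eq_integral => //; try by apply: mfun_EFin; exact: mfun_exp.
 case: ae0 => A [mA A0 sA]; exists A; split => // x hx; apply: sA => /= Dx; apply: hx => _.
 by have -> : F x = E x by apply/eqP; rewrite -subr_eq0 -/(D x) Dx.
rewrite -intQ; apply: ge0_le_integral => //.
- by move=> x _; rewrite lee_fin sqr_ge0.
- by apply: mfun_EFin; exact: mfun_exp.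
Qed.

End WeakTranslation.

Section WeakModulus.
Variable R : realType.
Local Notation mu2 := (leb2 R).
Local Notation plane := (plane R).
Implicit Types x y h : plane.

(** For each displacement [h] the translation estimate applies; integrating over [|h| < e] then
    costs the second moment of the disc in the direction of the gradient, [pi e^4 / 4]. *)
Lemma weak_modulus (v g1 g2 : plane -> R) (e : R) : mble v ->
 mble g1 -> mble g2 ->
 (\int[mu2]_x (v x^2)%:E < +oo)%E -> (\int[mu2]_x (g1 x^2)%:E < +oo)%E ->
 (\int[mu2]_x (g2 x^2)%:E < +oo)%E -> weak_partial false v g1 -> weak_partial true v g2 ->
 (\int[mu2]_x \int[mu2]_y ((v x - v y)^2 * ind (dsq x y < e^2)%R)%:E <=
 (pi * e ^+ 4 / 4)%:E * \int[mu2]_x (g1 x^2 + g2 x^2)%:E)%E.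
Proof.
move=> mv mg1 mg2 v2 g12 g22 w1 w2.
pose K x h : R := ind (nsq h < e^2) * (v (x.1 + h.1, x.2 + h.2) - v x)^2.
pose L x h : R := ind (nsq h < e^2) * (g1 x * h.1 + g2 x * h.2)^2.
have mK : mble (fun z : plane * plane => K z.1 z.2) by rewrite /K; meas.
have mL : mble (fun z : plane * plane => L z.1 z.2) by rewrite /L; meas.
have K0 x h : 0 <= K x h by rewrite /K mulr_ge0// sqr_ge0.
have L0 x h : 0 <= L x h by rewrite /L mulr_ge0// sqr_ge0.
have -> : (\int[mu2]_x \int[mu2]_y ((v x - v y)^2 * ind (dsq x y < e^2)%R)%:E =
  \int[mu2]_x \int[mu2]_h (K x h)%:E)%E.
 apply: eq_integral => x _; rewrite -(int_plane_shift x); last 2 first.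
 - by meas.
 - by move=> y; rewrite lee_fin mulr_ge0// sqr_ge0.
 apply: eq_integral => h _; congr EFin.
 rewrite /K /= [h.1 + _]addrC [h.2 + _]addrC mulrC; congr (_ * _); last by rewrite -sqrrN opprB.
 by congr (ind (_ < _)); rewrite /dsq /nsq /=; ring.
have -> : ((pi * e ^+ 4 / 4)%:E * \int[mu2]_x (g1 x^2 + g2 x^2)%:E =
  \int[mu2]_x \int[mu2]_h (L x h)%:E)%E.
 rewrite -ge0_integralZl; [|isd|isd|isd|]; last first.
  by rewrite lee_fin divr_ge0// mulr_ge0 ?pi_ge0// exprn_even_ge0.
 apply: eq_integral => x _; rewrite /L disc_quadratic ?sqr_ge0// -EFinM -exprM.
 by congr EFin; ring.
rewrite tonelli_plane; [|exact: mfun_EFin|by move=> x h; rewrite lee_fin].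
rewrite [leRHS]tonelli_plane; [|exact: mfun_EFin|by move=> x h; rewrite lee_fin].
have mKT : mble (fun z : plane * plane => K z.2 z.1) by rewrite /K; meas.
have mLT : mble (fun z : plane * plane => L z.2 z.1) by rewrite /L; meas.
apply: ge0_le_integral => //.
- by move=> h _; apply: integral_ge0 => x _; rewrite lee_fin.
- by apply: mfun_int_plane; [exact: mfun_EFin|move=> h x; rewrite lee_fin].
- by apply: mfun_int_plane; [exact: mfun_EFin|move=> h x; rewrite lee_fin].
move=> h _; rewrite /K /L; case: (nsq h < e^2) => /=; last first.
 by rewrite !integral0_eq// => x _; rewrite mul0r.
have := weak_translation mv mg1 mg2 v2 g12 g22 w1 w2 h.
set A := (X in (X <= _)%E); set B := (X in (_ <= X)%E) => AB.
have -> : (\int[mu2]_x (1 * (v (x.1 + h.1, x.2 + h.2)%R - v x)^2)%R%:E = A)%E by apply: eq_integral => x _; rewrite mul1r.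
apply: (le_trans AB); rewrite le_eqVlt; apply/orP; left; apply/eqP.
by apply: eq_integral => x _; rewrite mul1r [h.1 * _]mulrC [h.2 * _]mulrC.
Qed.

(** Reverse triangle inequality for complex numbers: passing from [u] to [|u|] does not increase the
    modulus of continuity, so [|u|] can be used without being differentiated. *)
Lemma modulus_diff (a b c d : R) :
 (sqrt (a^2 + b^2) - sqrt (c^2 + d^2))^2 <= (a - c)^2 + (b - d)^2.
Proof.
have p : 0 <= a^2 + b^2 by rewrite addr_ge0 ?sqr_ge0.
have q : 0 <= c^2 + d^2 by rewrite addr_ge0 ?sqr_ge0.
have h : a * c + b * d <= sqrt (a^2 + b^2) * sqrt (c^2 + d^2).
 apply: le_trans (ler_norm _) _; rewrite -sqrtr_sqr -sqrtrM// ler_wsqrtr//.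
 by have := sqr_ge0 (a * d - b * c); lra.
have := sqr_sqrtr p; have := sqr_sqrtr q; move: h.
move: (sqrt _) (sqrt _) => s t; nra.
Qed.

End WeakModulus.

(** * The logarithmic potential *)

Section LogKernel.
Variable R : realType.
Local Notation leb := (@lebesgue_measure R).
Implicit Types (a b k s : R).

Lemma ftc_segment (F f : R -> R) a b : a < b ->
 (forall x : R, a <= x -> x <= b -> derives x F (f x)) ->
 (forall x : R, a <= x -> x <= b -> {for x, continuous f}) ->
 (\int[leb]_(x in `[a, b]) (f x)%:E = (F b - F a)%:E)%E.
Proof.
move=> ab dF cf; rewrite EFinB; apply: continuous_FTC2 => //.
- apply: continuous_in_subspaceT => x; rewrite inE => /andP[ax xb]; exact: cf.
- split.
 + by move=> x; rewrite in_itv/= => /andP[ax xb]; have h := dF x (ltW ax) (ltW xb).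
 + by apply: cvg_at_right_filter; exact: is_der1_cont (dF a (lexx _) (ltW ab)).
 + by apply: cvg_at_left_filter; exact: is_der1_cont (dF b (ltW ab) (lexx _)).
- by move=> x; rewrite in_itv/= => /andP[ax xb]; have h := dF x (ltW ax) (ltW xb); rewrite derive1E derive_val.
Qed.

Lemma int_open (f : R -> R) a b : mble f ->
 (\int[leb]_s (ind ((a < s) && (s < b)) * f s)%:E = \int[leb]_(s in `[a, b]) (f s)%:E)%E.
Proof.
move=> mf; rewrite [RHS]integral_itv_bndoo; last by apply: measurable_funTS; exact: mfun_EFin.
rewrite [RHS]integral_mkcond; apply: eq_integral => s _.
by rewrite patchE mem_setE in_itv/=; case: (_ && _); rewrite ?mul1r ?mul0r.
Qed.
Let onek k : 0 < 1 + k^2.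
by rewrite ltr_pwDl ?sqr_ge0. Qed.
Let onek0 k : 1 + k^2 != 0.
by rewrite gt_eqF. Qed.

(** Partial fractions: [(a^2 - s^2) / s] times the integrand plus [1 / (1 + k^2)] is
    [a^2 / (a^2 k^2 + s^2)], a rescaled Cauchy density. *)
Lemma cauchy_pair a s : 0 < s -> s < a ->
 (\int[leb]_k (s / ((a^2 * k^2 + s^2) * (1 + k^2)))%:E = (pi / (a + s))%:E)%E.
Proof.
move=> s0 sa; have a0 := lt_trans s0 sa; have sn : s != 0 by rewrite gt_eqF.
have an : a != 0 by lra.
have D k : 0 < a^2 * k^2 + s^2 by rewrite ltr_wpDl ?exprn_gt0// mulr_ge0 ?sqr_ge0.
have E : (\int[leb]_k (a^2 / (a^2 * k^2 + s^2))%:E = (pi * a / s)%:E)%E.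
 have san : s / a != 0 by rewrite mulf_neq0 ?invr_eq0.
 rewrite (@int_affine R _ 0 _ san); last 2 first.
 - by meas.
 - by pos.
 transitivity ((`|s / a|)%:E * \int[leb]_k ((a^2 / s^2)%:E * ((1 + k^2)^-1)%:E))%E.
  congr (_ * _)%E; apply: eq_integral => k _; rewrite -EFinM; congr EFin.
  rewrite addr0 (_ : a^2 * (s / a * k)^2 + s^2 = s^2 * (1 + k^2)); first by rewrite invfM mulrA.
  by field.
 rewrite ge0_integralZl; [|isd|isd|by move=> k _; rewrite lee_fin invr_ge0 ltW|]; last first.
  by pos.
 rewrite int_cauchy; congr EFin; rewrite gtr0_norm ?divr_gt0//.
 by field; rewrite sn.
have c0 : 0 < (a^2 - s^2) / s by rewrite divr_gt0// subr_gt0 ltrXn2r// ltW.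
set X := (\int[leb]_k _)%E.
have X0 : (0 <= X)%E by apply: integral_ge0 => k _; rewrite lee_fin divr_ge0 ?(ltW s0)// mulr_ge0 ?(ltW (onek k)) ?(ltW (D k)).
have : (((a^2 - s^2) / s)%:E * X + pi%:E = (pi * a / s)%:E)%E.
 rewrite -int_cauchy -ge0_integralZl; [|isd|isd| |by rewrite lee_fin ltW]; last first.
  by move=> k _; rewrite lee_fin divr_ge0 ?(ltW s0)// mulr_ge0 ?(ltW (onek k)) ?(ltW (D k)).
 rewrite -ge0_integralD; [|isd| |isd|by move=> k _; rewrite lee_fin invr_ge0 ltW|isd]; last first.
  move=> k _; rewrite lee_fin mulr_ge0 ?(ltW c0)// divr_ge0 ?(ltW s0)//.
  by pos.
 rewrite -E; apply: eq_integral => k _; rewrite -EFinM; congr EFin.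
 have -> : a^2 - s^2 = a^2 * (1 + k^2) - (a^2 * k^2 + s^2) by lra.
 have := lt0r_neq0 (D k); have := onek0 k.
 by move: (1 + k^2) (a^2 * k^2 + s^2) => p q pn qn; field; rewrite pn qn.
move: X0; case: (X) => [x||//] _; last by rewrite gt0_muley.
rewrite -EFinM => -[] h; congr EFin.
have as0 : a + s != 0 by lra.
have hx : (a^2 - s^2) / s * x = pi * (a - s) / s by rewrite -[LHS](addrK pi) h; field.
apply: (mulfI (lt0r_neq0 c0)); rewrite hx.
by field; rewrite as0.
Qed.

(** The bracket is the integral of [2 s / (a^2 k^2 + s^2)] for [s] between [b] and [a]; exchanging
    the integrals leaves [2 pi / (a + s)] by [cauchy_pair]. The point [k = 0] is left out because
    the logarithm is singular there when [b = 0]. *)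
Lemma log_kernel a b : 0 <= b -> b <= a -> 0 < a ->
 (\int[leb]_k ((1 + k^2)^-1 * (ln (a^2) + ln (1 + k^2) - ln (a^2 * k^2 + b^2)))%:E =
 (2 * pi * (ln a - ln ((a + b) / 2)))%:E)%E.
Proof.
move=> b0 ba a0; have a2 : 0 < a^2 by rewrite exprn_gt0.
have [eq_ab|neq_ab] := eqVneq b a.
 subst b; rewrite (_ : (a + a) / 2 = a); last by field.
 rewrite subrr mulr0 integral0_eq// => k _; congr EFin.
 have -> : a^2 * k^2 + a^2 = a^2 * (1 + k^2) by lra.
 by rewrite lnM ?posrE// subrr mulr0.
have {neq_ab ba}ab : b < a by lra.
pose S s k : R := (1 + k^2)^-1 * (ind ((b < s) && (s < a)) * (2 * s / (a^2 * k^2 + s^2))).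
have S0 s k : 0 <= S s k.
 rewrite mulr_ge0 ?invr_ge0 ?(ltW (onek k))//; case: (ltP b s) => bs; last by rewrite mul0r.
 rewrite mulr_ge0// divr_ge0//; first by rewrite mulr_ge0// (le_trans b0 (ltW bs)).
 by pos.
have mS' : mble (fun z : R * R => S z.2 z.1) by rewrite /S; meas.
transitivity (\int[leb]_k \int[leb]_s (S s k)%:E)%E.
 apply: (@eq_int_off R 0).
 - by meas.
 - by apply: mfun_int_line; [exact: mfun_EFin|move=> k s; rewrite lee_fin].
 move=> k k0; have k2 : 0 < a^2 * k^2 by rewrite mulr_gt0// lt_def sqr_ge0 sqrf_eq0 k0.
 have D s : 0 < a^2 * k^2 + s^2 by rewrite ltr_wpDr// sqr_ge0.
 have ms : mble (fun s => 2 * s / (a^2 * k^2 + s^2)) by meas.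
 have dF (s : R) : derives s (fun s => ln (a^2 * k^2 + s^2)) (2 * s / (a^2 * k^2 + s^2)).
  have d1 : derives s (fun s : R => a^2 * k^2 + s^2) (2 * s) by apply: is_derive_eq; rewrite /GRing.scale /=; ring.
  have := @is_derive1_comp R (@ln R) _ s _ _ (is_derive1_ln (D s)) d1.
  by move=> h; apply: (@is_derive_eq _ _ _ _ _ _ _ _ h); rewrite mulrC.
 have cf : continuous (fun s => 2 * s / (a^2 * k^2 + s^2)).
  move=> s; apply: cvgM; first by apply: cvgM; [exact: cvg_cst|exact: cvg_id].
  apply: cvgV; first by rewrite gt_eqF.
  by apply: cvgD; [exact: cvg_cst|exact: exprn_continuous].
 rewrite [RHS](_ : _ = ((1 + k^2)^-1)%:E *
  \int[leb]_s (ind ((b < s) && (s < a)) * (2 * s / (a^2 * k^2 + s^2)))%:E)%E; last first.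
  rewrite -ge0_integralZl; [by []|isd|isd| |by rewrite lee_fin invr_ge0 ltW].
  move=> s _; rewrite lee_fin; case: (ltP b s) => bs; last by rewrite mul0r.
  by rewrite mulr_ge0// divr_ge0 ?(ltW (D s))// mulr_ge0// (le_trans b0 (ltW bs)).
 rewrite int_open// (ftc_segment ab (fun s _ _ => dF s) (fun s _ _ => cf s)) -EFinM.
 congr EFin; congr (_ * _); congr (_ - _).
 by rewrite -lnM ?posrE//; congr ln; ring.
rewrite tonelli; [|exact: mfun_EFin|by move=> k s; rewrite lee_fin].
transitivity (\int[leb]_s (ind ((b < s) && (s < a)) * (2 * pi / (a + s)))%:E)%E.
 apply: eq_integral => s _; rewrite /S; case: (boolP ((b < s) && (s < a))) => [/andP[bs sa]|_]; last first.
  by rewrite mul0r integral0_eq// => k _; rewrite mul0r mulr0.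
 have s0 := le_lt_trans b0 bs.
 rewrite mul1r -mulrA EFinM -cauchy_pair// -ge0_integralZl; [|isd|isd| |isd].
  apply: eq_integral => k _; rewrite -EFinM; congr EFin; rewrite mul1r invfM; ring.
 move=> k _; rewrite lee_fin divr_ge0 ?(ltW s0)// mulr_ge0 ?(ltW (onek k))//.
 by pos.
rewrite int_open; last by meas.
have P s : b <= s -> 0 < a + s by lra.
have dF (s : R) : b <= s -> s <= a -> derives s (fun s => 2 * pi * ln (a + s)) (2 * pi / (a + s)).
 move=> bs sa.
 have d1 : derives s (fun s : R => a + s) 1 by have := is_deriveD (is_derive_cst a s (1 : R)) (is_derive_id s (1 : R)); rewrite add0r.
 have d2 := @is_derive1_comp R (@ln R) _ s _ _ (is_derive1_ln (P s bs)) d1.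
 have := is_deriveZ (2 * pi) d2.
 by move=> h; apply: (@is_derive_eq _ _ _ _ _ _ _ _ h); rewrite mulr1.
have cf (s : R) : b <= s -> s <= a -> {for s, continuous (fun s : R => 2 * pi / (a + s))}.
 move=> bs _; apply: cvgM; first exact: cvg_cst.
 apply: cvgV; first by rewrite gt_eqF// P.
 by apply: cvgD; [exact: cvg_cst|exact: cvg_id].
rewrite (ftc_segment ab dF cf); congr EFin; rewrite -mulrBr; congr (_ * _).
rewrite -!ln_div ?posrE ?divr_gt0 ?P ?(ltW ab)//.
have ab0 : a + b != 0 by lra.
by congr ln; field.
Qed.

(** Squared distance from [(A, 0)] to the point of signed radius [r] on the line of slope [k]. *)
Definition dcirc (A k r : R) : R := A^2 - 2 * A * r / sqrt (1 + k^2) + r^2.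

Lemma dcirc_ge0 A k r : 0 <= dcirc A k r.
Proof.
rewrite /dcirc; set s := sqrt (1 + k^2).
have s1 : 1 <= s by rewrite -[X in X <= _]sqrtr1 ler_wsqrtr// lerDl sqr_ge0.
have s0 : 0 < s by lra.
have v1 : s^-1 <= 1 by rewrite invf_le1.
have v0 : 0 <= s^-1 by rewrite invr_ge0 ltW.
have -> : A^2 - 2 * A * r / s + r^2 = (A - r * s^-1)^2 + r^2 * (1 - s^-1^2) by lra.
by rewrite addr_ge0 ?sqr_ge0// mulr_ge0 ?sqr_ge0// subr_ge0 expr_le1.
Qed.

Lemma dcirc_le A k r : dcirc A k r <= (`|A| + `|r|)^2.
Proof.
rewrite /dcirc; set s := sqrt (1 + k^2).
have s1 : 1 <= s by rewrite -[X in X <= _]sqrtr1 ler_wsqrtr// lerDl sqr_ge0.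
have v1 : s^-1 <= 1 by rewrite invf_le1// (lt_le_trans ltr01).
have v0 : 0 <= s^-1 by rewrite invr_ge0 (le_trans ler01).
have h : - (A * r) * s^-1 <= `|A| * `|r|.
 apply: (le_trans (ler_norm _)); rewrite normrM normrN normrM (ger0_norm v0) ler_piMr//.
by rewrite sqrrD !real_normK ?num_real//; lra.
Qed.

(** Pairing the antipodal points [r] and [- r] removes the square root and leaves a product of the
    form that [log_kernel] integrates. *)
Lemma dcirc_prod A k r :
 dcirc A k r * dcirc A k (- r) = ((A^2 + r^2)^2 * k^2 + (A^2 - r^2)^2) / (1 + k^2).
Proof.
have s2 : sqrt (1 + k^2)^2 = 1 + k^2 by rewrite sqr_sqrtr// ltW.
have sn : sqrt (1 + k^2) != 0 by rewrite gt_eqF// sqrtr_gt0.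
rewrite /dcirc; move: sn s2; move: (sqrt _) => s sn s2.
have k2 : k^2 = s^2 - 1 by lra.
by rewrite k2 [1 + _]addrC subrK; field.
Qed.

Lemma ln_sqr (x : R) : 0 < x -> ln (x^2) = 2 * ln x.
Proof. by move=> x0; rewrite lnXn//; ring. Qed.

(** Mean of the logarithm over a circle: [log_kernel] with [a = A^2 + r^2] and [b = |A^2 - r^2|],
    whose half-sum is the maximum of the squares. The constant [c] dominates the logarithm of every
    distance and keeps the integrand nonnegative. *)
Lemma circle_mean (A r c : R) : r != 0 -> ln ((`|A| + `|r|)^2) <= 2 * c ->
 (\int[leb]_k ((1 + k^2)^-1 * ((c - ln (dcirc A k r) / 2) + (c - ln (dcirc A k (- r)) / 2)))%:E =
 (2 * pi * (c - ln (Num.max (A^2) (r^2)) / 2))%:E)%E.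
Proof.
move=> r0 hc.
pose a := A^2 + r^2; pose b := `|A^2 - r^2|.
have r2 : 0 < r^2 by rewrite lt_def sqr_ge0 sqrf_eq0 r0.
have a0 : 0 < a by rewrite ltr_wpDl ?sqr_ge0.
have b0 : 0 <= b by exact: normr_ge0.
have ba : b <= a by rewrite ler_norml /a; have := sqr_ge0 A; lra.
have ab2 : (a + b) / 2 = Num.max (A^2) (r^2) by rewrite maxr_absE.
have lna : ln (a^2) <= 4 * c.
 rewrite ln_sqr//; suff : ln a <= 2 * c by lra.
 apply: le_trans hc; rewrite ler_ln ?posrE//; last first.
  by rewrite exprn_gt0// ltr_wpDl// normr_gt0.
 rewrite sqrrD !real_normK ?num_real// lerD2r lerDl//.
pose I k : R := (1 + k^2)^-1 * (ln (a^2) + ln (1 + k^2) - ln (a^2 * k^2 + b^2)).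
have mI : mble I by rewrite /I; meas.
have P k : k != 0 -> 0 < a^2 * k^2 + b^2.
 move=> k0; have k2 : 0 < k^2 by rewrite lt_def sqr_ge0 sqrf_eq0 k0.
 by rewrite ltr_wpDr ?sqr_ge0// mulr_gt0// exprn_gt0.
have I0 k : k != 0 -> 0 <= I k.
 move=> k0; rewrite mulr_ge0 ?invr_ge0 ?(ltW (onek k))// -lnM ?posrE ?exprn_gt0// subr_ge0.
 have b2 : b^2 <= a^2 by rewrite lerXn2r ?nnegrE// ltW.
 by rewrite ler_ln ?posrE ?mulr_gt0 ?P//; lra.
transitivity (\int[leb]_k ((2 * c - ln (a^2) / 2)%:E * ((1 + k^2)^-1)%:E +
  2^-1%:E * (Num.max 0 (I k))%:E))%E.
 apply: (@eq_int_off R 0); [by rewrite /dcirc; meas|by meas|].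
 move=> k k0; have Pk := P k k0.
 have := dcirc_prod A k r; rewrite -/a -[(A^2 - r^2)^2]real_normK ?num_real// -/b => E.
 have pp : 0 < dcirc A k r * dcirc A k (- r) by rewrite E divr_gt0.
 have d1 : 0 < dcirc A k r by rewrite lt_def dcirc_ge0 andbT; apply: contraTneq pp => ->; rewrite mul0r ltxx.
 have d2 : 0 < dcirc A k (- r) by rewrite lt_def dcirc_ge0 andbT; apply: contraTneq pp => ->; rewrite mulr0 ltxx.
 have L : ln (dcirc A k r) + ln (dcirc A k (- r)) = ln (a^2 * k^2 + b^2) - ln (1 + k^2) by rewrite -lnM// E ln_div ?posrE.
 rewrite (max_r (I0 k k0)); congr EFin.
 have -> : c - ln (dcirc A k r) / 2 + (c - ln (dcirc A k (- r)) / 2) =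
  2 * c - (ln (dcirc A k r) + ln (dcirc A k (- r))) / 2 by lra.
 by rewrite L /I; field.
have m0 k : 0 <= Num.max 0 (I k) by rewrite le_max lexx.
have c0 : 0 <= 2 * c - ln (a^2) / 2 by lra.
have v0 k : 0 <= (1 + k^2)^-1 by pos.
rewrite ge0_integralD; [|isd|by move=> k _; rewrite -EFinM lee_fin mulr_ge0|isd|by move=> k _; rewrite -EFinM lee_fin mulr_ge0|isd].
rewrite ge0_integralZl; [|isd..].
rewrite ge0_integralZl; [|isd..].
rewrite int_cauchy (_ : (\int[leb]_k (Num.max 0 (I k))%:E = \int[leb]_k (I k)%:E)%E); last first.
 by apply: (@eq_int_off R 0); [by meas|by meas|move=> k k0; rewrite (max_r (I0 k k0))].
rewrite log_kernel// ab2 ln_sqr//; congr EFin; lra.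
Qed.

End LogKernel.

Section Newton.
Variable R : realType.
Local Notation leb := (@lebesgue_measure R).
Local Notation mu2 := (leb2 R).
Local Notation plane := (plane R).
Implicit Types (x y : plane) (f c : R -> R).

Lemma half_inj (X Y : \bar R) : (0 <= X)%E -> (X + X = 2%:E * Y)%E -> X = Y.
Proof.
move=> X0 XY; have : (2%:E * X = 2%:E * Y)%E.
 by rewrite EFinD ge0_muleDl// mul1e.
by move=> /(congr1 (fun z => 2^-1%:E * z)%E); rewrite !muleA -!EFinM mulVf ?mul1e.
Qed.

Lemma newton_axis (A : R) f c : mble f -> mble c ->
 (forall q, 0 <= f q) -> (forall q, 0 <= c q) ->
 (forall r, ln ((`|A| + `|r|)^2) <= 2 * c (r^2)) ->
 (\int[mu2]_y (f (nsq y) * (c (nsq y) - ln (dsq (A, 0%R) y) / 2))%:E =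
 \int[mu2]_y (f (nsq y) * (c (nsq y) - ln (Num.max (A^2) (nsq y)) / 2))%:E)%E.
Proof.
move=> mf mc f0 c0 hc.
have onek k : 0 < 1 + k^2 :> R by rewrite ltr_pwDl ?sqr_ge0.
have s2 k : sqrt (1 + k^2)^2 = 1 + k^2 :> R by rewrite sqr_sqrtr// ltW.
have le (r u : R) : 0 <= u -> u <= (`|A| + `|r|)^2 -> 0 <= c (r^2) - ln u / 2.
 rewrite le_eqVlt => /predU1P[<-|u0] ule; first by rewrite ln0// mul0r subr0.
 have : ln u <= ln ((`|A| + `|r|)^2) by rewrite ler_ln ?posrE// (lt_le_trans u0).
 by have := hc r; lra.
have nsqE (k r : R) : nsq (r / sqrt (1 + k^2), k * r / sqrt (1 + k^2)) = r^2.
 rewrite /nsq !expr_div_n s2; field.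
 by rewrite gt_eqF.
have dsqE (k r : R) : dsq (A, 0) (r / sqrt (1 + k^2), k * r / sqrt (1 + k^2)) = dcirc A k r.
 rewrite /dsq /dcirc -(nsqE k r) /nsq /=; ring.
have nsqS (y : plane) : nsq y = sqrt (nsq y)^2 by rewrite sqr_sqrtr ?nsq_ge0.
have dsq_le y : dsq (A, 0) y <= (`|A| + `|sqrt (nsq y)|)^2.
 rewrite sqrrD !real_normK ?num_real// sqr_sqrtr ?nsq_ge0// [`|sqrt _|]ger0_norm//.
 have : - (A * y.1) <= `|A| * sqrt (nsq y).
  apply: (le_trans (ler_norm _)); rewrite normrN normrM ler_wpM2l// -sqrtr_sqr ler_wsqrtr//.
  by rewrite lerDl sqr_ge0.
 by rewrite /dsq /nsq /=; lra.
have dsq_ge0 (x y : plane) : 0 <= dsq x y by rewrite addr_ge0 ?sqr_ge0.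
have max_le (r : R) : Num.max (A^2) (r^2) <= (`|A| + `|r|)^2.
 rewrite ge_max sqrrD !real_normK ?num_real//.
 have := mulr_ge0 (normr_ge0 A) (normr_ge0 r); have := sqr_ge0 A; have := sqr_ge0 r.
 lra.
have max_ge0 (r : R) : 0 <= Num.max (A^2) (r^2) by rewrite le_max sqr_ge0.
pose P k r : R := (1 + k^2)^-1 * `|r| * (f (r^2) * (c (r^2) - ln (dcirc A k r) / 2)).
pose Q k r : R := (1 + k^2)^-1 * `|r| * (f (r^2) * (c (r^2) - ln (Num.max (A^2) (r^2)) / 2)).
have P0 k r : 0 <= P k r.
 rewrite mulr_ge0//; first by rewrite mulr_ge0// invr_ge0 ltW.
 by rewrite mulr_ge0// le ?dcirc_ge0 ?dcirc_le.
have Q0 k r : 0 <= Q k r.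
 rewrite mulr_ge0//; first by rewrite mulr_ge0// invr_ge0 ltW.
 by rewrite mulr_ge0// le.
have mPT : mble (fun z : R * R => P z.2 z.1) by rewrite /P /dcirc; meas.
have mQT : mble (fun z : R * R => Q z.2 z.1) by rewrite /Q; meas.
have -> : (\int[mu2]_y (f (nsq y) * (c (nsq y) - ln (dsq (A, 0%R) y) / 2))%:E =
  \int[leb]_r \int[leb]_k (P k r)%:E)%E.
 rewrite int_polar; [|by meas|]; last first.
  by move=> y; rewrite lee_fin mulr_ge0// {1}nsqS le//.
 rewrite [RHS](@tonelli R _ _ _ _ leb leb (fun r k => (P k r)%:E)); [|exact: mfun_EFin|by move=> r k; rewrite lee_fin].
 by apply: eq_integral => k _; apply: eq_integral => r _; rewrite nsqE dsqE.
have -> : (\int[mu2]_y (f (nsq y) * (c (nsq y) - ln (Num.max (A^2) (nsq y)) / 2))%:E =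
  \int[leb]_r \int[leb]_k (Q k r)%:E)%E.
 rewrite int_polar; [|by meas|]; last first.
  by move=> y; rewrite lee_fin mulr_ge0// nsqS le.
 rewrite [RHS](@tonelli R _ _ _ _ leb leb (fun r k => (Q k r)%:E)); [|exact: mfun_EFin|by move=> r k; rewrite lee_fin].
 by apply: eq_integral => k _; apply: eq_integral => r _; rewrite nsqE.
have iP r : (0 <= \int[leb]_k (P k r)%:E)%E by pos.
have iQ r : (0 <= \int[leb]_k (Q k r)%:E)%E by pos.
have miP : mble (fun r => \int[leb]_k (P k r)%:E)%E by apply: (@mfun_int_line R _ _ (fun r k => (P k r)%:E)); [exact: mfun_EFin|move=> r k; rewrite lee_fin].
have miQ : mble (fun r => \int[leb]_k (Q k r)%:E)%E by apply: (@mfun_int_line R _ _ (fun r k => (Q k r)%:E)); [exact: mfun_EFin|move=> r k; rewrite lee_fin].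
have miPN : mble (fun r : R => \int[leb]_k (P k (- r)%R)%:E)%E by apply: (measurableT_comp miP).
apply: half_inj; first by apply: integral_ge0 => r _; exact: iP.
rewrite -{2}(int_opp miP iP) -ge0_integralD//.
rewrite -ge0_integralZl; [|isd..].
apply: (@eq_int_off R 0).
- exact: mfun_eadd.
- by apply: mfun_emul => //.
move=> r r0.
have mPr s : mble (fun k => P k s) by rewrite /P /dcirc; meas.
rewrite -ge0_integralD; [|isd|isd|exact: (mfun_EFin (mPr r))
 |isd|exact: (mfun_EFin (mPr (- r)))].
have w0 : 0 <= `|r| * f (r^2) by pos.
transitivity ((`|r| * f (r^2))%:E * \int[leb]_k ((1 + k^2)^-1 *
  ((c (r^2) - ln (dcirc A k r) / 2) + (c (r^2) - ln (dcirc A k (- r)) / 2)))%:E)%E.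
 rewrite -ge0_integralZl; [|isd|by rewrite /dcirc; meas| |isd].
  apply: eq_integral => k _; rewrite -EFinD; congr EFin.
  by rewrite /P normrN sqrrN; ring.
 move=> k _; rewrite lee_fin mulr_ge0 ?invr_ge0 ?(ltW (onek k))// addr_ge0// le ?dcirc_ge0 ?dcirc_le//.
 by have := dcirc_le A k (- r); rewrite normrN.
rewrite circle_mean// /Q.
transitivity (2%:E * ((`|r| * f (r^2) * (c (r^2) - ln (Num.max (A^2) (r^2)) / 2))%:E *
 \int[leb]_k ((1 + k^2)^-1)%:E))%E.
 by rewrite int_cauchy; congr EFin; ring.
congr (_ * _)%E; rewrite -ge0_integralZl; [|isd|isd|by move=> k _; rewrite lee_fin invr_ge0 ltW|].
 by apply: eq_integral => k _; congr EFin; ring.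
by rewrite lee_fin mulr_ge0// le.
Qed.

(** A rotation brings [x] onto the first axis. The compensator [c] again keeps both integrands
    nonnegative, so that the identity makes sense without integrability of the logarithm. *)
Lemma newton x f c : mble f -> mble c ->
 (forall q, 0 <= f q) -> (forall q, 0 <= c q) ->
 (forall y, ln ((sqrt (nsq x) + sqrt (nsq y))^2) <= 2 * c (nsq y)) ->
 (\int[mu2]_y (f (nsq y) * (c (nsq y) - ln (dsq x y) / 2))%:E =
 \int[mu2]_y (f (nsq y) * (c (nsq y) - ln (Num.max (nsq x) (nsq y)) / 2))%:E)%E.
Proof.
move=> mf mc f0 c0 hc; pose A := sqrt (nsq x).
have A2 : A^2 = nsq x by rewrite sqr_sqrtr ?nsq_ge0.
have [C [S [CS xE]]] : exists C S, C^2 + S^2 = 1 /\ x = (A * C, A * S).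
 have [A0|A0] := eqVneq A 0.
  exists 1, 0; split; first by rewrite expr1n expr0n addr0.
  have := A2; rewrite A0 expr0n => /esym/eqP; rewrite paddr_eq0 ?sqr_ge0// !sqrf_eq0.
  by case: (x) => a b /= /andP[/eqP-> /eqP->]; rewrite !mul0r.
 exists (x.1 / A), (x.2 / A); split.
  by rewrite !expr_div_n -mulrDl A2 -/(nsq x) divff// -A2 sqrf_eq0.
 by rewrite !mulrA ![A * _]mulrC !mulfK// -surjective_pairing.
have dle y : dsq x y <= (sqrt (nsq x) + sqrt (nsq y))^2.
 rewrite sqrrD !sqr_sqrtr ?nsq_ge0//.
 have : - dotp x y <= sqrt (nsq x) * sqrt (nsq y).
  apply: (le_trans (ler_norm _)); rewrite normrN -sqrtr_sqr -sqrtrM ?nsq_ge0// ler_wsqrtr//.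
  exact: dotp_sqr.
 by rewrite /dsq /nsq /dotp; lra.
have i0 y : 0 <= f (nsq y) * (c (nsq y) - ln (dsq x y) / 2).
 rewrite mulr_ge0//; have := c0 (nsq y); have := hc y; have := dle y.
 have [d0|d0] := leP (dsq x y) 0; first by rewrite (ln0 d0) mul0r subr0.
 move=> h1; have : ln (dsq x y) <= ln ((sqrt (nsq x) + sqrt (nsq y))^2).
  by rewrite ler_ln ?posrE// (lt_le_trans d0).
 by lra.
rewrite -[LHS](@int_plane_affine R C (- S) S C 0 0); last 3 first.
- by rewrite mulNr opprK CS normr1.
- by meas.
- by [].
have O (y : plane) : nsq (C * y.1 + - S * y.2 + 0, S * y.1 + C * y.2 + 0) = nsq y by rewrite -[RHS]mul1r -CS /nsq /=; ring.
have D (y : plane) : dsq x (C * y.1 + - S * y.2 + 0, S * y.1 + C * y.2 + 0) = dsq (A, 0) y.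
 have -> : dsq (A, 0) y = (C^2 + S^2) * dsq (A, 0) y by rewrite CS mul1r.
 have [x1 x2] : x.1 = A * C /\ x.2 = A * S by rewrite xE.
 by rewrite /dsq x1 x2 /=; ring.
under eq_integral do rewrite O D.
rewrite -A2 newton_axis//.
move=> r; have := hc (r, 0); rewrite /nsq /= expr0n addr0 -/A sqrtr_sqr.
by rewrite (ger0_norm (sqrtr_ge0 _)).
Qed.

End Newton.

(** * The mass function of a radial density *)

Section RadialMass.
Variable R : realType.
Local Notation leb := (@lebesgue_measure R).
Local Notation mu2 := (leb2 R).
Local Notation plane := (plane R).
Implicit Types (x y : plane) (p q : R).
Variables (v : R -> R) (lam : R).
Hypotheses (mv : mble v) (v2 : (\int[mu2]_x (v (nsq x)^2)%:E = lam%:E)%E).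

Lemma int_half (f : R -> R) :
 (\int[leb]_(q in `]0%R, +oo[) (f q)%:E = \int[leb]_q (ind (0 < q)%R * f q)%:E)%E.
Proof.
rewrite integral_mkcond; apply: eq_integral => q _.
by rewrite patchE mem_setE in_itv/=; case: (0 < q); rewrite ?mul1r ?mul0r.
Qed.

Lemma int_radial_half (f : R -> R) : mble f -> (forall q, 0 <= f q) ->
 (\int[mu2]_x (f (nsq x))%:E = \int[leb]_q (pi * (ind (0 < q)%R * f q))%:E)%E.
Proof.
move=> mf f0; rewrite (@int_radial R (fun q => (f q)%:E)); [|exact: mfun_EFin|by move=> q; rewrite lee_fin].
rewrite int_half -ge0_integralZl; [by []|isd|isd|by move=> q _; rewrite lee_fin mulr_ge0|].
by pos.
Qed.

Definition rmass q : R := fine (\int[leb]_p (pi * (ind ((0 < p) && (p < q)) * v p^2))%:E)%E.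

Let lam0 : 0 <= lam.
by rewrite -lee_fin -v2; apply: integral_ge0 => x _; rewrite lee_fin sqr_ge0. Qed.

Lemma total_rmass : (\int[leb]_p (pi * (ind (0 < p)%R * v p^2))%:E = lam%:E)%E.
Proof. by rewrite -(@int_radial_half (fun p => v p^2)); [|meas|move=> q; exact: sqr_ge0]. Qed.

Lemma rmass_le_total q :
 (\int[leb]_p (pi * (ind ((0 < p) && (p < q)) * v p^2))%:E <= lam%:E)%E.
Proof.
rewrite -total_rmass; apply: le_int_real; try by meas.
 by pos.
move=> p; rewrite ler_wpM2l ?pi_ge0// ler_wpM2r ?sqr_ge0// ler_nat.
by case: (0 < p); case: (p < q).
Qed.

Lemma rmassE q : (\int[leb]_p (pi * (ind ((0 < p) && (p < q)) * v p^2))%:E = (rmass q)%:E)%E.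
Proof.
rewrite fineK// ge0_fin_numE; first exact: le_lt_trans (rmass_le_total q) (ltry _).
by pos.
Qed.

Lemma rmass_ge0 q : 0 <= rmass q.
Proof.
rewrite -lee_fin -rmassE; apply: integral_ge0 => p _.
by pos.
Qed.

Lemma rmass_le q : rmass q <= lam.
Proof. by rewrite -lee_fin -rmassE; exact: rmass_le_total. Qed.

Lemma mfun_rmass : mble rmass.
Proof.
by rewrite /rmass; meas; move=> *; rewrite lee_fin mulr_ge0 ?pi_ge0// mulr_ge0// sqr_ge0.
Qed.

(* By symmetry both orderings of [nsq x] and [nsq y] contribute equally. *)
Lemma max_law (g : R -> R) : mble g -> (forall q, 0 <= g q) ->
 (\int[mu2]_x \int[mu2]_y (v (nsq x)^2 * v (nsq y)^2 * g (Num.max (nsq x) (nsq y)))%:E =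
 (2 * pi)%:E * \int[leb]_q (ind (0 < q)%R * (g q * (rmass q * v q^2)))%:E)%E.
Proof.
move=> mg g0; have mr := mfun_rmass.
pose r q : R := ind (0 < q) * v q^2.
have mrr : mble r by rewrite /r; meas.
have r0 q : 0 <= r q by rewrite mulr_ge0// sqr_ge0.
pose K q p : R := pi * (r q * (pi * (r p * g (Num.max q p)))).
have K0 q p : 0 <= K q p by rewrite mulr_ge0 ?pi_ge0// mulr_ge0// mulr_ge0 ?pi_ge0// mulr_ge0.
have KC q p : K q p = K p q by rewrite /K maxC; ring.
transitivity (\int[leb]_q \int[leb]_p (K q p)%:E)%E.
 pose H q := (\int[leb]_p (pi * (ind (0 < p)%R * (v q^2 * v p^2 * g (Num.max q p))))%:E)%E.
 have H0' q p : 0 <= pi * (ind (0 < p) * (v q^2 * v p^2 * g (Num.max q p))) by pos.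
 have H0 q : (0 <= H q)%E by apply: integral_ge0 => p _; rewrite lee_fin.
 have mH : mble H by apply: mfun_int_line; [by meas|by move=> q p; rewrite lee_fin].
 transitivity (\int[mu2]_x H (nsq x))%E.
  apply: eq_integral => x _.
  apply: (@int_radial_half (fun p => v (nsq x)^2 * v p^2 * g (Num.max (nsq x) p))); first by meas.
  by pos.
 rewrite (int_radial mH H0).
 transitivity (\int[leb]_(q in `]0%R, +oo[) (pi%:E * H q))%E.
  rewrite ge0_integralZl; [by []|isd|exact: measurable_funTS|by move=> q _; exact: H0|].
  by pos.
 rewrite integral_mkcond; apply: eq_integral => q _.
 rewrite patchE mem_setE in_itv/= andbT /K /r; case: (ltP 0 q) => q0; last first.
  by rewrite integral0_eq// => p _; rewrite !mul0r mulr0.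
 rewrite -ge0_integralZl; [|isd..].
 by apply: eq_integral => p _; congr EFin; rewrite mul1r; ring.
pose A q p : R := K q p * ind (p < q).
have A0 q p : 0 <= A q p by rewrite mulr_ge0.
have mA : mble (fun z : R * R => A z.1 z.2) by rewrite /A /K; meas.
have mAT : mble (fun z : R * R => A z.2 z.1) by rewrite /A /K; meas.
have mA1 q : mble (fun p => A q p) by rewrite /A /K; meas.
have mA2 q : mble (fun p => A p q) by rewrite /A /K; meas.
have -> : (\int[leb]_q \int[leb]_p (K q p)%:E =
  \int[leb]_q \int[leb]_p (A q p)%:E + \int[leb]_q \int[leb]_p (A p q)%:E)%E.
 rewrite -ge0_integralD; last 5 first.
 - by [].
 - by pos.
 - by apply: mfun_int_line; [exact: mfun_EFin|move=> q p; rewrite lee_fin].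
 - by pos.
 - by apply: (@mfun_int_line R _ _ (fun q p => (A p q)%:E)); [exact: mfun_EFin|move=> q p; rewrite lee_fin].
 apply: eq_integral => q _; rewrite -ge0_integralD; last 5 first.
 - by [].
 - by pos.
 - exact: (mfun_EFin (mA1 q)).
 - by pos.
 - exact: (mfun_EFin (mA2 q)).
 apply: (@eq_int_off R q).
 - by rewrite /K; meas.
 - by apply: mfun_eadd; [exact: (mfun_EFin (mA1 q))|exact: (mfun_EFin (mA2 q))].
 move=> p pq; rewrite -EFinD; congr EFin; rewrite /A (KC p q).
 by case: (ltgtP p q) pq => //= _ _; rewrite mulr1 mulr0 ?addr0 ?add0r.
have -> : (\int[leb]_q \int[leb]_p (A p q)%:E = \int[leb]_q \int[leb]_p (A q p)%:E)%E by rewrite (@tonelli R _ _ _ _ leb leb (fun q p => (A p q)%:E)); [|exact: mfun_EFin|move=> q p; rewrite lee_fin].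
have i0 q : 0 <= ind (0 < q) * (g q * (rmass q * v q^2)) by rewrite mulr_ge0// mulr_ge0// mulr_ge0 ?rmass_ge0 ?sqr_ge0.
have -> : (\int[leb]_q \int[leb]_p (A q p)%:E = pi%:E * \int[leb]_q (ind (0 < q)%R * (g q * (rmass q * v q^2)))%:E)%E.
 rewrite -ge0_integralZl; [|isd..].
 apply: eq_integral => q _.
 transitivity (\int[leb]_p ((pi * (r q * g q))%:E * (pi * (ind ((0 < p) && (p < q)) * v p^2))%:E))%E.
  apply: eq_integral => p _; rewrite -EFinM; congr EFin; rewrite /A /K {2}/r.
  case: (ltP p q) => pq; last by rewrite andbF mul0r !mulr0.
  by rewrite andbT /=; ring.
 rewrite ge0_integralZl; [|isd|isd| |].
 - by rewrite rmassE; congr EFin; rewrite /r; ring.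
 - by pos.
 - by pos.
rewrite -ge0_muleDl ?lee_fin ?pi_ge0//; congr (_%:E * _)%E; ring.
Qed.

(** The case [g = 1] of [max_law], where the left side is the square of the total mass. *)
Lemma rmass_int : (\int[leb]_q (ind (0 < q)%R * (rmass q * v q^2))%:E = (lam^2 / (2 * pi))%:E)%E.
Proof.
have := @max_law (fun=> 1) (measurable_cst _) (fun=> ler01).
have -> : (\int[mu2]_x \int[mu2]_y (v (nsq x)^2 * v (nsq y)^2 * 1)%:E = (lam^2)%:E)%E.
 transitivity (\int[mu2]_x (lam%:E * (v (nsq x)^2)%:E))%E.
  apply: eq_integral => x _; rewrite -v2 -ge0_integralZr; [|isd|isd| |].
  - by apply: eq_integral => y _; rewrite mulr1 mulrC.
  - by pos.
  - by pos.
 rewrite ge0_integralZl; [by rewrite v2 -EFinM|isd..].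
have -> : (\int[leb]_q (ind (0 < q)%R * (1 * (rmass q * v q^2)))%:E =
  \int[leb]_q (ind (0 < q)%R * (rmass q * v q^2))%:E)%E by apply: eq_integral => q _; rewrite mul1r.
have p2 : 2 * pi != 0 :> R by rewrite mulf_neq0// gt_eqF// pi_gt0.
move=> /(congr1 (fun z => ((2 * pi)^-1)%:E * z)%E); rewrite muleA -!EFinM mulVf// mul1e => <-.
by rewrite mulrC.
Qed.

End RadialMass.

Section LogPotential.
Variable R : realType.
Local Notation leb := (@lebesgue_measure R).
Local Notation mu2 := (leb2 R).
Local Notation plane := (plane R).
Implicit Types (x y : plane) (p q L : R).
Variables (w : plane -> R) (lam T : R).
Hypotheses (mw : mble w) (w0 : forall x, 0 <= w x).
Hypothesis w2 : (\int[mu2]_x (w x^2)%:E = lam%:E)%E.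
Local Notation v := (vst w).
Hypothesis small : forall a : R, 0 < a -> a <= 1 ->
 (\int[leb]_(q in `]0%R, +oo[) (v q^2 * ind (q < a)%R)%:E <= (sqrt a * (T + lam) / pi)%:E)%E.

Let ell q : R := ln (1 + sqrt q).
Hypothesis log_moment : (\int[mu2]_x (ell (nsq x) * w x^2)%:E < +oo)%E.

Let mv : mble v := mfun_vst mw.
Let v2 : (\int[mu2]_x (v (nsq x)^2)%:E = lam%:E)%E := vst_L2 mw w0 w2.
Let lam0 : 0 <= lam := lam_ge0 w2.
Let M := rmass v.
Let mM : mble M := mfun_rmass mv.
Let M0 q : 0 <= M q := rmass_ge0 mv v2 q.
Let Mle q : M q <= lam := rmass_le mv v2 q.

Let ell0 q : 0 <= ell q.
by rewrite ln_ge0// lerDl. Qed.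
Let mell : mble ell. by rewrite /ell; meas. Qed.

Lemma rmass_small q : 0 < q -> q <= 1 -> M q <= sqrt q * (T + lam).
Proof.
move=> q0 q1; have := small q0 q1; rewrite int_half => h.
rewrite -lee_fin -(rmassE mv v2).
have -> : (\int[leb]_p (pi * (ind ((0 < p) && (p < q)) * v p^2))%:E =
  pi%:E * \int[leb]_p (ind (0 < p)%R * (v p^2 * ind (p < q)%R))%:E)%E.
 rewrite -ge0_integralZl; [|isd|isd| |isd].
  apply: eq_integral => p _; rewrite -EFinM; congr EFin; congr (_ * _).
  by rewrite -mulnb; ring.
 by pos.
have pi0 : 0 < pi :> R := pi_gt0 R.
have : (pi%:E * \int[leb]_p (ind (0 < p)%R * (v p^2 * ind (p < q)%R))%:E <=
 pi%:E * (sqrt q * (T + lam) / pi)%:E)%E by rewrite lee_pmul2l//.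
by rewrite -EFinM (mulrC pi) divfK// gt_eqF.
Qed.

(** The weight [ln (1 + sqrt q)] increases with the radius, so by the bathtub principle
    rearrangement does not increase the logarithmic moment. *)
Lemma star_log_moment :
 (\int[leb]_q (ind (0 < q)%R * (ell q * v q^2))%:E < +oo)%E.
Proof.
have m2 : mble (fun s : R => 2 * s) by meas.
have p2 (s : R) : 0 < s -> 0 <= 2 * s by lra.
have ellm p p' : 0 <= p -> p <= p' -> ell p <= ell p'.
 move=> p0 pp; rewrite ler_ln ?posrE// lerD2l ler_wsqrtr//.
have := @cake_bathtub R w mw (level_fin mw w2) (level_bound mw w2) _ m2 p2 ell mell ell0 ellm.
have -> : (\int[mu2]_x (cake (fun s : R => (2 * s)%R) (v (nsq x)) * (ell (nsq x))%:E) =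
  \int[mu2]_x (ell (nsq x) * v (nsq x)^2)%:E)%E by apply: eq_integral => x _; rewrite cake_sqr ?vst_ge0// mulrC.
have -> : (\int[mu2]_x (cake (fun s : R => (2 * s)%R) (w x) * (ell (nsq x))%:E) =
  \int[mu2]_x (ell (nsq x) * w x^2)%:E)%E by apply: eq_integral => x _; rewrite cake_sqr// mulrC.
move=> h; have {h} := le_lt_trans h log_moment.
rewrite (@int_radial_half R (fun q => ell q * v q^2)); [|by meas|by move=> q; rewrite mulr_ge0 ?sqr_ge0].
have -> : (\int[leb]_q (pi * (ind (0 < q)%R * (ell q * v q^2)))%:E =
  pi%:E * \int[leb]_q (ind (0 < q)%R * (ell q * v q^2))%:E)%E.
 rewrite -ge0_integralZl; [by []|isd|isd|by move=> q _; rewrite lee_fin mulr_ge0// mulr_ge0 ?sqr_ge0|].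
 by pos.
case: (\int[leb]_q (ind (0 < q)%R * (ell q * v q^2))%:E)%E => [r||]; rewrite ?ltry//.
by rewrite gt0_muley// lte_fin pi_gt0.
Qed.

Lemma vsq_fin : (\int[leb]_q (ind (0 < q)%R * v q^2)%:E < +oo)%E.
Proof. by rewrite -int_half (int_vsq mv v2) ltry. Qed.

(** Near 0 the factor [sqrt q] of [rmass_small] absorbs [ln q]; beyond 1 the mass is at most [lam]
    and [ln q] is at most twice [ell q]. *)
Lemma abs_log_le q : 0 < q -> M q * `|ln q| <= 2 * `|T + lam| + 2 * lam * ell q.
Proof.
move=> q0; have s0 : 0 < sqrt q by rewrite sqrtr_gt0.
have lnq : ln q = 2 * ln (sqrt q) by rewrite -ln_sqr// sqr_sqrtr// ltW.
have [q1|q1] := leP q 1.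
 have s1 : sqrt q <= 1 by rewrite -sqrtr1 ler_wsqrtr.
 have l0 : ln (sqrt q) <= 0 by rewrite ln_le0.
 have h : - ln (sqrt q) <= (sqrt q)^-1.
  rewrite -lnV//; have := @le_ln1Dx R ((sqrt q)^-1 - 1).
  have v1 : 1 <= (sqrt q)^-1 by rewrite invf_ge1.
  by rewrite addrCA subrr addr0 => /(_ _)h; lra.
 apply: (@le_trans _ _ (2 * `|T + lam|)); last by rewrite lerDl !mulr_ge0.
 rewrite lnq normrM ger0_norm// (ler0_norm l0) mulrCA ler_wpM2l//.
 apply: (@le_trans _ _ (sqrt q * `|T + lam| * (sqrt q)^-1)); last first.
  by rewrite mulrAC divff ?mul1r// gt_eqF.
 rewrite ler_pM ?oppr_ge0//; apply: (le_trans (rmass_small q0 q1)).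
 by rewrite ler_wpM2l ?ler_norm//.
have l0 : 0 <= ln q by rewrite ln_ge0// ltW.
rewrite (ger0_norm l0).
apply: (@le_trans _ _ (2 * lam * ell q)); last by rewrite lerDr.
rewrite lnq mulrCA -mulrA ler_wpM2l// ler_pM//.
 lra.
by rewrite ler_ln ?posrE// ?lerDr//.
Qed.

Lemma log_density_intble :
 leb.-integrable setT (fun q => (ind (0 < q)%R * (ln q * (M q * v q^2)))%:E).
Proof.
apply: (@intble_le _ _ R leb _ (fun q => (2 * `|T + lam|) * (ind (0 < q)%R * v q^2) +
 (2 * lam) * (ind (0 < q)%R * (ell q * v q^2)))).
- by meas.
- by meas.
- move=> q; case: (ltP 0 q) => q0; rewrite ?mul0r ?normr0 ?mulr0// !mul1r.
 rewrite normrM normrM (ger0_norm (M0 q)) (ger0_norm (sqr_ge0 _)).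
 have := ler_wpM2r (sqr_ge0 (v q)) (abs_log_le q0).
 have -> : `|ln q| * (M q * v q^2) = M q * `|ln q| * v q^2 by lra.
 suff -> : 2 * `|T + lam| * v q^2 + 2 * lam * (ell q * v q^2) = (2 * `|T + lam| + 2 * lam * ell q) * v q^2 by [].
 by ring.
have i1 := vsq_fin; have i2 := star_log_moment.
rewrite (_ : (\int[leb]_x _)%E = ((2 * `|T + lam|)%:E * \int[leb]_q (ind (0 < q)%R * v q^2)%:E +
 (2 * lam)%:E * \int[leb]_q (ind (0 < q)%R * (ell q * v q^2))%:E)%E); last first.
 rewrite -ge0_integralZl; [|isd|isd|isd|by rewrite lee_fin mulr_ge0].
 rewrite -ge0_integralZl; [|isd|isd| |by rewrite lee_fin mulr_ge0]; last first.
  by pos.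
 rewrite -ge0_integralD; [by []|isd| |isd| |isd].
  by pos.
 by pos.
by rewrite lte_add_pinfty// lte_mul_pinfty// lee_fin mulr_ge0.
Qed.

(** The positive part of [ln (L / |x - y|)], written as a superposition over [s] of the kernels
    [|x - y| < L exp (- s)], to each of which Riesz's inequality applies. *)
Definition klog L x y : \bar R :=
 (\int[leb]_s (ind ((0 < s) && (dsq x y < L^2 * expR (- (2 * s)))))%:E)%E.

Let mklog L : mble (fun z : plane * plane => klog L z.1 z.2).
by rewrite /klog; meas. Qed.

Lemma klog_ge0 L x y : (0 <= klog L x y)%E.
Proof. by apply: integral_ge0 => s _. Qed.

Lemma klog_layers L (f : plane -> R) : mble f -> (forall x, 0 <= f x) ->
 (\int[mu2]_x \int[mu2]_y ((f x * f y)%:E * klog L x y) =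
 \int[leb]_s (\int[mu2]_x \int[mu2]_y
  (f x * f y * ind ((0 < s) && (dsq x y < L^2 * expR (- (2 * s)))))%:E))%E.
Proof.
move=> mf f0.
pose F s x y : R := f x * f y * ind ((0 < s) && (dsq x y < L^2 * expR (- (2 * s)))).
have F0 s x y : 0 <= F s x y by rewrite mulr_ge0// mulr_ge0.
rewrite (@tonelli_line_plane R (fun s x => \int[mu2]_y (F s x y)%:E)%E); last 2 first.
- by rewrite /F; meas; move=> *; rewrite lee_fin F0.
- by pos.
apply: eq_integral => x _.
rewrite (@tonelli_line_plane R (fun s y => (F s x y)%:E)); [|by rewrite /F; meas|by move=> s y; rewrite lee_fin].
apply: eq_integral => y _; rewrite -ge0_integralZl; [by []|isd|isd|isd|].
by pos.
Qed.

Lemma klog_riesz L :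
 (\int[mu2]_x \int[mu2]_y ((w x^2 * w y^2)%:E * klog L x y) <=
 \int[mu2]_x \int[mu2]_y ((v (nsq x)^2 * v (nsq y)^2)%:E * klog L x y))%E.
Proof.
rewrite (@klog_layers L (fun x => w x^2)); [|by meas|by move=> x; exact: sqr_ge0].
rewrite (@klog_layers L (fun x => v (nsq x)^2)); [|by meas|by move=> x; exact: sqr_ge0].
have i0 (f : plane -> R) s x y : 0 <= f x^2 * f y^2 * ind ((0 < s) && (dsq x y < L^2 * expR (- (2 * s)))) by pos.
apply: ge0_le_integral; first exact: measurableT.
- by pos.
- by meas; pos.
- by meas; pos.
move=> s _; case: (0 < s) => /=.
 exact: (vst_riesz_sqr mw w0 w2 (L^2 * expR (- (2 * s)))).
rewrite integral0_eq; last by move=> x _; rewrite integral0_eq// => y _; rewrite mulr0.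
by pos.
Qed.

(** Also true on the diagonal, where [ln 0 = 0] by convention while [klog] is infinite. *)
Lemma klog_lower L x y : 1 <= L -> ((ln L - ln (dsq x y) / 2)%:E <= klog L x y)%E.
Proof.
move=> L1; have L0 : 0 < L by rewrite (lt_le_trans ltr01).
set m := ln L - _; have [m0|m0] := leP m 0; first by rewrite (le_trans _ (klog_ge0 L x y)).
rewrite -(int_itv_ind (ltW m0)); apply: le_int_real; try by meas.
move=> s; rewrite ler_nat; case: (ltP 0 s) => //= s0; case: ltP => //= sm.
rewrite lt0b; have [d0|d0] := leP (dsq x y) 0.
 by rewrite (le_lt_trans d0)// mulr_gt0 ?exprn_gt0 ?expR_gt0.
rewrite -[X in X < _](lnK d0) -[X in _ < X * _]lnK ?posrE ?exprn_gt0// -expRD ltr_expR ln_sqr//.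
by move: sm; rewrite /m; lra.
Qed.

Lemma klog_off L x y : 1 <= L -> 0 < dsq x y -> klog L x y = (Num.max 0 (ln L - ln (dsq x y) / 2))%:E.
Proof.
move=> L1 d0; have L0 : 0 < L by rewrite (lt_le_trans ltr01).
set m := ln L - _; have m0 : 0 <= Num.max 0 m by rewrite le_max lexx.
rewrite -(int_itv_ind m0); apply: eq_integral => s _; congr (ind _)%:E.
case: (ltP 0 s) => //= s0; rewrite lt_max ltNge (ltW s0) /=.
rewrite -[X in X < _](lnK d0) -[X in _ < X * _]lnK ?posrE ?exprn_gt0// -expRD ltr_expR ln_sqr//.
by rewrite /m; lra.
Qed.

Lemma eq_int_off_point x (f g : plane -> \bar R) : mble f -> mble g ->
 (forall y, 0 <= f y)%E -> (forall y, 0 <= g y)%E -> (forall y, 0 < dsq x y -> f y = g y) ->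
 (\int[mu2]_y f y = \int[mu2]_y g y)%E.
Proof.
move=> mf mg f0 g0 fg; rewrite -(int_plane_shift x mf f0) -(int_plane_shift x mg g0).
apply: eq_int_off0 => //; try by meas.
move=> z z0; apply: fg; rewrite (_ : dsq x _ = nsq z)//.
by rewrite /dsq /nsq /=; ring.
Qed.

(** The middle term pays for dropping the positive part in the truncated kernel, as Newton's theorem
    requires, and tends to 0 as [L] grows. *)
Definition glog L q : R := ln L + 2 * ln (1 + sqrt q / L) - ln q / 2.

Lemma glog_ge0 L q : 1 <= L -> 0 <= glog L q.
Proof.
move=> L1; have L0 : 0 < L by rewrite (lt_le_trans ltr01).
have l0 : 0 <= ln L by rewrite ln_ge0.
rewrite /glog; have [q0|q0] := leP q 0.
 by rewrite (ler0_sqrtr q0) mul0r addr0 ln1 mulr0 addr0 (ln0 q0) mul0r subr0.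
have s0 : 0 < sqrt q by rewrite sqrtr_gt0.
have lnq : ln q = 2 * ln (sqrt q) by rewrite -ln_sqr// sqr_sqrtr// ltW.
have p : 0 < sqrt q / L by rewrite divr_gt0.
have h : ln (sqrt q) = ln (sqrt q / L) + ln L by rewrite ln_div// subrK.
have : ln (sqrt q / L) <= ln (1 + sqrt q / L) by rewrite ler_ln ?posrE ?addr_gt0// lerDr.
have : 0 <= ln (1 + sqrt q / L) by rewrite ln_ge0// lerDl ltW.
lra.
Qed.

Lemma star_potential L : 1 <= L ->
 (\int[mu2]_x \int[mu2]_y ((v (nsq x)^2 * v (nsq y)^2)%:E * klog L x y) <=
 (2 * pi)%:E * \int[leb]_q (ind (0 < q)%R * (glog L q * (M q * v q^2)))%:E)%E.
Proof.
move=> L1; have L0 : 0 < L by rewrite (lt_le_trans ltr01).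
have l0 : 0 <= ln L by rewrite ln_ge0.
have mg : mble (glog L) by rewrite /glog; meas.
rewrite -(max_law mv v2 mg (fun q => glog_ge0 q L1)).
have mkl := mklog L.
have i0 (x y : plane) : 0 <= v (nsq x)^2 * v (nsq y)^2 * glog L (Num.max (nsq x) (nsq y)) by rewrite mulr_ge0 ?glog_ge0// mulr_ge0 ?sqr_ge0.
apply: ge0_le_integral; first exact: measurableT.
- by move=> x _; apply: integral_ge0 => y _; rewrite mule_ge0 ?klog_ge0// lee_fin mulr_ge0 ?sqr_ge0.
- apply: mfun_int_plane; last by move=> *; rewrite mule_ge0 ?klog_ge0// lee_fin mulr_ge0 ?sqr_ge0.
 by meas.
- by [meas|move=> *; rewrite lee_fin i0].
move=> x _.
(* With [m] the larger of the two radii, [L (1 + m / L)^2 >= 2 m] dominates [|x - y|], so this [c]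
   is an admissible compensator in [newton]. *)
pose c p : R := ln L + 2 * ln (1 + sqrt (Num.max (nsq x) p) / L).
have c0 p : 0 <= c p by rewrite addr_ge0// mulr_ge0// ln_ge0// lerDl divr_ge0// ltW.
have mc : mble c by rewrite /c; meas.
pose f p : R := v (nsq x)^2 * v p^2.
have f0 p : 0 <= f p by rewrite mulr_ge0 ?sqr_ge0.
have mf : mble f by rewrite /f; meas.
have hc y : ln ((sqrt (nsq x) + sqrt (nsq y))^2) <= 2 * c (nsq y).
 pose m := sqrt (Num.max (nsq x) (nsq y)).
 have m0 : 0 <= m by exact: sqrtr_ge0.
 have m1 : sqrt (nsq x) <= m by rewrite ler_wsqrtr// le_max lexx.
 have m2 : sqrt (nsq y) <= m by rewrite ler_wsqrtr// le_max lexx orbT.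
 have a0 := sqrtr_ge0 (nsq x); have b0 := sqrtr_ge0 (nsq y).
 have [z|z] := leP (sqrt (nsq x) + sqrt (nsq y)) 0.
  have -> : sqrt (nsq x) + sqrt (nsq y) = 0 by lra.
  by rewrite expr0n ln0// mulr_ge0.
 have P : 0 < 1 + m / L by rewrite ltr_pwDl// divr_ge0// ltW.
 have P2 : 0 < (1 + m / L)^2 by rewrite exprn_gt0.
 rewrite ln_sqr// ler_wpM2l// /c -/m -ln_sqr// -lnM// ler_ln ?posrE// ?mulr_gt0//.
 have -> : L * (1 + m / L)^2 = L + 2 * m + m^2 / L by field; rewrite gt_eqF.
 have : 0 <= m^2 / L by rewrite divr_ge0 ?sqr_ge0// ltW.
 by lra.
have nt := newton mf mc f0 c0 hc.
have -> : (\int[mu2]_y (v (nsq x)^2 * v (nsq y)^2 * glog L (Num.max (nsq x) (nsq y)))%:E =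
  \int[mu2]_y (f (nsq y) * (c (nsq y) - ln (dsq x y) / 2))%:E)%E by [].
rewrite (@eq_int_off_point x _ (fun y => (f (nsq y) * Num.max 0 (ln L - ln (dsq x y) / 2))%:E)); first last.
- by move=> y d0; rewrite klog_off//.
- by move=> y; rewrite lee_fin mulr_ge0// le_max lexx.
- by move=> y; rewrite mule_ge0 ?klog_ge0// lee_fin mulr_ge0 ?sqr_ge0.
- by meas.
- have mk := measurable_fun_pair2 x mkl.
 by [by meas|exact: mk].
have clog y : Num.max 0 (ln L - ln (dsq x y) / 2) <= c (nsq y) - ln (dsq x y) / 2.
 rewrite ge_max; apply/andP; split; last first.
  by rewrite lerD2r lerDl mulr_ge0// ln_ge0// lerDl divr_ge0// ltW.
 have [z|z] := leP (dsq x y) 0; first by rewrite (ln0 z) mul0r subr0.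
 have : ln (dsq x y) <= ln ((sqrt (nsq x) + sqrt (nsq y))^2).
  have le : dsq x y <= (sqrt (nsq x) + sqrt (nsq y))^2.
   rewrite sqrrD !sqr_sqrtr ?nsq_ge0//.
   have : - dotp x y <= sqrt (nsq x) * sqrt (nsq y).
    apply: (le_trans (ler_norm _)); rewrite normrN -sqrtr_sqr -sqrtrM ?nsq_ge0// ler_wsqrtr//.
    exact: dotp_sqr.
   by rewrite /dsq /nsq /dotp; lra.
  by rewrite ler_ln ?posrE// (lt_le_trans z).
 by have := hc y; lra.
apply: le_int_real.
- by meas.
- by meas.
- by move=> y; rewrite mulr_ge0// le_max lexx.
- by move=> y; rewrite ler_wpM2l.
Qed.
Let Il : R := fine (\int[mu2]_x (ell (nsq x) * w x^2)%:E)%E.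

Let IlE : (\int[mu2]_x (ell (nsq x) * w x^2)%:E = Il%:E)%E.
rewrite fineK// ge0_fin_numE//; apply: integral_ge0 => x _.
by pos.
Qed.
(** A nonnegative substitute for [- ln |x - y|], by [|x - y| <= (1 + |x|) (1 + |y|)]; the added
    logarithmic moments are finite and are subtracted at the end. *)
Let Z x y : R := ell (nsq x) + ell (nsq y) - ln (dsq x y) / 2.

Let Z0 x y : 0 <= Z x y.
have e1 := ell0 (nsq x); have e2 := ell0 (nsq y); rewrite /Z.
have [z|z] := leP (dsq x y) 0; first by rewrite (ln0 z) mul0r subr0 addr_ge0.
have a0 := sqrtr_ge0 (nsq x); have b0 := sqrtr_ge0 (nsq y).
suff : ln (dsq x y) <= 2 * (ell (nsq x) + ell (nsq y)) by lra.
rewrite -lnM ?posrE// -ln_sqr// ler_ln ?posrE//.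
have h : - dotp x y <= sqrt (nsq x) * sqrt (nsq y).
 apply: (le_trans (ler_norm _)); rewrite normrN -sqrtr_sqr -sqrtrM ?nsq_ge0// ler_wsqrtr//.
 exact: dotp_sqr.
have := sqr_sqrtr (nsq_ge0 x); have := sqr_sqrtr (nsq_ge0 y).
have -> : dsq x y = nsq x + nsq y - 2 * dotp x y by rewrite /dsq /nsq /dotp; ring.
move: h a0 b0; move: (sqrt (nsq x)) (sqrt (nsq y)) (dotp x y) => a b c h a0 b0 hb ha.
have ab := mulr_ge0 a0 b0.
apply: (@le_trans _ _ ((a + b)^2)); first by nra.
by rewrite lerXn2r ?nnegrE; lra.
Qed.
Let D x y : R := w x^2 * w y^2.
Let mD : mble (fun z : plane * plane => D z.1 z.2). by rewrite /D; meas. Qed.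
Let D0 x y : 0 <= D x y. by rewrite mulr_ge0 ?sqr_ge0. Qed.
Let mZ : mble (fun z : plane * plane => Z z.1 z.2). by rewrite /Z; meas. Qed.
Let S := (\int[mu2]_x \int[mu2]_y (D x y * Z x y)%:E)%E.

Let row_mass x : (\int[mu2]_y (D x y)%:E = (w x^2 * lam)%:E)%E.
rewrite EFinM -w2 -ge0_integralZl; [by []|isd..].
Qed.
Let row_ell x : (\int[mu2]_y (D x y * (ell (nsq x) + ell (nsq y)))%:E =
 (w x^2 * (ell (nsq x) * lam + Il))%:E)%E.
transitivity (\int[mu2]_y ((w x^2 * ell (nsq x))%:E * (w y^2)%:E + (w x^2)%:E * (ell (nsq y) * w y^2)%:E))%E.
 by apply: eq_integral => y _; congr EFin; rewrite /D; ring.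
rewrite ge0_integralD; [|isd..].
rewrite ge0_integralZl; [|isd..].
rewrite ge0_integralZl; [|isd..].
by rewrite w2 IlE; congr EFin; ring.
Qed.
Let total_mass : (\int[mu2]_x \int[mu2]_y (D x y)%:E = (lam^2)%:E)%E.
under eq_integral do rewrite row_mass mulrC EFinM.
rewrite ge0_integralZl; [by rewrite w2 -EFinM|isd..].
Qed.
Let total_ell : (\int[mu2]_x (w x^2 * (ell (nsq x) * lam + Il))%:E = (2 * lam * Il)%:E)%E.
have Il0 : 0 <= Il by rewrite -lee_fin -IlE; pos.
transitivity (\int[mu2]_x (lam%:E * (ell (nsq x) * w x^2)%:E + Il%:E * (w x^2)%:E))%E.
 by apply: eq_integral => x _; congr EFin; ring.
rewrite ge0_integralD; [|isd..].
rewrite ge0_integralZl; [|isd..].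
rewrite ge0_integralZl; [|isd..].
by rewrite w2 IlE; congr EFin; ring.
Qed.

Definition log_energy : R := Rintegral leb setT (fun q => ind (0 < q)%R * (ln q * (M q * v q^2))).

(** The error of the truncation at [L = n + 1]; it is dominated by the logarithmic moment of [v]. *)
Let tail n : R := Rintegral leb setT (fun q => ind (0 < q)%R * (ln (1 + sqrt q / n.+1%:R) * (M q * v q^2))).

Let lnn0 n q : 0 <= ln (1 + sqrt q / n.+1%:R) :> R.
by rewrite ln_ge0// lerDl divr_ge0 ?sqrtr_ge0. Qed.
Let tail_bound n q : `|ind (0 < q)%R * (ln (1 + sqrt q / n.+1%:R) * (M q * v q^2))| <=
 lam * (ind (0 < q)%R * (ell q * v q^2)).
have s0 := sqrtr_ge0 q; have := M0 q => m0; have v20 := sqr_ge0 (v q).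
rewrite ger0_norm; last by pos.
case: (0 < q); rewrite ?mul0r ?mulr0// !mul1r mulrA [leRHS]mulrA ler_wpM2r// [leRHS]mulrC ler_pM//.
have d1 : sqrt q / n.+1%:R <= sqrt q by rewrite ler_piMr// invf_le1// ler1n.
by rewrite ler_ln ?posrE// lerD2l.
Qed.
Let lam_ell_fin : (\int[leb]_q (lam * (ind (0 < q)%R * (ell q * v q^2)))%:E < +oo)%E.
rewrite (_ : (\int[leb]_x _)%E = (lam%:E * \int[leb]_q (ind (0 < q)%R * (ell q * v q^2))%:E)%E).
 by rewrite lte_mul_pinfty ?star_log_moment.
by rewrite -ge0_integralZl; [|isd..].
Qed.
Let tail_intble n :
 leb.-integrable setT (fun q => (ind (0 < q)%R * (ln (1 + sqrt q / n.+1%:R) * (M q * v q^2)))%:E).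
apply: (@intble_le _ _ R leb _ (fun q => lam * (ind (0 < q)%R * (ell q * v q^2)))).
- by meas.
- by meas.
- exact: tail_bound.
- exact: lam_ell_fin.
Qed.
Let tail_cvg : tail n @[n --> \oo] --> (0 : R).
have := @dominated_real _ _ _ leb (fun n q => ind (0 < q)%R * (ln (1 + sqrt q / n.+1%:R) * (M q * v q^2)))
 (fun=> 0) _ _ _ _ tail_bound _ lam_ell_fin.
rewrite integral0 => h.
have {}h : (tail n)%:E @[n --> \oo] --> (0 : R)%:E.
 have -> : (fun n => (tail n)%:E) = (fun n => \int[leb]_q
   (ind (0 < q)%R * (ln (1 + sqrt q / n.+1%:R) * (M q * v q^2)))%:E)%E by apply/funext => n; rewrite int_RintE//.
 apply: h; [by move=> n; meas|by meas| |by meas].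
 move=> q; rewrite -[X in _ --> X](mulr0 (ind (0 < q)%R)); apply: cvgM; first exact: cvg_cst.
 rewrite -[X in _ --> X](mul0r (M q * v q^2)); apply: cvgM; last exact: cvg_cst.
 rewrite -[X in _ --> X](ln1 R); apply: continuous_cvg; first by apply: continuous_ln; exact: ltr01.
 rewrite -[X in _ --> X](addr0 (1 : R)); apply: cvgD; first exact: cvg_cst.
 rewrite -[X in _ --> X](mulr0 (sqrt q)); apply: cvgM; first exact: cvg_cst.
 exact: cvg_harmonic.
by move/fine_cvgP: h => [].
Qed.
Let glog_energy n :
 (\int[leb]_q (ind (0 < q)%R * (glog n.+1%:R q * (M q * v q^2)))%:E =
 (ln n.+1%:R * (lam^2 / (2 * pi)) + (2 * tail n - log_energy / 2))%:E)%E.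
have i1 : leb.-integrable setT (fun q => (ind (0 < q)%R * (M q * v q^2))%:E).
 apply: intble_real; first by meas.
  by pos.
 by rewrite (rmass_int mv v2) ltry.
have i2 := tail_intble n; have i3 := log_density_intble.
pose g q : R := 2 * (ind (0 < q)%R * (ln (1 + sqrt q / n.+1%:R) * (M q * v q^2))) +
 (- 2^-1) * (ind (0 < q)%R * (ln q * (M q * v q^2))).
have i4 : leb.-integrable setT (fun q => (g q)%:E).
 exact: (integrableD measurableT (integrableZl measurableT 2 i2) (integrableZl measurableT (- 2^-1) i3)).
have Eg : Rintegral leb setT g = 2 * tail n - log_energy / 2 by rewrite /Rintegral (int_lin _ _ i2 i3) /=; rewrite /tail /log_energy; ring.
have := int_lin (ln n.+1%:R) 1 i1 i4.
have -> : Rintegral leb setT (fun q => ind (0 < q)%R * (M q * v q^2)) = lam^2 / (2 * pi) by rewrite /Rintegral (rmass_int mv v2).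
rewrite Eg mul1r => <-; apply: eq_integral => q _; congr EFin.
by rewrite /g /glog; ring.
Qed.
(** [ln L * lam^2] is added so that [klog] dominates the kernel. The same amount reappears in the
    bound of [star_potential], because [2 pi] times the integral of [M v^2] is [lam^2], and
    cancels. *)
Let S_step n : (S <= (2 * lam * Il + 4 * pi * tail n - pi * log_energy)%:E)%E.
have L1 : 1 <= n.+1%:R :> R by rewrite ler1n.
have l0 : 0 <= ln n.+1%:R :> R by rewrite ln_ge0.
have pi0 : 0 < pi :> R := pi_gt0 R.
have Il0 : 0 <= Il by rewrite -lee_fin -IlE; pos.
have mkl := mklog n.+1%:R.
have mDZ : mble (fun z : plane * plane => D z.1 z.2 * Z z.1 z.2) by exact: (mfun_mul mD mZ).
have mDc : mble (fun z : plane * plane => ln n.+1%:R * D z.1 z.2) by meas.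
have e1 : (\int[mu2]_x \int[mu2]_y (D x y * Z x y + ln n.+1%:R * D x y)%:E = S + (ln n.+1%:R * lam^2)%:E)%E.
 rewrite (int2D mDZ mDc); [|by move=> x y; rewrite mulr_ge0|by move=> x y; rewrite mulr_ge0].
 by rewrite (int2Z l0 mD)// total_mass.
have dk0 x y : (0 <= (D x y)%:E * klog n.+1%:R x y)%E by rewrite mule_ge0 ?klog_ge0 ?lee_fin.
have de0 x y : 0 <= D x y * (ell (nsq x) + ell (nsq y)) by pos.
have mdk : mble (fun z : plane * plane => ((D z.1 z.2)%:E * klog n.+1%:R z.1 z.2)%E) by meas.
have mdkx x : mble (fun y => ((D x y)%:E * klog n.+1%:R x y)%E) := measurable_fun_pair2 x mdk.
have mDx x : mble (D x) := measurable_fun_pair2 x mD.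
have e2 : (\int[mu2]_x \int[mu2]_y (D x y * Z x y + ln n.+1%:R * D x y)%:E <=
  (2 * lam * Il)%:E + \int[mu2]_x \int[mu2]_y ((D x y)%:E * klog n.+1%:R x y))%E.
 rewrite -total_ell -ge0_integralD; [|isd| |isd| |]; first last.
 - by apply: mfun_int_plane.
 - by move=> x _; apply: integral_ge0.
 - by pos.
 apply: ge0_le_integral; first exact: measurableT.
 - by pos.
 - apply: mfun_int_plane; first by apply: mfun_EFin; exact: mfun_add.
  by pos.
 - by apply: mfun_eadd; [meas|exact: mfun_int_plane].
 move=> x _; rewrite -row_ell; have mDx' := mDx x.
 rewrite -ge0_integralD; [|isd|isd|isd|by move=> y _|exact: mdkx].
 have mZx : mble (Z x) := measurable_fun_pair2 x mZ.
 apply: ge0_le_integral; first exact: measurableT.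
 - by pos.
 - by meas.
 - by apply: mfun_eadd; [meas|exact: mdkx].
 move=> y _; apply: (@le_trans _ _ ((D x y * (ell (nsq x) + ell (nsq y)))%:E + (D x y)%:E * (ln n.+1%:R - ln (dsq x y) / 2)%:E)%E).
  by rewrite lee_fin /Z; lra.
 by apply: leeD2l; apply: lee_wpmul2l; rewrite ?lee_fin ?klog_lower.
have := le_trans (klog_riesz n.+1%:R) (star_potential L1).
rewrite glog_energy -EFinM => e3.
have := le_trans e2 (leeD2l (2 * lam * Il)%:E e3); rewrite e1 -leeBrDr// -EFinB => h.
apply: (le_trans h); rewrite lee_fin le_eqVlt; apply/orP; left; apply/eqP.
have pn : pi != 0 :> R by rewrite gt_eqF.
have E : 2 * pi * (lam^2 / (2 * pi)) = lam^2 :> R by rewrite mulrCA divff ?mulr1// mulf_neq0.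
move: E; move: (lam^2 / (2 * pi)) => z <-.
by field.
Qed.

Lemma S_bound : (S <= (2 * lam * Il - pi * log_energy)%:E)%E.
Proof.
have h : (fun n => 2 * lam * Il + 4 * pi * tail n - pi * log_energy) @ \oo --> 2 * lam * Il - pi * log_energy.
 have -> : 2 * lam * Il - pi * log_energy = 2 * lam * Il + 4 * pi * 0 - pi * log_energy by lra.
 apply: cvgB; last exact: cvg_cst.
 apply: cvgD; first exact: cvg_cst.
 by apply: cvgM; [exact: cvg_cst|exact: tail_cvg].
have S0 : (0 <= S)%E by apply: integral_ge0 => x _; apply: integral_ge0 => y _; rewrite lee_fin mulr_ge0.
have := S_step 0%N; case E : S => [s||]//; last by move: S0; rewrite E.
move=> _; rewrite lee_fin.
apply: (@ler_cvg_to _ _ _ _ (fun=> s) _ _ _ (@cvg_cst _ _ _ _ _) h).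
by apply: nearW => n; have := S_step n; rewrite E.
Qed.
Let H x y : R := ln (eucl (x - y)) * w x^2 * w y^2.

Let HE x y : H x y = 1 * (D x y * (ell (nsq x) + ell (nsq y))) + (- 1) * (D x y * Z x y).
have -> : H x y = ln (dsq x y) / 2 * (w x^2 * w y^2).
 rewrite /H (_ : eucl (x - y) = sqrt (dsq x y))// -mulrA; congr (_ * _).
 have [d0|d0] := leP (dsq x y) 0; first by rewrite ler0_sqrtr// !ln0// mul0r.
 rewrite -[dsq x y in RHS]sqr_sqrtr ?(ltW d0)// ln_sqr ?sqrtr_gt0//.
 by lra.
by rewrite /D /Z; ring.
Qed.
Let mH : mble (fun z : plane * plane => H z.1 z.2).
rewrite (_ : (fun _ => _) = (fun z : plane * plane => 1 * (D z.1 z.2 * (ell (nsq z.1) + ell (nsq z.2))) + (- 1) * (D z.1 z.2 * Z z.1 z.2))).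
 by meas.
by apply/funext => z.
Qed.
Let mHint : mble (fun x => Rintegral mu2 setT (H x)).
rewrite (_ : (fun _ => _) = (fun x => fine (\int[mu2]_y (Num.max (H x y) 0)%:E - \int[mu2]_y (Num.max (- H x y) 0)%:E)%E)).
 apply: (@measurableT_comp _ _ _ _ _ _ fine); first exact: (fine_measurable measurableT).
 apply: emeasurable_funB; apply: mfun_int_plane.
 - by meas.
 - by move=> x y; rewrite lee_fin le_max lexx orbT.
 - by meas.
 - by move=> x y; rewrite lee_fin le_max lexx orbT.
apply/funext => x; rewrite /Rintegral integralE; congr fine; congr (_ - _)%E.
 by apply: eq_integral => y _; rewrite funeposE EFin_max.
by apply: eq_integral => y _; rewrite funenegE EFin_max.
Qed.

(** [H] is a difference of two nonnegative kernels of finite total integral, hence integrable in [y]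
    for almost every [x]. The iterated integral is thus [2 lam Il - S], and [S_bound] applies. *)
Lemma log_potential : pi * log_energy <= Rintegral mu2 setT (fun x => Rintegral mu2 setT (H x)).
Proof.
pose J x := (\int[mu2]_y (D x y * Z x y)%:E)%E.
have J0 x : (0 <= J x)%E by apply: integral_ge0 => y _; rewrite lee_fin mulr_ge0.
have mDZ : mble (fun z : plane * plane => D z.1 z.2 * Z z.1 z.2) by exact: (mfun_mul mD mZ).
have mDZx x : mble (fun y => D x y * Z x y) := measurable_fun_pair2 x mDZ.
have mDx x : mble (D x) := measurable_fun_pair2 x mD.
have mJ : mble J by apply: mfun_int_plane; [meas|move=> x y; rewrite lee_fin mulr_ge0].
have Sfin : (S < +oo)%E by rewrite (le_lt_trans S_bound) ?ltry.
have iJ : mu2.-integrable setT J by apply/integrableP; under eq_integral do rewrite gee0_abs//.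
have aeJ := integrable_ae measurableT iJ.
have Il0 : 0 <= Il by rewrite -lee_fin -IlE; pos.
pose A x : R := w x^2 * (ell (nsq x) * lam + Il).
have A0 x : 0 <= A x by rewrite mulr_ge0 ?sqr_ge0// addr_ge0// mulr_ge0.
have iA : mu2.-integrable setT (fun x => (A x)%:E) by apply: intble_real => //; [rewrite /A; meas|rewrite total_ell ltry].
have mfJ : mble (fun x => fine (J x)).
 exact: (@measurableT_comp _ _ _ _ _ _ fine _ _ (fine_measurable measurableT) mJ).
have SJ : (\int[mu2]_x (fine (J x))%:E = S)%E.
 apply: ae_eq_integral => //; first by meas.
 case: aeJ => B [mB B0 sB]; exists B; split => // x hx; apply: sB => /= h; apply: hx => _.
 by rewrite fineK//; exact: h.
have ifJ : mu2.-integrable setT (fun x => (fine (J x))%:E) by apply: intble_real => //; [move=> x; exact: fine_ge0|rewrite SJ].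
have EH : (\int[mu2]_x (Rintegral mu2 setT (H x))%:E = \int[mu2]_x (1 * A x + (-1) * fine (J x))%:E)%E.
 apply: ae_eq_integral => //; [exact: (mfun_EFin mHint)|by rewrite /A; meas|].
 case: aeJ => B [mB B0 sB]; exists B; split => // x hx; apply: sB => /= h; apply: hx => _.
 have {}h := h I.
 have jx : mu2.-integrable setT (fun y => (D x y * Z x y)%:E).
  apply: intble_real; [exact: mDZx|by move=> y; rewrite mulr_ge0|by rewrite ltey_eq h].
 have ax : mu2.-integrable setT (fun y => (D x y * (ell (nsq x) + ell (nsq y)))%:E).
  apply: intble_real; first by have mDx' := mDx x; meas.
   by pos.
  by rewrite row_ell ltry.
 congr EFin; rewrite {1}/Rintegral.
 under eq_integral do rewrite HE.
 by rewrite (int_lin _ _ ax jx) {1}/Rintegral row_ell.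
rewrite {1}/Rintegral EH (int_lin _ _ iA ifJ) {1}/Rintegral total_ell /= {1}/Rintegral SJ.
have := S_bound; have : (S \is a fin_num)%E.
 rewrite ge0_fin_numE//; apply: integral_ge0 => x _; exact: J0.
by case: S => // s _; rewrite lee_fin /=; lra.
Qed.

End LogPotential.


(** * The ground state as a radial ODE system *)

Section DeriveRules.
Variable R : realType.
Implicit Types (f g : R -> R) (x df dg : R).

Lemma der_eq f x df dg : derives x f df -> df = dg -> derives x f dg.
Proof. by move=> h <-. Qed.

Lemma der_cst x (c : R) : derives x (fun=> c) 0.
Proof. exact: is_derive_cst. Qed.

Lemma der_id x : derives x (fun y : R => y) 1.
Proof. exact: is_derive_id. Qed.

Lemma der_add f g x df dg : derives x f df -> derives x g dg ->
 derives x (fun y => f y + g y) (df + dg).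
Proof. by exact: is_deriveD. Qed.

Lemma der_opp f x df : derives x f df -> derives x (fun y => - f y) (- df).
Proof. by exact: is_deriveN. Qed.

Lemma der_mul f g x df dg : derives x f df -> derives x g dg ->
 derives x (fun y => f y * g y) (df * g x + f x * dg).
Proof.
move=> hf hg; have h := @is_deriveM R (R : normedModType R) f g x (1 : R) _ _ hf hg.
by apply: (der_eq h); rewrite addrC; rewrite mulrC.
Qed.

Lemma der_sqr f x df : derives x f df ->
 derives x (fun y => f y^2) (2 * f x * df).
Proof.
move=> hf; have := der_mul hf hf.
by rewrite (_ : (fun y => f y * f y) = (fun y => f y^2))// => h; apply: (der_eq h); ring.
Qed.

Lemma der_inv f x df : f x != 0 -> derives x f df ->
 derives x (fun y => (f y)^-1) (- df / f x^2).
Proof.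
move=> nz hf; apply: (der_eq (@is_deriveV R f x _ _ nz hf)).
by rewrite /GRing.scale /=; ring.
Qed.

Lemma der_ln f x df : 0 < f x -> derives x f df ->
 derives x (fun y => ln (f y)) (df / f x).
Proof.
move=> p hf; apply: (der_eq (@is_derive1_comp R (@ln R) f x _ _ (is_derive1_ln p) hf)).
by rewrite mulrC.
Qed.

Lemma der_sqrt f x df : 0 < f x -> derives x f df ->
 derives x (fun y => sqrt (f y)) (df / (2 * sqrt (f x))).
Proof.
move=> p hf; apply: (der_eq (@is_derive1_comp R (@sqrt R) f x _ _ (is_derive1_sqrt p) hf)).
by rewrite mulrC.
Qed.

Lemma der_ln1 x : 0 < x -> derives x (@ln R) x^-1.
Proof. exact: is_derive1_ln. Qed.

Lemma der_sqrt1 x : 0 < x -> derives x sqrt (2 * sqrt x)^-1.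
Proof. exact: is_derive1_sqrt. Qed.

Lemma der_inv1 x : x != 0 -> derives x GRing.inv (- 1 / x^2).
Proof. by move=> x0; exact: (@der_inv id x 1 x0 (der_id x)). Qed.

Lemma der_mulk (k : R) x : derives x ( *%R k) k.
Proof.
have h : derives x (fun y => k * y) (0 * x + k * 1) by exact: der_mul (der_cst x k) (der_id x).
by apply: (der_eq h); rewrite mul0r add0r mulr1.
Qed.

End DeriveRules.

(** Differentiates by syntax with the derivative left as an existential variable; [derivs] then asks
    for the comparison with the expected derivative. Nonvanishing and positivity conditions become
    side goals. *)
Ltac deriv :=
 match goal with
 | H : is_derive ?x _ ?f _ |- is_derive ?x _ ?f _ => exact H
 | H : is_derive ?x _ ?f _ |- is_derive ?x _ (fun y => ?f y) _ => exact H
 | |- is_derive _ _ (fun y => ?c) _ => eapply der_cst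
 | |- is_derive _ _ (@ln _) _ => eapply der_ln1
 | |- is_derive _ _ sqrt _ => eapply der_sqrt1
 | |- is_derive _ _ GRing.inv _ => eapply der_inv1
 | |- is_derive _ _ (GRing.mul _) _ => eapply der_mulk
 | |- is_derive _ _ (fun y => y) _ => eapply der_id
 | |- is_derive _ _ (fun y => (@?f y) + (@?g y)) _ => eapply der_add; deriv
 | |- is_derive _ _ (fun y => - (@?f y)) _ => eapply der_opp; deriv
 | |- is_derive _ _ (fun y => (@?f y) * (@?g y)) _ => eapply der_mul; deriv
 | |- is_derive _ _ (fun y => (@?f y)^2) _ => eapply der_sqr; deriv
 | |- is_derive _ _ (fun y => (@?f y)^-1) _ => eapply der_inv; [|deriv]
 | |- is_derive _ _ (fun y => ln (@?f y)) _ => eapply der_ln; [|deriv]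
 | |- is_derive _ _ (fun y => sqrt (@?f y)) _ => eapply der_sqrt; [|deriv]
 | |- is_derive _ _ _ _ => idtac
 end.
Ltac derivs := eapply der_eq; [deriv; try done|cbv beta].

Section Infinity.
Variable R : realType.
Implicit Types (f g : R -> R) (a b c e l x : R).

Lemma cvgy_ge f l a c : f x @[x --> +oo] --> l -> (forall x, a <= x -> c <= f x) -> c <= l.
Proof.
move=> h fc; apply: (cvgr_to_ge h); near=> x; apply: fc.
by [].
Unshelve. all: by end_near. Qed.

Lemma cvgy_le f l a c : f x @[x --> +oo] --> l -> (forall x, a <= x -> f x <= c) -> l <= c.
Proof.
move=> h fc; apply: (cvgr_to_le h); near=> x; apply: fc.
by [].
Unshelve. all: by end_near. Qed.

Lemma cvgy0 f : (forall e, 0 < e -> exists b, forall x, b <= x -> `|f x| <= e) ->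
 f x @[x --> +oo] --> (0 : R).
Proof.
move=> h; apply/cvgrPdist_le => e e0; have [b hb] := h e e0.
near=> x; rewrite sub0r normrN; apply: hb.
by [].
Unshelve. all: by end_near. Qed.

Lemma cvgy_ex f l e : f x @[x --> +oo] --> l -> 0 < e -> exists b, forall x, b < x -> `|f x - l| <= e.
Proof.
move=> /cvgrPdist_le /(_ e) h /h [b [_ hb]]; exists b => x bx.
by rewrite distrC; exact: hb.
Qed.

Lemma cvgy0_bound f a c : 0 < a -> (forall x, a <= x -> `|f x| <= c / x) -> f x @[x --> +oo] --> (0 : R).
Proof.
move=> a0 h; apply: cvgy0 => e e0; exists (Num.max a (c / e)) => x.
rewrite ge_max => /andP[ax cx]; have x0 := lt_le_trans a0 ax.
by apply: (le_trans (h x ax)); rewrite ler_pdivrMr// mulrC -ler_pdivrMr.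
Qed.

Lemma cvgy_shift f g l a : (forall x, a <= x -> f x = g x) -> g x @[x --> +oo] --> l -> f x @[x --> +oo] --> l.
Proof.
move=> fg; apply: cvg_trans; apply: near_eq_cvg; near=> x; apply/esym; apply: fg.
by [].
Unshelve. all: by end_near. Qed.

End Infinity.

Section FirstExit.
Variable R : realType.
Implicit Types (f : R -> R) (a b c x y : R).

Lemma cont_near f x (e : R) : {for x, continuous f} -> 0 < e ->
 exists2 d, 0 < d & forall y, `|y - x| < d -> `|f y - f x| < e.
Proof.
move=> /cvgrPdist_lt h e0; have /nbhs_ballP[d d0 hd] := h e e0.
exists d => // y yd; rewrite distrC; apply: hd.
by rewrite /ball /= distrC.
Qed.

Lemma first_exit f a b c : a <= b -> (forall x, a <= x -> x <= b -> {for x, continuous f}) ->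
 f a < c -> c <= f b -> exists s, [/\ a < s, s <= b, c <= f s & forall x, a <= x -> x < s -> f x < c].
Proof.
move=> ab cf fa fb.
pose S := [set x | a <= x /\ x <= b /\ c <= f x].
have hS : has_inf S by split; [exists b|exists a => x []].
pose s := inf S.
have as_ : a <= s by apply: lb_le_inf; [exists b|move=> x []].
have sb : s <= b by apply: ge_inf => //; exists a => x [].
have pre x : a <= x -> x < s -> f x < c.
 move=> ax xs; rewrite ltNge; apply/negP => cx.
 have : s <= x by apply: ge_inf; [by exists a => y []|split => //; split => //; exact: ltW (lt_le_trans xs sb)].
 by lra.
have fs : c <= f s.
 rewrite leNgt; apply/negP => fs.
 have e0 : 0 < c - f s by lra.
 have [d d0 hd] := cont_near (cf s as_ sb) e0.
 have [x Sx xs] := inf_adherent d0 hS.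
 have sx : s <= x by apply: ge_inf => //; exists a => y [].
 have : `|x - s| < d by rewrite ger0_norm ?subr_ge0// ltrBlDl.
 move=> /hd; have [_ [_ cx]] := Sx; have := ler_norm (f x - f s); lra.
exists s; split => //; rewrite lt_neqAle as_ andbT; apply/eqP => E.
by move: fs; rewrite -E leNgt fa.
Qed.

End FirstExit.

Section RadialGround.
Variable R : realType.
Implicit Types p q s t c : R.
(* With q = |x|^2: E is the profile of u0, G = q E', and m(q) = 4 pi q W' is the mass of the disc |x|^2 < q. *)
Variables (E G w m : R -> R) (C0 : R).
Hypothesis dE : forall q, 0 < q -> derives q E (G q / q).
Hypothesis dG : forall q, 0 < q -> derives q G ((w q - 1) * E q / 4).
Hypothesis dw : forall q, 0 < q -> derives q w (m q / (4 * pi * q)).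
Hypothesis dm : forall q, 0 < q -> derives q m (pi * E q^2).
Hypothesis E_gt0 : forall q, 0 < q -> 0 < E q.
Hypothesis G_le0 : forall q, 0 < q -> G q <= 0.
Hypothesis G_neg : exists2 q, 0 < q & G q < 0.
Hypothesis E_lb : forall q, 0 < q -> q <= 1 -> 1 <= C0 * E q.
Hypothesis E_ub : forall q, 0 < q -> E q <= C0.
Hypothesis G_small : forall q, 0 < q -> q <= 1 -> - G q <= C0 * q.
Hypothesis m_small : forall q, 0 < q -> q <= 1 -> m q <= C0 * q.
Hypothesis m_gt0 : forall q, 0 < q -> 0 < m q.
Hypothesis w_ge0 : forall q, 0 < q -> 0 <= w q.
Hypothesis w_small : forall q, 0 < q -> q <= 1 -> w q <= C0 * q.

Let pi0 : 0 < pi :> R := pi_gt0 R.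
Let pin : pi != 0 :> R. by rewrite gt_eqF. Qed.

Definition gA q : R := - G q / E q.
Definition gF q : R := E q^2.
(** This is [q A' - A / 2], rewritten with the equation for [E], hence [q^(3/2)] times the
    derivative of [A / sqrt q]: its sign is the monotonicity that the Hardy weight needs. *)
Definition gzeta q : R := gA q^2 - gA q / 2 + q * (1 - w q) / 4.
(** A combination of Pohozaev type: its derivative is the kinetic energy density of the ground state
    divided by pi. Vanishing at 0 and tending to [N^2 / (8 pi^2)], it shows that this energy is
    [N^2 / (8 pi)]. *)
Definition gP q : R := 4 * (E q * G q) - (w q - 1) * (q * E q^2) + 4 * G q^2 + m q^2 / (8 * pi^2).
(** An explicit primitive of [m F ln q]; by Newton's theorem pi times its limit is the double
    integral of [ln |x - y|] against the ground state density. *)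
Definition gK q : R := m q^2 * ln q / (2 * pi) - 2 * (m q * w q) + 2 * m q + 8 * pi * (E q * G q) - 2 * pi * gP q.

Lemma gF_gt0 q : 0 < q -> 0 < gF q.
Proof. by move=> q0; rewrite exprn_gt0// E_gt0. Qed.

Lemma gA_ge0 q : 0 < q -> 0 <= gA q.
Proof. by move=> q0; rewrite divr_ge0 ?oppr_ge0 ?G_le0// ltW// E_gt0. Qed.

Lemma der_gF q : 0 < q -> derives q gF (- 2 * gA q * gF q / q).
Proof.
move=> q0; have h := dE q0; rewrite /gF.
derivs.
have qn : q != 0 by lra.
have En : E q != 0 by rewrite gt_eqF// E_gt0.
by rewrite /gA; field; rewrite qn.
Qed.

Lemma der_gA q : 0 < q -> derives q gA ((gzeta q + gA q / 2) / q).
Proof.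
move=> q0; have h := dE q0; have h2 := dG q0.
have qn : q != 0 by lra.
have En : E q != 0 by rewrite gt_eqF// E_gt0.
rewrite /gA; derivs.
by rewrite /gzeta /gA; field; rewrite qn.
Qed.

Lemma der_gFzeta q : 0 < q ->
 derives q (fun q => gF q * gzeta q) (gF q * (gzeta q / (2 * q) + (gA q / q - m q / (4 * pi)) / 4)).
Proof.
move=> q0; have h1 := der_gF q0; have h2 := der_gA q0; have h3 := dw q0.
have qn : q != 0 by lra.
have dz : derives q gzeta (((2 * gA q + 1 / 2) * gzeta q + gA q / 4 - q * m q / (16 * pi)) / q).
 rewrite /gzeta; derivs.
 by rewrite /gzeta; move: pi pin => p pn; field; rewrite qn.
derivs.
by move: pi pin => p pn; field; rewrite pn.
Qed.

Lemma der_gP q : 0 < q -> derives q gP (4 * gF q * gA q^2 / q).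
Proof.
move=> q0; have h1 := dE q0; have h2 := dG q0; have h3 := dw q0; have h4 := dm q0.
have qn : q != 0 by lra.
have En : E q != 0 by rewrite gt_eqF// E_gt0.
rewrite /gP; derivs.
by rewrite /gA /gF; move: pi pin => p pn; field; rewrite qn En.
Qed.

Lemma der_gK q : 0 < q -> derives q gK (m q * gF q * ln q).
Proof.
move=> q0; have h1 := dE q0; have h2 := dG q0; have h3 := dw q0; have h4 := dm q0; have h5 := der_gP q0.
have qn : q != 0 by lra.
have En : E q != 0 by rewrite gt_eqF// E_gt0.
rewrite /gK; derivs.
by rewrite /gA /gF; move: pi pin => p pn; field; rewrite qn En.
Qed.
(** The integrating factor [1 / sqrt q] removes the term in [zeta] from the derivative of
    [F * zeta]; only [D] remains. *)
Let Y q : R := gF q * gzeta q / sqrt q.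
Let D q : R := gA q / q - m q / (4 * pi).

Let dY q : 0 < q -> derives q Y (gF q * D q / (4 * sqrt q)).
move=> q0; have h1 := der_gFzeta q0; have s0 : 0 < sqrt q by rewrite sqrtr_gt0.
rewrite /Y; derivs; first by rewrite gt_eqF.
rewrite /D; move: (gF q) (gzeta q) (gA q) (m q) => f z a b.
move: (sqr_sqrtr (ltW q0)) s0; move: (sqrt q) => s <- s0.
by lra.
Qed.
Let dD q : 0 < q -> derives q D ((gzeta q - gA q / 2) / q^2 - gF q / 4).
move=> q0; have h1 := der_gA q0; have h2 := dm q0.
have qn : q != 0 by lra.
rewrite /D; derivs.
by rewrite -/(gF q); move: pi pin => p pn; field; rewrite qn.
Qed.
Let dAs q : 0 < q -> derives q (fun q => gA q / sqrt q) (Y q / (gF q * q)).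
move=> q0; have h1 := der_gA q0; have s0 : 0 < sqrt q by rewrite sqrtr_gt0.
have f0 := gF_gt0 q0.
derivs; first by rewrite gt_eqF.
rewrite /Y; move: (gF q) f0 (gzeta q) (gA q) => f f0 z a.
move: (sqr_sqrtr (ltW q0)) s0; move: (sqrt q) => s <- s0.
by field; rewrite !gt_eqF.
Qed.
Let C0_gt0 : 0 < C0.
have h := E_lb ltr01 (lexx 1); have e := E_gt0 ltr01.
by rewrite -(pmulr_lgt0 C0 e) (lt_le_trans ltr01).
Qed.
Let invE q : 0 < q -> q <= 1 -> (E q)^-1 <= C0.
by move=> q0 q1; rewrite -[leLHS]mul1r ler_pdivrMr ?E_gt0// E_lb. Qed.

Lemma gA_small q : 0 < q -> q <= 1 -> gA q <= C0^2 * q.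
Proof.
move=> q0 q1; have -> : C0^2 * q = C0 * q * C0 by ring.
rewrite ler_pM ?oppr_ge0 ?G_le0 ?invE ?G_small// invr_ge0 ltW ?E_gt0//.
Qed.
Let C2 : R := C0^2 * (C0 ^+ 4 + C0^2 + (1 + C0)).

Let C2_ge0 : 0 <= C2.
by have c := ltW C0_gt0; rewrite /C2; pos. Qed.

Lemma gFzeta_small q : 0 < q -> q <= 1 -> `|gF q * gzeta q| <= C2 * q.
Proof.
move=> q0 q1; have c := C0_gt0; have a0 := gA_ge0 q0; have a1 := gA_small q0 q1.
have w0 := w_ge0 q0; have w1 := w_small q0 q1.
have wC : w q <= C0 by apply: (le_trans w1); rewrite ler_piMr// ltW.
have F1 : gF q <= C0^2 by rewrite lerXn2r ?nnegrE ?E_ub// ltW// E_gt0.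
have aa : gA q^2 <= C0 ^+ 4 * q.
 apply: (@le_trans _ _ ((C0^2 * q)^2)).
  by rewrite lerXn2r ?nnegrE// mulr_ge0 ?sqr_ge0// ltW.
 have -> : (C0^2 * q)^2 = C0 ^+ 4 * (q * q) by lra.
 by rewrite ler_wpM2l ?exprn_ge0 ?(ltW c)// ler_piMl// ltW.
rewrite normrM ger0_norm ?(ltW (gF_gt0 q0))//.
have -> : C2 * q = C0^2 * ((C0 ^+ 4 + C0^2 + (1 + C0)) * q) by rewrite /C2; ring.
rewrite ler_pM ?(ltW (gF_gt0 q0))// /gzeta.
have s0 := sqr_ge0 (gA q).
have q2 : q * w q <= C0 * q by rewrite mulrC ler_pM2r.
have q3 : 0 <= q * w q by rewrite mulr_ge0// ltW.
rewrite ler_norml; apply/andP; split; lra.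
Qed.
Let Y_small q : 0 < q -> q <= 1 -> `|Y q| <= C2 * sqrt q.
move=> q0 q1; have s0 : 0 < sqrt q by rewrite sqrtr_gt0.
rewrite normrM [X in _ * X]ger0_norm// ler_pdivrMr//.
have -> : C2 * sqrt q * sqrt q = C2 * q by rewrite -mulrA -expr2 sqr_sqrtr// ltW.
exact: gFzeta_small.
Qed.
Let cY q : 0 < q -> {for q, continuous Y}.
by move=> q0; exact: is_der1_cont (dY q0). Qed.
Let sgnY q : 0 < q -> Y q <= 0 -> gzeta q <= 0.
move=> q0; rewrite /Y => h; have f := gF_gt0 q0; have s0 : 0 < sqrt q by rewrite sqrtr_gt0.
by move: h; rewrite pmulr_lle0 ?invr_gt0// pmulr_rle0.
Qed.

(* If zeta were negative somewhere, then at some point both Y and D would be negative, and stay so;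
 the function A / sqrt q would then decrease logarithmically to -oo, although A >= 0. *)
Let Y_ge0 q0 : 0 < q0 -> 0 <= Y q0.
move=> q00; rewrite leNgt; apply/negP => Yq.
pose c := - Y q0 / 2; have c0 : 0 < c by rewrite /c divr_gt0 ?oppr_gt0.
pose e := Num.min (Num.min q0 1) ((c / (C2 + 1))^2) / 2.
have C21 : 0 < C2 + 1 by rewrite ltr_wpDl.
have cc : 0 < c / (C2 + 1) by rewrite divr_gt0.
have e0 : 0 < e by rewrite divr_gt0// !lt_min q00 ltr01 exprn_gt0.
have em : e < Num.min (Num.min q0 1) ((c / (C2 + 1))^2) by move: e0; rewrite /e; lra.
move: (em); rewrite !lt_min -andbA => /and3P[eq e1 ec].
have Ye : - Y e < c.
 have := Y_small e0 (ltW e1).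
 have : sqrt e < c / (C2 + 1) by rewrite -(ltr_pXn2r (ltn0Sn 1)) ?nnegrE ?(ltW cc)// sqr_sqrtr ?(ltW e0).
 rewrite ltr_pdivlMr// => h1 h2.
 have := ler_norm (- Y e); rewrite normrN; have := sqrtr_gt0 e; rewrite e0 => s0; nra.
have cf x : e <= x -> x <= q0 -> {for x, continuous (fun q => - Y q)} by move=> ex _; apply: continuousN; apply: cY; exact: lt_le_trans e0 ex.
have cq : c <= - Y q0 by rewrite /c; lra.
have [s [es sq cs pre]] := first_exit (ltW eq) cf Ye cq.
have s0 := lt_trans e0 es.
have c20 : 0 < c / 2 by lra.
have [d d0 hd] := cont_near (cY s0) c20.
pose x := Num.max (s - d / 2) ((e + s) / 2).
have xs : x < s by rewrite gt_max; lra.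
have ex : e < x by rewrite lt_max; lra.
have sx : s - d / 2 <= x by rewrite le_max lexx.
have x0 := lt_trans e0 ex.
(* Just before [s], the first point where [- Y] reaches [c], the mean value theorem finds a point
   where [Y] decreases, so that [D < 0]; being close to [s], it also has [Y < 0]. *)
have [q1 [xq1 q1s E1]] := mean_value xs (fun z (h1 : x <= z) (h2 : z <= s) => dY (lt_le_trans x0 h1)).
have q10 := lt_trans x0 xq1.
have fx := pre x (ltW ex) xs.
have D1 : D q1 < 0.
 rewrite ltNge; apply/negP => D0.
 have : 0 <= Y s - Y x.
  have f0 := ltW (gF_gt0 q10); rewrite E1 mulr_ge0// ?subr_ge0 ?(ltW xs)//.
  by pos.
 by lra.
have Y1 : Y q1 < 0.
 have : `|q1 - s| < d by rewrite ltr_norml; apply/andP; split; lra.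
 by move=> /hd; have := ler_norm (Y q1 - Y s); lra.
(* As long as [Y <= 0], [D] keeps decreasing and therefore so does [Y]; a first exit of [Y] to
   nonnegative values is then impossible. *)
have persist q : q1 <= q -> Y q <= Y q1.
 move=> q1q; rewrite leNgt; apply/negP => Yq1.
 have key t : q1 <= t -> (forall x, q1 <= x -> x < t -> Y x <= 0) -> Y t <= Y q1.
  move=> q1t Yneg.
  apply: (@der_le0_ge R Y _ q1 t q1t (fun z h1 _ => dY (lt_le_trans q10 h1))) => z h1 h2.
  have z0 := lt_trans q10 h1.
  have Dz : D z <= D q1.
   apply: (@der_le0_ge R D _ q1 z (ltW h1) (fun z h1 _ => dD (lt_le_trans q10 h1))) => y h3 h4.
   have y0 := lt_trans q10 h3.
   have zy := sgnY y0 (Yneg y (ltW h3) (lt_trans h4 h2)).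
   have := gA_ge0 y0; have := gF_gt0 y0 => fy ay.
   have : (gzeta y - gA y / 2) / y^2 <= 0 by rewrite pmulr_lle0 ?invr_gt0 ?exprn_gt0//; lra.
   by lra.
  rewrite pmulr_lle0 ?invr_gt0 ?mulr_gt0 ?sqrtr_gt0// pmulr_rle0 ?gF_gt0//; lra.
 have [[t [q1t tq Yt]]|h] := pselect (exists t, [/\ q1 <= t, t <= q & 0 < Y t]).
  have ck z : q1 <= z -> z <= t -> {for z, continuous Y} by move=> h1 _; apply: cY; exact: lt_le_trans q10 h1.
  have [s' [q1s' _ ks' pre']] := first_exit q1t ck Y1 (ltW Yt).
  by have := key s' (ltW q1s') (fun z h1 h2 => ltW (pre' z h1 h2)); lra.
 have := key q q1q; rewrite leNgt => /(_ _)/negP; apply => // y q1y yq.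
 by rewrite leNgt; apply/negP => y0; apply: h; exists y; split => //; exact: ltW.
pose y := - Y q1 / C0^2.
have y0 : 0 < y by rewrite divr_gt0 ?oppr_gt0// exprn_gt0.
have dec t : q1 <= t -> gA t / sqrt t + y * ln t <= gA q1 / sqrt q1 + y * ln q1.
 move=> q1t; apply: (@der_le0_ge R (fun t => gA t / sqrt t + y * ln t) (fun t => Y t / (gF t * t) + y * t^-1) q1 t q1t).
  move=> z h1 _; have z0 := lt_le_trans q10 h1; have h := dAs z0.
  derivs; by ring.
 move=> z h1 _; have z0 := lt_trans q10 h1.
 have F1 : gF z <= C0^2 by rewrite lerXn2r ?nnegrE ?E_ub// ltW// E_gt0.
 have -> : Y z / (gF z * z) + y * z^-1 = (Y z + y * gF z) / (gF z * z) by field; rewrite (gt_eqF z0) (gt_eqF (gF_gt0 z0)).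
 rewrite pmulr_lle0; last by rewrite invr_gt0 (mulr_gt0 (gF_gt0 z0) z0).
 have : y * gF z <= y * C0^2 by rewrite ler_pM2l.
 have -> : y * C0^2 = - Y q1 by rewrite divfK// gt_eqF// exprn_gt0.
 have := persist z (ltW h1); lra.
(* Makes [y * ln t] exceed the value at [q1] by [y], which contradicts [gA t >= 0]. *)
pose B := (gA q1 / sqrt q1 + y * ln q1) / y + 1.
pose t := Num.max q1 (expR B).
have q1t : q1 <= t by rewrite le_max lexx.
have t0 := lt_le_trans q10 q1t.
have lt : B <= ln t by rewrite -[leLHS]expRK ler_ln ?posrE ?expR_gt0// le_max lexx orbT.
have := dec t q1t; have : 0 <= gA t / sqrt t by rewrite divr_ge0 ?gA_ge0// sqrtr_ge0.
have : y * B <= y * ln t by rewrite ler_pM2l.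
have -> : y * B = gA q1 / sqrt q1 + y * ln q1 + y by rewrite mulrDr mulr1 (mulrC y) divfK ?gt_eqF.
by lra.
Qed.

Lemma gzeta_ge0 q : 0 < q -> 0 <= gzeta q.
Proof.
move=> q0; have := Y_ge0 q0; rewrite pmulr_lge0 ?invr_gt0 ?sqrtr_gt0//.
by rewrite pmulr_rge0// gF_gt0.
Qed.

Lemma gA_sqrt_nondecreasing p q : 0 < p -> p <= q -> gA p / sqrt p <= gA q / sqrt q.
Proof.
move=> p0 pq; apply: (@der_ge0_le R _ _ p q pq (fun z h1 _ => dAs (lt_le_trans p0 h1))) => z h1 _.
have z0 := lt_trans p0 h1.
by rewrite divr_ge0 ?Y_ge0// mulr_ge0// ltW// gF_gt0.
Qed.

(** [A / sqrt q] is nondecreasing and positive somewhere, so [A] grows at least like [sqrt q]. *)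
Lemma gA_large : exists2 q1, 1 <= q1 & forall q, q1 <= q -> 2 <= gA q.
Proof.
have [p p0 Gp] := G_neg.
have s0 : 0 < sqrt p by rewrite sqrtr_gt0.
have a0 : 0 < gA p / sqrt p by rewrite divr_gt0// divr_gt0 ?oppr_gt0// E_gt0.
set k := gA p / _ in a0.
exists (Num.max (Num.max p 1) ((2 / k)^2)); first by rewrite !le_max lexx orbT.
move=> q; rewrite !ge_max -andbA => /and3P[pq q1 kq].
have q0 := lt_le_trans p0 pq.
have k2 : 0 < 2 / k by rewrite divr_gt0.
have : 2 / k <= sqrt q by rewrite -[leLHS]ger0_norm ?(ltW k2)// -sqrtr_sqr ler_wsqrtr.
rewrite ler_pdivrMr// => h; apply: (le_trans h).
by have := gA_sqrt_nondecreasing p0 pq; rewrite ler_pdivlMr ?sqrtr_gt0// mulrC.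
Qed.

(** Once [A >= 2], the derivative of [F q^3] carries the negative factor [3 - 2 A]. *)
Lemma gF_decay : exists q1 c, [/\ 1 <= q1, 0 <= c & forall q, q1 <= q -> 2 <= gA q /\ gF q <= c / q ^+ 3].
Proof.
have [q1 q11 h] := gA_large; have q10 := lt_le_trans ltr01 q11.
exists q1, (gF q1 * q1 ^+ 3); split => //; first by exact: (mulr_ge0 (ltW (gF_gt0 q10)) (exprn_ge0 3 (ltW q10))).
move=> q q1q; have q0 := lt_le_trans q10 q1q; split; first exact: h.
rewrite ler_pdivlMr ?exprn_gt0//.
apply: (@der_le0_ge R (fun q => gF q * q ^+ 3) (fun q => q^2 * gF q * (3 - 2 * gA q)) q1 q q1q).
 move=> z h1 _; have z0 := lt_le_trans q10 h1; have hF := der_gF z0.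
 have -> : (fun q => gF q * q ^+ 3) = (fun q => gF q * (q * q^2)) by [].
 by derivs; field; rewrite gt_eqF.
move=> z h1 _; have z0 := lt_trans q10 h1.
have := h z (ltW h1) => a2; rewrite pmulr_rle0; last by rewrite mulr_gt0 ?gF_gt0// exprn_gt0.
by lra.
Qed.
Let m_nd p q : 0 < p -> p <= q -> m p <= m q.
move=> p0 pq; apply: (@der_ge0_le R m _ p q pq (fun z h1 _ => dm (lt_le_trans p0 h1))) => z h1 _.
by pos.
Qed.
Let mtail c q1 p q : 1 <= q1 -> 0 <= c -> (forall q, q1 <= q -> gF q <= c / q ^+ 3) -> q1 <= p -> p <= q ->
 m q + pi * c / q^2 <= m p + pi * c / p^2.
move=> q11 c0 h q1p pq; have q10 := lt_le_trans ltr01 q11; have p0 := lt_le_trans q10 q1p.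
apply: (@der_le0_ge R (fun q => m q + pi * c / q^2) (fun q => pi * (gF q - 2 * c / q ^+ 3)) p q pq).
 move=> z h1 _; have z0 := lt_le_trans p0 h1; have hm := dm z0.
 have z2 : z^2 != 0 by rewrite gt_eqF// exprn_gt0.
 by derivs; rewrite /gF; field; rewrite gt_eqF.
move=> z h1 _; have z0 := lt_trans p0 h1.
rewrite pmulr_rle0//.
have := h z (le_trans q1p (ltW h1)); have : 0 <= c / z ^+ 3 by rewrite divr_ge0// exprn_ge0// ltW.
by lra.
Qed.

(** The argument is cut at 1 because [m] is controlled only at positive arguments; [m] being
    nondecreasing there, this supremum is its limit. *)
Definition gN : R := sup (range (fun x => m (Num.max x 1))).

Let max1 x : 0 < Num.max x 1 :> R. by rewrite lt_max ltr01 orbT. Qed.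
Let m_bounded : has_ubound (range (fun x => m (Num.max x 1))).
have [q1 [c [q11 c0 h]]] := gF_decay; have q10 := lt_le_trans ltr01 q11.
exists (m q1 + pi * c / q1^2) => _ [x _ <-].
have pc z : 0 <= pi * c / z^2 by pos.
have [le|lt] := leP (Num.max x 1) q1.
 by apply: (le_trans (m_nd (max1 x) le)); rewrite lerDl.
have := mtail q11 c0 (fun q hq => (h q hq).2) (lexx q1) (ltW lt); have := pc (Num.max x 1); lra.
Qed.

Lemma m_cvg : m x @[x --> +oo] --> gN.
Proof.
apply: (@cvgy_shift _ _ (fun x => m (Num.max x 1)) _ 1).
 by move=> x x1; rewrite max_l.
apply: nondecreasing_cvgr; last exact: m_bounded.
move=> x y xy; apply: m_nd => //.
by rewrite ge_max !le_max xy lexx orbT.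
Qed.

Lemma m_le q : 0 < q -> m q <= gN.
Proof. by move=> q0; apply: (cvgy_ge m_cvg (a := q)) => x; exact: m_nd. Qed.

Lemma m_lt q : 0 < q -> m q < gN.
Proof.
move=> q0; have q1 : q < q + 1 by rewrite ltrDl.
have q10 := lt_trans q0 q1.
apply: (lt_le_trans _ (m_le q10)).
have [z [h1 h2 e]] := mean_value q1 (fun z (h1 : q <= z) (_ : z <= q + 1) => dm (lt_le_trans q0 h1)).
have z0 := lt_trans q0 h1.
by rewrite -subr_gt0 e mulr_gt0 ?subr_gt0// mulr_gt0// gF_gt0.
Qed.

Lemma gN_gt0 : 0 < gN.
Proof. exact: (lt_le_trans (m_gt0 ltr01) (m_le ltr01)). Qed.

Lemma m_tail : exists q1 c, [/\ 1 <= q1, 0 <= c & forall q, q1 <= q ->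
 [/\ 2 <= gA q, gF q <= c / q ^+ 3 & gN - m q <= pi * c / q^2]].
Proof.
have [q1 [c [q11 c0 h]]] := gF_decay; have q10 := lt_le_trans ltr01 q11.
exists q1, c; split => // q q1q; have [ha hf] := h q q1q; split => //.
rewrite lerBlDl; apply: (cvgy_le m_cvg (a := q)) => x qx.
have := mtail q11 c0 (fun q hq => (h q hq).2) q1q qx.
by have : 0 <= pi * c / x^2 by [rewrite divr_ge0 ?sqr_ge0// mulr_ge0// pi_ge0]; lra.
Qed.
Let w_upper q : 1 <= q -> w q <= w 1 + gN / (4 * pi) * ln q.
move=> q1; have := @der_le0_ge R (fun q => w q - gN / (4 * pi) * ln q) (fun q => (m q - gN) / (4 * pi * q)) 1 q q1 _ _.
rewrite ln1 mulr0 subr0 => h; suff : w q - gN / (4 * pi) * ln q <= w 1 by lra.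
apply: h => z h1 h2.
 have z0 := lt_le_trans ltr01 h1; have hw := dw z0.
 by derivs; move: pi pin => p pn; field; rewrite gt_eqF.
have z0 := lt_trans ltr01 h1.
by rewrite pmulr_lle0 ?subr_le0 ?m_le// invr_gt0 !mulr_gt0.
Qed.
Let w_lower q : 1 <= q -> m 1 / (4 * pi) * ln q <= w q.
move=> q1; have := @der_ge0_le R (fun q => w q - m 1 / (4 * pi) * ln q) (fun q => (m q - m 1) / (4 * pi * q)) 1 q q1 _ _.
rewrite ln1 mulr0 subr0 => h; have := w_ge0 ltr01; suff : w 1 <= w q - m 1 / (4 * pi) * ln q by lra.
apply: h => z h1 h2.
 have z0 := lt_le_trans ltr01 h1; have hw := dw z0.
 by derivs; move: pi pin => p pn; field; rewrite gt_eqF.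
have z0 := lt_trans ltr01 h1.
by rewrite divr_ge0 ?subr_ge0 ?m_nd ?(ltW h1)// !mulr_ge0// ltW.
Qed.
Let ln_le_id q : 0 < q -> ln q <= q.
by have := @le_ln1Dx R (q - 1); rewrite addrCA subrr addr0 => /(_ _) h; lra. Qed.

(** Eventually [w >= 1], so [G] is nondecreasing and nonpositive. If it stayed below [- e], then
    [E + e ln q] would be nonincreasing and [E] would become negative. *)
Lemma G_cvg : G x @[x --> +oo] --> (0 : R).
Proof.
apply: cvgy0 => e e0.
pose k := m 1 / (4 * pi); have k0 : 0 < k by rewrite divr_gt0 ?m_gt0// mulr_gt0.
pose a := Num.max 1 (expR (k^-1)).
have a1 : 1 <= a by rewrite le_max lexx.
have a0 := lt_le_trans ltr01 a1.
have w1 z : a <= z -> 1 <= w z.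
 move=> az; have z1 := le_trans a1 az; apply: (le_trans _ (w_lower z1)); rewrite -/k.
 have : k^-1 <= ln z.
  rewrite -[leLHS]expRK ler_ln ?posrE ?expR_gt0 ?(lt_le_trans ltr01)//.
  by apply: le_trans az; rewrite le_max lexx orbT.
 by rewrite -ler_pdivrMl// mulr1.
have Gnd p q : a <= p -> p <= q -> G p <= G q.
 move=> ap pq; have p0 := lt_le_trans a0 ap.
 apply: (@der_ge0_le R G _ p q pq (fun z h1 _ => dG (lt_le_trans p0 h1))) => z h1 _.
 have z0 := lt_trans p0 h1.
 by rewrite divr_ge0// mulr_ge0 ?subr_ge0 ?w1 ?(le_trans ap (ltW h1))// ltW// E_gt0.
suff [b ab Gb] : exists2 b, a <= b & - e <= G b.
 exists b => x bx; have := Gnd b x ab bx; have x0 := lt_le_trans a0 (le_trans ab bx).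
 by have := G_le0 x0 => g; rewrite ler0_norm//; lra.
have [//|h] := pselect (exists2 b, a <= b & - e <= G b).
have Ge z : a <= z -> G z < - e by move=> az; rewrite ltNge; apply/negP => z0; apply: h; exists z.
pose b := Num.max a (expR ((E a + e * ln a) / e + 1)).
have ab : a <= b by rewrite le_max lexx.
have b0 := lt_le_trans a0 ab.
have := @der_le0_ge R (fun q => E q + e * ln q) (fun q => (G q + e) / q) a b ab _ _.
have lb : (E a + e * ln a) / e + 1 <= ln b by rewrite -[leLHS]expRK ler_ln ?posrE ?expR_gt0// le_max lexx orbT.
have : e * ((E a + e * ln a) / e + 1) <= e * ln b by rewrite ler_pM2l.
have -> : e * ((E a + e * ln a) / e + 1) = E a + e * ln a + e by field; rewrite gt_eqF.
move=> h1 h2; have := E_gt0 b0; suff : E b + e * ln b <= E a + e * ln a by lra.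
apply: h2 => z h2 h3.
 have z0 := lt_le_trans a0 h2; have hE := dE z0.
 by derivs; field; rewrite gt_eqF.
have z0 := lt_trans a0 h2; rewrite pmulr_lle0 ?invr_gt0//.
by have := Ge z (ltW h2); lra.
Qed.
Let EG_cvg : E x * G x @[x --> +oo] --> (0 : R).
apply: cvgy0 => e e0; have c0 := C0_gt0.
have [b hb] := cvgy_ex G_cvg (divr_gt0 e0 c0).
exists (Num.max 1 (b + 1)) => x; rewrite ge_max => /andP[x1 bx].
have x0 := lt_le_trans ltr01 x1.
have bx' : b < x by lra.
have := hb x bx'; rewrite subr0 => h; rewrite normrM ger0_norm ?(ltW (E_gt0 x0))//.
have -> : e = C0 * (e / C0) by rewrite mulrC divfK// gt_eqF.
by rewrite ler_pM ?E_ub// ltW// E_gt0.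
Qed.
Let wqF_cvg : (w x - 1) * (x * E x^2) @[x --> +oo] --> (0 : R).
have [q1 [c [q11 c0 h]]] := m_tail; have q10 := lt_le_trans ltr01 q11.
pose k := w 1 + gN / (4 * pi) + 1.
apply: (@cvgy0_bound _ _ q1 (k * c)) => // x q1x.
have x0 := lt_le_trans q10 q1x; have x1 := le_trans q11 q1x.
have [_ hF _] := h x q1x.
have n0 : 0 <= gN / (4 * pi) by rewrite divr_ge0 ?(ltW gN_gt0)// mulr_ge0// pi_ge0.
have wx : `|w x - 1| <= k * x.
 have := w_upper x1; have := w_ge0 x0; have := ln_le_id x0 => l1 wx0 wu.
 have : gN / (4 * pi) * ln x <= gN / (4 * pi) * x by rewrite ler_wpM2l.
 have w1 := w_ge0 ltr01.
 have n1 : 0 <= gN / (4 * pi) * x by rewrite mulr_ge0// ltW.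
 have : w 1 <= w 1 * x by rewrite ler_peMr.
 rewrite /k; move: (gN / (4 * pi)) wu n1 => n wu n1 h1 h2.
 by rewrite ler_norml; lra.
rewrite normrM -/(gF x).
have -> : k * c / x = k * x * (x * (c / x ^+ 3)) by field; rewrite gt_eqF.
rewrite ler_pM// normrM gtr0_norm// gtr0_norm ?gF_gt0// ler_pM2l//.
Qed.

Lemma gP_cvg : gP x @[x --> +oo] --> gN^2 / (8 * pi^2).
Proof.
have -> : gN^2 / (8 * pi^2) = 4 * 0 - 0 + 4 * (0 * 0) + gN * gN / (8 * pi^2) by lra.
apply: cvgD; last first.
 apply: cvgM; last exact: cvg_cst.
 by apply: cvgM; exact: m_cvg.
apply: cvgD; last first.
 apply: cvgM; first exact: cvg_cst.
 by apply: cvgM; exact: G_cvg.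
by apply: cvgB; [apply: cvgM; [exact: cvg_cst|exact: EG_cvg]|exact: wqF_cvg].
Qed.

(** A primitive of [pi F ln q]; its limit gives the logarithmic moment behind [I]. *)
Definition gJ q : R := m q * ln q - 4 * pi * w q.

Lemma der_gJ q : 0 < q -> derives q gJ (pi * gF q * ln q).
Proof.
move=> q0; have h1 := dm q0; have h2 := dw q0; rewrite /gJ.
by derivs; rewrite /gF; move: pi pin => p pn; field; rewrite gt_eqF.
Qed.

Definition gL : R := sup (range (fun x => gJ (Num.max x 1))).

Lemma gJ_cvg : gJ x @[x --> +oo] --> gL.
Proof.
apply: (@cvgy_shift _ _ (fun x => gJ (Num.max x 1)) _ 1).
 by move=> x x1; rewrite max_l.
have Jnd p q : 1 <= p -> p <= q -> gJ p <= gJ q.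
 move=> p1 pq; have p0 := lt_le_trans ltr01 p1.
 apply: (@der_ge0_le R gJ _ p q pq (fun z h1 _ => der_gJ (lt_le_trans p0 h1))) => z h1 _.
 have z0 := lt_trans p0 h1; have f0 := ltW (gF_gt0 z0).
 by rewrite mulr_ge0 ?ln_ge0 ?(le_trans p1 (ltW h1))// mulr_ge0// pi_ge0.
apply: nondecreasing_cvgr.
 by move=> x y xy; apply: Jnd; rewrite ?ge_max !le_max ?xy ?lexx ?orbT.
have [q1 [c [q11 c0 h]]] := m_tail; have q10 := lt_le_trans ltr01 q11.
exists (gJ q1 + pi * c / q1) => _ [x _ <-].
have pc z : 0 < z -> 0 <= pi * c / z by move=> z0; rewrite divr_ge0 ?(ltW z0)// mulr_ge0// pi_ge0.
have x1 : 1 <= Num.max x 1 by rewrite le_max lexx orbT.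
have [le|lt] := leP (Num.max x 1) q1.
 by apply: (le_trans (Jnd _ _ x1 le)); rewrite lerDl pc.
have := pc (Num.max x 1) (max1 x).
suff : gJ (Num.max x 1) + pi * c / Num.max x 1 <= gJ q1 + pi * c / q1 by lra.
apply: (@der_le0_ge R (fun q => gJ q + pi * c / q) (fun q => pi * (gF q * ln q - c / q^2)) q1 _ (ltW lt)).
 move=> z h1 _; have z0 := lt_le_trans q10 h1; have hJ := der_gJ z0.
 have zn : z != 0 by lra.
 by derivs; field.
move=> z h1 _; have z0 := lt_trans q10 h1; rewrite pmulr_rle0// subr_le0.
have [_ hF _] := h z (ltW h1).
have -> : c / z^2 = c / z ^+ 3 * z by field; rewrite gt_eqF.
by rewrite ler_pM ?ln_le_id ?ln_ge0 ?(le_trans q11 (ltW h1))// ltW// gF_gt0.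
Qed.

Lemma gK_cvg : gK x @[x --> +oo] --> gN * gL / (2 * pi) + 2 * gN - gN^2 / (4 * pi).
Proof.
have -> : gK = (fun q => m q * gJ q / (2 * pi) + 2 * m q + 8 * pi * (E q * G q) - 2 * pi * gP q) by apply/funext => q; rewrite /gK /gJ; move: pi pin => p pn; field.
have -> : gN * gL / (2 * pi) + 2 * gN - gN^2 / (4 * pi) =
 gN * gL / (2 * pi) + 2 * gN + 8 * pi * 0 - 2 * pi * (gN^2 / (8 * pi^2)) by move: pi pin => p pn; field.
apply: cvgB; last by apply: cvgM; [exact: cvg_cst|exact: gP_cvg].
apply: cvgD; last by apply: cvgM; [exact: cvg_cst|exact: EG_cvg].
apply: cvgD; last by apply: cvgM; [exact: cvg_cst|exact: m_cvg].
apply: cvgM; last exact: cvg_cst.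
by apply: cvgM; [exact: m_cvg|exact: gJ_cvg].
Qed.
Let Y_cvg : Y x @[x --> +oo] --> (0 : R).
have h : (G x^2 + E x * G x / 2 - (w x - 1) * (x * E x^2) / 4) @[x --> +oo] --> (0 : R).
 have -> : 0 = 0 * 0 + 0 / 2 - 0 / 4 :> R by lra.
 apply: cvgB; last by apply: cvgM; [exact: wqF_cvg|exact: cvg_cst].
 apply: cvgD; last by apply: cvgM; [exact: EG_cvg|exact: cvg_cst].
 by apply: cvgM; exact: G_cvg.
apply: cvgy0 => e e0; have [b hb] := cvgy_ex h e0.
exists (Num.max 1 (b + 1)) => x; rewrite ge_max => /andP[x1 bx].
have x0 := lt_le_trans ltr01 x1.
have bx' : b < x by lra.
have := hb x bx'; rewrite subr0 => hx; apply: le_trans hx.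
have -> : G x^2 + E x * G x / 2 - (w x - 1) * (x * E x^2) / 4 = gF x * gzeta x by rewrite /gF /gzeta /gA; field; rewrite gt_eqF// E_gt0.
rewrite normrM ler_piMr// ger0_norm// invf_le1 ?sqrtr_gt0//.
by rewrite -[leLHS]sqrtr1 ler_wsqrtr.
Qed.

(** [Y] tends to 0 and its derivative is at least [- F m / (16 pi sqrt q)]; comparison with
    [m' = pi F], using [m <= N], from [q] to infinity bounds [Y q] by a multiple of the tail
    mass. *)
Lemma gFzeta_tail q : 0 < q -> gF q * gzeta q <= gN / (16 * pi^2) * (gN - m q).
Proof.
move=> q0; have s0 : 0 < sqrt q by rewrite sqrtr_gt0.
pose k := gN / (16 * pi^2); pose r := (sqrt q)^-1.
have r0 : 0 < r by rewrite invr_gt0.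
have cv : (Y x - r * k * (gN - m x)) @[x --> +oo] --> (0 - r * k * (gN - gN) : R).
 apply: cvgB; first exact: Y_cvg.
 by apply: cvgM; [exact: cvg_cst|apply: cvgB; [exact: cvg_cst|exact: m_cvg]].
have : Y q - r * k * (gN - m q) <= 0 - r * k * (gN - gN).
 apply: (cvgy_ge cv (a := q)) => x qx.
 apply: (@der_ge0_le R (fun x => Y x - r * k * (gN - m x)) (fun x => gF x * D x / (4 * sqrt x) + r * k * (pi * gF x)) q x qx).
  move=> z h1 _; have z0 := lt_le_trans q0 h1; have hm := dm z0; have hY := dY z0.
  by derivs; rewrite -/(gF z); ring.
 move=> z h1 _; have z0 := lt_trans q0 h1; have f0 := ltW (gF_gt0 z0).
 have sz : 0 < sqrt z by rewrite sqrtr_gt0.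
 have rz : (sqrt z)^-1 <= r by rewrite lef_pV2// ler_wsqrtr// ltW.
 have a0 := gA_ge0 z0; have mz := m_le z0; have mz0 := ltW (m_gt0 z0).
 have -> : gF z * D z / (4 * sqrt z) + r * k * (pi * gF z) =
  gF z * (gA z / z / (4 * sqrt z) + (gN * r - m z * (sqrt z)^-1) / (16 * pi)).
  rewrite /D /k; move: gN (gA z) (gF z) (m z) => n a f b.
  by move: pi pin => p pn; field; rewrite pn !gt_eqF.
 rewrite mulr_ge0// addr_ge0//.
  by rewrite divr_ge0 ?(divr_ge0 a0 (ltW z0))//.
 rewrite divr_ge0//; last by rewrite mulr_ge0// pi_ge0.
 by rewrite subr_ge0 ler_pM//.
rewrite subrr mulr0 subr0 subr_le0 /Y mulrC -mulrA ler_pM2l//.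
Qed.

(** [A] is nondecreasing, so beyond [q] the density decays at least like the power [- 2 A q], whence
    [(N - m q) (2 A q - 1) <= pi q F q]. Since [A^2 F = G^2], the quantity is at most [pi G^2] at
    large arguments. *)
Lemma gA_tail : gA x^2 / x * (gN - m x) @[x --> +oo] --> (0 : R).
Proof.
have [q1 [c [q11 c0 h]]] := m_tail; have q10 := lt_le_trans ltr01 q11.
have bound q : q1 <= q -> gA q^2 / q * (gN - m q) <= pi * (G q * G q).
 move=> q1q; have q0 := lt_le_trans q10 q1q; have [a2 _ _] := h q q1q.
 have s0 : 0 < sqrt q by rewrite sqrtr_gt0.
 have And x : q <= x -> gA q <= gA x.
  move=> qx; have := gA_sqrt_nondecreasing q0 qx; rewrite ler_pdivlMr ?sqrtr_gt0 ?(lt_le_trans q0)//.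
  apply: le_trans; rewrite mulrAC ler_pdivlMr// ler_wpM2l ?gA_ge0// ler_wsqrtr//.
 have cv : (pi * (x * gF x) - (gN - m x) * (2 * gA q - 1)) @[x --> +oo] --> (pi * 0 - (gN - gN) * (2 * gA q - 1) : R).
  apply: cvgB; last first.
   by apply: cvgM; [apply: cvgB; [exact: cvg_cst|exact: m_cvg]|exact: cvg_cst].
  apply: cvgM; first exact: cvg_cst.
  apply: (@cvgy0_bound _ _ q1 c) => // x q1x; have x0 := lt_le_trans q10 q1x.
  have [_ hF _] := h x q1x; have f0 := ltW (gF_gt0 x0).
  rewrite ger0_norm; last exact: (mulr_ge0 (ltW x0) f0).
  apply: (@le_trans _ _ (x * (c / x ^+ 3))); first by rewrite ler_pM2l.
  have -> : x * (c / x ^+ 3) = c / x * (x^-1) by field; rewrite gt_eqF.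
  by rewrite ler_piMr ?divr_ge0 ?(ltW x0)// invf_le1// (le_trans q11).
 have : pi * 0 - (gN - gN) * (2 * gA q - 1) <= pi * (q * gF q) - (gN - m q) * (2 * gA q - 1).
  apply: (cvgy_le cv (a := q)) => x qx.
  apply: (@der_le0_ge R (fun x => pi * (x * gF x) - (gN - m x) * (2 * gA q - 1)) (fun x => 2 * pi * gF x * (gA q - gA x)) q x qx).
   move=> z h1 _; have z0 := lt_le_trans q0 h1; have hm := dm z0; have hF := der_gF z0.
   by derivs; rewrite -/(gF z); field; rewrite gt_eqF.
  move=> z h1 _; have z0 := lt_trans q0 h1.
  rewrite pmulr_rle0 ?subr_le0 ?And ?(ltW h1)//.
  by rewrite mulr_gt0 ?gF_gt0// mulr_gt0.
 rewrite subrr mul0r mulr0 subrr subr_ge0 => hb.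
 have d0 : 0 <= gN - m q by rewrite subr_ge0 m_le.
 have -> : pi * (G q * G q) = gA q^2 / q * (pi * (q * gF q)) by rewrite /gA /gF; field; rewrite !gt_eqF// E_gt0.
 rewrite ler_wpM2l ?divr_ge0 ?sqr_ge0 ?(ltW q0)//; apply: le_trans hb.
 by rewrite ler_peMr//; lra.
have cv : (pi * (G x * G x)) @[x --> +oo] --> (pi * (0 * 0) : R) by apply: cvgM; [exact: cvg_cst|apply: cvgM; exact: G_cvg].
rewrite mulr0 mulr0 in cv.
apply: (@squeeze_cvgr _ _ _ _ (fun=> 0) _ _ _ _ (cvg_cst 0) cv).
near=> x; have q1x : q1 <= x by near: x; apply: nbhs_pinfty_ge; exact: num_real.
by rewrite bound// mulr_ge0 ?divr_ge0 ?sqr_ge0 ?subr_ge0 ?m_le//.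
Unshelve. all: by end_near. Qed.

Lemma ln_small q : 0 < q -> q <= 1 -> q * `|ln q| <= 2 * sqrt q.
Proof.
move=> q0 q1; have s0 : 0 < sqrt q by rewrite sqrtr_gt0.
rewrite ler0_norm ?ln_le0// -(sqr_sqrtr (ltW q0)) sqrtr_sqr (ger0_norm (ltW s0)) ln_sqr//.
have := ln_le_id (_ : 0 < (sqrt q)^-1); rewrite invr_gt0 lnV// => /(_ s0) h.
have -> : sqrt q^2 * - (2 * ln (sqrt q)) = 2 * sqrt q * (sqrt q * - ln (sqrt q)) by lra.
rewrite ler_piMr//.
by rewrite -(divff (lt0r_neq0 s0)) ler_pM2l.
Qed.

(** Uses the positivity of [m] in place of a value at 0: if the bound failed at [q], monotonicity of
    [m - k q] would make [m] negative at a small positive argument. *)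
Lemma m_lower q : 0 < q -> q <= 1 -> pi / C0^2 * q <= m q.
Proof.
move=> q0 q1; rewrite leNgt; apply/negP => lt.
have dmk (k z : R) : 0 < z -> derives z (fun x : R => m x - k * x : R) (pi * gF z - k) by move=> z0; have hm := dm z0; derivs.
have c0 := C0_gt0; have k0 : 0 < pi / C0^2 by rewrite divr_gt0 ?exprn_gt0.
set k := _ / _ in lt k0.
pose p := Num.min (q / 2) ((k * q - m q) / (2 * k)).
have p0 : 0 < p by rewrite lt_min !divr_gt0 ?subr_gt0// mulr_gt0.
have pq : p <= q by rewrite ge_min; lra.
have pk : k * p <= (k * q - m q) / 2.
 have -> : (k * q - m q) / 2 = k * ((k * q - m q) / (2 * k)) by field; rewrite gt_eqF.
 by rewrite ler_pM2l// ge_min lexx orbT.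
have := @der_ge0_le R (fun x => m x - k * x) (fun x => pi * gF x - k) p q pq.
move=> /(_ _ _) h; have {h} : m p - k * p <= m q - k * q.
 apply: h.
  by move=> z h1 _; exact: dmk (lt_le_trans p0 h1).
 move=> z h1 h2; have z0 := lt_trans p0 h1; have z1 := le_trans (ltW h2) q1.
 rewrite subr_ge0 ler_pM2l// -exprVn lerXn2r ?nnegrE ?invr_ge0 ?(ltW c0) ?(ltW (E_gt0 z0))//.
 by rewrite -[leLHS]mul1r ler_pdivrMr// mulrC E_lb.
have := m_gt0 p0; lra.
Qed.

Lemma ground_at_zero : exists2 c, 0 <= c & forall q, 0 < q -> q <= 1 ->
 [/\ `|gP q| <= c * q, `|gK q| <= c * sqrt q, `|gJ q| <= c * sqrt q & `|gF q * gzeta q| <= c * q].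
Proof.
have c0 := C0_gt0; have pi1 := pi_ge0 R.
pose a := 4 * C0^2 + (1 + C0) * C0^2 + 4 * C0^2 + C0^2 / (8 * pi^2).
have a0 : 0 <= a by rewrite /a; have c1 := ltW c0; pos.
pose b := 2 * C0 + 4 * pi * C0.
have b0 : 0 <= b by rewrite /b; have c1 := ltW c0; pos.
pose d := C0 * b / (2 * pi) + 2 * C0 + 8 * pi * C0^2 + 2 * pi * a.
have d0 : 0 <= d by rewrite /d; have c1 := ltW c0; pos.
exists (a + b + d + C2); first exact: (addr_ge0 (addr_ge0 (addr_ge0 a0 b0) d0) C2_ge0).
move=> q q0 q1; have s0 : 0 < sqrt q by rewrite sqrtr_gt0.
have s1 : sqrt q <= 1 by rewrite -sqrtr1 ler_wsqrtr.
have qs : q <= sqrt q by rewrite -{1}(sqr_sqrtr (ltW q0)) ler_piMl//.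
have E0 := ltW (E_gt0 q0); have E1 := E_ub q0.
have G1 : `|G q| <= C0 * q by rewrite ler0_norm ?G_le0// G_small.
have G2 : `|G q| <= C0 by apply: (le_trans G1); rewrite ler_piMr// ltW.
have w0 := w_ge0 q0; have w1 := w_small q0 q1.
have m0 := ltW (m_gt0 q0); have m1 := m_small q0 q1.
have EGb : `|E q * G q| <= C0^2 * q by rewrite normrM ger0_norm// -mulrA ler_pM.
have E2 : E q^2 <= C0^2 by rewrite lerXn2r ?nnegrE// ltW.
have wqF : `|(w q - 1) * (q * E q^2)| <= (1 + C0) * C0^2 * q.
 rewrite normrM -mulrA (mulrC _ q) ler_pM//; last first.
  by rewrite ger0_norm ?mulr_ge0 ?(ltW q0)// ler_pM2l.
 have : C0 * q <= C0 by rewrite ler_piMr// ltW.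
 by rewrite ler_norml => h; lra.
have GG : G q^2 <= C0^2 * q by rewrite -real_normK ?num_real// -mulrA ler_pM.
have mm : m q^2 / (8 * pi^2) <= C0^2 / (8 * pi^2) * q.
 rewrite [leRHS]mulrAC ler_wpM2r ?invr_ge0 ?mulr_ge0// -mulrA ler_pM//.
 by apply: (le_trans m1); rewrite ler_piMr// ltW.
have mm0 : 0 <= m q^2 / (8 * pi^2) by pos.
have Pb : `|gP q| <= a * q.
 have -> : a * q = 4 * (C0^2 * q) + (1 + C0) * C0^2 * q + 4 * (C0^2 * q) + C0^2 / (8 * pi^2) * q by rewrite /a; ring.
 rewrite /gP; have := sqr_ge0 (G q).
 move: EGb wqF GG mm mm0; rewrite !ler_norml.
 move: (E q * G q) ((w q - 1) * _) (G q^2) (m q^2 / _) (C0^2 * q) ((1 + C0) * _ * q) (C0^2 / _ * q).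
 by move=> x1 x2 x3 x4 x5 x6 x7 /andP[? ?] /andP[? ?] ? ? ? ?; apply/andP; split; lra.
have Jb : `|gJ q| <= b * sqrt q.
 have -> : b * sqrt q = 2 * C0 * sqrt q + 4 * pi * C0 * sqrt q by rewrite /b; ring.
 rewrite /gJ; apply: (le_trans (ler_normB _ _)); apply: lerD.
  rewrite normrM ger0_norm//; apply: (@le_trans _ _ (C0 * (q * `|ln q|))).
   by rewrite mulrA ler_wpM2r.
  by rewrite [_ * C0]mulrC -mulrA ler_pM2l// ln_small.
 rewrite ger0_norm; last by rewrite mulr_ge0// mulr_ge0.
 rewrite -[leRHS]mulrA ler_wpM2l ?mulr_ge0//; apply: (le_trans w1).
 by rewrite ler_pM2l.
have mC : m q <= C0 by apply: (le_trans m1); rewrite ler_piMr// ltW.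
have Kb : `|gK q| <= d * sqrt q.
 have -> : gK q = m q * gJ q / (2 * pi) + 2 * m q + 8 * pi * (E q * G q) - 2 * pi * gP q by rewrite /gK /gJ; move: pi pin => p pn; field.
 have -> : d * sqrt q = C0 * b / (2 * pi) * sqrt q + 2 * C0 * sqrt q + 8 * pi * C0^2 * sqrt q + 2 * pi * a * sqrt q by rewrite /d; ring.
 apply: (le_trans (ler_normB _ _)); apply: lerD; last first.
  rewrite normrM ger0_norm ?mulr_ge0// -!mulrA ler_pM2l// ler_wpM2l//.
  by apply: (le_trans Pb); rewrite ler_wpM2l.
 apply: (le_trans (ler_normD _ _)); apply: lerD; last first.
  rewrite normrM ger0_norm ?mulr_ge0// -!mulrA ler_pM2l// ler_wpM2l//.
  by apply: (le_trans EGb); rewrite mulrA !ler_wpM2l ?mulr_ge0 ?(ltW c0).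
 apply: (le_trans (ler_normD _ _)); apply: lerD; last first.
  rewrite ger0_norm ?mulr_ge0// -mulrA ler_pM2l//.
  by apply: (le_trans m1); rewrite ler_pM2l.
 rewrite normrM [X in _ * X]ger0_norm ?invr_ge0 ?mulr_ge0// normrM (ger0_norm m0).
 rewrite [leRHS]mulrAC ler_wpM2r ?invr_ge0 ?mulr_ge0//.
 by rewrite -mulrA ler_pM.
have zb := gFzeta_small q0 q1.
have ab : a * q <= (a + b + d + C2) * q by rewrite ler_pM2r//; have := C2_ge0; lra.
have cb : C2 * q <= (a + b + d + C2) * q by rewrite ler_pM2r//; lra.
have bb : b * sqrt q <= (a + b + d + C2) * sqrt q by rewrite ler_pM2r//; have := C2_ge0; lra.
have db : d * sqrt q <= (a + b + d + C2) * sqrt q by rewrite ler_pM2r//; have := C2_ge0; lra.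
by split; [exact: le_trans ab|exact: le_trans db|exact: le_trans bb|exact: le_trans cb].
Qed.

End RadialGround.


(** * From the ground state to the radial system *)

Section RadialLaplacian.
Variable R : realType.
Local Notation plane := (plane R).
Implicit Types (q r s : R).

Lemma der_line1 (F : plane -> R) (r s : R) : derivable F (r, s) (evec R false) ->
 derives r (fun t => F (t, s)) (partial false F (r, s)).
Proof.
move=> d.
have E : (fun h : R => h^-1 *: (((fun t => F (t, s)) \o shift r) (h *: (1 : R)) - F (r, s))) =
  (fun h : R => h^-1 *: ((F \o shift (r, s)) (h *: evec R false) - F (r, s))).
 apply/funext => h; congr (_ *: (F _ - _)).
 by apply: injective_projections; rewrite /= /GRing.scale /= ?mulr0 ?add0r.
apply: DeriveDef.
 by rewrite /derivable E.
by rewrite /derive E.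
Qed.

Lemma der_line2 (F : plane -> R) (r s : R) : derivable F (r, s) (evec R true) ->
 derives s (fun t => F (r, t)) (partial true F (r, s)).
Proof.
move=> d.
have E : (fun h : R => h^-1 *: (((fun t => F (r, t)) \o shift s) (h *: (1 : R)) - F (r, s))) =
  (fun h : R => h^-1 *: ((F \o shift (r, s)) (h *: evec R true) - F (r, s))).
 apply/funext => h; congr (_ *: (F _ - _)).
 by apply: injective_projections; rewrite /= /GRing.scale /= ?mulr0 ?add0r.
apply: DeriveDef.
 by rewrite /derivable E.
by rewrite /derive E.
Qed.

Variables (F : plane -> R) (phi : R -> R).
Hypothesis F2 : Ck 2 F.
Hypothesis radF : forall x, F x = phi (eucl x).

Let dF x b : derivable F x (evec R b).
by have [_] := F2 (s := [::]) isT; apply. Qed.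
Let ddF x b b' : derivable (partial b F) x (evec R b').
by have [_] := F2 (s := [:: b]) isT; apply. Qed.

Lemma radial_cont : continuous (fun q => F (sqrt q, 0)).
Proof.
have [c _] := F2 (s := [::]) isT.
move=> q; apply: (@continuous_comp _ _ _ (fun q => (sqrt q, 0)) F); last exact: c.
apply: (@cvg_pair _ _ _ (nbhs q) (nbhs (sqrt q)) (nbhs (0 : R)) _ _ _ (fun q => sqrt q) (fun=> 0)).
 exact: sqrt_continuous.
exact: cvg_cst.
Qed.

(** [q] times the derivative in [q] of the profile, that is half the radius times the radial
    derivative. *)
Definition radial_flux q : R := sqrt q * partial false F (sqrt q, 0) / 2.

Lemma radial_flux_cont : continuous radial_flux.
Proof.
have [c _] := F2 (s := [:: false]) isT.
move=> q; apply: cvgM; last exact: cvg_cst.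
apply: cvgM; first exact: sqrt_continuous.
apply: (@continuous_comp _ _ _ (fun q => (sqrt q, 0)) (partial false F)); last exact: c.
apply: (@cvg_pair _ _ _ (nbhs q) (nbhs (sqrt q)) (nbhs (0 : R)) _ _ _ (fun q => sqrt q) (fun=> 0)).
 exact: sqrt_continuous.
exact: cvg_cst.
Qed.
Let sq (r s : R) : 0 < r -> 0 < r^2 + s^2.
by move=> r0; rewrite ltr_pwDl ?sqr_ge0// exprn_gt0. Qed.
Let F_axis r s : F (r, s) = F (sqrt (r^2 + s^2), 0).
by rewrite !radF /eucl expr0n addr0 sqr_sqrtr// addr_ge0 ?sqr_ge0.
Qed.
Let partial2 r s : 0 < r -> partial true F (r, s) =
 s * (partial false F (sqrt (r^2 + s^2), 0) / sqrt (r^2 + s^2)).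
move=> r0; have p := sq s r0; have p1 : 0 < sqrt (r^2 + s^2) by rewrite sqrtr_gt0.
have h1 := der_line2 (@dF (r, s) true).
have d1 : derives s (fun t : R => sqrt (r^2 + t^2)) (2 * s * 1 / (2 * sqrt (r^2 + s^2))).
 apply: der_sqrt => //; apply: (der_eq (der_add (der_cst s (r^2)) (der_sqr (der_id s)))).
 by rewrite add0r.
have := @is_derive1_comp R _ _ s _ _ (der_line1 (@dF (sqrt (r^2 + s^2), 0) false)) d1.
rewrite (_ : _ \o _ = (fun t => F (r, t))); last by apply/funext => t /=; rewrite [RHS]F_axis.
move=> h2; have := @derive_val _ _ _ _ _ _ _ h1; rewrite (@derive_val _ _ _ _ _ _ _ h2) => <-.
by lra.
Qed.

Lemma radial_der q : 0 < q ->
 derives q (fun q => F (sqrt q, 0)) (radial_flux q / q).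
Proof.
move=> q0; have s0 : 0 < sqrt q by rewrite sqrtr_gt0.
have h := @is_derive1_comp R _ _ q _ _ (der_line1 (@dF (sqrt q, 0) false)) (der_sqrt1 q0).
apply: (der_eq h); rewrite /radial_flux.
move: (partial _ _ _) => z; move: (sqr_sqrtr (ltW q0)) s0; move: (sqrt q) => s <- s0.
by field; rewrite gt_eqF.
Qed.

(** In the variable [q] the radial Laplacian is [4 (q f')']. The second derivative across the axis
    is obtained by differentiating the radial form [s f'(rho) / rho] of the first one at [s = 0]. *)
Lemma radial_flux_der q : 0 < q ->
 derives q radial_flux (laplacian F (sqrt q, 0) / 4).
Proof.
move=> q0; have s0 : 0 < sqrt q by rewrite sqrtr_gt0.
have h := @is_derive1_comp R _ _ q _ _ (der_line1 (@ddF (sqrt q, 0) false false)) (der_sqrt1 q0).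
have h2 := der_sqrt1 q0.
have p2 : partial true (partial true F) (sqrt q, 0) = partial false F (sqrt q, 0) / sqrt q.
 have e1 := der_line2 (@ddF (sqrt q, 0) true true).
 pose rho (t : R) := sqrt (sqrt q^2 + t^2).
 have r0 : rho 0 = sqrt q by rewrite /rho expr0n addr0 sqr_sqrtr// ltW.
 have d1 : is_derive (0 : R) (1 : R) rho (2 * 0 * 1 / (2 * sqrt (sqrt q^2 + 0^2))).
  apply: der_sqrt; first by rewrite expr0n addr0 exprn_gt0.
  apply: (der_eq (der_add (der_cst 0 _) (der_sqr (der_id (0 : R))))).
  by rewrite add0r.
 have d2 := @is_derive1_comp R _ rho 0 _ _ (der_line1 (@ddF (rho 0, 0) false false)) d1.
 have rn : rho 0 != 0 by lra.
 have d3 := der_mul (der_id (0 : R)) (der_mul d2 (der_inv rn d1)).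
 have e2 : is_derive (0 : R) (1 : R) (fun t => partial true F (sqrt q, t)) (partial false F (rho 0, 0) / rho 0).
  rewrite (_ : (fun t => _) = (fun t => t * (partial false F (rho t, 0) / rho t))).
   apply: (der_eq d3) => /=.
   by lra.
  by apply/funext => t; rewrite partial2.
 by rewrite -(@derive_val _ _ _ _ _ _ _ e1) (@derive_val _ _ _ _ _ _ _ e2) r0.
rewrite /laplacian p2.
have d := der_mul (der_mul h2 h) (der_cst q (2^-1 : R)).
apply: (der_eq d) => /=.
move: (partial false F _) (partial false (partial false F) _) => a b.
move: (sqrt q) s0 => s s0.
by field; rewrite gt_eqF.
Qed.

End RadialLaplacian.

(** * Improper integrals over the half-line *)

Section HalfLine.
Variable R : realType.
Local Notation leb := (@lebesgue_measure R).
Implicit Types (f F : R -> R) (q c d : R).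

Lemma window_int f F c d : mble f -> c < d ->
 (forall q, c <= q -> derives q F (f q)) -> (forall q, c <= q -> {for q, continuous f}) ->
 (\int[leb]_q (ind ((c < q) && (q < d)) * f q)%:E = (F d - F c)%:E)%E.
Proof.
move=> mf cd dF cf; rewrite int_open//.
have d1 x : c <= x -> x <= d -> derives x F (f x) by move=> h _; exact: dF.
have d2 x : c <= x -> x <= d -> {for x, continuous f} by move=> h _; exact: cf.
exact: ftc_segment cd d1 d2.
Qed.
(** Starting from 2 keeps the point 1 strictly inside every window []a n, b n[]. *)
Let a n : R := n.+2%:R^-1.
Let b n : R := n.+2%:R.

Let a0 n : 0 < a n. by rewrite invr_gt0. Qed.
Let a1 n : a n < 1. by rewrite invf_lt1// ltr1n. Qed.
Let b1 n : 1 < b n. by rewrite ltr1n. Qed.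
Let window_cvg (g : R -> R) q : ind ((a n < q) && (q < b n)) * g q @[n --> \oo] --> ind (0 < q) * g q.
have [q0|q0] := ltP 0 q; last first.
 rewrite mul0r (_ : (fun n => _) = (fun=> 0)); first exact: cvg_cst.
 by apply/funext => n; rewrite ltNge (le_trans q0 (ltW (a0 n))) mul0r.
apply: cvg_near_cst.
near=> n; congr (ind _ * _); apply/andP; split.
 rewrite -[ltRHS]invrK ltf_pV2 ?posrE ?invr_gt0//.
 apply: (lt_le_trans (_ : _ < n%:R)); last by rewrite ler_nat (leqW (leqnSn n)).
 by near: n; exact: nbhs_infty_gtr.
apply: (lt_le_trans (_ : _ < n%:R)); last by rewrite ler_nat (leqW (leqnSn n)).
by near: n; exact: nbhs_infty_gtr.
Unshelve. all: by end_near. Qed.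
Let ind_le (g : R -> R) n q : `|ind ((a n < q) && (q < b n)) * g q| <= `|ind (0 < q) * g q|.
rewrite !normrM ler_wpM2r//; case: ltP => //= aq; case: ltP => //= qb; rewrite ?normr0//.
by rewrite (lt_trans (a0 n)).
Qed.

Section Antiderivative.
Variables f F : R -> R.
Hypothesis mf : mble f.
Hypothesis dF : forall q, 0 < q -> derives q F (f q).
Hypothesis cf : forall q, 0 < q -> {for q, continuous f}.

Let window c d : 0 < c -> c < d ->
 (\int[leb]_q (ind ((c < q) && (q < d)) * f q)%:E = (F d - F c)%:E)%E.
move=> c0 cd; apply: window_int => // q cq; first exact: dF (lt_le_trans c0 cq).
exact: cf (lt_le_trans c0 cq).
Qed.

Lemma half_line_int (l0 l1 : R) : leb.-integrable setT (fun q => (ind (0 < q)%R * f q)%:E) ->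
 F (n.+2%:R^-1) @[n --> \oo] --> l0 -> F n.+2%:R @[n --> \oo] --> l1 ->
 (\int[leb]_q (ind (0 < q)%R * f q)%:E = (l1 - l0)%:E)%E.
Proof.
move=> fi h0 h1.
have h : (\int[leb]_q (ind ((a n < q) && (q < b n)) * f q)%:E)%E @[n --> \oo] -->
  (\int[leb]_q (ind (0 < q)%R * f q)%:E)%E.
 apply: (@dominated_real _ _ _ leb (fun n q => ind ((a n < q) && (q < b n)) * f q) (fun q => ind (0 < q)%R * f q)
  (fun q => `|ind (0 < q)%R * f q|)).
 - by move=> n; meas.
 - by meas.
 - by [].
 - exact: ind_le.
 - by meas.
 - by move/integrableP : fi => [_].
move: h; rewrite (_ : (fun n => _) = (fun n => (F (b n) - F (a n))%:E)); last first.
 by apply/funext => n; rewrite window// (lt_trans (a1 n)).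
move=> h2; have h3 : (F (b n) - F (a n))%:E @[n --> \oo] --> (l1 - l0)%:E.
 by apply: cvg_EFin; [exact: nearW|apply: cvgB].
exact: (cvg_unique _ h2 h3).
Qed.
Let fatou_half (c : R) :
 (forall n, (\int[leb]_q (ind ((a n < q) && (q < b n)) * `|f q|)%:E <= c%:E)%E) ->
 leb.-integrable setT (fun q => (ind (0 < q)%R * f q)%:E).
move=> h.
apply: (@intble_le _ _ R leb _ (fun q => `|ind (0 < q)%R * f q|)) => //; try by meas.
have -> : (\int[leb]_x `|ind (0 < x)%R * f x|%:E = \int[leb]_x (ind (0 < x)%R * `|f x|)%:E)%E by apply: eq_integral => q _; rewrite normrM ger0_norm.
apply: (@le_lt_trans _ _ c%:E); last exact: ltry.
apply: (@fatou_real _ _ _ leb (fun n q => ind ((a n < q) && (q < b n)) * `|f q|)) => //.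
- by move=> n; meas.
- by exact: (@window_cvg (fun q => `|f q|)).
Qed.

(** A bounded primitive bounds the integral of [f] over each window, and Fatou's lemma passes to the
    half-line. The variant below allows the sign change at 1 of a logarithmic factor. *)
Lemma half_line_intble_ge0 c : (forall q, 0 < q -> 0 <= f q) -> (forall q, 0 < q -> `|F q| <= c) ->
 leb.-integrable setT (fun q => (ind (0 < q)%R * f q)%:E).
Proof.
move=> f0 Fc; apply: (@fatou_half (2 * c)) => n.
have -> : (\int[leb]_q (ind ((a n < q) && (q < b n)) * `|f q|)%:E = \int[leb]_q (ind ((a n < q) && (q < b n)) * f q)%:E)%E.
 apply: eq_integral => q _; congr EFin; case: ltP => //= aq; rewrite ?mul0r//.
 by rewrite ger0_norm// f0// (lt_trans (a0 n)).
rewrite window ?(lt_trans (a1 n))// lee_fin.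
have := Fc (a n) (a0 n); have := Fc (b n) (lt_trans ltr01 (b1 n)).
by rewrite !ler_norml => /andP[? ?] /andP[? ?]; lra.
Qed.

Lemma half_line_intble_sign c : (forall q, 0 < q -> q <= 1 -> f q <= 0) -> (forall q, 1 <= q -> 0 <= f q) ->
 (forall q, 0 < q -> `|F q| <= c) ->
 leb.-integrable setT (fun q => (ind (0 < q)%R * f q)%:E).
Proof.
move=> f0 f1 Fc; apply: (@fatou_half (4 * c)) => n.
have fz : f 1 = 0 by apply/le_anti; rewrite f0// f1.
have -> : (\int[leb]_q (ind ((a n < q) && (q < b n)) * `|f q|)%:E =
 \int[leb]_q ((ind ((a n < q) && (q < 1)) * - f q)%:E + (ind ((1 < q) && (q < b n)) * f q)%:E))%E.
 apply: eq_integral => q _; rewrite -EFinD; congr EFin.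
 have [->|qn] := eqVneq q 1; first by rewrite fz normr0 oppr0 !mulr0 addr0.
 have [lt|ge] := ltP q 1.
  rewrite (ltNge 1) (ltW lt) mul0r addr0 (lt_trans lt (b1 n)) andbT.
  case: (ltP (a n) q) => aq; rewrite ?mul0r// ler0_norm// f0 ?(ltW lt)//.
  exact: lt_trans (a0 n) aq.
 have gt : 1 < q by lra.
 by rewrite gt (lt_trans (a1 n) gt) mul0r add0r ger0_norm// f1.
have wneg : (\int[leb]_q (ind ((a n < q) && (q < 1)) * - f q)%:E = (- F 1 - - F (a n))%:E)%E.
 apply: (@window_int (fun q => - f q) (fun q => - F q)); [by meas|exact: a1| |] => q aq;
 have q0 := lt_le_trans (a0 n) aq; first exact: der_opp (dF q0).
 by apply: continuousN; exact: cf.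
rewrite ge0_integralD; [|isd| |isd| |isd].
- rewrite wneg window// lee_fin.
 have := Fc (a n) (a0 n); have := Fc (b n) (lt_trans ltr01 (b1 n)); have := Fc 1 ltr01.
 by rewrite !ler_norml => /andP[? ?] /andP[? ?] /andP[? ?]; lra.
- move=> q _; rewrite lee_fin; case: (ltP (a n) q) => aq; rewrite ?mul0r//=; case: (ltP q 1) => q1; rewrite ?mul0r// mul1r.
 by rewrite oppr_ge0 f0 ?(ltW q1)// (lt_trans (a0 n)).
- move=> q _; rewrite lee_fin; case: (ltP 1 q) => q1; rewrite ?mul0r//=.
 by rewrite mulr_ge0// f1// ltW.
Qed.

End Antiderivative.

Lemma cvgy_nat F (l : R) : F x @[x --> +oo] --> l -> F n.+2%:R @[n --> \oo] --> l.
Proof.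
move=> h; apply/cvgrPdist_le => e e0; have [c hc] := cvgy_ex h e0.
near=> n; rewrite distrC; apply: hc.
apply: (lt_le_trans (_ : _ < n%:R)); last by rewrite ler_nat (leqW (leqnSn n)).
by near: n; exact: nbhs_infty_gtr.
Unshelve. all: by end_near. Qed.

Lemma int_radial_signed (h : R -> R) : mble h ->
 (\int[leb2 R]_x (h (nsq x))%:E = \int[leb]_q (pi * (ind (0 < q)%R * h q))%:E)%E.
Proof.
move=> mh; rewrite integralE [RHS]integralE.
have p0 := pi_ge0 R.
have m0 (c : R) : 0 <= Num.max c 0 by rewrite le_max lexx orbT.
congr (_ - _)%E.
 transitivity (\int[leb2 R]_x (Num.max (h (nsq x)) 0)%:E)%E.
  by apply: eq_integral => x _; rewrite funeposE EFin_max.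
 rewrite (@int_radial_half R (fun q => Num.max (h q) 0)); [|by meas|by move=> q].
 apply: eq_integral => q _; rewrite funeposE -EFin_max; congr EFin.
 by case: (0 < q); rewrite ?mul1r ?mul0r ?mulr0 ?maxxx// maxr_pMr// mulr0.
transitivity (\int[leb2 R]_x (Num.max (- h (nsq x)) 0)%:E)%E.
 by apply: eq_integral => x _; rewrite funenegE EFin_max.
rewrite (@int_radial_half R (fun q => Num.max (- h q) 0)); [|by meas|by move=> q].
apply: eq_integral => q _; rewrite funenegE -EFin_max; congr EFin.
by case: (0 < q); rewrite ?mul1r ?mul0r ?mulr0 ?oppr0 ?maxxx// maxr_pMr// mulr0 mulrN.
Qed.

End HalfLine.

(* What the transport argument uses of the ground state: F is the density of u0^2 and m its mass function in
 the variable q = |x|^2; A = - q E' / E, zeta = q A' - A / 2; P and K are the first integrals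
 with P' = 4 q E'^2 and K' = m F ln q. *)
Record profile (R : realType) (F A zeta P K m : R -> R) (N Kinf : R) : Prop := Profile {
 profile_F : forall q : R, 0 < q -> 0 < F q;
 profile_A : forall q : R, 0 < q -> 0 <= A q;
 profile_zeta : forall q : R, 0 < q -> 0 <= zeta q;
 profile_m : forall q : R, 0 < q -> 0 < m q < N;
 profile_dm : forall q : R, 0 < q -> derives q m (pi * F q);
 profile_dF : forall q : R, 0 < q -> derives q F (- 2 * A q * F q / q);
 profile_dA : forall q : R, 0 < q -> derives q A ((zeta q + A q / 2) / q);
 profile_dFzeta : forall q : R, 0 < q -> derives q (fun q => F q * zeta q)
  (F q * (zeta q / (2 * q) + (A q / q - m q / (4 * pi)) / 4));
 profile_dP : forall q : R, 0 < q -> derives q P (4 * F q * A q^2 / q);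
 profile_dK : forall q : R, 0 < q -> derives q K (m q * F q * ln q);
 profile_A_nd : forall p q : R, 0 < p -> p <= q -> A p / sqrt p <= A q / sqrt q;
 profile_m_cvg : m x @[x --> +oo] --> N;
 profile_P_cvg : P x @[x --> +oo] --> N^2 / (8 * pi^2);
 profile_K_cvg : K x @[x --> +oo] --> Kinf;
 profile_A_tail : A x^2 / x * (N - m x) @[x --> +oo] --> (0 : R);
 profile_zeta_tail : forall q : R, 0 < q -> F q * zeta q <= N / (16 * pi^2) * (N - m q);
 profile_zero : exists2 c : R, 0 <= c & forall q : R, 0 < q -> q <= 1 ->
  [/\ `|P q| <= c * q, `|K q| <= c * sqrt q, `|F q * zeta q| <= c * q, A q <= c * q &
   m q <= c * q /\ q <= c * m q] }.

Section GroundState.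
Variable R : realType.
Local Notation leb := (@lebesgue_measure R).
Local Notation mu2 := (leb2 R).
Local Notation plane := (plane R).
Implicit Types q r : R.

(** For functions of [q = |x|^2] differentiability is known only at [q > 0], so the end point 0 is
    reached by continuity. *)
Lemma mean_value_open (f df : R -> R) (a b : R) : a < b -> continuous f ->
 (forall x, a < x -> x < b -> derives x f (df x)) ->
 exists c, [/\ a < c, c < b & f b - f a = df c * (b - a)].
Proof.
move=> ab cf h.
have d x : x \in `]a, b[ -> derives x f (df x) by rewrite in_itv/= => /andP[ax xb]; exact: h.
have [c] := MVT ab d (continuous_subspaceT cf); rewrite in_itv/= => /andP[ac cb] e.
by exists c.
Qed.

Lemma der_nonincreasing_le0 (f : R -> R) (x d : R) : (forall y, x < y -> f y <= f x) ->
 derives x f d -> d <= 0.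
Proof.
move=> mon hd; rewrite leNgt; apply/negP => d0.
have [dl dl0 h] := is_der_near (divr_gt0 d0 (ltr0n R 2)) hd.
have h0 : 0 < dl / 2 by lra.
have : `|dl / 2| < dl by rewrite gtr0_norm//; lra.
move=> /h; rewrite (gtr0_norm h0) ler_norml => /andP[h1 _].
have : f (x + dl / 2) <= f x by apply: mon; rewrite ltrDl.
have : 0 < d * (dl / 2) by rewrite mulr_gt0.
by lra.
Qed.

Variables (U0 W : plane -> R).
Hypothesis gs : ground_state U0 W.

Definition gE q : R := U0 (sqrt q, 0).
Definition gG q : R := radial_flux U0 q.
Definition gw q : R := W (sqrt q, 0).
Definition gm q : R := 4 * pi * radial_flux W q.

Let U2 : Ck 2 U0. by case: gs. Qed.
Let W2 : Ck 2 W. by case: gs => _ []. Qed.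
Let eqU x : laplacian U0 x = (W x - 1) * U0 x. by case: gs => _ [_ [h _]]. Qed.
Let eqW x : laplacian W x = U0 x^2. by case: gs => _ [_ [_ [h _]]]. Qed.
Let W00 : W (0, 0) = 0. by case: gs => _ [_ [_ [_ [h _]]]]. Qed.
Let prof : exists f w : R -> R,
  (forall x, U0 x = f (eucl x)) /\ (forall x, W x = w (eucl x)) /\
  (forall r, 0 <= r -> 0 < f r) /\
  (forall r s, 0 <= r -> r < s -> f s < f r) /\ (f @ +oo --> 0).
by case: gs => _ [_ [_ [_ [_ [_ [_ h]]]]]]. Qed.
Let radU : exists f, forall x, U0 x = f (eucl x). by case: prof => f [w [h _]]; exists f. Qed.
Let radW : exists f, forall x, W x = f (eucl x). by case: prof => f [w [_ [h _]]]; exists w. Qed.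
Let euclx q : eucl (sqrt q, 0 : R) = sqrt q.
by rewrite /eucl /= expr0n addr0 sqrtr_sqr ger0_norm//. Qed.

Lemma U0_nsq x : U0 x = gE (nsq x).
Proof. by case: radU => f h; rewrite /gE !h euclx. Qed.

Lemma gE_cont : continuous gE. Proof. exact: radial_cont. Qed.
Lemma gG_cont : continuous gG. Proof. by exact: (radial_flux_cont U2). Qed.
Lemma gw_cont : continuous gw. Proof. exact: radial_cont. Qed.
Lemma gm_cont : continuous gm.
Proof. by move=> q; apply: cvgM; [exact: cvg_cst|exact: (radial_flux_cont W2)]. Qed.

Lemma gE_gt0 q : 0 < gE q.
Proof. by case: prof => f [w [h [_ [p _]]]]; rewrite /gE h p// sqrtr_ge0. Qed.

Lemma gE_decreasing p q : 0 <= p -> p < q -> gE q < gE p.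
Proof.
case: prof => f [w [h [_ [_ [d _]]]]] p0 pq; rewrite /gE !h !euclx d//.
by rewrite ltr_sqrt// (le_lt_trans p0).
Qed.

Lemma der_gE q : 0 < q -> derives q gE (gG q / q).
Proof. by exact: (radial_der U2). Qed.

Lemma der_gG q : 0 < q -> derives q gG ((gw q - 1) * gE q / 4).
Proof. by move=> q0; case: radU => f h; have := radial_flux_der U2 h q0; rewrite eqU. Qed.
Let pi0 : 0 < pi :> R := pi_gt0 R.
Let pin : pi != 0 :> R. by rewrite gt_eqF. Qed.

Lemma der_gw q : 0 < q -> derives q gw (gm q / (4 * pi * q)).
Proof.
move=> q0; case: radW => f h; apply: (der_eq (radial_der W2 q0)).
by rewrite /gm; move: pi pin => p pn; field; rewrite gt_eqF.
Qed.

Lemma der_gm q : 0 < q -> derives q gm (pi * gE q^2).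
Proof.
move=> q0; case: radW => f h; have := radial_flux_der W2 h q0; rewrite eqW => d.
apply: (der_eq (der_mul (der_cst q (4 * pi)) d)).
by rewrite -/(gE q); field.
Qed.
Let gG0 : gG 0 = 0. by rewrite /gG /radial_flux sqrtr0 !mul0r. Qed.
Let gm0 : gm 0 = 0. by rewrite /gm /radial_flux sqrtr0 !mul0r mulr0. Qed.
Let gw0 : gw 0 = 0. by rewrite /gw sqrtr0. Qed.

Lemma gE_le q : 0 < q -> gE q <= gE 0.
Proof. by move=> q0; exact: ltW (gE_decreasing (lexx 0) q0). Qed.
Let gmE q : 0 < q -> exists c, [/\ 0 < c, c < q & gm q = pi * gE c^2 * q].
move=> q0; have [c [c0 cq]] := mean_value_open q0 gm_cont (fun x h _ => der_gm h).
by rewrite gm0 !subr0; exists c.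
Qed.

Lemma gm_gt0 q : 0 < q -> 0 < gm q.
Proof. by move=> q0; have [c [_ _ ->]] := gmE q0; rewrite !mulr_gt0 ?gE_gt0. Qed.

Lemma gm_le q : 0 < q -> gm q <= pi * gE 0^2 * q.
Proof.
move=> q0; have [c [c0 _ ->]] := gmE q0; rewrite ler_pM2r// ler_pM2l//.
by rewrite lerXn2r ?nnegrE ?(ltW (gE_gt0 _))// gE_le.
Qed.
Let gwE q : 0 < q -> exists c, [/\ 0 < c, c < q & gw q = gm c / (4 * pi * c) * q].
move=> q0; have [c [c0 cq]] := mean_value_open q0 gw_cont (fun x h _ => der_gw h).
by rewrite gw0 !subr0; exists c.
Qed.

Lemma gw_ge0 q : 0 < q -> 0 <= gw q.
Proof.
move=> q0; have [c [c0 _ ->]] := gwE q0.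
by rewrite mulr_ge0 ?(ltW q0)// divr_ge0 ?(ltW (gm_gt0 c0))// !mulr_ge0// ltW.
Qed.

Lemma gw_le q : 0 < q -> gw q <= gE 0^2 * q.
Proof.
move=> q0; have [c [c0 _ ->]] := gwE q0; rewrite ler_pM2r// ler_pdivrMr ?mulr_gt0//.
apply: (le_trans (gm_le c0)); have := mulr_ge0 (mulr_ge0 (ltW pi0) (sqr_ge0 (gE 0))) (ltW c0).
have -> : gE 0^2 * (4 * pi * c) = 4 * (pi * gE 0^2 * c) by lra.
by lra.
Qed.

Lemma gG_le0 q : 0 < q -> gG q <= 0.
Proof.
move=> q0; have := der_nonincreasing_le0 _ (der_gE q0).
rewrite pmulr_lle0 ?invr_gt0//; apply => y qy.
exact: ltW (gE_decreasing (ltW q0) qy).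
Qed.

Lemma gG_neg : exists2 q, 0 < q & gG q < 0.
Proof.
have [c [c1 c2 e]] := mean_value_open (ltr01 : (0 : R) < 1) gE_cont (fun x h _ => der_gE h).
exists c => //; have := gE_decreasing (lexx 0) (ltr01 : (0 : R) < 1).
rewrite -subr_lt0 e subr0 mulr1 pmulr_llt0// invr_gt0//.
Qed.

Lemma gG_lower q : 0 < q -> - gG q <= gE 0 * q.
Proof.
move=> q0; have [c [c0 cq]] := mean_value_open q0 gG_cont (fun x h _ => der_gG h).
rewrite gG0 !subr0 => ->; rewrite -mulNr ler_pM2r//.
have := gw_ge0 c0; have := gE_le c0; have := gE_gt0 c => e0 e1 w0.
have : 0 <= gw c * gE c by rewrite mulr_ge0// ltW.
by lra.
Qed.

Definition gC : R := gE 0 + (gE 1)^-1 + pi * gE 0^2 + gE 0^2.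

Let gCge : [/\ gE 0 <= gC, (gE 1)^-1 <= gC, pi * gE 0^2 <= gC & gE 0^2 <= gC].
have e0 := gE_gt0 0; have e1 : 0 < (gE 1)^-1 by rewrite invr_gt0 gE_gt0.
have e2 := sqr_ge0 (gE 0); have e3 := mulr_ge0 (ltW pi0) e2.
rewrite /gC; move: e0 e1 e2 e3; move: (pi * gE 0^2) (gE 0^2) (gE 0) ((gE 1)^-1) => a b c d *.
by split; lra.
Qed.

Lemma gE_lb q : 0 < q -> q <= 1 -> 1 <= gC * gE q.
Proof.
move=> q0 q1; have [_ h _ _] := gCge.
have le : gE 1 <= gE q by move: q1; rewrite le_eqVlt => /predU1P[->//|q1]; exact: ltW (gE_decreasing (ltW q0) q1).
rewrite -[leLHS](@mulVf _ (gE 1)) ?gt_eqF ?gE_gt0// ler_pM ?invr_ge0 ?(ltW (gE_gt0 _))//.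
Qed.

Lemma gE_ub q : 0 < q -> gE q <= gC.
Proof. by move=> q0; have [h _ _ _] := gCge; exact: le_trans (gE_le q0) h. Qed.

Lemma gG_small q : 0 < q -> q <= 1 -> - gG q <= gC * q.
Proof. by move=> q0 _; have [h _ _ _] := gCge; apply: (le_trans (gG_lower q0)); rewrite ler_pM2r. Qed.

Lemma gm_small q : 0 < q -> q <= 1 -> gm q <= gC * q.
Proof. by move=> q0 _; have [_ _ h _] := gCge; apply: (le_trans (gm_le q0)); rewrite ler_pM2r. Qed.

Lemma gw_small q : 0 < q -> q <= 1 -> gw q <= gC * q.
Proof. by move=> q0 _; have [_ _ _ h] := gCge; apply: (le_trans (gw_le q0)); rewrite ler_pM2r. Qed.

Local Ltac ground := match goal with
 | |- forall q, _ -> is_derive _ _ gE _ => exact der_gE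
 | |- forall q, _ -> is_derive _ _ gG _ => exact der_gG
 | |- forall q, _ -> is_derive _ _ gw _ => exact der_gw
 | |- forall q, _ -> is_derive _ _ gm _ => exact der_gm
 | |- forall q, _ -> is_true (0 < gE _) => exact (fun q _ => gE_gt0 q)
 | |- forall q, _ -> is_true (gG _ <= 0) => exact gG_le0
 | |- exists2 q, _ & _ => exact gG_neg
 | |- forall q, _ -> _ -> is_true (1 <= _ * gE _) => exact gE_lb
 | |- forall q, _ -> is_true (gE _ <= _) => exact gE_ub
 | |- forall q, _ -> _ -> is_true (- gG _ <= _) => exact gG_small
 | |- forall q, _ -> _ -> is_true (gm _ <= _) => exact gm_small
 | |- forall q, _ -> is_true (0 < gm _) => exact gm_gt0
 | |- forall q, _ -> is_true (0 <= gw _) => exact gw_ge0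
 | |- forall q, _ -> _ -> is_true (gw _ <= _) => exact gw_small
 | H : is_true ?a |- is_true ?a => exact H
 end.
Local Notation N0 := (gN gm).
Local Notation L0 := (gL gw gm).

Let m_cvg0 : gm x @[x --> +oo] --> N0.
by eapply (@m_cvg R gE gG gw gm gC); ground. Qed.
Let m_le0 q : 0 < q -> gm q <= N0.
by eapply (@m_le R gE gG gw gm gC); ground. Qed.
Let J_cvg0 : gJ gw gm x @[x --> +oo] --> L0.
by eapply (@gJ_cvg R gE gG gw gm gC); ground. Qed.
Let zero0 : exists2 c, 0 <= c & forall q, 0 < q -> q <= 1 ->
 [/\ `|gP gE gG gw gm q| <= c * q, `|gK gE gG gw gm q| <= c * sqrt q,
  `|gJ gw gm q| <= c * sqrt q & `|gF gE q * gzeta gE gG gw q| <= c * q].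
by eapply (@ground_at_zero R gE gG gw gm gC); ground. Qed.
Let mE : mble gE.
by apply: continuous_measurable_fun; exact: gE_cont. Qed.
Let inv_cvg : (n.+2%:R^-1 : R) @[n --> \oo] --> (0 : R).
apply/cvgrPdist_le => e e0; near=> n; rewrite sub0r normrN ger0_norm//.
rewrite -[leRHS]invrK lef_pV2 ?posrE ?invr_gt0//; apply: (le_trans (_ : _ <= n%:R)); last first.
 by lra.
by near: n; exact: nbhs_infty_ger.
Unshelve. all: by end_near. Qed.
Let gm_zero : gm (n.+2%:R^-1) @[n --> \oo] --> (0 : R).
by rewrite -[X in _ --> X]gm0; apply: continuous_cvg; [exact: gm_cont|exact: inv_cvg]. Qed.
Let pie : mble (fun q => pi * gE q^2).
by meas. Qed.
Let cpie q : 0 < q -> {for q, continuous (fun q => pi * gE q^2)}.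
move=> q0; have h := der_gE q0.
by apply: (@is_der1_cont _ _ _ (0 * gE q^2 + pi * (2 * gE q * (gG q / q)))); deriv.
Qed.

Lemma ground_mass : (\int[mu2]_x (U0 x^2)%:E = N0%:E)%E.
Proof.
under eq_integral do rewrite U0_nsq.
have i : leb.-integrable setT (fun q => (ind (0 < q)%R * (pi * gE q^2))%:E).
 apply: (half_line_intble_ge0 pie der_gm cpie (c := N0)).
  by pos.
 by move=> q q0; rewrite ger0_norm ?m_le0// ltW// gm_gt0.
rewrite (@int_radial_signed R (fun q => gE q^2)); last by meas.
have := half_line_int pie der_gm cpie i gm_zero (cvgy_nat m_cvg0).
rewrite subr0 => <-; apply: eq_integral => q _; congr EFin; ring.
Qed.

Lemma NconstE : Nconst U0 = N0.
Proof. by rewrite /Nconst /Rintegral ground_mass. Qed.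
Let mJ : mble (fun q => pi * gF gE q * ln q).
by meas. Qed.
Let dJ q : 0 < q -> derives q (gJ gw gm) (pi * gF gE q * ln q).
by eapply (@der_gJ R gE gw gm); ground. Qed.
Let cJ q : 0 < q -> {for q, continuous (fun q => pi * gF gE q * ln q)}.
move=> q0; have h := der_gE q0; rewrite /gF.
by eapply is_der1_cont; deriv.
Qed.
Let gJ_bound : exists c, forall q, 0 < q -> `|gJ gw gm q| <= c.
have [c c0 hz] := zero0.
exists (Num.max c (Num.max `|gJ gw gm 1| `|L0|)) => q q0.
have [q1|q1] := leP q 1.
 have [_ _ h _] := hz q q0 q1; rewrite le_max; apply/orP; left.
 apply: (le_trans h); rewrite ler_piMr// -sqrtr1 ler_wsqrtr//.
rewrite le_max; apply/orP; right.
have nd a b : 1 <= a -> a <= b -> gJ gw gm a <= gJ gw gm b.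
 move=> a1 ab; have a0 := lt_le_trans ltr01 a1.
 apply: (@der_ge0_le R _ _ a b ab (fun z h1 _ => dJ (lt_le_trans a0 h1))) => z h1 _.
 rewrite mulr_ge0 ?ln_ge0 ?(le_trans a1 (ltW h1))//.
 by rewrite mulr_ge0 ?pi_ge0// sqr_ge0.
have up : gJ gw gm q <= L0 by apply: (cvgy_ge J_cvg0 (a := q)) => x qx; apply: nd => //; exact: ltW.
have lo := nd 1 q (lexx 1) (ltW q1).
rewrite ler_norml le_max; apply/andP; split; last first.
 by apply/orP; right; apply: (le_trans up); exact: ler_norm.
rewrite lerNl; apply: (@le_trans _ _ `|gJ gw gm 1|); last by rewrite le_max lexx.
rewrite -normrN; apply: le_trans (ler_norm _); by rewrite lerN2.
Qed.

(** [ln |x|] is half of [ln q], and [gJ] is a primitive of [pi F ln q] that vanishes at 0. *)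
Lemma IconstE : Iconst U0 = L0 / (4 * pi).
Proof.
have [c hc] := gJ_bound.
have i : leb.-integrable setT (fun q => (ind (0 < q)%R * (pi * gF gE q * ln q))%:E).
 apply: (half_line_intble_sign mJ dJ cJ (c := c)) => //.
  move=> q q0 q1; rewrite pmulr_rle0 ?ln_le0//.
  by rewrite mulr_gt0// exprn_gt0// gE_gt0.
 move=> q q1; rewrite mulr_ge0 ?ln_ge0//.
 by rewrite mulr_ge0 ?pi_ge0// sqr_ge0.
have J0 : gJ gw gm (n.+2%:R^-1) @[n --> \oo] --> (0 : R).
 have [k k0 hz] := zero0.
 have sq0 : k * sqrt (n.+2%:R^-1) @[n --> \oo] --> (k * 0 : R).
  apply: cvgM; first exact: cvg_cst.
  by rewrite -[X in _ --> X]sqrtr0; apply: continuous_cvg; [exact: sqrt_continuous|exact: inv_cvg].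
 rewrite mulr0 in sq0.
 apply/cvgrPdist_le => e e0; move/cvgrPdist_le : sq0 => /(_ e e0); apply: filterS => n.
 rewrite !sub0r !normrN => h; apply: le_trans h; rewrite [leRHS]ger0_norm ?mulr_ge0//.
 have p0 : (0 : R) < n.+2%:R^-1 by [].
 have p1 : (n.+2%:R^-1 : R) <= 1 by rewrite invf_le1// ler1n.
 by have [_ _ + _] := hz _ p0 p1.
have := half_line_int mJ dJ cJ i J0 (cvgy_nat J_cvg0); rewrite subr0 => e.
rewrite /Iconst /Rintegral.
have -> : (\int[mu2]_x (ln (eucl x) * U0 x^2)%:E = (L0 / 2)%:E)%E.
 transitivity (\int[mu2]_x (ln (nsq x) / 2 * gE (nsq x)^2)%:E)%E.
  apply: eq_integral => x _; rewrite -U0_nsq; congr (_ * _)%:E.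
  rewrite -[eucl x]/(sqrt (nsq x)); have [d0|d0] := leP (nsq x) 0; first by rewrite ler0_sqrtr// !ln0// mul0r.
  by rewrite -[nsq x in RHS]sqr_sqrtr ?(ltW d0)// ln_sqr ?sqrtr_gt0// mulrC mulKf.
 rewrite (@int_radial_signed R (fun q => ln q / 2 * gE q^2)); last by meas.
 have i0 : leb.-integrable setT (fun q : R => (0 : R)%:E) by exact: integrable0.
 have := int_lin (2^-1) 0 i i0; rewrite {1}/Rintegral e /= => h.
 transitivity (\int[leb]_x (2^-1 * (ind (0 < x)%R * (pi * gF gE x * ln x)) + 0 * 0)%:E)%E.
  by apply: eq_integral => q _; congr EFin; rewrite /gF; field.
 by rewrite h; congr EFin; ring.
rewrite /=; move: pi pin => p pn; move: L0 => l; by field.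
Qed.

(** The last argument is the limit of [gK] rewritten with [L = 4 pi I]; it is the quantity through
    which [I] enters the final inequality. *)
Lemma ground_profile : exists F A zeta P K m : R -> R,
 profile F A zeta P K m (Nconst U0)
  (2 * ((Iconst U0 + 1) * Nconst U0 - Nconst U0^2 / (8 * pi))).
Proof.
exists (gF gE), (gA gE gG), (gzeta gE gG gw), (gP gE gG gw gm), (gK gE gG gw gm), gm.
have -> : 2 * ((Iconst U0 + 1) * Nconst U0 - Nconst U0^2 / (8 * pi)) =
  N0 * L0 / (2 * pi) + 2 * N0 - N0^2 / (4 * pi) by rewrite NconstE IconstE; move: pi pin => p pn; field.
rewrite NconstE; split.
- by eapply (@gF_gt0 R gE); ground.
- by eapply (@gA_ge0 R gE gG); ground.
- by eapply (@gzeta_ge0 R gE gG gw gm gC); ground.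
- move=> q q0; rewrite gm_gt0//=; eapply (@m_lt R gE gG gw gm gC); ground.
- exact: der_gm.
- by eapply (@der_gF R gE gG); ground.
- by eapply (@der_gA R gE gG gw); ground.
- by eapply (@der_gFzeta R gE gG gw gm); ground.
- by eapply (@der_gP R gE gG gw gm); ground.
- by eapply (@der_gK R gE gG gw gm); ground.
- by eapply (@gA_sqrt_nondecreasing R gE gG gw gm gC); ground.
- exact: m_cvg0.
- by eapply (@gP_cvg R gE gG gw gm gC); ground.
- by eapply (@gK_cvg R gE gG gw gm gC); ground.
- by eapply (@gA_tail R gE gG gw gm gC); ground.
- by eapply (@gFzeta_tail R gE gG gw gm gC); ground.
have [c c0 hz] := zero0.
have e0 : 0 < gC by have [h _ _ _] := gCge; exact: lt_le_trans (gE_gt0 0) h.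
have k0 : 0 <= gC^2 / pi by pos.
have s0 := sqr_ge0 gC.
pose k := c + gC^2 + gC + gC^2 / pi.
have [k1 k2 k3 k4] : [/\ c <= k, gC^2 <= k, gC <= k & gC^2 / pi <= k] by rewrite /k; split; lra.
exists k; first exact: le_trans k1.
move=> q q0 q1; have [h1 h2 _ h4] := hz q q0 q1; split.
- by apply: (le_trans h1); rewrite ler_pM2r.
- by apply: (le_trans h2); rewrite ler_pM2r// sqrtr_gt0.
- by apply: (le_trans h4); rewrite ler_pM2r.
- apply: (@le_trans _ _ (gC^2 * q)); last by rewrite ler_pM2r.
 by eapply (@gA_small R gE gG gC); ground.
split.
 by apply: (le_trans (gm_small q0 q1)); rewrite ler_pM2r.
apply: (@le_trans _ _ (gC^2 / pi * gm q)); last by rewrite ler_pM2r// gm_gt0.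
have : pi / gC^2 * q <= gm q by eapply (@m_lower R gE gm gC); ground.
have g2 : 0 < gC^2 by rewrite exprn_gt0.
have -> : pi / gC^2 * q = q / (gC^2 / pi) by rewrite invf_div mulrC.
by rewrite ler_pdivrMr ?divr_gt0// mulrC.
Qed.

End GroundState.


(** * Transport of the ground state profile *)

Section LipschitzFTC.
Variable R : realType.
Local Notation leb := (@lebesgue_measure R).
Implicit Types (f g G dG : R -> R) (a b c p q h : R).

Definition clamp a b q : R := Num.max a (Num.min q b).

Lemma clamp_itv a b q : a <= b -> a <= clamp a b q /\ clamp a b q <= b.
Proof. by move=> ab; rewrite le_max lexx ge_max ge_min lexx orbT ab. Qed.

Lemma clamp_id a b q : a <= q -> q <= b -> clamp a b q = q.
Proof. by move=> aq qb; rewrite /clamp min_l// max_r. Qed.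

Lemma clamp_lo a b q : a <= b -> q <= a -> clamp a b q = a.
Proof. by move=> ab qa; rewrite /clamp min_l ?(le_trans qa)// max_l. Qed.

Lemma clamp_hi a b q : a <= b -> b <= q -> clamp a b q = b.
Proof. by move=> ab bq; rewrite /clamp min_r// max_r. Qed.

Lemma clamp_nd a b p q : p <= q -> clamp a b p <= clamp a b q.
Proof.
move=> pq; rewrite ge_max !le_max lexx; apply/orP; right.
by rewrite le_min ge_min pq ge_min lexx orbT.
Qed.

Lemma clamp_lip a b p q : `|clamp a b p - clamp a b q| <= `|p - q|.
Proof.
wlog pq : p q / p <= q.
 move=> H; have [/H//|/ltW/H] := leP p q.
 by rewrite distrC [leRHS]distrC.
rewrite ler0_norm ?subr_le0 ?clamp_nd// [leRHS]ler0_norm ?subr_le0//.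
rewrite !opprB lerBlDr /clamp ge_max; apply/andP; split.
 have : a <= Num.max a (Num.min p b) by rewrite le_max lexx.
 by lra.
apply: (@le_trans _ _ (q - p + Num.min p b)); last by rewrite lerD2l le_max lexx orbT.
by case: (leP p b) => pb; rewrite ge_min; lra.
Qed.

Lemma lipschitz_cont G c : 0 <= c -> (forall p q, `|G p - G q| <= c * `|p - q|) -> continuous G.
Proof.
move=> c0 lip q; apply/cvgrPdist_lt => e e0.
have d0 : 0 < e / (c + 1) by rewrite divr_gt0// ltr_wpDl.
apply/nbhs_ballP; exists (e / (c + 1)) => //= p; rewrite /= => pq.
apply: (le_lt_trans (lip q p)).
apply: (@le_lt_trans _ _ ((c + 1) * `|q - p|)); first by rewrite ler_wpM2r// lerDl.
by rewrite mulrC -ltr_pdivlMr// ltr_wpDl.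
Qed.

Lemma inv_nat_cvg : (n.+1%:R^-1 : R) @[n --> \oo] --> (0 : R).
Proof. exact: cvg_harmonic. Qed.

Lemma quotient_bound n (X d e : R) : `|X - d * n.+1%:R^-1| <= e * n.+1%:R^-1 -> `|d - n.+1%:R * X| <= e.
Proof.
have n0 : 0 < n.+1%:R :> R by [].
move=> h; have -> : d - n.+1%:R * X = - (n.+1%:R * (X - d * n.+1%:R^-1)).
 by rewrite mulrBr [n.+1%:R * (d * _)]mulrCA divff ?mulr1 ?opprB//.
by rewrite normrN normrM (gtr0_norm n0) mulrC -ler_pdivlMr.
Qed.

(* A Lipschitz function is the integral of its derivative: apply dominated convergence to its difference quotients. *)
Lemma lipschitz_ftc G dG a b c : 0 <= a -> a < b -> 0 <= c ->
 (forall p q, a <= p -> p <= b -> a <= q -> q <= b -> `|G p - G q| <= c * `|p - q|) ->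
 mble dG ->
 {ae leb, forall q, a < q -> q < b -> derives q G (dG q)} ->
 leb.-integrable setT (fun q => (ind ((a < q) && (q < b)) * dG q)%:E) /\
 (\int[leb]_q (ind ((a < q) && (q < b)) * dG q)%:E = (G b - G a)%:E)%E.
Proof.
move=> a0 ab c0 lip mdG ae.
(* Constant outside [[a, b]], so that the difference quotients are defined and bounded by [c] on the
   whole line. *)
pose H q := G (clamp a b q).
have lipH p q : `|H p - H q| <= c * `|p - q|.
 have [h1 h2] := clamp_itv p (ltW ab); have [h3 h4] := clamp_itv q (ltW ab).
 by apply: (le_trans (lip _ _ h1 h2 h3 h4)); rewrite ler_wpM2l// clamp_lip.
have cH : continuous H := lipschitz_cont c0 lipH.
have mH : mble H by exact: continuous_measurable_fun.
have [Phi dPhi] := antideriv cH.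
pose Q n q := n.+1%:R * (H (q + n.+1%:R^-1) - H q).
have mQ n : mble (Q n).
 have mHs : mble (fun q => H (q + n.+1%:R^-1)) by meas.
 by rewrite /Q; meas.
have Qc n q : `|Q n q| <= c.
 rewrite normrM normr_nat mulrC -ler_pdivlMr//; apply: (le_trans (lipH _ _)).
 by rewrite addrC addKr ger0_norm.
have [ii lim1] : leb.-integrable setT (fun q => (ind ((a < q) && (q < b)) * dG q)%:E) /\
 (\int[leb]_q (ind ((a < q) && (q < b)) * Q n q)%:E)%E @[n --> \oo] --> (\int[leb]_q (ind ((a < q) && (q < b)) * dG q)%:E)%E.
 apply: (@dominated_ae _ _ _ leb (fun n q => ind ((a < q) && (q < b)) * Q n q) (fun q => ind ((a < q) && (q < b)) * dG q)
  (fun q => ind ((a < q) && (q < b)) * c)).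
 - by move=> n; meas.
 - by meas.
 - case: ae => B [mB B0 sB]; exists B; split => // q hq; apply: sB => /= h; apply: hq => /=.
  case E : ((a < q) && (q < b)); last by under eq_fun do rewrite mul0r; rewrite mul0r; exact: cvg_cst.
  rewrite mul1r; under eq_fun do rewrite mul1r.
  move/andP : E => [aq qb].
  have d := h aq qb.
  apply/cvgrPdist_le => e e0; have [dl dl0 hd] := is_der_near e0 d.
  have m0 : 0 < Num.min dl (b - q) by rewrite lt_min dl0 subr_gt0.
  have /cvgrPdist_lt := inv_nat_cvg => /(_ _ m0); apply: filterS => n.
  rewrite sub0r normrN lt_min => /andP[h1 h2].
  have i0 : (0 : R) < n.+1%:R^-1 by [].
  rewrite (gtr0_norm i0) in h2.
  have h3 : q + n.+1%:R^-1 <= b by rewrite -lerBrDl ltW.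
  have h4 : a <= q + n.+1%:R^-1 by rewrite (le_trans (ltW aq))// lerDl.
  have := hd _ h1; rewrite (gtr0_norm i0).
  by rewrite /Q /H (clamp_id (ltW aq) (ltW qb)) (clamp_id h4 h3); exact: quotient_bound.
 - move=> n q; rewrite normrM ger0_norm// ler_wpM2l//.
 - by meas.
 - rewrite (_ : (\int[leb]_x _)%E = (\int[leb]_q (ind ((a < q) && (q < b)) * (fun=> c) q)%:E)%E)//.
  rewrite int_open//.
  have dc x : a <= x -> x <= b -> derives x ( *%R c) c by move=> _ _; exact: der_mulk.
  have cc x : a <= x -> x <= b -> {for x, continuous (fun _ : R => c)} by move=> _ _; exact: cvg_cst.
  by rewrite (ftc_segment ab dc cc) ltry.
(* The integral of a difference quotient reduces to averages of [H] over intervals of length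
   [1 / (n + 1)] at the two ends, which converge by continuity. *)
have E n : (\int[leb]_q (ind ((a < q) && (q < b)) * Q n q)%:E =
  (n.+1%:R * (Phi (b + n.+1%:R^-1) - Phi b) - n.+1%:R * (Phi (a + n.+1%:R^-1) - Phi a))%:E)%E.
 rewrite int_open//.
 have i0 : (0 : R) < n.+1%:R^-1 by [].
 have dQ x : a <= x -> x <= b -> derives x (fun q => n.+1%:R * (Phi (q + n.+1%:R^-1) - Phi q)) (Q n x).
  move=> ax _; have x0 : 0 <= x := le_trans a0 ax.
  have x1 : 0 <= x + n.+1%:R^-1 by pos.
  have d1 := dPhi x x0.
  have d2 : derives x (fun q => Phi (q + n.+1%:R^-1)) (H (x + n.+1%:R^-1)).
   have ds : derives x (fun q : R => q + n.+1%:R^-1) (1 + 0) by exact: der_add (der_id x) (der_cst x _).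
   apply: (der_eq (@is_derive1_comp R Phi _ x _ _ (dPhi _ x1) ds)).
   by lra.
  apply: (der_eq (der_mul (der_cst x n.+1%:R) (der_add d2 (der_opp d1)))).
  by rewrite mul0r add0r.
 have cQ x : a <= x -> x <= b -> {for x, continuous (Q n)}.
  move=> _ _; apply: cvgM; first exact: cvg_cst.
  apply: cvgB; last exact: cH.
  apply: (@continuous_comp _ _ _ (fun q => q + n.+1%:R^-1) H); last exact: cH.
  by apply: cvgD; [exact: cvg_id|exact: cvg_cst].
 by rewrite (ftc_segment ab dQ cQ).
have quot q : 0 <= q -> n.+1%:R * (Phi (q + n.+1%:R^-1) - Phi q) @[n --> \oo] --> H q.
 move=> q0; apply/cvgrPdist_le => e e0; have [dl dl0 hd] := is_der_near e0 (dPhi q q0).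
 have /cvgrPdist_lt := inv_nat_cvg => /(_ _ dl0); apply: filterS => n.
 rewrite sub0r normrN => h1; have := hd _ h1.
 have i0 : (0 : R) < n.+1%:R^-1 by [].
 by rewrite (gtr0_norm i0); exact: quotient_bound.
have lim2 : (\int[leb]_q (ind ((a < q) && (q < b)) * Q n q)%:E)%E @[n --> \oo] --> (H b - H a)%:E.
 rewrite (_ : (fun n => _) = (fun n => (n.+1%:R * (Phi (b + n.+1%:R^-1) - Phi b) - n.+1%:R * (Phi (a + n.+1%:R^-1) - Phi a))%:E)); last exact/funext.
 apply: cvg_EFin; first exact: nearW.
 by apply: cvgB; apply: quot => //; exact: le_trans a0 (ltW ab).
by rewrite (cvg_unique _ lim1 lim2)// /H !clamp_id// ?(ltW ab).
Qed.

End LipschitzFTC.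

(** * The mass function of a nonincreasing profile *)

Section MassFunction.
Variable R : realType.
Local Notation leb := (@lebesgue_measure R).
Local Notation mu2 := (leb2 R).
Implicit Types p q s : R.
Variables (v : R -> R) (lam : R).
Hypotheses (mv : mble v) (v2 : (\int[mu2]_x (v (nsq x)^2)%:E = lam%:E)%E).
Hypothesis v0 : forall q, 0 <= v q.
Hypothesis v_ni : forall p q, 0 < p -> p <= q -> v q <= v p.
Local Notation M := (rmass v).

Let pi0 : 0 < pi :> R := pi_gt0 R.

Lemma int_ind_co p q : p <= q -> (\int[leb]_s (ind ((p <= s) && (s < q))%R)%:E = (q - p)%:E)%E.
Proof.
move=> pq; transitivity (\int[leb]_(s in `[p, q[) cst 1 s)%E.
 rewrite [RHS]integral_mkcond; apply: eq_integral => s _.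
 by rewrite patchE mem_setE in_itv/=; case: (_ && _).
rewrite integral_cst//= mul1e lebesgue_measure_itv/= lte_fin.
by case: ltP => h//; have -> : p = q by [apply/le_anti; rewrite pq h]; rewrite subrr.
Qed.
Let step p q : 0 < p -> p <= q ->
 ((M q)%:E = (M p)%:E + \int[leb]_s (pi * (ind ((p <= s) && (s < q))%R * v s^2))%:E)%E.
move=> p0 pq; rewrite -!(rmassE mv v2) -ge0_integralD; [|isd| |isd| |isd].
- apply: eq_integral => s _; rewrite -EFinD -mulrDr -mulrDl; congr (pi * (_ * _))%:E.
 case: (ltP 0 s) => s0 /=; last first.
  by rewrite leNgt (le_lt_trans s0 p0) addr0.
 case: (ltP s p) => sp /=; first by rewrite (lt_le_trans sp pq) addr0.
 by rewrite add0r.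
- by move=> s _; pos.
- by move=> s _; pos.
Qed.

Lemma rmass_increment p q : 0 < p -> p <= q ->
 pi * (q - p) * v q^2 <= M q - M p /\ M q - M p <= pi * (q - p) * v p^2.
Proof.
move=> p0 pq; have := step p0 pq.
set I := (\int[leb]_s _)%E => e.
have Ie : I = (M q - M p)%:E by move: e; case: I => [r||]//= [->]; rewrite addrAC subrr add0r.
have box c : 0 <= c -> (\int[leb]_s (pi * (ind ((p <= s) && (s < q))%R * c))%:E = (pi * (q - p) * c)%:E)%E.
 move=> c0; have -> : (pi * (q - p) * c)%:E = ((pi * c)%:E * (q - p)%:E)%E :> \bar R by rewrite -EFinM; congr EFin; ring.
 rewrite -(int_ind_co pq) -ge0_integralZl; [|isd..].
 by apply: eq_integral => s _; congr EFin; ring.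
split; rewrite -lee_fin -Ie -box ?sqr_ge0//.
 apply: le_int_real; [by meas|isd|isd|].
 move=> s; rewrite ler_pM2l//; case: (leP p s) => ps; rewrite ?mul0r//=; case: (ltP s q) => sq; rewrite ?mul0r// !mul1r.
 by rewrite lerXn2r ?nnegrE// v_ni ?(ltW sq)// (lt_le_trans p0).
apply: le_int_real; [by meas|isd|isd|].
move=> s; rewrite ler_pM2l//; case: (leP p s) => ps; rewrite ?mul0r//=; case: (ltP s q) => sq; rewrite ?mul0r// !mul1r.
by rewrite lerXn2r ?nnegrE// v_ni.
Qed.

Lemma rmass_nd p q : 0 < p -> p <= q -> M p <= M q.
Proof.
move=> p0 pq; have [h _] := rmass_increment p0 pq; rewrite -subr_ge0; apply: le_trans h.
by rewrite mulr_ge0// mulr_ge0 ?pi_ge0// subr_ge0.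
Qed.

Lemma rmass_lower q : 0 < q -> pi * q * v q^2 <= M q.
Proof.
move=> q0; rewrite -lee_fin -(rmassE mv v2).
have -> : (pi * q * v q^2)%:E = ((pi * v q^2)%:E * q%:E)%E :> \bar R by congr EFin; ring.
rewrite -(int_itv_ind (ltW q0)) -ge0_integralZl; [|isd..].
apply: le_int_real; [by meas|isd|isd|].
move=> s; rewrite -mulrA ler_pM2l// mulrC; case: (ltP 0 s) => s0; rewrite ?mul0r//=; case: (ltP s q) => sq; rewrite ?mul0r// !mul1r.
by rewrite lerXn2r ?nnegrE// v_ni ?(ltW sq).
Qed.

Lemma rmass_near_total e : 0 < e -> exists2 q, 0 < q & lam - e <= M q.
Proof.
move=> e0.
have h : (\int[leb]_p (pi * (ind ((0 < p) && (p < n.+1%:R)) * v p^2))%:E)%E @[n --> \oo] --> lam%:E.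
 rewrite -(total_rmass mv v2).
 apply: (@dominated_real _ _ _ leb (fun n p => pi * (ind ((0 < p) && (p < n.+1%:R)) * v p^2)) _ (fun p => pi * (ind (0 < p) * v p^2))).
 - by move=> n; meas.
 - by meas.
 - move=> p; apply: cvgM; first exact: cvg_cst.
  apply: cvgM; last exact: cvg_cst.
  apply: cvg_near_cst; near=> n; congr (ind _).
  suff -> : p < n.+1%:R by rewrite andbT.
  apply: (lt_le_trans (_ : _ < n%:R)); last by rewrite ler_nat.
  by near: n; exact: nbhs_infty_gtr.
 - move=> n p; rewrite ger0_norm; last by pos.
  by rewrite ler_pM2l// ler_wpM2r ?sqr_ge0//; case: (0 < p) => //=; case: ltP.
 - by meas.
 - by rewrite (total_rmass mv v2) ltry.
have : M n.+1%:R @[n --> \oo] --> lam.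
 have E : (fun n => (M n.+1%:R)%:E) = (fun n => \int[leb]_p (pi * (ind ((0 < p) && (p < n.+1%:R)) * v p^2))%:E)%E by apply/funext => n; rewrite (rmassE mv v2).
 by move: h; rewrite -E => /fine_cvgP[].
move=> /cvgrPdist_le /(_ e e0) [n _ /(_ n (leqnn n))] hn.
exists n.+1%:R => //; move: hn; rewrite ler_norml => /andP[]; lra.
Unshelve. all: by end_near. Qed.

(** Lebesgue differentiation: [v] may jump, so the derivative is asserted only almost everywhere. *)
Lemma rmass_ae : {ae leb, forall q, 0 < q -> derives q M (pi * v q^2)}.
Proof.
pose f p : R := pi * (ind (0 < p) * v p^2).
have mf : mble f by rewrite /f; meas.
have fi : leb.-integrable setT (EFin \o f).
 apply: intble_real => //; first by move=> p; rewrite /f; pos.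
 by rewrite (total_rmass mv v2) ltry.
have li : locally_integrable setT f by apply: open_integrable_locally => //; exact: openT.
have ii y : leb.-integrable `]-oo, y] (EFin \o f) by apply: (integrableS measurableT _ _ fi) => //.
have FM q : (\int[leb]_(t in `]-oo, q]) (f t))%R = M q.
 rewrite /Rintegral -integral_itv_bndo_bndc; last first.
  by apply: measurable_funTS; exact: mfun_EFin.
 congr fine; rewrite integral_mkcond; apply: eq_integral => s _.
 rewrite patchE mem_setE in_itv/=; case: (s < q); rewrite ?andbT ?andbF//.
 by rewrite mul0r mulr0.
case: (FTC1Ny ii li) => B [mB B0 sB]; exists B; split => // q hq; apply: sB => /= h; apply: hq => q0.
have [d1 d2] := h.
have E : (fun x => (\int[leb]_(t in `]-oo, x]) (f t))%R) = M by apply/funext.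
rewrite E in d1 d2.
have -> : pi * v q^2 = f q by rewrite /f q0 mul1r.
by apply: DeriveDef; [exact: d1|rewrite -derive1E].
Qed.

Lemma rmass_open q : (\int[leb]_p (ind ((0 < p) && (p < q))%R * v p^2)%:E = (M q / pi)%:E)%E.
Proof.
have := rmassE mv v2 q.
have -> : (\int[leb]_p (pi * (ind ((0 < p) && (p < q)) * v p^2))%:E =
  pi%:E * \int[leb]_p (ind ((0 < p) && (p < q)) * v p^2)%:E)%E by rewrite -ge0_integralZl; [by []|isd..].
move=> /(congr1 (fun z => (pi^-1)%:E * z)%E); rewrite muleA -!EFinM mulVf ?gt_eqF// mul1e => ->.
by rewrite mulrC.
Qed.

Lemma rmass_closed q : (\int[leb]_p (ind ((0 < p) && (p <= q))%R * v p^2)%:E = (M q / pi)%:E)%E.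
Proof.
have E : (\int[leb]_p (ind ((0 < p) && (p <= q))%R * v p^2)%:E =
  \int[leb]_p (ind ((0 < p) && (p < q))%R * v p^2)%:E)%E.
 transitivity (\int[leb]_(s in `]0%R, q]) (v s^2)%:E)%E.
  rewrite [RHS]integral_mkcond; apply: eq_integral => s _.
  by rewrite patchE mem_setE in_itv/=; case: (_ && _); rewrite ?mul1r ?mul0r.
 rewrite -integral_itv_bndo_bndc; last by apply: measurable_funTS; apply: mfun_EFin; meas.
 rewrite [LHS]integral_mkcond; apply: eq_integral => s _.
 by rewrite patchE mem_setE in_itv/=; case: (_ && _); rewrite ?mul1r ?mul0r.
by rewrite E rmass_open.
Qed.

Hypothesis lam_gt0 : 0 < lam.

(** If [M q] vanished, so would [v q], and by monotonicity [v] beyond [q]; the total mass could then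
    not be reached. *)
Lemma rmass_gt0 q : 0 < q -> 0 < M q.
Proof.
move=> q0; rewrite ltNge; apply/negP => Mq.
have vq : v q = 0.
 have := rmass_lower q0 => h; have := le_trans h Mq.
 rewrite pmulr_rle0 ?mulr_gt0// => h2; apply/eqP; rewrite -sqrf_eq0 eq_le h2 sqr_ge0//.
have [p p0 hp] := rmass_near_total (divr_gt0 lam_gt0 (ltr0n R 2)).
have : M p <= 0.
 have [pq|qp] := leP p q; first exact: le_trans (rmass_nd p0 pq) Mq.
 have [_] := rmass_increment q0 (ltW qp); rewrite vq expr0n mulr0; lra.
by have := lam_gt0; lra.
Qed.

Lemma rmass_cont q : 0 < q -> {for q, continuous M}.
Proof.
move=> q0; apply/cvgrPdist_lt => e e0.
have h0 : 0 < q / 2 by rewrite divr_gt0.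
pose c := pi * v (q / 2)^2 + 1.
have c0 : 0 < c by rewrite ltr_wpDl// mulr_ge0 ?sqr_ge0// pi_ge0.
have d0 : 0 < Num.min (q / 2) (e / c) by rewrite lt_min h0 divr_gt0.
apply/nbhs_ballP; exists (Num.min (q / 2) (e / c)) => //= p; rewrite /ball /= lt_min => /andP[h1 h2].
have lip x y : q / 2 <= x -> x <= y -> `|M x - M y| <= c * (y - x).
 move=> hx xy; have x0 := lt_le_trans h0 hx; have [_ h] := rmass_increment x0 xy.
 rewrite distrC ger0_norm ?subr_ge0 ?rmass_nd//; apply: (le_trans h).
 have -> : pi * (y - x) * v x^2 = pi * v x^2 * (y - x) by ring.
 rewrite ler_wpM2r ?subr_ge0//; apply: (@le_trans _ _ (pi * v (q / 2)^2)); last by rewrite lerDl.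
 by rewrite ler_pM2l// lerXn2r ?nnegrE// v_ni.
have hp : q / 2 <= p by move: h1; rewrite ltr_norml => /andP[? ?]; lra.
rewrite ltr_pdivlMr// mulrC in h2; apply: le_lt_trans h2.
have [pq|qp] := leP p q.
 by rewrite distrC [in leRHS]ger0_norm ?subr_ge0//; exact: lip.
rewrite [in leRHS]distrC [in leRHS]ger0_norm ?subr_ge0 ?(ltW qp)//; apply: lip; last exact: ltW.
by lra.
Qed.

End MassFunction.


Section Calculus2.
Variable R : realType.
Implicit Types (f df : R -> R) (a b p q x y c : R).

Lemma intermediate_value f a b y : a <= b -> (forall x, a <= x -> x <= b -> {for x, continuous f}) ->
 f a <= y -> y <= f b -> exists c, [/\ a <= c, c <= b & f c = y].
Proof.
move=> ab cf fa fb.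
have cw : {within `[a, b], continuous f} by apply: continuous_in_subspaceT => x; rewrite inE => /andP[ax xb]; exact: cf.
have yy : Num.min (f a) (f b) <= y <= Num.max (f a) (f b) by rewrite ge_min fa le_max fb orbT.
have [c] := IVT ab cw yy; rewrite in_itv/= => /andP[ac cb] e.
by exists c.
Qed.

Lemma C1_lipschitz f df a b : a <= b ->
 (forall x, a <= x -> x <= b -> derives x f (df x)) ->
 (forall x, a <= x -> x <= b -> {for x, continuous df}) ->
 exists2 c, 0 <= c & forall p q, a <= p -> p <= b -> a <= q -> q <= b -> `|f p - f q| <= c * `|p - q|.
Proof.
move=> ab d cdf.
have cw : {within `[a, b], continuous (fun x => `|df x|)}.
 apply: continuous_in_subspaceT => x; rewrite inE /= in_itv/= => /andP[ax xb].
 by apply: cvg_norm; exact: cdf.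
have [c _ hc] := EVT_max ab cw.
exists `|df c| => // p q ap pb aq qb.
wlog pq : p q ap pb aq qb / p <= q.
 move=> H; have [pq|/ltW pq] := leP p q; first exact: H.
 by rewrite distrC [in leRHS]distrC; exact: H.
move: pq; rewrite le_eqVlt => /predU1P[->|pq]; first by rewrite !subrr !normr0.
have dd x : p <= x -> x <= q -> derives x f (df x) by move=> px xq; apply: d; [exact: le_trans px|exact: le_trans qb].
have [x [px xq e]] := mean_value pq dd.
rewrite distrC e normrM [in leRHS]distrC ler_wpM2r//; apply: hc.
by rewrite in_itv/= (le_trans ap (ltW px)) (le_trans (ltW xq) qb).
Qed.

Lemma expR_tangent_half x : 2 + x <= 2 * expR (x / 2).
Proof. by have := @expR_ge1Dx R (x / 2); lra. Qed.

(* e^d x^2 - (2 + d) x + 1 = (e^(d/2) x - 1)^2 + (2 e^(d/2) - 2 - d) x. *)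
Lemma quadratic_ge0 (d x : R) : 0 <= x -> 0 <= expR d * x^2 - (2 + d) * x + 1.
Proof.
move=> x0; have h := expR_tangent_half d.
have -> : expR d = expR (d / 2)^2 by rewrite expr2 -expRD -splitr.
move: (expR (d / 2)) h => e h.
have -> : e^2 * x^2 - (2 + d) * x + 1 = (e * x - 1)^2 + (2 * e - (2 + d)) * x by lra.
by rewrite addr_ge0 ?sqr_ge0// mulr_ge0// subr_ge0.
Qed.

(** The convexity step, with [s^2 = tau q], [r^2 = q], [rho = v^2] and [F], [A], [z] taken at
    [tau q]. Since [k exp d r / s = 1], a factor [k] on the right can be supplied at the price of
    [exp d]. What remains is [exp d >= 1 + d] on the terms in [A] and [quadratic_ge0] with
    [x = q rho / (tau F)] on those in [z]; equality holds at [d = 0], [x = 1]. *)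
Lemma transport_pointwise (c rho F A z s r : R) : 0 <= rho -> 0 < F -> 0 <= A -> 0 <= z -> 0 < s -> 0 < r ->
 forall k d, k = expR (- c) -> d = c - (ln (r^2) - ln (s^2)) / 2 ->
 k^2 * (rho * (z / s^2 + A / (2 * s^2)) * (1 + d) + rho * z / s^2 - F * z / r^2) <=
 k * (rho * (A / (2 * s * r) + r * z * rho / (s ^+ 3 * F))).
Proof.
move=> rho0 F0 A0 z0 s0 r0 k d kE dE'.
have k0 : 0 < k by rewrite kE expR_gt0.
have dE : d = c - (ln r - ln s) by rewrite dE' !ln_sqr//; field.
have kd : k * expR d * (r / s) = 1.
 have -> : r / s = expR (ln r - ln s) by rewrite expRB !lnK.
 rewrite kE -!expRD dE (_ : _ + _ = 0) ?expR0//; ring.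
have e1 : 1 + d <= expR d by exact: expR_ge1Dx.
have x0 : 0 <= r^2 * rho / (s^2 * F) by have f0 := ltW F0; pos.
have q0 := quadratic_ge0 d x0.
move: (expR d) kd e1 q0 => ed kd e1 q0.
have -> : k * (rho * (A / (2 * s * r) + r * z * rho / (s ^+ 3 * F))) =
 k^2 * (ed * (rho * A / (2 * s^2) + r^2 * z * rho^2 / (s ^+ 4 * F))).
 transitivity (k * (k * ed * (r / s)) * (rho * (A / (2 * s * r) + r * z * rho / (s ^+ 3 * F)))).
  by rewrite kd mulr1.
 by field; rewrite !gt_eqF.
rewrite ler_pM2l ?exprn_gt0// -subr_ge0.
have -> : ed * (rho * A / (2 * s^2) + r^2 * z * rho^2 / (s ^+ 4 * F)) -
 (rho * (z / s^2 + A / (2 * s^2)) * (1 + d) + rho * z / s^2 - F * z / r^2) =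
 rho * A / (2 * s^2) * (ed - (1 + d)) +
 z * F / r^2 * (ed * (r^2 * rho / (s^2 * F))^2 - (2 + d) * (r^2 * rho / (s^2 * F)) + 1) by field; rewrite !gt_eqF.
have f0 := ltW F0; apply: addr_ge0; apply: mulr_ge0 => //; [by pos|by rewrite subr_ge0|by pos].
Qed.

End Calculus2.

Section SequenceLimits.
Variable R : realType.
Implicit Types (u w : nat -> R) (l c : R).

Definition tends u l := u n @[n --> \oo] --> l.

Lemma tends_cst c : tends (fun=> c) c. Proof. exact: cvg_cst. Qed.
Lemma tends_add u w l c : tends u l -> tends w c -> tends (fun n => u n + w n) (l + c).
Proof. exact: cvgD. Qed.
Lemma tends_opp u l : tends u l -> tends (fun n => - u n) (- l). Proof. exact: cvgN. Qed.
Lemma tends_mul u w l c : tends u l -> tends w c -> tends (fun n => u n * w n) (l * c).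
Proof. exact: cvgM. Qed.
Lemma tends_sqr u l : tends u l -> tends (fun n => u n^2) (l^2).
Proof. by move=> h; exact: tends_mul. Qed.

Lemma tends0 u w : tends w 0 -> (forall n, `|u n| <= w n) -> tends u 0.
Proof.
move=> h uw; apply/cvgrPdist_le => e e0; move/cvgrPdist_le : h => /(_ e e0); apply: filterS => n.
rewrite !sub0r !normrN => h; apply: (le_trans (uw n)); exact: le_trans (ler_norm _) h.
Qed.

Lemma tends_le u l c : tends u l -> (forall n, u n <= c) -> l <= c.
Proof. by move=> h uc; apply: (cvgr_to_le h); apply: nearW. Qed.

End SequenceLimits.

Ltac lims := match goal with
 | H : tends ?u _ |- tends ?u _ => exact H
 | |- tends (fun n => ?c) _ => eapply tends_cst
 | |- tends (fun n => @?u n + @?w n) _ => eapply tends_add; lims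
 | |- tends (fun n => - @?u n) _ => eapply tends_opp; lims
 | |- tends (fun n => @?u n * @?w n) _ => eapply tends_mul; lims
 | |- tends (fun n => @?u n^2) _ => eapply tends_sqr; lims
 end.

(** * The transported Hardy weight *)

Section Transport.
Variable R : realType.
Local Notation leb := (@lebesgue_measure R).
Local Notation mu2 := (leb2 R).
Implicit Types p q s x : R.
Variables (F A zeta P K m : R -> R) (N Kinf : R).
Hypothesis pr : profile F A zeta P K m N Kinf.
Variables (v : R -> R) (T : R).
Hypotheses (mv : mble v) (v2 : (\int[mu2]_x (v (nsq x)^2)%:E = N%:E)%E).
Hypothesis v0 : forall q, 0 <= v q.
Hypothesis v_ni : forall p q, 0 < p -> p <= q -> v q <= v p.
Hypothesis weighted : weighted_bound v N T.
Local Notation M := (rmass v).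
Hypothesis M_small : forall q, 0 < q -> q <= 1 -> M q <= sqrt q * (T + N).
Hypothesis log_integrable : leb.-integrable setT (fun q => (ind (0 < q)%R * (ln q * (M q * v q^2)))%:E).

Let pi0 : 0 < pi :> R := pi_gt0 R.

Let N_gt0 : 0 < N.
by have /andP[h1 h2] := profile_m pr ltr01; exact: lt_trans h2. Qed.
Let m_incr p q : 0 < p -> p < q -> m p < m q.
move=> p0 pq.
have d x : p <= x -> x <= q -> derives x m (pi * F x) by move=> px _; exact: (profile_dm pr (lt_le_trans p0 px)).
have [x [px xq e]] := mean_value pq d.
by rewrite -subr_gt0 e mulr_gt0 ?subr_gt0// mulr_gt0// (profile_F pr)// (lt_trans p0).
Qed.
Let m_mono p q : 0 < p -> p <= q -> m p <= m q.
by move=> p0; rewrite le_eqVlt => /predU1P[->//|/m_incr h]; exact: ltW (h p0). Qed.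
Let m_leE p q : 0 < p -> 0 < q -> m p <= m q -> p <= q.
by move=> p0 q0 h; rewrite leNgt; apply/negP => /(m_incr q0); rewrite ltNge h. Qed.
Let m_cont q : 0 < q -> {for q, continuous m}.
by move=> q0; exact: is_der1_cont (profile_dm pr q0). Qed.
(** Inverse of [m], which increases strictly from 0 to [N] on the positive half-line; 1 is the
    default at values that [m] does not take. *)
Let ginv y : R := xget 1 [set s | 0 < s /\ m s = y].

Let ginvK s : 0 < s -> ginv (m s) = s.
move=> s0; have : exists x, [set x | 0 < x /\ m x = m s] x by exists s.
move=> /xgetPex => /(_ 1) []; rewrite -/(ginv (m s)) => g0 e.
by apply/le_anti/andP; split; apply: m_leE => //; rewrite e.
Qed.
Let m_onto y : 0 < y -> y < N -> exists2 s, 0 < s & m s = y.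
move=> y0 yN; have [c c0 hz] := profile_zero pr.
have ey : 0 < N - y by lra.
have [b hb] := cvgy_ex (profile_m_cvg pr) ey.
pose p := Num.min 1 (y / (c + 1)); pose q := Num.max (b + 1) 1.
have c1 : 0 < c + 1 by lra.
have p0 : 0 < p by rewrite lt_min ltr01 divr_gt0.
have p1 : p <= 1 by rewrite ge_min lexx.
have [_ _ _ _ [hm _]] := hz p p0 p1.
have mp : m p <= y.
 apply: (le_trans hm); apply: (@le_trans _ _ ((c + 1) * p)); first by rewrite ler_pM2r// lerDl.
 by rewrite mulrC -ler_pdivlMr// ge_min lexx orbT.
have pq : p <= q by rewrite (le_trans p1)// le_max lexx orbT.
have mq : y <= m q.
 have bq : b < q by rewrite lt_max; apply/orP; left; rewrite ltrDl.
 by have := hb q bq; rewrite ler_norml => /andP[? _]; lra.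
have [s [ps _ e]] := intermediate_value pq (fun x h _ => m_cont (lt_le_trans p0 h)) mp mq.
by exists s => //; exact: lt_le_trans ps.
Qed.
Let F_ni p q : 0 < p -> p <= q -> F q <= F p.
move=> p0 pq.
apply: (@der_le0_ge R F _ p q pq (fun x h _ => profile_dF pr (lt_le_trans p0 h))) => x px _.
have x0 := lt_trans p0 px; have a0 := profile_A pr x0; have f0 := ltW (profile_F pr x0).
by rewrite pmulr_lle0 ?invr_gt0// mulr_le0_ge0// mulr_le0_ge0.
Qed.

(** * A window [[a, b]] that [tau] maps onto [[1/t, t]] *)

Section Window.
Variables (t : R) (a b c : R).
Hypotheses (t1 : 1 < t) (a0 : 0 < a) (Ma : M a = m t^-1) (Mb : M b = m t) (b0 : 0 < b).

Let t0 : 0 < t := lt_trans ltr01 t1.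
Let ti0 : 0 < t^-1. by rewrite invr_gt0. Qed.
Let tit : t^-1 < t. by rewrite (lt_trans _ t1)// invf_lt1. Qed.
Let ab : a < b.
rewrite ltNge; apply/negP => ba; have := rmass_nd mv v2 v0 v_ni b0 ba.
by rewrite Ma Mb leNgt m_incr.
Qed.
Let tau q : R := ginv (M q).

Let tau_spec q : a <= q -> q <= b -> [/\ t^-1 <= tau q, tau q <= t & m (tau q) = M q].
move=> aq qb; have q0 := lt_le_trans a0 aq.
have h1 := rmass_nd mv v2 v0 v_ni a0 aq; have h2 := rmass_nd mv v2 v0 v_ni q0 qb.
rewrite Ma in h1; rewrite Mb in h2.
have /andP[mt0 _] := profile_m pr ti0; have /andP[_ mtN] := profile_m pr t0.
have [s s0 e] := m_onto (lt_le_trans mt0 h1) (le_lt_trans h2 mtN).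
by rewrite /tau -e ginvK//; split => //; apply: m_leE => //; rewrite e.
Qed.
Let tau_a : tau a = t^-1. by rewrite /tau Ma ginvK. Qed.
Let tau_b : tau b = t. by rewrite /tau Mb ginvK. Qed.
Let tau_gt0 q : a <= q -> q <= b -> 0 < tau q.
by move=> aq qb; have [h _ _] := tau_spec aq qb; exact: lt_le_trans h. Qed.
Let tau_nd p q : a <= p -> p <= q -> q <= b -> tau p <= tau q.
move=> ap pq qb; have pb := le_trans pq qb; have aq := le_trans ap pq.
have [_ _ e1] := tau_spec ap pb; have [_ _ e2] := tau_spec aq qb.
apply: m_leE; rewrite ?tau_gt0// e1 e2; apply: (rmass_nd mv v2 v0 v_ni) => //.
exact: lt_le_trans ap.
Qed.
(** Bound for [tau' = v^2 / F(tau)] on the window: [v] is largest at [a], and [F] is smallest at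
    [t]. *)
Let Ct : R := v a^2 / F t.

Let Ct_ge0 : 0 <= Ct. by rewrite divr_ge0 ?sqr_ge0// ltW// (profile_F pr). Qed.
Let tau_lip p q : a <= p -> p <= b -> a <= q -> q <= b -> `|tau p - tau q| <= Ct * `|p - q|.
wlog pq : p q / p <= q.
 move=> H ap pb aq qb; have [pq|/ltW pq] := leP p q; first exact: H.
 by rewrite distrC [in leRHS]distrC; apply: H.
move=> ap pb aq qb; have tpq := tau_nd ap pq qb.
rewrite distrC [in leRHS]distrC !ger0_norm ?subr_ge0//.
move: (tpq); rewrite le_eqVlt => /predU1P[->|lt]; first by rewrite subrr mulr_ge0 ?subr_ge0.
have tp0 := tau_gt0 ap pb.
have d x : tau p <= x -> x <= tau q -> derives x m (pi * F x) by move=> px _; exact: (profile_dm pr (lt_le_trans tp0 px)).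
have [x [px xq e]] := mean_value lt d.
have [_ _ e1] := tau_spec ap pb; have [_ tq e2] := tau_spec aq qb.
rewrite e1 e2 in e.
have p0 := lt_le_trans a0 ap; have [_ h] := rmass_increment mv v2 v0 v_ni p0 pq.
have x0 := lt_trans tp0 px.
have Fx : F t <= F x by apply: F_ni => //; exact: ltW (lt_le_trans xq tq).
have F0 := profile_F pr t0.
rewrite mulrAC ler_pdivlMr//.
apply: (@le_trans _ _ ((tau q - tau p) * F x)); first by rewrite ler_wpM2l ?subr_ge0.
rewrite -(ler_pM2l pi0); have -> : pi * ((tau q - tau p) * F x) = M q - M p by rewrite e; ring.
apply: (le_trans h); have -> : pi * (v a^2 * (q - p)) = pi * (q - p) * v a^2 by ring.
by rewrite ler_wpM2l ?mulr_ge0 ?subr_ge0 ?(ltW pi0)// lerXn2r ?nnegrE// v_ni.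
Qed.
Let tau_der q : a < q -> q < b -> derives q M (pi * v q^2) ->
 derives q tau (v q^2 / F (tau q)).
move=> aq qb dM; have [_ _ e] := tau_spec (ltW aq) (ltW qb).
have s0 := tau_gt0 (ltW aq) (ltW qb); have F0 := profile_F pr s0.
have dg : is_derive (m (tau q)) (1 : R) ginv (pi * F (tau q))^-1.
 have near0 : \forall x \near tau q, 0 < x by exact: lt_nbhsr.
 apply: (@is_derive_inverse R m ginv) => //.
 - by apply: filterS near0 => x; exact: ginvK.
 - by apply: filterS near0 => x; exact: m_cont.
 - exact: (profile_dm pr s0).
 - by rewrite mulf_neq0// gt_eqF.
rewrite e in dg.
apply: (der_eq (@is_derive1_comp R ginv M q _ _ dg dM)).
by move: (pi : R) pi0 => p p0; field; rewrite !gt_eqF.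
Qed.
(** [tau] frozen at its end values outside the window, so that every function built from it is
    continuous on the line. *)
Let tc q : R := tau (clamp a b q).

Let tc_spec q : [/\ t^-1 <= tc q, tc q <= t & 0 < tc q].
have [h1 h2] := clamp_itv q (ltW ab); have [h3 h4 _] := tau_spec h1 h2.
by split => //; exact: lt_le_trans h3.
Qed.
Let tc_id q : a <= q -> q <= b -> tc q = tau q.
by move=> aq qb; rewrite /tc clamp_id. Qed.
Let tc_lip p q : `|tc p - tc q| <= Ct * `|p - q|.
have [h1 h2] := clamp_itv p (ltW ab); have [h3 h4] := clamp_itv q (ltW ab).
by apply: (le_trans (tau_lip h1 h2 h3 h4)); rewrite ler_wpM2l// clamp_lip.
Qed.
Let tc_cont : continuous tc. exact: lipschitz_cont Ct_ge0 tc_lip. Qed.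
Let tc_comp (f : R -> R) : (forall s, 0 < s -> {for s, continuous f}) -> continuous (fun q => f (tc q)).
move=> cf q; apply: (@continuous_comp _ _ _ tc f); first exact: tc_cont.
by apply: cf; have [] := tc_spec q.
Qed.
Let zeta_der s : 0 < s -> exists d, derives s zeta d.
move=> s0; have h1 := profile_dFzeta pr s0; have h2 := profile_dF pr s0.
have Fn : F s != 0 by rewrite gt_eqF// (profile_F pr).
eexists; apply: (@is_der_local R zeta (fun x => F x * zeta x * (F x)^-1) s _ 0 (s + 1)) => //.
- by rewrite ltrDl.
- by move=> y y0 _; rewrite [F y * _]mulrC mulfK// gt_eqF// (profile_F pr).
Qed.
Let cF s : 0 < s -> {for s, continuous F}.
by move=> s0; exact: is_der1_cont (profile_dF pr s0). Qed.
Let cA s : 0 < s -> {for s, continuous A}.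
by move=> s0; exact: is_der1_cont (profile_dA pr s0). Qed.
Let cz s : 0 < s -> {for s, continuous zeta}.
by move=> s0; have [d h] := zeta_der s0; exact: is_der1_cont h. Qed.
Let k : R := expR (- c).
Let k0 : 0 < k. exact: expR_gt0. Qed.
Let dFz s : R := F s * (zeta s / (2 * s) + (A s / s - m s / (4 * pi)) / 4).
(** [g1 (tau q) + g2 (tau q) * ln q] is a primitive of the exact derivative in the convexity step.
    Differentiated along [tau' = v^2 / F], it gives the left side of [transport_pointwise], minus
    [k^2 v^2 A^2 / tau], plus the multiple of [ln q * M * v^2] that becomes the interaction. The
    terms in [m^2], [K] and [P] compensate what differentiating [F * zeta] leaves over. *)
Let g1 s : R := k^2 * (2 * (F s * zeta s) * (1 + c + ln s / 2) +
 ((1 + c) * m s^2 / (2 * pi) + K s / 2) / (8 * pi) - P s / 4).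
Let g2 s : R := - (k^2 * (F s * zeta s)).
Let dg1 s : R := k^2 * (2 * dFz s * (1 + c + ln s / 2) + F s * zeta s / s +
 ((1 + c) * (m s * F s) + m s * F s * ln s / 2) / (8 * pi) - F s * A s^2 / s).
Let dg2 s : R := - (k^2 * dFz s).

Let der_g1 s : 0 < s -> derives s g1 (dg1 s).
move=> s0; have h1 := profile_dFzeta pr s0; have h2 := profile_dm pr s0; have h3 := profile_dK pr s0.
have h4 := profile_dP pr s0.
have e := der_ln1 s0.
rewrite /g1.
have d1 := der_mul (der_mul (der_cst s 2) h1) (der_add (der_cst s (1 + c)) (der_mul e (der_cst s 2^-1))).
have d2 := der_mul (der_mul (der_cst s (1 + c)) (der_sqr h2)) (der_cst s (2 * pi)^-1).
have d3 := der_mul (der_add d2 (der_mul h3 (der_cst s 2^-1))) (der_cst s (8 * pi)^-1).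
have d4 := der_add (der_add d1 d3) (der_opp (der_mul h4 (der_cst s 4^-1))).
apply: (der_eq (der_mul (der_cst s (k^2)) d4)) => /=.
rewrite /dg1 /dFz; have pn : pi != 0 :> R by rewrite gt_eqF.
move: (k^2) (F s) (zeta s) (A s) (m s) (K s) (P s) (ln s) => kk f z al mm kv pv l.
by move: pi pn => p pn; field; rewrite gt_eqF.
Qed.
Let der_g2 s : 0 < s -> derives s g2 (dg2 s).
move=> s0; have h1 := profile_dFzeta pr s0.
apply: (der_eq (der_opp (der_mul (der_cst s (k^2)) h1))).
by rewrite mul0r add0r.
Qed.
Let cdFz s : 0 < s -> {for s, continuous dFz}.
move=> s0; have [d hz] := zeta_der s0; have h1 := profile_dF pr s0; have h2 := profile_dA pr s0.
have h3 := profile_dm pr s0; have sn : s != 0 by rewrite gt_eqF.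
have s2 : 2 * s != 0 by lra.
by rewrite /dFz; eapply is_der1_cont; deriv.
Qed.
Let cdg1 s : 0 < s -> {for s, continuous dg1}.
move=> s0; have [d hz] := zeta_der s0; have h1 := profile_dF pr s0; have h2 := profile_dA pr s0.
have h3 := profile_dm pr s0; have sn : s != 0 by rewrite gt_eqF.
have s2 : 2 * s != 0 by lra.
by rewrite /dg1 /dFz; eapply is_der1_cont; deriv.
Qed.
Let cdg2 s : 0 < s -> {for s, continuous dg2}.
move=> s0; apply: continuousN; apply: cvgM; [exact: cvg_cst|exact: cdFz].
Qed.
Let cg2 s : 0 < s -> {for s, continuous g2}.
by move=> s0; exact: is_der1_cont (der_g2 s0). Qed.
Let G q : R := g1 (tau q) + g2 (tau q) * ln q.
Let dG q : R := (dg1 (tc q) + dg2 (tc q) * ln q) * (v q^2 / F (tc q)) + g2 (tc q) / q.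

Let meas_tc (f : R -> R) : (forall s, 0 < s -> {for s, continuous f}) -> mble (fun q => f (tc q)).
by move=> cf; apply: continuous_measurable_fun; exact: tc_comp. Qed.
Let mdG : mble dG.
have h1 := meas_tc cdg1; have h2 := meas_tc cdg2; have h3 := meas_tc cF.
have h4 := meas_tc cg2.
by rewrite /dG; meas.
Qed.
Let G_lip : exists2 C, 0 <= C & forall p q, a <= p -> p <= b -> a <= q -> q <= b -> `|G p - G q| <= C * `|p - q|.
have d1 s : t^-1 <= s -> s <= t -> derives s g1 (dg1 s) by move=> h _; exact: der_g1 (lt_le_trans ti0 h).
have c1 s : t^-1 <= s -> s <= t -> {for s, continuous dg1} by move=> h _; exact: cdg1 (lt_le_trans ti0 h).
have d2 s : t^-1 <= s -> s <= t -> derives s g2 (dg2 s) by move=> h _; exact: der_g2 (lt_le_trans ti0 h).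
have c2 s : t^-1 <= s -> s <= t -> {for s, continuous dg2} by move=> h _; exact: cdg2 (lt_le_trans ti0 h).
have d3 s : a <= s -> s <= b -> derives s (@ln R) s^-1 by move=> h _; exact: der_ln1 (lt_le_trans a0 h).
have c3 s : a <= s -> s <= b -> {for s, continuous (fun x : R => x^-1)} by move=> h _; apply: inv_continuous; rewrite gt_eqF// (lt_le_trans a0 h).
have [C1 C10 l1] := C1_lipschitz (ltW tit) d1 c1.
have [C2 C20 l2] := C1_lipschitz (ltW tit) d2 c2.
have [C3 C30 l3] := C1_lipschitz (ltW ab) d3 c3.
have [x _ hx] : exists2 x, x \in `[t^-1, t] & forall y, y \in `[t^-1, t] -> `|g2 y| <= `|g2 x|.
 apply: EVT_max; first exact: ltW.
 apply: continuous_in_subspaceT => y; rewrite inE /= in_itv/= => /andP[h _].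
 by apply: cvg_norm; exact: is_der1_cont (der_g2 (lt_le_trans ti0 h)).
have [y _ hy] : exists2 y, y \in `[a, b] & forall z, z \in `[a, b] -> `|ln z| <= `|ln y|.
 apply: EVT_max; first exact: ltW.
 apply: continuous_in_subspaceT => z; rewrite inE /= in_itv/= => /andP[h _].
 by apply: cvg_norm; apply: continuous_ln; exact: lt_le_trans h.
exists (C1 * Ct + C2 * Ct * `|ln y| + `|g2 x| * C3).
 exact: (addr_ge0 (addr_ge0 (mulr_ge0 C10 Ct_ge0) (mulr_ge0 (mulr_ge0 C20 Ct_ge0) (normr_ge0 _))) (mulr_ge0 (normr_ge0 _) C30)).
move=> p q ap pb aq qb; have [p1 p2 _] := tau_spec ap pb; have [q1 q2 _] := tau_spec aq qb.
have -> : G p - G q = (g1 (tau p) - g1 (tau q)) + (g2 (tau p) - g2 (tau q)) * ln p + g2 (tau q) * (ln p - ln q) by rewrite /G; ring.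
have tl := tau_lip ap pb aq qb.
rewrite [leRHS]mulrDl [X in _ <= X + _]mulrDl; apply: (le_trans (ler_normD _ _)); apply: lerD; last first.
 rewrite normrM -mulrA ler_pM// ?l3//; apply: hx; rewrite in_itv/= q1//.
apply: (le_trans (ler_normD _ _)); apply: lerD.
 by apply: (le_trans (l1 _ _ p1 p2 q1 q2)); rewrite -mulrA ler_wpM2l.
rewrite normrM mulrAC ler_pM//; last by apply: hy; rewrite in_itv/= ap.
by apply: (le_trans (l2 _ _ p1 p2 q1 q2)); rewrite -mulrA ler_wpM2l.
Qed.
Let G_ftc : leb.-integrable setT (fun q => (ind ((a < q) && (q < b)) * dG q)%:E) /\
 (\int[leb]_q (ind ((a < q) && (q < b)) * dG q)%:E = (G b - G a)%:E)%E.
have [C C0 lip] := G_lip.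
apply: (lipschitz_ftc (ltW a0) ab C0 lip mdG).
case: (rmass_ae mv v2) => B [mB B0 sB]; exists B; split => // q hq; apply: sB => /= h; apply: hq => aq qb.
have q0 := lt_trans a0 aq; have dt := tau_der aq qb (h q0).
have s0 := tau_gt0 (ltW aq) (ltW qb).
have e1 := @is_derive1_comp R g1 tau q _ _ (der_g1 s0) dt.
have e2 := @is_derive1_comp R g2 tau q _ _ (der_g2 s0) dt.
have := der_add e1 (der_mul e2 (der_ln1 q0)).
move=> hh; apply: (der_eq hh) => /=.
by rewrite /dG tc_id ?(ltW aq) ?(ltW qb)//; ring.
Qed.
Let gam q : R := A (tc q) / sqrt (tc q).
Let ga : R := A t^-1 / sqrt t^-1.
Let gb : R := A t / sqrt t.

Let gam_ge0 q : 0 <= gam q.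
by have [_ _ h] := tc_spec q; rewrite divr_ge0// (profile_A pr). Qed.
Let gam_nd p q : p <= q -> gam p <= gam q.
move=> pq; have [_ _ h] := tc_spec p; apply: (profile_A_nd pr) => //.
have [h1 h2] := clamp_itv p (ltW ab); have [h3 h4] := clamp_itv q (ltW ab).
by apply: tau_nd => //; exact: clamp_nd.
Qed.
Let gam_lo q : q <= a -> gam q = ga.
by move=> qa; rewrite /gam /tc clamp_lo ?(ltW ab)// tau_a. Qed.
Let gam_hi q : b <= q -> gam q = gb.
by move=> bq; rewrite /gam /tc clamp_hi ?(ltW ab)// tau_b. Qed.
Let gam_le q : gam q <= gb.
by have [/gam_nd|/ltW/gam_hi->//] := leP q b; rewrite (gam_hi (lexx b)). Qed.
Let cgam : continuous gam.
apply: (@tc_comp (fun s => A s / sqrt s)) => s s0.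
apply: cvgM; first exact: cA.
apply: (@cvgV R); first by rewrite gt_eqF// sqrtr_gt0.
exact: sqrt_continuous.
Qed.
Let sm q : 0 < sqrt (Num.max a q). by rewrite sqrtr_gt0 lt_max a0. Qed.
Let sa : 0 < sqrt a. by rewrite sqrtr_gt0. Qed.
(** Inside the window this is the intended weight; below [a] it is constant and above [b] a multiple
    of [1 / sqrt q], which keeps it bounded and [q * beta q] nondecreasing. *)
Let beta q : R := k * gam q / sqrt (Num.max a q).
Let gp q : R := zeta (tc q) / (tc q * sqrt (tc q)) * (v q^2 / F (tc q)).
Let dbeta q : R := ind ((a < q) && (q < b)) * (k * (gp q / sqrt q - gam q / (2 * q * sqrt q))) +
 ind (b <= q) * (- (k * gam q) / (2 * q * sqrt q)).
Let X q : R := beta q + q * dbeta q - q * beta q^2.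
(** [- Kc] is a lower bound of the Hardy integrand [X], approached as [q] tends to infinity. *)
Let Kc : R := k^2 * gb^2.

Let Kc_ge0 : 0 <= Kc. by rewrite mulr_ge0 ?sqr_ge0. Qed.
Let gam2 q : k^2 * gam q^2 <= Kc.
rewrite ler_wpM2l ?sqr_ge0// lerXn2r ?nnegrE//.
by rewrite -(gam_hi (lexx b)).
Qed.
Let cbeta : continuous beta.
move=> q; apply: cvgM; first by apply: cvgM; [exact: cvg_cst|exact: cgam].
apply: (@cvgV R); first by rewrite gt_eqF.
apply: (continuous_comp _ (@sqrt_continuous R _)).
exact: cont_maxr.
Qed.
Let mgam : mble gam. by apply: continuous_measurable_fun. Qed.
Let mgp : mble gp.
have h1 := meas_tc cF; have h2 := meas_tc cz; have h3 : mble tc.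
 by apply: continuous_measurable_fun.
by rewrite /gp; meas.
Qed.
Let mdbeta : mble dbeta.
by have h1 := mgam; have h2 := mgp; rewrite /dbeta; meas. Qed.
Let gp_ge0 q : 0 <= gp q.
have [_ _ h] := tc_spec q; have z0 := profile_zeta pr h; have f0 := ltW (profile_F pr h); have t0' := ltW h.
by rewrite /gp; pos.
Qed.
Let X_lo q : 0 < q -> q <= a -> - (k^2 * ga^2) <= X q.
move=> q0 qa; rewrite /X /dbeta [a < q]ltNge qa [b <= q]leNgt (le_lt_trans qa ab) !mul0r addr0 mulr0 addr0.
rewrite /beta max_l// gam_lo//.
have g0 : 0 <= ga by rewrite -(gam_lo (lexx a)).
have h1 : 0 <= k * ga / sqrt a := divr_ge0 (mulr_ge0 (ltW k0) g0) (ltW sa).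
have h2 : q * (k * ga / sqrt a)^2 <= k^2 * ga^2.
 rewrite expr_div_n sqr_sqrtr ?(ltW a0)// exprMn mulrC mulrAC ler_pdivrMr//.
 by rewrite ler_wpM2l// mulr_ge0 ?sqr_ge0.
by lra.
Qed.
Let X_mid q : a < q -> q < b -> X q = k * (gam q / (2 * sqrt q) + sqrt q * gp q) - k^2 * gam q^2.
move=> aq qb; have q0 := lt_trans a0 aq; have s0 : 0 < sqrt q by rewrite sqrtr_gt0.
rewrite /X /dbeta aq [b <= q]leNgt qb mul0r addr0 mul1r /beta max_r ?(ltW aq)//.
move: (gam q) (gp q) => g gq; move: (sqr_sqrtr (ltW q0)) s0; move: (sqrt q) => s' <- s0.
by field; rewrite gt_eqF.
Qed.
Let X_hi q : b <= q -> - Kc <= X q.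
move=> bq; have q0 := lt_le_trans b0 bq; have s0 : 0 < sqrt q by rewrite sqrtr_gt0.
have aq := lt_le_trans ab bq.
have -> : X q = k * gb / (2 * sqrt q) - Kc.
 rewrite /X /dbeta [q < b]ltNge bq andbF mul0r add0r mul1r /beta max_r ?(ltW aq)// gam_hi// /Kc.
 move: gb => g; move: (sqr_sqrtr (ltW q0)) s0; move: (sqrt q) => s' <- s0.
 by field; rewrite gt_eqF.
have g0 : 0 <= gb by rewrite -(gam_hi (lexx b)).
have : 0 <= k * gb / (2 * sqrt q) := divr_ge0 (mulr_ge0 (ltW k0) g0) (mulr_ge0 (ler0n _ 2) (ltW s0)).
by lra.
Qed.
Let X_ge q : 0 < q -> - Kc <= X q.
move=> q0; have [qa|aq] := leP q a.
 apply: (le_trans _ (X_lo q0 qa)); rewrite lerN2 -(gam_lo (lexx a)); exact: gam2.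
have [bq|qb] := leP b q; first exact: X_hi.
rewrite X_mid//; have h := gam2 q.
have : 0 <= k * (gam q / (2 * sqrt q) + sqrt q * gp q).
 apply: mulr_ge0; first exact: ltW.
 by pos.
by lra.
Qed.
Let beta_der q : 0 < q -> q != a -> q != b -> derives q M (pi * v q^2) ->
 derives q beta (dbeta q).
move=> q0 qa qb dM; have s0 : 0 < sqrt q by rewrite sqrtr_gt0.
have sn : sqrt q != 0 by lra.
have ds := der_inv sn (der_sqrt1 q0).
have [lt|ge] := ltP q a.
 rewrite /dbeta [a < q]ltNge (ltW lt) [b <= q]leNgt (lt_trans lt ab) !mul0r addr0.
 apply: (@is_der_local _ beta (cst (k * ga / sqrt a)) _ _ (q - 1) a) => //.
 - lra.
 - by move=> y _ ya; rewrite /beta gam_lo ?(ltW ya)// max_l// ltW.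
have {ge}gt : a < q by lra.
have [lt|ge] := ltP q b; last first.
 have {ge}gb' : b < q by lra.
 rewrite /dbeta [q < b]ltNge (ltW gb') andbF mul0r add0r mul1r.
 apply: (@is_der_local _ beta (fun y => k * gb * (sqrt y)^-1) _ _ b (q + 1)) => //.
 - by rewrite ltrDl.
 - by move=> y yb _; rewrite /beta gam_hi ?(ltW yb)// max_r// (ltW (lt_trans ab yb)).
 apply: (der_eq (der_mul (der_cst q (k * gb)) ds)).
 rewrite gam_hi ?(ltW gb')//; move: gb => g; move: (sqr_sqrtr (ltW q0)) s0; move: (sqrt q) => s' <- s0.
 lra.
rewrite /dbeta gt [b <= q]leNgt lt mul0r addr0 mul1r.
have dt := tau_der gt lt dM; have tq0 := tau_gt0 (ltW gt) (ltW lt).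
have st0 : 0 < sqrt (tau q) by rewrite sqrtr_gt0.
have stn : sqrt (tau q) != 0 by lra.
have F0 := profile_F pr tq0.
have dA := @is_derive1_comp R A tau q _ _ (profile_dA pr tq0) dt.
have dst := @der_inv R (fun y => sqrt (tau y)) q _ stn (@is_derive1_comp R sqrt tau q _ _ (der_sqrt1 tq0) dt).
have dd := der_mul (der_mul (der_cst q k) (der_mul dA dst)) ds.
apply: (@is_der_local _ beta (fun y => k * (A (tau y) / sqrt (tau y)) * (sqrt y)^-1) _ _ a b) => //.
 by move=> y ay yb; rewrite /beta /gam tc_id ?(ltW ay) ?(ltW yb)// max_r// ltW.
apply: (der_eq dd) => /=.
rewrite /gp /gam tc_id ?(ltW gt) ?(ltW lt)//.
move: (zeta (tau q)) (A (tau q)) (F (tau q)) F0 (v q^2) => z al f F0 rho.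
move: (sqr_sqrtr (ltW tq0)) st0; move: (sqrt (tau q)) => s''; move: (tau q) => x <- st0.
move: (sqr_sqrtr (ltW q0)) s0; move: (sqrt q) => s' <- s0.
by field; rewrite !gt_eqF.
Qed.
Let hardy_window : (\int[leb]_(q in `]0%R, +oo[) (v q^2 * (Num.max (X q) (- Kc) + Kc))%:E
 <= ((T / 4 + Kc * N) / pi)%:E)%E.
case: (rmass_ae mv v2) => B [mB B0 sB].
(* Leaves out the two ends of the window, where [beta] has corners, and a null set outside which [M]
   has derivative [pi v^2]. *)
pose good q := [&& q != a, q != b & q \notin B].
have nB q : q \notin B -> ~ B q by move=> h hq; move: h; rewrite mem_set.
apply: (@hardy_cont R v N T mv v2 weighted beta dbeta good (k * gb / sqrt a) (k * gb) Kc).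
- exact: cbeta.
- exact: mdbeta.
- have mB' : mble (fun q : R => q \notin B).
  apply: (measurable_fun_bool true); rewrite setTI (_ : _ @^-1` _ = ~` B); first exact: measurableC.
  apply/seteqP; split => q /=; first by move=> /nB.
  by move=> h; apply/negP => hq; rewrite inE in hq.
 by rewrite /good; meas.
- by move=> q _; exact: (divr_ge0 (mulr_ge0 (ltW k0) (gam_ge0 q)) (ltW (sm q))).
- move=> q _; rewrite /beta; apply: ler_pM.
 + exact: (mulr_ge0 (ltW k0) (gam_ge0 q)).
 + by [].
 + by rewrite ler_pM2l//.
 + by rewrite lef_pV2 ?posrE// ler_wsqrtr// le_max lexx.
- move=> q q0; rewrite /beta.
 apply: (@le_trans _ _ (k * gam q)); last by rewrite ler_pM2l//.
 rewrite mulrAC ler_pdivrMr//; apply: ler_wpM2l; first exact: (mulr_ge0 (ltW k0) (gam_ge0 q)).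
 by rewrite ler_wsqrtr// le_max lexx orbT.
- move=> p q p0 pq; have q0 := le_trans p0 pq.
 have e x : x * beta x = k * gam x * (x / sqrt (Num.max a x)) by rewrite /beta; ring.
 rewrite !e; apply: ler_pM.
 + exact: (mulr_ge0 (ltW k0) (gam_ge0 p)).
 + exact: (divr_ge0 p0 (ltW (sm p))).
 + by rewrite ler_pM2l// gam_nd.
 rewrite ler_pdivrMr// mulrAC ler_pdivlMr//.
 have [qa|aq] := leP q a; first by rewrite max_l ?(le_trans pq)// ler_wpM2r//.
 rewrite -{2}(sqr_sqrtr q0) -mulrA [_ * sqrt (Num.max a p)]mulrC mulrA.
 apply: ler_wpM2r; first exact: sqrtr_ge0.
 rewrite -{1}(sqr_sqrtr p0); apply: ler_pM; rewrite ?sqrtr_ge0// ler_wsqrtr//.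
 by rewrite le_max lexx orbT.
- move=> q /and3P[qa qb /nB qB] q0; apply: beta_der => //.
 by apply: contrapT => h; apply: qB; apply: sB => /= hh; apply: h; exact: hh.
- exact: Kc_ge0.
- have n1 (x : R) : {ae leb, forall q, q != x}.
  exists [set x]; split; [exact: measurable_set1|exact: lebesgue_measure_set1|].
  by move=> q /= /negP; rewrite negbK => /eqP.
 have n3 : {ae leb, forall q, q \notin B} by exists B; split => // q /= /negP; rewrite negbK inE.
 apply: (@filterS3 _ _ (ae_filter_ringOfSetsType leb) _ _ _ _ _ (n1 a) (n1 b) n3) => q h1 h2 h3 _.
 by rewrite /good h1 h2.
- by move=> q _; exact: X_ge.
Qed.
(** This is [transport_pointwise] at [tau q] with [k^2 v^2 A^2 / tau] subtracted on both sides. *)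
Let low q : a < q -> q < b ->
 dG q - k^2 / (16 * pi) * (ln q * (M q * v q^2)) <= v q^2 * X q.
move=> aq qb; have q0 := lt_trans a0 aq; have r0 : 0 < sqrt q by rewrite sqrtr_gt0.
have [_ _ e] := tau_spec (ltW aq) (ltW qb); have tq0 := tau_gt0 (ltW aq) (ltW qb).
have s0 : 0 < sqrt (tau q) by rewrite sqrtr_gt0.
have := @transport_pointwise R c (v q^2) (F (tau q)) (A (tau q)) (zeta (tau q)) (sqrt (tau q)) (sqrt q)
 (sqr_ge0 _) (profile_F pr tq0) (profile_A pr tq0) (profile_zeta pr tq0) s0 r0 k _ erefl erefl.
rewrite X_mid// /dG /gam /gp tc_id ?(ltW aq) ?(ltW qb)// -e /dg1 /dg2 /g2 /dFz.
have F0 := profile_F pr tq0.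
move: (sqr_sqrtr (ltW tq0)) (sqr_sqrtr (ltW q0)) => e1 e2.
rewrite e1 e2.
move: (ln q) (ln (tau q)) => lq lt.
move: (F (tau q)) F0 (A (tau q)) (zeta (tau q)) (m (tau q)) (v q^2) => f F0 al z mm rho.
move: (tau q) (sqrt (tau q)) s0 e1 tq0 => x s' s0 <- tq0.
move: (sqrt q) r0 e2 => r' r0 <-.
have pn : pi != 0 :> R by rewrite gt_eqF.
move=> h; rewrite -subr_ge0; move: h; rewrite -subr_ge0.
move: (k) k0 => kk kk0; move: (pi : R) pn => p pn.
set L := (X in 0 <= X -> _); set L' := (X in _ -> 0 <= X).
suff -> : L' = L by [].
by rewrite /L /L'; field; rewrite pn !gt_eqF.
Qed.

Definition window_energy : R := Rintegral leb setT (fun q => ind ((a < q) && (q < b)) * (ln q * (M q * v q^2))).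

(** Integrates [low] over the window, where [dG] contributes its end values only, and the bounds
    [- k^2 ga^2] and [- Kc] of the Hardy integrand on the outer parts. These carry the masses
    [m (1/t)] and [N - m t], which gives the last two error terms. *)
Lemma window_bound : g1 t + g2 t * ln b - (g1 t^-1 + g2 t^-1 * ln a) - k^2 / (16 * pi) * window_energy
 - k^2 * (A t^-1^2 / t^-1) * m t^-1 / pi - k^2 * (A t^2 / t) * (N - m t) / pi <= T / (4 * pi).
Proof.
have [i3 e3] := G_ftc.
have mM := mfun_rmass mv.
have i1 : leb.-integrable setT (fun q => (ind ((0 < q) && (q < b)) * v q^2)%:E) by apply: intble_real; [by meas|isd|by rewrite (rmass_open mv v2) ltry].
have i2 : leb.-integrable setT (fun q => (ind ((0 < q) && (q <= a)) * v q^2)%:E) by apply: intble_real; [by meas|isd|by rewrite (rmass_closed mv v2) ltry].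
have i4 : leb.-integrable setT (fun q => (ind ((a < q) && (q < b)) * (ln q * (M q * v q^2)))%:E).
 apply: (@intble_le _ _ R leb _ (fun q => `|ind (0 < q)%R * (ln q * (M q * v q^2))|)).
 - by meas.
 - by meas.
 - move=> q; rewrite !normrM ler_wpM2r// !ger0_norm// ler_nat.
  by case: (ltP a q) => // aq; rewrite (lt_trans a0 aq); case: ltP.
 - by move/integrableP : log_integrable => [_].
have r1 : Rintegral leb setT (fun q => ind ((0 < q) && (q < b)) * v q^2) = M b / pi by rewrite /Rintegral (rmass_open mv v2).
have r2 : Rintegral leb setT (fun q => ind ((0 < q) && (q <= a)) * v q^2) = M a / pi by rewrite /Rintegral (rmass_closed mv v2).
have r3 : Rintegral leb setT (fun q => ind ((a < q) && (q < b)) * dG q) = G b - G a by rewrite /Rintegral e3.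
have j1 := int_lin Kc (- (k^2 * ga^2)) i1 i2.
have j2 := int_lin 1 (- (k^2 / (16 * pi))) i3 i4.
rewrite r1 r2 in j1; rewrite r3 -/window_energy in j2.
have i5 := integrableD measurableT (integrableZl measurableT Kc i1) (integrableZl measurableT (- (k^2 * ga^2)) i2).
have i6 := integrableD measurableT (integrableZl measurableT 1 i3) (integrableZl measurableT (- (k^2 / (16 * pi))) i4).
have j3 := int_lin 1 1 i5 i6.
rewrite {1}/Rintegral j1 {1}/Rintegral j2 /= in j3.
have mX : mble X.
 have h1 := mdbeta; have h2 : mble beta by apply: continuous_measurable_fun; exact: cbeta.
 by rewrite /X; meas.
have i7 : leb.-integrable setT (fun q => (ind (0 < q)%R * (v q^2 * (Num.max (X q) (- Kc) + Kc)))%:E).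
 apply: intble_real; first by meas.
  move=> q; rewrite mulr_ge0// mulr_ge0 ?sqr_ge0// -lerBlDr sub0r le_max lexx orbT//.
 rewrite -int_half; exact: le_lt_trans hardy_window (ltry _).
have := hardy_window; rewrite int_half => hw.
have := le_trans (le_integral measurableT (integrableD measurableT (integrableZl measurableT 1 i5) (integrableZl measurableT 1 i6)) i7 _) hw.
rewrite j3 => /(_ _) hh.
have : 1 * (Kc * (M b / pi) + - (k^2 * ga^2) * (M a / pi)) + 1 * (1 * (G b - G a) + - (k^2 / (16 * pi)) * window_energy)
 <= (T / 4 + Kc * N) / pi.
 rewrite -lee_fin; apply: hh => q _; rewrite lee_fin !mul1r.
 case: (ltP 0 q) => q0; last first.
  by rewrite [a < q]ltNge (le_trans q0 (ltW a0)) !mul0r !mulr0.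
 have mx : X q <= Num.max (X q) (- Kc) by rewrite le_max lexx.
 rewrite /= mul1r; apply: (@le_trans _ _ (v q^2 * (X q + Kc))); last by rewrite ler_wpM2l ?sqr_ge0// lerD2r.
 have v20 := sqr_ge0 (v q).
 have [qa|aq] := leP q a.
  rewrite (le_lt_trans qa ab) !mul1r !mul0r mulr0 !addr0.
  have h : v q^2 * - (k^2 * ga^2) <= v q^2 * X q by apply: ler_wpM2l => //; exact: X_lo.
  by rewrite addrC mulrDr [Kc * _]mulrC lerD2r [X in X <= _]mulrC.
 have [bq|qb] := leP b q.
  rewrite !mul0r !mulr0 !addr0 mulr_ge0//.
  by rewrite -lerBlDr sub0r; exact: X_hi.
 rewrite !mul1r mul0r mulr0 addr0 [leRHS]mulrDr [Kc * _]mulrC [leLHS]addrC lerD2r mulNr.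
 exact: low.
rewrite Ma Mb /G tau_a tau_b.
have -> : A t^-1^2 / t^-1 = ga^2 by rewrite expr_div_n sqr_sqrtr// ltW.
have -> : k^2 * (A t^2 / t) = Kc by rewrite /Kc expr_div_n sqr_sqrtr// ltW.
have -> : T / (4 * pi) = T / 4 / pi by rewrite invfM mulrA.
move=> h; rewrite -subr_ge0; move: h; rewrite -subr_ge0.
move: (k^2 / (16 * pi)) (pi^-1) (k^2 * ga^2) Kc (g1 t) (g2 t * ln b) (g1 t^-1) (g2 t^-1 * ln a) => x1 x2 x3 x4 x5 x6 x7 x8.
move: window_energy (m t) (m t^-1) => x9 y1 y2.
set L := (X in 0 <= X -> _); set L' := (X in _ -> 0 <= X).
suff -> : L' = L by [].
by rewrite /L /L'; ring.
Qed.

End Window.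

Let ell q : R := ln (1 + sqrt q).
Hypothesis log_moment : (\int[leb]_q (ind (0 < q)%R * (ell q * v q^2))%:E < +oo)%E.

(** [M] is continuous, small near 0 by [M_small] and close to [N] far out, so it takes every value
    in between. *)
Let window_exists t : 1 < t -> exists ab : R * R, [/\ 0 < ab.1, 0 < ab.2, M ab.1 = m t^-1 & M ab.2 = m t].
move=> t1; have t0 := lt_trans ltr01 t1; have ti0 : 0 < t^-1 by rewrite invr_gt0.
have onto y : 0 < y -> y < N -> exists2 q, 0 < q & M q = y.
 move=> y0 yN; pose D := `|T + N| + 1; have D0 : 0 < D by rewrite ltr_wpDl.
 pose p := Num.min 1 ((y / D)^2).
 have yD : 0 < y / D by rewrite divr_gt0.
 have p0 : 0 < p by rewrite lt_min ltr01 exprn_gt0.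
 have p1 : p <= 1 by rewrite ge_min lexx.
 have Mp : M p <= y.
  apply: (le_trans (M_small p0 p1)).
  have sp : sqrt p <= y / D.
   rewrite -[leRHS]gtr0_norm// -sqrtr_sqr ler_wsqrtr//.
   by rewrite ge_min lexx orbT.
  apply: (@le_trans _ _ (sqrt p * D)).
   by rewrite ler_wpM2l//; apply: (le_trans (ler_norm _)); rewrite lerDl.
  by rewrite -ler_pdivlMr.
 have e0 : 0 < N - y by lra.
 have [q q0 hq] := rmass_near_total mv v2 e0.
 have Mq : y <= M q by lra.
 have [pq|/ltW qp] := leP p q; last first.
  exists p => //; apply/le_anti; rewrite Mp (le_trans Mq)//.
  exact: (rmass_nd mv v2 v0 v_ni).
 have [s [ps _ e]] := intermediate_value pq (fun x h _ => rmass_cont mv v2 v0 v_ni (lt_le_trans p0 h)) Mp Mq.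
 by exists s => //; exact: lt_le_trans ps.
have /andP[h1 h2] := profile_m pr ti0; have /andP[h3 h4] := profile_m pr t0.
have [x x0 ex] := onto _ h1 h2; have [y y0 ey] := onto _ h3 h4.
by exists (x, y).
Qed.
Let tail_mass q : 0 < q ->
 (\int[leb]_s (pi * (ind (q <= s)%R * v s^2))%:E = (N - M q)%:E)%E.
move=> q0; have := total_rmass mv v2.
have -> : (\int[leb]_p (pi * (ind (0 < p)%R * v p^2))%:E =
 \int[leb]_p (pi * (ind ((0 < p) && (p < q)) * v p^2))%:E + \int[leb]_s (pi * (ind (q <= s)%R * v s^2))%:E)%E.
 rewrite -ge0_integralD; [|isd..].
 apply: eq_integral => s _; rewrite -EFinD -mulrDr -mulrDl; congr (pi * (_ * _))%:E.
 case: (ltP 0 s) => s0 /=; last by rewrite leNgt (le_lt_trans s0 q0) addr0.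
 by case: (ltP s q) => sq /=; rewrite ?addr0 ?add0r.
rewrite (rmassE mv v2); case: (\int[leb]_s (pi * (ind (q <= s)%R * v s^2))%:E)%E => [r||]//= [<-].
by rewrite addrAC subrr add0r.
Qed.
(** The tail mass times [ln q] is dominated by the tail of the logarithmic moment, since
    [ln q <= ln s <= 2 ln (1 + sqrt s)] for [s] beyond [q]. *)
Let tail_log e : 0 < e -> exists2 Q, 1 <= Q & forall q, Q <= q -> (N - M q) * ln q <= e.
move=> e0.
have mell : mble ell by rewrite /ell; meas.
have ell0 q : 0 <= ell q by rewrite ln_ge0// lerDl.
have fin2 : (\int[leb]_s (2 * pi * (ind (0 < s)%R * (ell s * v s^2)))%:E < +oo)%E.
 rewrite (_ : (\int[leb]_x _)%E = ((2 * pi)%:E * \int[leb]_q (ind (0 < q)%R * (ell q * v q^2))%:E)%E).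
  by rewrite lte_mul_pinfty// lee_fin mulr_ge0// pi_ge0.
 rewrite -ge0_integralZl; [by []|isd|isd|isd|].
 by pos.
have h : (\int[leb]_s (2 * pi * (ind (n.+1%:R <= s)%R * (ell s * v s^2)))%:E)%E @[n --> \oo] --> (\int[leb]_s (0 : R)%:E)%E.
 apply: (@dominated_real _ _ _ leb (fun n s => 2 * pi * (ind (n.+1%:R <= s)%R * (ell s * v s^2))) (fun=> 0)
  (fun s => 2 * pi * (ind (0 < s)%R * (ell s * v s^2)))).
 - by move=> n; meas.
 - by meas.
 - move=> s; apply: cvg_near_cst; near=> n.
  suff -> : (n.+1%:R <= s) = false by rewrite mul0r mulr0.
  apply/negbTE; rewrite -ltNge; apply: (lt_le_trans (_ : _ < n%:R)); last by rewrite ler_nat.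
  by near: n; exact: nbhs_infty_gtr.
 - move=> n s; rewrite ger0_norm; last by pos.
  rewrite ler_pM2l ?mulr_gt0// ler_wpM2r ?mulr_ge0//.
  by case: (leP n.+1%:R s) => // h; rewrite (lt_le_trans _ h).
 - by meas.
 - exact: fin2.
rewrite integral0 in h.
have /fine_cvgP[h1 h2] := h.
have /cvgrPdist_le /(_ e e0) := h2.
case: h1 => n1 _ hn1; case=> n2 _ hn2.
pose n := maxn n1 n2.
exists n.+1%:R; first by rewrite ler1n.
move=> q nq; have q0 : 0 < q by rewrite (lt_le_trans _ nq).
have q1 : 1 <= q by apply: le_trans nq; rewrite ler1n.
have lq : 0 <= ln q by rewrite ln_ge0.
have fn := hn1 n (leq_maxl _ _); have := hn2 n (leq_maxr _ _) => /=.
rewrite sub0r normrN => he.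
rewrite -lee_fin; apply: (@le_trans _ _ (\int[leb]_s (2 * pi * (ind (n.+1%:R <= s)%R * (ell s * v s^2)))%:E)%E); last first.
 by rewrite -(fineK fn); apply: le_trans he; exact: ler_norm.
rewrite mulrC EFinM -(tail_mass q0) -ge0_integralZl; [|isd..].
apply: le_int_real; [by meas|isd|isd|].
move=> s; case: (leP q s) => qs; last by rewrite mul0r !mulr0; pos.
rewrite (le_trans nq qs) !mul1r.
have s0 := lt_le_trans q0 qs.
have -> : 2 * pi * (ell s * v s^2) = 2 * ell s * (pi * v s^2) by lra.
rewrite ler_wpM2r ?mulr_ge0 ?pi_ge0//.
apply: (@le_trans _ _ (ln s)); first by rewrite ler_ln.
have ss : 0 < sqrt s by rewrite sqrtr_gt0.
rewrite -{1}(sqr_sqrtr (ltW s0)) ln_sqr// ler_pM2l// ler_ln ?posrE ?lerDr//.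
Unshelve. all: by end_near. Qed.

Definition star_energy : R := Rintegral leb setT (fun q => ind (0 < q)%R * (ln q * (M q * v q^2))).

Lemma kinetic_lower_bound :
 N^2 / (8 * pi) * expR (- (2 * (pi * (star_energy - Kinf) / N^2))) <= T.
Proof.
have hw n : exists ab : R * R, [/\ 0 < ab.1, 0 < ab.2, M ab.1 = m (n.+2%:R)^-1 & M ab.2 = m n.+2%:R] by apply: window_exists; rewrite ltr1n.
have [f hf] := choice hw.
pose a n := (f n).1; pose b n := (f n).2; pose t n : R := n.+2%:R; pose ti n : R := (n.+2%:R)^-1.
have a0 n : 0 < a n by case: (hf n).
have b0 n : 0 < b n by case: (hf n).
have Ma n : M (a n) = m (ti n) by case: (hf n).
have Mb n : M (b n) = m (t n) by case: (hf n).
have t1 n : 1 < t n by rewrite ltr1n.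
have t0 n : 0 < t n by [].
have ti0 n : 0 < ti n by rewrite invr_gt0.
have ti1 n : ti n <= 1 by rewrite invf_le1// ler1n.
(* This [c] maximises the limiting lower bound over the scales [k = exp (- c)]: the terms in
   [star_energy] and [Kinf] cancel, and [k^2 N^2 / (32 pi^2)] is left. *)
pose c := pi * (star_energy - Kinf) / N^2.
pose k := expR (- c).
have ti_cvg : tends ti 0.
 apply/cvgrPdist_le => e e0; near=> n; rewrite sub0r normrN ger0_norm ?(ltW (ti0 n))//.
 rewrite -[leRHS]invrK lef_pV2 ?posrE ?invr_gt0//; apply: (le_trans (_ : _ <= n%:R)); last first.
  lra.
 by near: n; exact: nbhs_infty_ger.
have sti_cvg : tends (fun n => sqrt (ti n)) 0 by rewrite /tends -[X in _ --> X]sqrtr0; apply: continuous_cvg; [exact: sqrt_continuous|exact: ti_cvg].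
have m_t : tends (fun n => m (t n)) N := cvgy_nat (profile_m_cvg pr).
have P_t : tends (fun n => P (t n)) (N^2 / (8 * pi^2)) := cvgy_nat (profile_P_cvg pr).
have K_t : tends (fun n => K (t n)) Kinf := cvgy_nat (profile_K_cvg pr).
have A_t : tends (fun n => A (t n)^2 / t n * (N - m (t n))) 0 := cvgy_nat (profile_A_tail pr).
have [C C0 hz] := profile_zero pr.
have zero_le (u : nat -> R) : (forall n, `|u n| <= C * ti n) -> tends u 0 by apply: tends0; rewrite -(mulr0 C); lims.
have P_ti : tends (fun n => P (ti n)) 0 by apply: zero_le => n; have [] := hz _ (ti0 n) (ti1 n).
have K_ti : tends (fun n => K (ti n)) 0.
 apply: (@tends0 _ _ (fun n => C * sqrt (ti n))); first by rewrite -(mulr0 C); lims.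
 by move=> n; have [] := hz _ (ti0 n) (ti1 n).
have m_ti : tends (fun n => m (ti n)) 0.
 apply: zero_le => n; have [_ _ _ _ [h _]] := hz _ (ti0 n) (ti1 n).
 by have /andP[/ltW m0 _] := profile_m pr (ti0 n); rewrite ger0_norm.
pose z n := F (t n) * zeta (t n); pose zi n := F (ti n) * zeta (ti n).
have z0 n : 0 <= z n.
 exact: (mulr_ge0 (ltW (profile_F pr (t0 n))) (profile_zeta pr (t0 n))).
have zi0 n : 0 <= zi n.
 exact: (mulr_ge0 (ltW (profile_F pr (ti0 n))) (profile_zeta pr (ti0 n))).
pose c1 := N / (16 * pi^2).
have c10 : 0 <= c1 by rewrite divr_ge0 ?(ltW N_gt0)// mulr_ge0// sqr_ge0.
have zle n : z n <= c1 * (N - m (t n)) := profile_zeta_tail pr (t0 n).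
have Nm n : 0 <= N - m (t n) by rewrite subr_ge0; have /andP[_ /ltW] := profile_m pr (t0 n).
have z_cvg : tends z 0.
 apply: (@tends0 _ _ (fun n => c1 * (N - m (t n)))); first by rewrite -(mulr0 c1) -(subrr N); lims.
 by move=> n; rewrite ger0_norm.
have zi_cvg : tends zi 0 by apply: zero_le => n; have [] := hz _ (ti0 n) (ti1 n).
(* [F * zeta] at [t n] is at most a multiple of the tail mass [N - M (b n)], which beats [ln (b n)]
   by [tail_log]. *)
have zb_cvg : tends (fun n => z n * Num.max 0 (ln (b n))) 0.
 apply/cvgrPdist_le => e e0.
 have ce : 0 < e / (c1 + 1) by rewrite divr_gt0// ltr_wpDl.
 have [Q Q1 hQ] := tail_log ce.
 have lQ : 0 <= ln Q by rewrite ln_ge0.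
 have zQ : tends (fun n => z n * ln Q) 0 by rewrite -(mul0r (ln Q)); lims.
 move/cvgrPdist_le : zQ => /(_ e e0); apply: filterS => n.
 rewrite !sub0r !normrN => h.
 have mx : 0 <= Num.max 0 (ln (b n)) by rewrite le_max lexx.
 rewrite ger0_norm; last exact: (mulr_ge0 (z0 n) mx).
 have [Qb|bQ] := leP Q (b n); last first.
  apply: le_trans h; apply: le_trans (ler_norm _); rewrite ler_wpM2l// ge_max lQ /=.
  by rewrite ler_ln ?posrE ?(lt_le_trans ltr01 Q1)// ltW.
 have lb : 0 <= ln (b n) by rewrite ln_ge0// (le_trans Q1).
 rewrite max_r//; apply: (@le_trans _ _ (c1 * ((N - M (b n)) * ln (b n)))).
  by rewrite mulrA ler_wpM2r// Mb.
 apply: (@le_trans _ _ (c1 * (e / (c1 + 1)))); first by rewrite ler_wpM2l// hQ.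
 rewrite mulrCA ler_piMr ?(ltW e0)// ler_pdivrMr ?mul1r ?lerDl//.
 by rewrite ltr_wpDl.
pose D := C * (`|T + N| + 1) + 1.
have D0 : 0 < D by rewrite ltr_wpDl// mulr_ge0//.
(* From [m (ti n) = M (a n) <= sqrt (a n) * (T + N)], valid for [a n <= 1], the end [a n] is at
   least of the order of the square of [ti n]. So [- ln (a n)] grows at most like [- 2 ln (ti n)],
   and the factor [ti n] in the bound of [zi n] absorbs it. *)
have za_cvg : tends (fun n => zi n * Num.max 0 (- ln (a n))) 0.
 apply: (@tends0 _ _ (fun n => C * (2 * `|ln D| * ti n + 4 * sqrt (ti n)))).
  rewrite (_ : 0 = C * (2 * `|ln D| * 0 + 4 * 0)); last by rewrite !mulr0 addr0 mulr0.
  by lims.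
 move=> n; have mx : 0 <= Num.max 0 (- ln (a n)) by rewrite le_max lexx.
 rewrite ger0_norm; last exact: (mulr_ge0 (zi0 n) mx).
 have [_ _ hzi _ [_ hm]] := hz _ (ti0 n) (ti1 n).
 have zC : zi n <= C * ti n by apply: le_trans hzi; exact: ler_norm.
 have up : Num.max 0 (- ln (a n)) <= 2 * `|ln D| + 2 * `|ln (ti n)|.
  rewrite ge_max addr_ge0 ?mulr_ge0//=.
  have [a1|/ltW a1] := leP (a n) 1; last first.
   by rewrite (@le_trans _ _ 0)// oppr_le0 ln_ge0.
  have sa : 0 < sqrt (a n) by rewrite sqrtr_gt0.
  have : ti n <= D * sqrt (a n).
   apply: (le_trans hm); rewrite -Ma.
   apply: (@le_trans _ _ (C * (sqrt (a n) * (T + N)))); first by rewrite ler_wpM2l// M_small.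
   rewrite mulrCA mulrC ler_pM2r//; apply: (@le_trans _ _ (C * (`|T + N| + 1))); last by rewrite lerDl.
   by rewrite ler_wpM2l//; apply: (le_trans (ler_norm _)); rewrite lerDl.
  rewrite -ler_ln ?posrE ?mulr_gt0// lnM//.
  have -> : ln (a n) = 2 * ln (sqrt (a n)) by rewrite -ln_sqr// sqr_sqrtr// ltW.
  have := ler_norm (ln D); have := ler_norm (- ln (ti n)); rewrite normrN.
  lra.
 apply: (@le_trans _ _ (C * ti n * (2 * `|ln D| + 2 * `|ln (ti n)|))).
  by apply: ler_pM.
 rewrite -mulrA ler_wpM2l// mulrDr lerD//; first by rewrite mulrC.
 have := @ln_small R (ti n) (ti0 n) (ti1 n).
 rewrite mulrCA; move: (ti n * `|ln (ti n)|) (sqrt (ti n)) => x y; lra.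
have W_cvg : tends (fun n => window_energy (a n) (b n)) star_energy.
 have mM := mfun_rmass mv.
 pose g q := ln q * (M q * v q^2).
 have mg : mble g by rewrite /g; meas.
 have ifin : (\int[leb]_q `|ind (0 < q)%R * g q|%:E < +oo)%E by move/integrableP : log_integrable => [_].
 have dom n q : `|ind ((a n < q) && (q < b n)) * g q| <= `|ind (0 < q)%R * g q|.
  rewrite !normrM ler_wpM2r// !ger0_norm// ler_nat.
  by case: (ltP (a n) q) => // aq; rewrite (lt_trans (a0 n) aq); case: ltP.
 have [_ h] : leb.-integrable setT (fun q => (ind (0 < q)%R * g q)%:E) /\
  (\int[leb]_q (ind ((a n < q) && (q < b n)) * g q)%:E)%E @[n --> \oo] --> (\int[leb]_q (ind (0 < q)%R * g q)%:E)%E.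
  apply: (@dominated_ae _ _ _ leb (fun n q => ind ((a n < q) && (q < b n)) * g q) (fun q => ind (0 < q)%R * g q)
   (fun q => `|ind (0 < q)%R * g q|)) => //; [by move=> n; meas|by meas| |by meas].
  case: (rmass_ae mv v2) => B [mB B0 sB]; exists B; split => // q hq; apply: sB => /= hd; apply: hq => /=.
  case: (ltP 0 q) => q0; last first.
   apply: cvg_near_cst; apply: nearW => n.
   suff -> : (a n < q) = false by rewrite !mul0r.
   by apply/negbTE; rewrite -leNgt (le_trans q0)// ltW.
  have [vq|vq] := leP (v q) 0.
   have -> : g q = 0 by rewrite /g (_ : v q = 0) ?expr0n ?mulr0//; apply/le_anti; rewrite vq v0.
   by apply: cvg_near_cst; apply: nearW => n; rewrite !mulr0.
  (* At a point where [v q > 0] and [M] has its derivative, [M] still increases beyond [q]. Hence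
     [M q] lies strictly between 0 and [N], and [q] belongs to all later windows. *)
  have MN : M q < N.
   rewrite lt_neqAle (rmass_le mv v2) andbT; apply/eqP => MqN.
   have d0 : 0 < pi * v q^2 by rewrite mulr_gt0// exprn_gt0.
   have [dl dl0 hn] := is_der_near (divr_gt0 d0 (ltr0n R 2)) (hd q0).
   have h0 : 0 < dl / 2 by rewrite divr_gt0.
   have : `|dl / 2| < dl by rewrite gtr0_norm// ltr_pdivrMr// mulr_natr ltrDl.
   move=> /hn; rewrite (gtr0_norm h0) ler_norml MqN => /andP[h1 _].
   have := rmass_le mv v2 (q + dl / 2).
   have : 0 < pi * v q^2 * (dl / 2) by rewrite mulr_gt0.
   move: h1; have -> : pi * v q^2 / 2 * (dl / 2) = pi * v q^2 * (dl / 2) / 2 by ring.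
   lra.
  have Mq0 := rmass_gt0 mv v2 v0 v_ni N_gt0 q0.
  apply: cvg_near_cst.
  have n1 : \forall n \near \oo, m (ti n) < M q by apply: (cvgr_lt _ m_ti).
  have n2 : \forall n \near \oo, M q < m (t n) by apply: (cvgr_gt _ m_t).
  apply: filterS2 n1 n2 => n; rewrite -Ma -Mb => h1 h2.
  have -> : a n < q by rewrite ltNge; apply/negP => /(rmass_nd mv v2 v0 v_ni q0); rewrite leNgt h1.
  have -> // : q < b n by rewrite ltNge; apply/negP => /(rmass_nd mv v2 v0 v_ni (b0 n)); rewrite leNgt h2.
 have E n : (\int[leb]_q (ind ((a n < q) && (q < b n)) * g q)%:E = (window_energy (a n) (b n))%:E)%E.
  rewrite int_RintE//; apply: (@intble_le _ _ R leb _ (fun q => `|ind (0 < q)%R * g q|)) => //; by meas.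
 move: h; rewrite (_ : (fun n => _) = (fun n => (window_energy (a n) (b n))%:E)); last exact/funext.
 rewrite (int_RintE log_integrable) => /fine_cvgP[_]; exact.
have err1 : tends (fun n => A (ti n)^2 / ti n * m (ti n)) 0.
 apply: (@tends0 _ _ (fun n => C^2 * ti n * m (ti n))).
  by rewrite -(mulr0 (C^2 * 0)); lims.
 move=> n; have [_ _ _ hA _] := hz _ (ti0 n) (ti1 n); have A0 := profile_A pr (ti0 n).
 have /andP[/ltW m0 _] := profile_m pr (ti0 n).
 rewrite ger0_norm; last by rewrite mulr_ge0// divr_ge0 ?sqr_ge0// ltW.
 rewrite ler_wpM2r// ler_pdivrMr// -mulrA -exprMn lerXn2r ?nnegrE//.
 lra.
have bound n : k^2 * (2 * z n * (1 + c + ln (t n) / 2) + ((1 + c) * m (t n)^2 / (2 * pi) + K (t n) / 2) / (8 * pi) - P (t n) / 4)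
  + - (k^2 * z n) * ln (b n)
 - (k^2 * (2 * zi n * (1 + c + ln (ti n) / 2) + ((1 + c) * m (ti n)^2 / (2 * pi) + K (ti n) / 2) / (8 * pi) - P (ti n) / 4)
  + - (k^2 * zi n) * ln (a n))
 - k^2 / (16 * pi) * window_energy (a n) (b n)
 - k^2 * (A (ti n)^2 / ti n) * m (ti n) / pi - k^2 * (A (t n)^2 / t n) * (N - m (t n)) / pi <= T / (4 * pi).
 exact: (@window_bound (t n) (a n) (b n) c (t1 n) (a0 n) (Ma n) (Mb n) (b0 n)).
(* A smaller expression with convergent terms only: those in [ln (t n)] and [ln (ti n)] have the
   favourable sign and are dropped, and [ln (a n)], [ln (b n)] are kept only in their unfavourable
   sign. *)
pose U n := k^2 * (- (2 * `|1 + c| * z n) + ((1 + c) * m (t n)^2 / (2 * pi) + K (t n) / 2) / (8 * pi) - P (t n) / 4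
  - z n * Num.max 0 (ln (b n)))
 - k^2 * (2 * `|1 + c| * zi n + ((1 + c) * m (ti n)^2 / (2 * pi) + K (ti n) / 2) / (8 * pi) - P (ti n) / 4
  + zi n * Num.max 0 (- ln (a n)))
 - k^2 / (16 * pi) * window_energy (a n) (b n)
 - k^2 / pi * (A (ti n)^2 / ti n * m (ti n)) - k^2 / pi * (A (t n)^2 / t n * (N - m (t n))).
have U_le n : U n <= T / (4 * pi).
 apply: le_trans (bound n); rewrite /U.
 have l1 : 0 <= ln (t n) by rewrite ln_ge0// ltW.
 have l2 : ln (ti n) <= 0 by rewrite ln_le0.
 have k20 := sqr_ge0 k.
 have c1' := ler_norm (1 + c); have c2' := ler_norm (- (1 + c)); rewrite normrN in c2'.
 have e1 : - (2 * `|1 + c| * z n) - z n * Num.max 0 (ln (b n)) <= 2 * z n * (1 + c + ln (t n) / 2) - z n * ln (b n).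
  have : z n * ln (b n) <= z n * Num.max 0 (ln (b n)) by rewrite ler_wpM2l// le_max lexx orbT.
  have : 0 <= z n * (`|1 + c| + (1 + c)) by rewrite mulr_ge0//; lra.
  have : 0 <= z n * ln (t n) by pos.
  lra.
 have e2 : 2 * zi n * (1 + c + ln (ti n) / 2) - zi n * ln (a n) <= 2 * `|1 + c| * zi n + zi n * Num.max 0 (- ln (a n)).
  have : zi n * - ln (a n) <= zi n * Num.max 0 (- ln (a n)) by rewrite ler_wpM2l// le_max lexx orbT.
  have : 0 <= zi n * (`|1 + c| - (1 + c)) by rewrite mulr_ge0//; lra.
  have : 0 <= zi n * - ln (ti n) by rewrite mulr_ge0// oppr_ge0.
  lra.
 have h1 := mulr_ge0 k20 (etrans (subr_ge0 _ _) e1); have h2 := mulr_ge0 k20 (etrans (subr_ge0 _ _) e2).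
 rewrite -subr_ge0; have := addr_ge0 h1 h2; congr (0 <= _).
 move: pi (ln (b n)) (ln (a n)) (Num.max 0 (ln (b n))) (Num.max 0 (- ln (a n))) (window_energy (a n) (b n)) => p y1 y2 y3 y4 y5.
 move: (m (t n)) (m (ti n)) (A (t n)^2 / t n) (A (ti n)^2 / ti n) (K (t n)) (K (ti n)) (P (t n)) (P (ti n)) => x1 x2 x3 x4 x5 x6 x7 x8.
 move: (z n) (zi n) (ln (t n)) (ln (ti n)) `|1 + c| (1 + c) (k^2) => u1 u2 u3 u4 u5 u6 u7.
 move: (16 * p)^-1 (8 * p)^-1 (2 * p)^-1 p^-1 => i1 i2 i3 i4.
 ring.
have U_cvg : tends U (k^2 * (- (2 * `|1 + c| * 0) + ((1 + c) * N^2 / (2 * pi) + Kinf / 2) / (8 * pi) - N^2 / (8 * pi^2) / 4 - 0)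
 - k^2 * (2 * `|1 + c| * 0 + ((1 + c) * 0^2 / (2 * pi) + 0 / 2) / (8 * pi) - 0 / 4 + 0)
 - k^2 / (16 * pi) * star_energy - k^2 / pi * 0 - k^2 / pi * 0) by rewrite /U; lims.
have := tends_le U_cvg U_le.
have kE : k^2 = expR (- (2 * c)) by rewrite -expRM_natl; congr expR; ring.
have pin : (pi : R) != 0 by rewrite gt_eqF.
have NN : N != 0 by rewrite gt_eqF.
rewrite -/c -kE.
set L := (X in X <= _ -> _).
have -> : L = N^2 / (8 * pi) * k^2 / (4 * pi).
 have -> : L = k^2 * (((1 + c) * N^2 / (2 * pi) + Kinf / 2) / (8 * pi) - N^2 / (8 * pi^2) / 4)
   - k^2 / (16 * pi) * star_energy by rewrite /L expr0n !(add0r, addr0, oppr0, subr0, mul0r, mulr0).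
 rewrite /c; move: (k^2) star_energy Kinf pi pin (N) NN => k2 se Ki p pn n nn.
 by field; rewrite pn.
by rewrite ler_pM2r// invr_gt0 mulr_gt0.
Unshelve. all: by end_near. Qed.

End Transport.

(** * The interpolation inequality *)

Section Interpolation.
Variable R : realType.
Local Notation leb := (@lebesgue_measure R).
Local Notation mu2 := (leb2 R).
Local Notation plane := (plane R).

Lemma rmass_scale (v : R -> R) (lam s q : R) : mble v ->
  (\int[mu2]_x (v (nsq x)^2)%:E = lam%:E)%E ->
  rmass (fun p => s * v p) q = s^2 * rmass v q.
Proof.
move=> mv v2; apply: EFin_inj; rewrite EFinM -(rmassE mv v2) -ge0_integralZl; [|isd..].
have E : (\int[leb]_p (pi * (ind ((0 < p) && (p < q)) * (s * v p)^2))%:E =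
  \int[leb]_p ((s^2)%:E * (pi * (ind ((0 < p) && (p < q)) * v p^2))%:E))%E by apply: eq_integral => p _; congr EFin; ring.
rewrite {1}/rmass E fineK// ge0_integralZl; [|isd..].
by rewrite (rmassE mv v2).
Qed.

Variables (w : plane -> R) (lam T : R).
Hypotheses (mw : mble w) (w0 : forall x, 0 <= w x).
Hypothesis w2 : (\int[mu2]_x (w x^2)%:E = lam%:E)%E.
Hypothesis lam_gt0 : 0 < lam.
Hypothesis modulus : forall e, 0 < e ->
  (\int[mu2]_x \int[mu2]_y ((w x - w y)^2 * ind (dsq x y < e^2)%R)%:E <=
   (pi * e ^+ 4 / 4 * T)%:E)%E.
Hypothesis log_moment : (\int[mu2]_x (ln (1 + sqrt (nsq x)) * w x^2)%:E < +oo)%E.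

Variables (F A zeta P K m : R -> R) (N Kinf : R).
Hypothesis pr : profile F A zeta P K m N Kinf.
Hypothesis N_gt0 : 0 < N.

Let v := vst w.
Let E := Rintegral mu2 setT (fun x => Rintegral mu2 setT (fun y => ln (eucl (x - y)) * w x^2 * w y^2)).

(** Scaling [v] by [sqrt (N / lam)] gives it the mass of the ground state; [T] is multiplied by
    [N / lam] and the logarithmic energy, quartic in [v], by its square. [log_potential] then
    replaces that energy by [E]. *)
Lemma kinetic_potential :
  N^2 / (8 * pi) * expR (- (2 * (((N / lam)^2 * E - pi * Kinf) / N^2))) <= N / lam * T.
Proof.
have mv : mble v := mfun_vst mw.
have v2 : (\int[mu2]_x (v (nsq x)^2)%:E = lam%:E)%E := vst_L2 mw w0 w2.
have wgt := @weighted_modulus R w lam T mw w0 w2 modulus.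
have small := @mass_small R v lam T mv v2 wgt.
have LP := log_potential mw w0 w2 small log_moment.
have LI := log_density_intble mw w0 w2 small log_moment.
have LM := star_log_moment mw w0 w2 log_moment.
have MS := rmass_small mw w0 w2 small.
have T0 : 0 <= T.
  have P0 : 0 < pi * 1 ^+ 4 / 4 :> R by rewrite divr_gt0// mulr_gt0 ?pi_gt0.
  rewrite -(pmulr_rge0 _ P0) -lee_fin; apply: le_trans (modulus ltr01).
  by pos.
have k0 : 0 <= N / lam by rewrite divr_ge0// ltW.
pose s := sqrt (N / lam); have ss : s^2 = N / lam by rewrite sqr_sqrtr.
have kl : N / lam * lam = N by rewrite divfK// gt_eqF.
pose u q := s * v q.
have uE q : u q^2 = N / lam * v q^2 by rewrite exprMn ss.
have mu : mble u by rewrite /u; meas.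
have u2 : (\int[mu2]_x (u (nsq x)^2)%:E = N%:E)%E.
  under eq_integral do rewrite uE EFinM.
  rewrite ge0_integralZl; [|isd..].
  by rewrite v2 -EFinM kl.
have u0 q : 0 <= u q by rewrite mulr_ge0 ?sqrtr_ge0 ?vst_ge0.
have u_ni p q : 0 < p -> p <= q -> u q <= u p.
  move=> p0 pq; rewrite ler_wpM2l ?sqrtr_ge0//.
  by apply: vst_noninc => //; exact: level_bound w2.
have wgt_u (p : R -> R) (e : R) : mble p -> (forall q, 0 < p q) -> 0 < e ->
  ((pi * e^2 * N)%:E <= (pi * e ^+ 4 / 8 * (N / lam * T))%:E +
   \int[mu2]_x \int[mu2]_y (u (nsq x)^2 * (p (nsq y) / p (nsq x)) * ind (dsq x y < e^2)%R)%:E)%E.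
  move=> mp p0 e0; have pp q : 0 <= p q by exact: ltW.
  rewrite (_ : (\int[mu2]_x _)%E = ((N / lam)%:E * \int[mu2]_x \int[mu2]_y
    (v (nsq x)^2 * (p (nsq y) / p (nsq x)) * ind (dsq x y < e^2)%R)%:E)%E); last first.
    rewrite -ge0_integralZl; [|isd..].
    apply: eq_integral => x _; rewrite -ge0_integralZl; [|isd..].
    by apply: eq_integral => y _; rewrite uE -EFinM !mulrA.
  have := lee_wpmul2l (_ : (0 <= (N / lam)%:E)%E) (wgt p e mp p0 e0).
  rewrite lee_fin => /(_ k0); rewrite ge0_muleDr; first last.
  - by pos.
  - rewrite lee_fin mulr_ge0//.
    by rewrite divr_ge0// mulr_ge0 ?pi_ge0// exprn_even_ge0.
  by rewrite -!EFinM mulrCA kl [N / lam * (_ * T)]mulrCA.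
have uM q : rmass u q = N / lam * rmass v q by rewrite (rmass_scale s q mv v2) ss.
have MSu q : 0 < q -> q <= 1 -> rmass u q <= sqrt q * (N / lam * T + N).
  move=> q0 q1; rewrite uM -{3}kl -mulrDr mulrCA ler_wpM2l//; exact: MS.
have pt (q : R) : (N / lam)^2 * (ind (0 < q)%R * (ln q * (rmass v q * v q^2))) = ind (0 < q)%R * (ln q * (rmass u q * u q^2)) by rewrite uM uE; ring.
have LIu : leb.-integrable setT (fun q => (ind (0 < q)%R * (ln q * (rmass u q * u q^2)))%:E).
  have := integrableZl measurableT ((N / lam)^2) LI; apply: eq_integrable => // q _.
  by rewrite -EFinM pt.
have pt1 (q : R) : N / lam * (ind (0 < q)%R * (ln (1 + sqrt q) * v q^2)) = ind (0 < q)%R * (ln (1 + sqrt q) * u q^2) by rewrite uE; ring.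
have LMu : (\int[leb]_q (ind (0 < q)%R * (ln (1 + sqrt q) * u q^2))%:E < +oo)%E.
  rewrite (_ : (\int[leb]_q _)%E = ((N / lam)%:E * \int[leb]_q (ind (0 < q)%R * (ln (1 + sqrt q) * v q^2))%:E)%E).
    by rewrite lte_mul_pinfty//.
  rewrite -ge0_integralZl; [|isd|isd| |isd].
    by apply: eq_integral => q _; rewrite -EFinM pt1.
  by move=> q _; rewrite lee_fin mulr_ge0// mulr_ge0 ?sqr_ge0// ln_ge0// lerDl.
have := @kinetic_lower_bound R F A zeta P K m N Kinf pr u (N / lam * T) mu u2 u0 u_ni wgt_u MSu LIu LMu.
have -> : star_energy u = (N / lam)^2 * log_energy w.
  rewrite /star_energy /log_energy -RintegralZl//; congr Rintegral; apply/funext => q.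
  by rewrite pt.
apply: le_trans; rewrite ler_wpM2l ?divr_ge0 ?sqr_ge0 ?mulr_ge0 ?pi_ge0// ler_expR lerN2 ler_pM2l//.
rewrite ler_pM2r ?invr_gt0 ?exprn_gt0// mulrBr lerD2r mulrCA ler_wpM2l ?sqr_ge0//.
Qed.

End Interpolation.

Lemma sqr_le_sum4 (R : realDomainType) (a b c d : R) (s := a^2 + b^2 + c^2 + d^2) :
  [/\ a^2 <= s, b^2 <= s, c^2 <= s & d^2 <= s].
Proof.
rewrite /s; have := sqr_ge0 a; have := sqr_ge0 b; have := sqr_ge0 c; have := sqr_ge0 d.
by split; lra.
Qed.

(** After taking logarithms the exponent is affine in [E] with slope [- 2 / lam^2]; multiplication
    by [lam^2 / (4 pi)] makes this slope [- 1 / (2 pi)] and the ground state constant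
    [(I + 1) / N - 1 / (8 pi)] times [lam^2]. *)
Lemma logarithmic_form (R : realType) (N lam T E I : R) : 0 < N -> 0 < lam ->
  N^2 / (8 * pi) * expR (- (2 * (((N / lam)^2 * E -
    pi * (2 * ((I + 1) * N - N^2 / (8 * pi)))) / N^2))) <= N / lam * T ->
  - ((2 * pi)^-1 * E) <= lam^2 / (4 * pi) * ln (8 * pi * T / (N * lam)) - ((I + 1) / N - (8 * pi)^-1) * lam^2.
Proof.
move=> N0 l0; have pi0 : 0 < pi :> R := pi_gt0 R.
have Nn : N != 0 by lra.
have ln0 : lam != 0 by lra.
have pin : pi != 0 :> R by lra.
set X := - _ => h.
have c0 : 0 < 8 * pi / N^2 by rewrite divr_gt0 ?mulr_gt0.
have {}h : expR X <= 8 * pi * T / (N * lam).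
  have := ler_wpM2l (ltW c0) h; congr (_ <= _).
    by move: (expR X) (N) Nn pi pin => x n nn p pn; field; rewrite pn.
  by move: (T) (N) Nn pi (lam) ln0 => t n nn p l l1; field; rewrite l1.
have {}h : X <= ln (8 * pi * T / (N * lam)) by rewrite -(expRK X) ler_ln ?posrE ?expR_gt0//; apply: lt_le_trans h; exact: expR_gt0.
have d0 : 0 <= lam^2 / (4 * pi) by pos.
apply: le_trans (lerD (ler_wpM2l d0 h) (lexx (- (((I + 1) / N - (8 * pi)^-1) * lam^2)))).
rewrite le_eqVlt; apply/orP; left; apply/eqP; rewrite /X.
by move: (E) (N) Nn pi pin (lam) ln0 (I) => x n nn p pn l l1 i; field; rewrite nn pn.
Qed.
Theorem theorem4p1 (R : realType) (U0 W : plane R -> R)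
  (ur ui g1r g1i g2r g2i : plane R -> R) :
  ground_state U0 W ->
  in_X ur ui g1r g1i g2r g2i ->
  ~ {ae leb2 R, forall x, ur x = 0 /\ ui x = 0} ->
  let N := Nconst U0 in
  let I := Iconst U0 in
  let lam := Rintegral (leb2 R) setT (fun x => ur x ^+ 2 + ui x ^+ 2) in
  let T := Rintegral (leb2 R) setT
             (fun x => g1r x ^+ 2 + g1i x ^+ 2 + g2r x ^+ 2 + g2i x ^+ 2) in
  let V := (2 * pi)^-1 *
    Rintegral (leb2 R) setT (fun x => Rintegral (leb2 R) setT (fun y =>
      ln (eucl (x - y)) * (ur x ^+ 2 + ui x ^+ 2) * (ur y ^+ 2 + ui y ^+ 2))) in
  - V <= lam ^+ 2 / (4 * pi) * ln (8 * pi * T / (N * lam))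
         - ((I + 1) / N - (8 * pi)^-1) * lam ^+ 2.
Proof.
move=> gs [mr [mi [m1r [m1i [m2r [m2i [w1r [w1i [w2r [w2i fin]]]]]]]]]] nz; cbv zeta.
set N := Nconst U0; set I1 := Iconst U0.
set lam := (X in X^2 / _); set T := (X in 8 * pi * X); rewrite -/lam.
set V := (2 * pi)^-1 * _.
pose rho x := ur x^2 + ui x^2.
pose gr x := g1r x^2 + g1i x^2 + g2r x^2 + g2i x^2.
have rho0 x : 0 <= rho x by rewrite addr_ge0 ?sqr_ge0.
have gr0 x : 0 <= gr x by rewrite !addr_ge0 ?sqr_ge0.
have lg0 (x : plane R) : 0 <= ln (1 + eucl x) by rewrite ln_ge0// lerDl sqrtr_ge0.
have me : mble (@eucl R) by rewrite /eucl; meas.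
have lr0 x : 0 <= ln (1 + eucl x) * rho x by pos.
have sub (f : plane R -> R) : mble f -> (forall x, 0 <= f x) ->
    (forall x, f x <= gr x + rho x + ln (1 + eucl x) * rho x) -> (\int[leb2 R]_x (f x)%:E < +oo)%E.
  move=> mf f0 fle; apply: le_lt_trans fin; apply: le_int_real => //.
  by meas.
have fin_rho : (\int[leb2 R]_x (rho x)%:E < +oo)%E by apply: sub => // [|x]; [rewrite /rho; meas|rewrite -addrA addrCA lerDl addr_ge0].
have fin_gr : (\int[leb2 R]_x (gr x)%:E < +oo)%E by apply: sub => // [|x]; [rewrite /gr; meas|rewrite -addrA lerDl addr_ge0].
have fin_lr : (\int[leb2 R]_x (ln (1 + eucl x) * rho x)%:E < +oo)%E by apply: sub => // [|x]; [rewrite /rho; meas|rewrite lerDr addr_ge0].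
have part (f g : plane R -> R) : mble f -> (forall x, f x^2 <= g x) ->
    mble g -> (\int[leb2 R]_x (g x)%:E < +oo)%E -> (\int[leb2 R]_x (f x^2)%:E < +oo)%E by move=> mf fg mg; apply: le_lt_trans; apply: le_int_real => //; [meas|isd].
have mrho : mble rho by rewrite /rho; meas.
have mgr : mble gr by rewrite /gr; meas.
have grE x : gr x = g1r x^2 + g1i x^2 + g2r x^2 + g2i x^2 by [].
have bnd x : [/\ g1r x^2 <= gr x, g1i x^2 <= gr x, g2r x^2 <= gr x & g2i x^2 <= gr x].
  exact: sqr_le_sum4.
have b1 x : g1r x^2 <= gr x by case: (bnd x).
have b2 x : g1i x^2 <= gr x by case: (bnd x).
have b3 x : g2r x^2 <= gr x by case: (bnd x).
have b4 x : g2i x^2 <= gr x by case: (bnd x).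
have br x : ur x^2 <= rho x by rewrite lerDl sqr_ge0.
have bi x : ui x^2 <= rho x by rewrite lerDr sqr_ge0.
have lamE : (\int[leb2 R]_x (rho x)%:E = lam%:E)%E by apply: int_RintE; apply: intble_real.
have TE : (\int[leb2 R]_x (gr x)%:E = T%:E)%E by apply: int_RintE; apply: intble_real.
pose w x := sqrt (rho x).
have wE x : w x^2 = rho x by rewrite sqr_sqrtr.
have mw : mble w by rewrite /w; meas.
have w0 x : 0 <= w x by exact: sqrtr_ge0.
have w2 : (\int[leb2 R]_x (w x^2)%:E = lam%:E)%E by under eq_integral do rewrite wE.
(* A vanishing integral of [rho] would make [u] zero almost everywhere. *)
have lam_gt0 : 0 < lam.
  rewrite lt_neqAle -lee_fin -lamE integral_ge0 ?andbT; last by move=> x _; rewrite lee_fin.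
  apply/eqP => l0; apply: nz.
  have : (\int[leb2 R]_(x in setT) `|(rho x)%:E| = 0)%E by under eq_integral do rewrite gee0_abs ?lee_fin//; rewrite lamE -l0.
  move/ae_eq_integral_abs => /(_ measurableT) -[|B [mB B0 sB]]; first by apply/measurable_EFinP.
  exists B; split => // x hx; apply: sB => hr; apply: hx.
  have := hr I; case => /eqP; rewrite paddr_eq0 ?sqr_ge0// !sqrf_eq0 => /andP[/eqP r0 /eqP i0].
  by split.
(* The moduli of the real and imaginary parts add up to the full gradient, and that of [w = |u|] is
   at most their sum. *)
have modulus e : 0 < e ->
  (\int[leb2 R]_x \int[leb2 R]_y ((w x - w y)^2 * ind (dsq x y < e^2)%R)%:E <=
   (pi * e ^+ 4 / 4 * T)%:E)%E.
  move=> e0; have e4 : 0 <= pi * e ^+ 4 / 4 by rewrite divr_ge0// mulr_ge0 ?pi_ge0// exprn_even_ge0.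
  have hr := weak_modulus e mr m1r m2r (part _ rho mr br mrho fin_rho) (part _ gr m1r b1 mgr fin_gr) (part _ gr m2r b3 mgr fin_gr) w1r w2r.
  have hi := weak_modulus e mi m1i m2i (part _ rho mi bi mrho fin_rho) (part _ gr m1i b2 mgr fin_gr) (part _ gr m2i b4 mgr fin_gr) w1i w2i.
  pose Q (f : plane R -> R) x y := (f x - f y)^2 * ind (dsq x y < e^2).
  have Q0 f x y : 0 <= Q f x y by rewrite mulr_ge0 ?sqr_ge0.
  apply: (@le_trans _ _ (\int[leb2 R]_x \int[leb2 R]_y (Q ur x y)%:E + \int[leb2 R]_x \int[leb2 R]_y (Q ui x y)%:E)%E).
    rewrite -ge0_integralD; first last.
    - by rewrite /Q; meas; pos.
    - by pos.
    - by rewrite /Q; meas; pos.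
    - by pos.
    - by [].
    have E x : (\int[leb2 R]_y (Q ur x y)%:E + \int[leb2 R]_y (Q ui x y)%:E = \int[leb2 R]_y (Q ur x y + Q ui x y)%:E)%E.
      rewrite -ge0_integralD; first by apply: eq_integral => y _; rewrite EFinD.
      - by [].
      - by pos.
      - by rewrite /Q; meas.
      - by pos.
      - by rewrite /Q; meas.
    under [leRHS]eq_integral do rewrite E.
    apply: ge0_le_integral => //.
    - by pos.
    - by meas; pos.
    - by rewrite /Q; meas; pos.
    move=> x _; apply: le_int_real => [||y|y].
    - by meas.
    - by rewrite /Q; meas.
    - by pos.
    - by rewrite -mulrDl ler_wpM2r//; exact: modulus_diff.
  apply: (le_trans (leeD hr hi)).
  rewrite -ge0_muleDr; [|by apply: integral_ge0 => x _; rewrite lee_fin addr_ge0 ?sqr_ge0..].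
  rewrite -ge0_integralD; [|isd..].
  rewrite [leRHS]EFinM -TE le_eqVlt; apply/orP; left; apply/eqP; congr (_ * _)%E.
  by apply: eq_integral => x _; rewrite grE; congr EFin; ring.
have log_moment : (\int[leb2 R]_x (ln (1 + sqrt (nsq x)) * w x^2)%:E < +oo)%E by under eq_integral do rewrite wE.
have [F [A [zeta [P [K [m pr]]]]]] := ground_profile gs.
have N_gt0 : 0 < N by have /andP[a b] := profile_m pr ltr01; exact: lt_trans b.
have := kinetic_potential mw w0 w2 lam_gt0 modulus log_moment pr N_gt0.
rewrite -/N -/I1; set E := Rintegral _ _ _.
have VE : V = (2 * pi)^-1 * E.
  rewrite /V /E; congr (_ * _); congr Rintegral; apply/funext => x; congr Rintegral; apply/funext => y.
  by rewrite !wE.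
by rewrite VE; exact: logarithmic_form.
Qed.
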